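(* Let $\mathbb{G}$ be a Carnot group, let $\mathcal{L}=\sum_{i=1}^{m_1}X_i^2$ be the sub-Laplacian on $\mathbb{G}$ (built from the Jacobian basis $X_1,\dots,X_{m_1}$ of the horizontal layer), and let $K\subset\mathbb{G}$ be bounded. Then $K$ is removable for Lipschitz $\mathcal{L}$-solutions if and only if $\kappa(K)=0$, where $\kappa$ is the Lipschitz capacity $$\kappa(K)=\sup\{|\langle \mathcal{L}f,1\rangle| : f\in \mathrm{Lip}_{\mathrm{loc}},\ \|\nabla_{\mathbb{G}}f\|_{L^\infty}\le 1,\ \operatorname{supp}(\mathcal{L}f)\subset K\}.$$
   Context: Carnot groups. A Carnot group $\mathbb{G}$ is a connected, simply connected, nilpotent Lie group whose Lie algebra has a stratification $\mathfrak{g}=\mathfrak{v}_1\oplus\cdots\oplus\mathfrak{v}_s$ into non-zero subspaces with $[\mathfrak{v}_1,\mathfrak{v}_i]=\mathfrak{v}_{i+1}$ for $1\le i\le s-1$ and $[\mathfrak{v}_1,\mathfrak{v}_s]=\{0\}$. Via the exponential map $\mathbb{G}$ is identified with $\mathbb{R}^N$, $N=\sum_i\dim\mathfrak{v}_i$, with identity $0$; $m_1=\dim\mathfrak{v}_1$. Elements $X\in\mathfrak{g}$ act as left-invariant vector fields, $Xf(x)=\frac{d}{dt}|_{t=0}f(x\cdot\exp(tX))$. The Jacobian basis $X_1,\dots,X_{m_1}$ of $\mathfrak{v}_1$ is the one characterized by $X_j|_0=\partial_j|_0$. The Carnot-Carathéodory distance $d(x,y)$ is the infimum of all $T$ for which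 there is a piecewise smooth $\gamma:[0,T]\to\mathbb{G}$ with $\gamma(0)=x$, $\gamma(T)=y$ and $\langle\dot\gamma(t),\xi\rangle^2\le\sum_{j=1}^{m_1}\langle X_jI(\gamma(t)),\xi\rangle^2$ for all $\xi\in\mathbb{R}^N$ and a.e. $t$, where $X_jI(x)\in\mathbb{R}^N$ is the coefficient vector of $X_j$ at $x$. Boundedness and Lipschitz conditions refer to $d$. The horizontal gradient is $\nabla_{\mathbb{G}}f=(X_1f,\dots,X_{m_1}f)$. For $\Omega\subset\mathbb{G}$ open, $\mathrm{Lip}(\Omega)$ is the set of $f:\Omega\to\mathbb{R}$ for which there is $C>0$ with $|f(x)-f(y)|\le C\,d(x,y)$ for all $x,y\in\Omega$. $\mathrm{Lip}_{\mathrm{loc}}$ is the set of $f:\mathbb{G}\to\mathbb{R}$ such that for each compact $E$ there is $C(E)>0$ with $|f(x)-f(y)|\le C(E)d(x,y)$ for all $x,y\in E$. $\mathcal{L}f$ and its support are taken in the sense of distributions; $\langle\mathcal{L}f,1\rangle$ is the pairing of the compactly supported distribution $\mathcal{L}f$ with the constant function $1$, i.e. with any $\psi\in C_0^\infty$ equal to $1$ near $\operatorname{supp}\mathcal{L}f$. Removability. $K$ is removable for Lipschitz $\mathcal{L}$-solutions if for every domain $\Omega\subset\mathbb{G}$ (not required to contain $K$) every $f\in\mathrm{Lip}(\Omega)$ satisfying $\mathcal{L}f=0$ in $\Omega\setminus K$ also satisfies $\mathcal{L}f=0$ in $\Omega$. Here ''$\mathcal{L}f=0$ in $\Omega\setminus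 K$'' means that the support in $\Omega$ of the distribution $\mathcal{L}f\in\mathcal{D}'(\Omega)$ is contained in $K$. *)

(* Defs.v *)
From HB Require Import structures.
From mathcomp Require Import all_boot all_order all_algebra.
From mathcomp Require Import all_classical all_reals all_analysis.

Set Implicit Arguments.
Unset Strict Implicit.
Unset Printing Implicit Defensive.
Import Order.TTheory GRing.Theory Num.Theory.
Import numFieldNormedType.Exports.

Local Open Scope classical_set_scope.
Local Open Scope ring_scope.

Definition rV_display : measure_display.
Proof. exact. Qed.

Section rV_measurable.
Context {R : realType} {n : nat}.

(* The sigma-algebra generated by the coordinates, which is the Borel one. *)
Definition rV_cylinder : set (set 'rV[R]_n) :=
  [set A | exists i (B : set R), measurable B /\ A = (fun v : 'rV[R]_n => v 0 i) @^-1` B].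

Let rV0 : <<s rV_cylinder >> set0. Proof. exact: sigma_algebra0. Qed.

Let rVC A : <<s rV_cylinder >> A -> <<s rV_cylinder >> (~` A).
Proof. exact: sigma_algebraC. Qed.

Let rVU (F : (set 'rV[R]_n)^nat) : (forall i, <<s rV_cylinder >> (F i)) ->
  <<s rV_cylinder >> (\bigcup_i (F i)).
Proof. exact: sigma_algebra_bigcup. Qed.

HB.instance Definition _ :=
  @isMeasurable.Build rV_display 'rV[R]_n <<s rV_cylinder >> rV0 rVC rVU.
End rV_measurable.

Lemma measurable_coord (R : realType) n (i : 'I_n) :
  measurable_fun [set: 'rV[R]_n] (fun v : 'rV[R]_n => v 0 i).
Proof.
move=> _ B mB; rewrite setTI; apply: sub_sigma_algebra.
by exists i, B.
Qed.

Lemma measurable_rV d (T : measurableType d) (R : realType) n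
    (f : T -> 'rV[R]_n) :
  (forall i, measurable_fun [set: T] (fun t => f t 0 i)) ->
  measurable_fun [set: T] f.
Proof.
move=> mf; apply: (@measurability _ _ _ _ _ _ rV_cylinder) => //.
move=> _ [_ [i [B [mB ->]]] <-].
exact: (mf i measurableT B mB).
Qed.

Section lebesgue_rV.
Context {R : realType}.

Definition rV_cons n (p : R * 'rV[R]_n) : 'rV[R]_n.+1 :=
  row_mx (const_mx p.1 : 'rV_1) p.2.
Definition rV_uncons n (v : 'rV[R]_n.+1) : R * 'rV[R]_n :=
  (v 0 0, rsubmx (v : 'rV_(1 + n))).

Lemma rV_consK n : cancel (@rV_cons n) (@rV_uncons n).
Proof.
move=> [x v]; rewrite /rV_uncons /rV_cons /= row_mxKr; congr pair.
transitivity (row_mx (const_mx x : 'rV_1) v 0 (lshift n 0)).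
  by congr (_ _ _); exact/val_inj.
by rewrite row_mxEl mxE.
Qed.

Lemma measurable_rV_cons n : measurable_fun [set: R * 'rV[R]_n] (@rV_cons n).
Proof.
apply: measurable_rV => i; rewrite /rV_cons.
case: (@split_ordP 1 n i) => j ->.
- rewrite (_ : (fun _ => _) = fst); first exact: measurable_fst.
  apply/funext => p.
  by rewrite [LHS](row_mxEl (const_mx p.1 : 'rV_1) p.2) mxE.
- rewrite (_ : (fun _ => _) = (fun v : 'rV[R]_n => v 0 j) \o snd).
    exact: (measurableT_comp (measurable_coord j)).
  apply/funext => p.
  exact: (row_mxEr (const_mx p.1 : 'rV_1) p.2).
Qed.

Lemma measurable_rV_uncons n :
  measurable_fun [set: 'rV[R]_n.+1] (@rV_uncons n).
Proof.
apply: measurable_fun_pair; first exact: measurable_coord.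
apply: measurable_rV => i; rewrite /=.
rewrite (_ : (fun _ => _) = (fun v : 'rV[R]_n.+1 => v 0 (rshift 1 i))).
  exact: measurable_coord.
by apply/funext => v; rewrite mxE.
Qed.

Section leb_cons.
Context n (m : {sigma_finite_measure set 'rV[R]_n -> \bar R}).

Definition leb_cons : set 'rV[R]_n.+1 -> \bar R :=
  pushforward ((@lebesgue_measure R) \x m)%E (@rV_cons n).

Let leb_cons0 : leb_cons set0 = 0%E.
Proof. by rewrite /leb_cons /pushforward preimage_set0 measure0. Qed.

Let leb_cons_ge0 A : (0 <= leb_cons A)%E.
Proof. by rewrite /leb_cons /pushforward; apply: measure_ge0. Qed.

Let leb_cons_additive : semi_sigma_additive leb_cons.
Proof.
move=> F mF tF mUF; rewrite /leb_cons /pushforward preimage_bigcup.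
have mrF k : measurable (@rV_cons n @^-1` F k).
  by rewrite -[X in measurable X]setTI; exact: measurable_rV_cons.
apply: measure_semi_sigma_additive => //.
- apply/trivIsetP => i j _ _ ij; rewrite -preimage_setI.
  by move/trivIsetP : tF => /(_ _ _ _ _ ij) ->//; rewrite preimage_set0.
- by apply: bigcup_measurable => k _; exact: mrF.
Qed.

HB.instance Definition _ := isMeasure.Build _ _ _
  leb_cons leb_cons0 leb_cons_ge0 leb_cons_additive.

Let leb_cons_sigma_finite : sigma_finite setT leb_cons.
Proof.
have /sigma_finiteP[F [FT ndF Foo]] := sigma_finiteT (@lebesgue_measure R).
have /sigma_finiteP[G [GT ndG Goo]] := sigma_finiteT m.
have FGT : setT = \bigcup_k (F k `*` G k).
  rewrite -setXTT FT GT predeqE => -[x y]; split.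
    move=> [/= [k _ Fkx] [l _ Gly]]; exists (maxn k l) => //; split.
      by move: x Fkx; exact/subsetPset/ndF/leq_maxl.
    by move: y Gly; exact/subsetPset/ndG/leq_maxr.
  by move=> [k _ []/= ? ?]; split; exists k.
exists (fun k => @rV_uncons n @^-1` (F k `*` G k)).
  by rewrite -preimage_bigcup -FGT.
move=> k; have [mF Fkoo] := Foo k; have [mG Gkoo] := Goo k.
have mFG : measurable (F k `*` G k) by exact: measurableX.
split.
  by rewrite -[X in measurable X]setTI; exact: measurable_rV_uncons.
rewrite /leb_cons /pushforward -comp_preimage.
rewrite (_ : _ \o _ = id); last by apply/funext => p /=; rewrite rV_consK.
by rewrite product_measure1E// lte_mul_pinfty// ge0_fin_numE.
Qed.

HB.instance Definition _ := @Measure_isSigmaFinite.Build _ _ _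
  leb_cons leb_cons_sigma_finite.

End leb_cons.

Fixpoint leb n : {sigma_finite_measure set 'rV[R]_n -> \bar R} :=
  if n is n'.+1 then leb_cons (leb n') else @dirac _ 'rV[R]_0 0 R.

End lebesgue_rV.


Lemma leb_prod (R : realType) n (A : set R) (B : set 'rV[R]_n) :
  measurable A -> measurable B ->
  leb n.+1 (@rV_uncons R n @^-1` (A `*` B)) = (lebesgue_measure A * leb n B)%E.
Proof.
move=> mA mB; rewrite /= /leb_cons /pushforward -comp_preimage.
rewrite (_ : _ \o _ = id); last by apply/funext => p /=; rewrite rV_consK.
by rewrite product_measure1E.
Qed.

Lemma leb_box (R : realType) n (a b : 'rV[R]_n) :
  (forall i, a 0 i <= b 0 i) ->
  leb n [set v : 'rV[R]_n | forall i, a 0 i <= v 0 i <= b 0 i] =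
  (\prod_(i < n) (b 0 i - a 0 i))%:E.
Proof.
elim: n a b => [|n IH] a b ab.
  rewrite big_ord0 /= diracE mem_set//.
  by move=> -[].
pose a' := @rsubmx R 1 1 n a; pose b' := @rsubmx R 1 1 n b.
pose Q := [set v : 'rV[R]_n | forall i, a' 0 i <= v 0 i <= b' 0 i].
have liftE (u : 'rV[R]_n.+1) i : u 0 (lift ord0 i) = @rsubmx R 1 1 n u 0 i.
  by rewrite mxE; congr (u _ _); exact/val_inj.
rewrite (_ : [set v | _] = @rV_uncons R n @^-1` (`[a 0 0, b 0 0] `*` Q)).
  rewrite leb_prod//; first last.
    rewrite (_ : Q = \bigcap_(i in [set: 'I_n])
        ((fun v : 'rV[R]_n => v 0 i) @^-1` `[a' 0 i, b' 0 i])).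
      apply: fin_bigcap_measurable => [|i _]; first exact: finite_finset.
      rewrite -[X in measurable X]setTI.
      by apply: measurable_coord => //; exact: measurable_itv.
    apply/seteqP; split => v /= H i; first by rewrite /= in_itv /= => _; exact: H.
    by have := H i I; rewrite /= in_itv.
  rewrite lebesgue_measure_itv/= IH; last first.
    by move=> i; rewrite -!liftE.
  rewrite big_ord_recl EFinM; congr (_ * _)%E; last first.
    by congr EFin; apply: eq_bigr => i _; rewrite !liftE.
  rewrite lte_fin; case: ltP => [_|ba]; first by rewrite EFinB.
  by rewrite (@le_anti _ _ (a 0 0) (b 0 0)) ?subrr// ab.
apply/seteqP; split => v /=.
  move=> H; split => [|i]; first by rewrite in_itv/= H.
  by rewrite /= -!liftE.
move=> [/= + H] i; rewrite in_itv /= => H0.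
case: (unliftP ord0 i) => [j ->|->//].
by have := H j; rewrite /= -!liftE.
Qed.

Section smooth.
Context {R : realType}.

(* All iterated directional derivatives up to order [k] exist and are
   continuous; for finite-dimensional [V] this is the usual class C^k. *)
Fixpoint is_Ck (V W : normedModType R) (k : nat) (f : V -> W) : Prop :=
  continuous f /\
  if k is k'.+1 then
    forall v, (forall x, derivable f x v) /\ is_Ck k' ('D_v f)
  else True.

Definition smooth (V W : normedModType R) (f : V -> W) : Prop :=
  forall k, is_Ck k f.
End smooth.

Section group_law.
Context {R : realType} {N : nat}.
Variable op : 'rV[R]_N -> 'rV[R]_N -> 'rV[R]_N.

(* Group laws on R^N read in exponential coordinates: [exp_op] says that the
   one-parameter subgroups are the lines [t |-> t *: v], i.e. that the
   exponential map, from the tangent space 'rV_N at 0, is the identity.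
   The inverse is therefore [- x], and connectedness and simple connectedness
   are those of R^N. *)
Record is_exp_lie_group : Prop := IsExpLieGroup {
  exp_opA : associative op;
  exp_op0x : left_id 0 op;
  exp_opx0 : right_id 0 op;
  exp_opNx : left_inverse 0 -%R op;
  exp_op_smooth : smooth (fun p : 'rV[R]_N * 'rV[R]_N => op p.1 p.2);
  exp_op : forall v s t, op (s *: v) (t *: v) = (s + t) *: v }.

(* Action of the left-invariant vector field with value [v] at 0. Applied to
   [id] it gives the coefficient vector of that field at [x]. *)
Definition lie_derive (v : 'rV[R]_N) (W : normedModType R)
    (f : 'rV[R]_N -> W) (x : 'rV[R]_N) : W :=
  derive1 (fun t : R => f (op x (t *: v))) 0.

Definition lie_derivable (v : 'rV[R]_N) (W : normedModType R)
    (f : 'rV[R]_N -> W) (x : 'rV[R]_N) : Prop :=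
  derivable (fun t : R => f (op x (t *: v))) 0 1.

(* The value at 0 of the commutator of the left-invariant fields extending
   [u] and [v]. *)
Definition lie_bracket (u v : 'rV[R]_N) : 'rV[R]_N :=
  lie_derive u (lie_derive v id) 0 - lie_derive v (lie_derive u id) 0.

(* C = [A, B], the smallest subspace containing all the brackets. *)
Definition is_bracket_space (A B C : {vspace 'rV[R]_N}) : Prop :=
  forall W : {vspace 'rV[R]_N}, (C <= W)%VS <->
    (forall u v, u \in A -> v \in B -> lie_bracket u v \in W).

(* The layers are [V 1], ..., [V s]; the other values of [V] are irrelevant.
   Nilpotency of the Lie algebra follows from the bracket relations. *)
Record is_stratification (s : nat) (V : nat -> {vspace 'rV[R]_N}) : Prop :=
  IsStratification {
  strat_gt0 : (0 < s)%N;
  strat_neq0 : forall i, (1 <= i <= s)%N -> V i != 0%VS;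
  strat_direct : directv (\sum_(i < s) V i.+1);
  strat_full : (\sum_(i < s) V i.+1)%VS = fullv;
  strat_bracket : forall i, (1 <= i < s)%N ->
    is_bracket_space (V 1%N) (V i) (V i.+1);
  strat_last : is_bracket_space (V 1%N) (V s) 0%VS }.
End group_law.

(* A Carnot group in exponential coordinates with respect to a basis of the Lie
   algebra that begins with a basis of the first layer: [layer1_coord] says
   that [layer 1] is spanned by the first [\dim (layer 1)] coordinate vectors,
   so that its Jacobian basis consists of the fields extending them. *)
Record carnotGroup (R : realType) := CarnotGroup {
  cdim : nat;
  cop : 'rV[R]_cdim -> 'rV[R]_cdim -> 'rV[R]_cdim;
  cstep : nat;
  layer : nat -> {vspace 'rV[R]_cdim};
  cop_lie : is_exp_lie_group cop;
  layer_strat : is_stratification cop cstep layer;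
  layer1_coord : forall j : 'I_cdim,
    (j < \dim (layer 1%N))%N -> delta_mx 0 j \in layer 1%N }.

Section carnot.
Context {R : realType} (G : carnotGroup R).
Local Notation N := (cdim G).
Local Notation pt := 'rV[R]_(cdim G).
Local Notation mu := (leb (cdim G)).

Definition hdim : nat := \dim (layer G 1%N).

(* The Jacobian basis is [jac j] for [j < hdim]. *)
Definition jac (j : 'I_N) (W : normedModType R) (f : pt -> W) (x : pt) : W :=
  lie_derive (@cop R G) (delta_mx 0 j) f x.

Definition jac_derivable (j : 'I_N) (W : normedModType R) (f : pt -> W)
    (x : pt) : Prop :=
  lie_derivable (@cop R G) (delta_mx 0 j) f x.

Definition sub_laplacian (f : pt -> R) (x : pt) : R :=
  \sum_(j < N | (j < hdim)%N) jac j (jac j f) x.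

(* Euclidean norm of the horizontal gradient (X_1 f, ..., X_m1 f). *)
Definition hgrad_norm (f : pt -> R) (x : pt) : R :=
  Num.sqrt (\sum_(j < N | (j < hdim)%N) jac j f x ^+ 2).

Definition dotv (u v : pt) : R := \sum_i u 0 i * v 0 i.

(* Each piece is the restriction to a closed interval of a smooth curve. *)
Definition piecewise_smooth (T : R) (g : R -> pt) : Prop :=
  exists s : seq R, itv_partition 0 T s /\
    forall i, (i < size s)%N -> exists h : R -> pt, smooth h /\
      {in `[nth 0 (0 :: s) i, nth 0 (0 :: s) i.+1], g =1 h}.

Definition subunit_at (g : R -> pt) (t : R) : Prop :=
  derivable g t 1 /\
  forall xi : pt, dotv (derive1 g t) xi ^+ 2 <=
    \sum_(j < N | (j < hdim)%N) dotv (jac j id (g t)) xi ^+ 2.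

(* An infimum in \bar R; it is finite by Chow's theorem. *)
Definition cc_dist (x y : pt) : \bar R :=
  ereal_inf [set T%:E | T in [set T : R | exists g : R -> pt,
    [/\ 0 <= T, piecewise_smooth T g, g 0 = x, g T = y &
        {ae @lebesgue_measure R, forall t : R,
           t \in `[0, T] -> subunit_at g t}]]].

Definition cc_bounded (K : set pt) : Prop :=
  exists M : R, forall x y, K x -> K y -> (cc_dist x y <= M%:E)%E.

Definition lip_on (A : set pt) (f : pt -> R) : Prop :=
  exists2 C : R, 0 < C &
    forall x y, A x -> A y -> (`|f x - f y|%:E <= C%:E * cc_dist x y)%E.

Definition lip_loc (f : pt -> R) : Prop :=
  forall E : set pt, compact E -> lip_on E f.

Definition domain (Om : set pt) : Prop :=
  [/\ open Om, connected Om & Om !=set0].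

Definition supp (phi : pt -> R) : set pt := closure [set x | phi x != 0].

Definition test_fun (Om : set pt) (phi : pt -> R) : Prop :=
  [/\ smooth phi, compact (supp phi) & supp phi `<=` Om].

(* The distribution L f on [Om]. Lebesgue measure is a Haar measure and the
   left-invariant fields are divergence-free, so L is its own adjoint. *)
Definition distr_L (Om : set pt) (f phi : pt -> R) : R :=
  \int[mu]_(x in Om) (f x * sub_laplacian phi x).

(* Complement in [Om] of the largest open subset of [Om] on which [u] is 0. *)
Definition distr_supp (Om : set pt) (u : (pt -> R) -> R) : set pt :=
  [set x | Om x /\ forall U : set pt, open U -> U x -> U `<=` Om ->
     exists2 phi, test_fun U phi & u phi != 0].

Definition removable (K : set pt) : Prop :=
  forall Om f, domain Om -> lip_on Om f ->
    distr_supp Om (distr_L Om f) `<=` K ->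
    forall phi, test_fun Om phi -> distr_L Om f phi = 0.

(* ||grad f||_oo <= 1. Since [derive1] is total, the first clause asks that the
   gradient exist almost everywhere; for [lip_loc f] it holds by the
   Pansu-Rademacher theorem. *)
Definition hgrad_le1 (f : pt -> R) : Prop :=
  {ae mu, forall x : pt, forall j : 'I_N, (j < hdim)%N -> jac_derivable j f x} /\
  (Lnorm mu +oo%E (fun x => (hgrad_norm f x)%:E) <= 1)%E.

(* [c] is the value <u, 1> of the compactly supported distribution [u]; it does
   not depend on the cutoff [psi]. *)
Definition pairing1 (u : (pt -> R) -> R) (c : R) : Prop :=
  exists psi, [/\ test_fun setT psi,
    forall x, distr_supp setT u x -> \forall y \near x, psi y = 1 &
    u psi = c].

Definition lip_capacity (K : set pt) : \bar R :=
  ereal_sup [set (`|c|)%:E | c in [set c : R | exists f : pt -> R,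
    [/\ lip_loc f, hgrad_le1 f, distr_supp setT (distr_L setT f) `<=` K &
        pairing1 (distr_L setT f) c]]].

End carnot.

(* Main.v *)
Require Import Defs.
From HB Require Import structures.
From mathcomp Require Import all_boot all_order all_algebra.
From mathcomp Require Import all_classical all_reals all_analysis.
From mathcomp Require Import measurable_realfun ess_sup_inf.
From mathcomp Require Import ring lra zify.

Set Implicit Arguments.
Unset Strict Implicit.
Unset Printing Implicit Defensive.
Import Order.TTheory GRing.Theory Num.Theory.
Import numFieldNormedType.Exports.

Local Open Scope classical_set_scope.
Local Open Scope ring_scope.

(* If kappa(K) > 0, some f with bounded horizontal gradient has <Lf, 1> <> 0 and
   Lf supported in K; cutting [1] off outside a large ball shows that f violates
   removability there.  The work is in the converse.  Let f be Lipschitz on Om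
   with Lf supported in K and <Lf, phi> <> 0 for a test function phi.  Cut Lf
   off: it suffices to find g with bounded horizontal gradient and Lg = phi Lf,
   for then <Lg, 1> <> 0.  Put g = phi f - h, where h must solve L h = F for the
   remaining terms F of L (phi f), which involve only first differences of f.
   Discretely F is the limit of F_d = D_d (phi f) - phi D_d f, where D_d is the
   sum of the second differences of step d along the horizontal directions; no
   product rule is needed, the F_d are uniformly bounded with support in a fixed
   compact set, and D_d is symmetric for Lebesgue measure, which is a Haar
   measure since right translations are compositions of shears.

   The horizontal Lipschitz bound for h does not use hypoellipticity.  At scale
   e, h is the potential of the random walk with steps in the directions e X_j.
   The endpoint of a walk depends only on its signature, the vector of the
   numbers of occurrences of the short words as subwords of the word of steps,
   because the coordinates are annihilated by sufficiently many differences.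
   The signature takes polynomially many values, so its entropy H_n is O(log n);
   the first step changes the law of the endpoint by an amount controlled by
   H_(n+1) - H_n, and since these increments telescope the sum of the gradients
   over all times is bounded at infinitely many good scales.  For dim V_1 >= 2
   the walk leaves compact sets fast enough, as seen on two coordinates, which
   gives the required decay for large times; for dim V_1 = 1 the potential is
   explicit.  By Chow's theorem horizontal Lipschitz bounds give
   equicontinuity, and h is a limit of the discrete potentials.

   To pass from horizontal Lipschitz bounds to the metric d, mollify by left
   translations, which preserve the bounds; to bound the gradient almost
   everywhere, use that Lipschitz functions of one variable are differentiable
   almost everywhere, along with Fubini's theorem. *)

(** * Entropy of the law of a function of random words *)

(** What has to be bounded is the increment of the potential over one step of size [e = 2 ^- K].
    Times are grouped in blocks from [4 ^ k] to [4 ^ k.+1]. There, entropy bounds the effect of the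
    first step at one time by a multiple of [lam + dH / lam], where [dH] is an entropy increment;
    with [lam = 2 ^- k] a block costs [2 ^ k] times a constant plus the entropy gained, [D k]. For
    [k > K] the small-ball estimate for two coordinates contributes a factor [4 ^ (K - k)], so every
    block costs [2 ^ (K - |k - K|)], up to constants and [D k]. One coordinate alone would
    contribute [2 ^ (K - k)], and the blocks would not sum up. The [D k] are bounded only on
    average, whence the good scales. The factor [e ^+ 2] of the potential then leaves a bound of
    order [e]. Only the first layer is spanned by coordinate vectors, so degrees are measured by a
    filtration instead of dilations. The triangularity of the group law for this filtration is
    behind the polynomial coordinates, Chow's theorem and the invariance of Lebesgue measure. *)

Lemma big_tuple_cons {S : finType} {V : nmodType} n (F : seq S -> V) :
  \sum_(w : n.+1.-tuple S) F w = \sum_(s : S) \sum_(w : n.-tuple S) F (s :: w).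
Proof.
rewrite pair_bigA /=.
rewrite (reindex (fun p : S * n.-tuple S => [tuple of p.1 :: p.2]))//=.
exists (fun w : n.+1.-tuple S => (thead w, [tuple of behead w])) => [[s w] _|w _] /=.
  by rewrite theadE; congr pair; apply/val_inj.
by apply/esym; exact: tuple_eta.
Qed.

Section word_average.
Context {R : realType} {S : finType}.
Hypothesis S_gt0 : (0 < #|S|)%N.
Local Notation q := (#|S|%:R : R).

Definition wavg n (F : seq S -> R) : R := q ^- n * \sum_(w : n.-tuple S) F w.

Let q_gt0 : 0 < q. Proof. by rewrite ltr0n. Qed.

Lemma wavgS n F : wavg n.+1 F = q^-1 * \sum_(s : S) wavg n (fun w => F (s :: w)).
Proof.
rewrite /wavg big_tuple_cons -mulr_sumr mulrA; congr (_ * _).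
by rewrite exprS invfM.
Qed.

Lemma wavg0 F : wavg 0 F = F [::].
Proof.
rewrite /wavg expr0 invr1 mul1r (bigD1 [tuple]) //= big1 ?addr0 // => w.
by rewrite (tuple0 w) (_ : [tuple] == [tuple]).
Qed.

Lemma wavg_cst n (c : R) : wavg n (fun=> c) = c.
Proof.
rewrite /wavg sumr_const card_tuple -[c *+ _]mulr_natl mulrA natrX mulVf ?mul1r//.
by rewrite expf_neq0// gt_eqF.
Qed.

Lemma wavgD n F F' : wavg n (fun w => F w + F' w) = wavg n F + wavg n F'.
Proof. by rewrite /wavg big_split mulrDr. Qed.

Lemma wavgZ n c F : wavg n (fun w => c * F w) = c * wavg n F.
Proof. by rewrite /wavg -mulr_sumr mulrCA. Qed.

Lemma wavgB n F F' : wavg n (fun w => F w - F' w) = wavg n F - wavg n F'.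
Proof. by rewrite /wavg -mulrBr -sumrB. Qed.

Lemma wavg_le n F F' : (forall w, size w = n -> F w <= F' w) ->
  wavg n F <= wavg n F'.
Proof.
move=> FF'; rewrite /wavg ler_pM2l ?invr_gt0 ?exprn_gt0//.
by apply: ler_sum => w _; rewrite FF'// size_tuple.
Qed.

Lemma eq_wavg n F F' : (forall w, size w = n -> F w = F' w) ->
  wavg n F = wavg n F'.
Proof.
by move=> FF'; congr (_ * _); apply: eq_bigr => w _; rewrite FF'// size_tuple.
Qed.

Lemma ler_norm_wavg n F : `|wavg n F| <= wavg n (fun w => `|F w|).
Proof.
rewrite /wavg normrM ger0_norm ?invr_ge0 ?exprn_ge0 ?(ltW q_gt0)//.
by rewrite ler_pM2l ?invr_gt0 ?exprn_gt0// ler_norm_sum.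
Qed.

Lemma wavg_sum (I : Type) (r : seq I) (P : pred I) n (F : I -> seq S -> R) :
  wavg n (fun w => \sum_(i <- r | P i) F i w) = \sum_(i <- r | P i) wavg n (F i).
Proof. by rewrite /wavg exchange_big /= mulr_sumr. Qed.

Lemma wavg_cat m n F :
  wavg (m + n) F = wavg m (fun u => wavg n (fun v => F (u ++ v))).
Proof.
elim: m F => [|m IH] F; first by rewrite add0n wavg0.
rewrite addSn !wavgS; congr (_ * _); apply: eq_bigr => s _.
by rewrite IH.
Qed.

End word_average.

Lemma ln_le_subr1 {R : realType} (x : R) : 0 < x -> ln x <= x - 1.
Proof.
by move=> x0; have := expR_ge1Dx (ln x); rewrite lnK ?posrE//; lra.
Qed.

Section entropy.
Context {R : realType} {S : finType} {T : eqType} (f : seq S -> T).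
Hypothesis S_gt0 : (0 < #|S|)%N.
(** Left cancellation: prefixing a letter relabels the values of [f] without merging any, so the law
    of [f (s :: u)] has the same entropy as the law of [f u]. *)
Hypothesis f_cons : forall s u w, (f (s :: u) == f (s :: w)) = (f u == f w).
Local Notation q := (#|S|%:R : R).
Local Notation avg := (@wavg R S).

Let q_gt0 : 0 < q. Proof. by rewrite ltr0n. Qed.

Definition wprob n (t : T) : R := avg n (fun w => (f w == t)%:R).

Definition wentropy n : R := - avg n (fun w => ln (wprob n (f w))).

(** The law of [f] when the first letter is [s]; next, its density [rho] with respect to the law of
    [f] on all words of length [n.+1]. *)
Let P s n t : R := avg n (fun w => (f (s :: w) == t)%:R).
Let rho s n t : R := P s n t / wprob n.+1 t.

Lemma wprob_gt0 n w : size w = n -> 0 < wprob n (f w).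
Proof.
move=> wn; rewrite /wprob /wavg mulr_gt0 ?invr_gt0 ?exprn_gt0//.
have wn' : size w == n by exact/eqP.
by rewrite (bigD1 (Tuple wn'))//= eqxx ltr_pwDl// sumr_ge0.
Qed.

Let rho_avg s n (phi : T -> R) :
  avg n.+1 (fun w => rho s n (f w) * phi (f w)) = avg n (fun u => phi (f (s :: u))).
Proof.
transitivity (avg n (fun u => avg n.+1 (fun w =>
    (f (s :: u) == f w)%:R * (phi (f w) / wprob n.+1 (f w))))).
  rewrite /rho /P /wavg.
  under eq_bigr do rewrite -!mulrA mulr_suml.
  rewrite -mulr_sumr exchange_big/= mulrCA; congr (_ * _).
  rewrite mulr_sumr; apply: eq_bigr => u _; congr (_ * _); apply: eq_bigr => w _.
  by rewrite [(wprob _ _)^-1 * _]mulrC.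
apply: eq_wavg => u un.
transitivity (phi (f (s :: u)) / wprob n.+1 (f (s :: u)) * wprob n.+1 (f (s :: u))).
  rewrite [X in _ = _ * X]/wprob -wavgZ; apply: eq_wavg => w _.
  by rewrite eq_sym; case: eqP => [->|]; rewrite ?mul1r ?mulr1 ?mul0r ?mulr0.
by rewrite divfK// gt_eqF// wprob_gt0//= un.
Qed.

Let rhoE s n u : size u = n ->
  rho s n (f (s :: u)) = wprob n (f u) / wprob n.+1 (f (s :: u)).
Proof.
by move=> un; congr (_ / _); apply: eq_wavg => w _; rewrite f_cons.
Qed.

Let rho_ge0 s n w : size w = n.+1 -> 0 <= rho s n (f w).
Proof.
move=> wn; rewrite divr_ge0//; last exact/ltW/wprob_gt0.
by rewrite -(wavg_cst S_gt0 n 0); apply: (wavg_le S_gt0).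
Qed.

(** Relative entropy of the law with first letter [s] with respect to the full law at time
    [n.+1]. *)
Let D s n : R := avg n (fun u => ln (rho s n (f (s :: u)))).

(** The mutual information of the first letter and the value of [f]: the entropy at [n.+1] minus the
    conditional entropy, which is the entropy at [n] by [f_cons]. *)
Let D_sum n : q^-1 * \sum_s D s n = wentropy n.+1 - wentropy n.
Proof.
rewrite /wentropy opprK wavgS -mulrN -[avg n _ in RHS](mulKf (lt0r_neq0 q_gt0)).
rewrite -mulrDr; congr (_ * _).
rewrite (_ : q * avg n (fun w => ln (wprob n (f w))) =
   \sum_(s : S) avg n (fun w => ln (wprob n (f w)))); last first.
  by rewrite sumr_const mulr_natl.
rewrite -sumrN -big_split/=; apply: eq_bigr => s _.
rewrite addrC -wavgB; apply: eq_wavg => u un; rewrite rhoE// ln_div//.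
- exact: wprob_gt0.
- by apply: wprob_gt0; rewrite /= un.
Qed.

(** With [y] the square root of [x], this is [ln y >= 1 - 1 / y] multiplied by [2 * y ^+ 2]. It
    serves to compare relative entropy with Hellinger distance. *)
Let xlnx (x : R) : 0 <= x -> 2 * (x - Num.sqrt x) <= x * ln x.
Proof.
rewrite le_eqVlt => /predU1P[<-|x0]; first by rewrite sqrtr0 subrr mulr0 mul0r.
set y := Num.sqrt x; have y0 : 0 < y by rewrite sqrtr_gt0.
have xy : x = y ^+ 2 by rewrite sqr_sqrtr// ltW.
rewrite xy lnXn// -mulr_natl.
have : ln y^-1 <= y^-1 - 1 by apply: ln_le_subr1; rewrite invr_gt0.
rewrite lnV ?posrE// => lny.
have : 0 <= y ^+ 2 * (y^-1 - 1 + ln y) by rewrite mulr_ge0 ?sqr_ge0//; lra.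
have -> : y ^+ 2 * (y^-1 - 1 + ln y) = y - y ^+ 2 + y ^+ 2 * ln y.
  by field; rewrite gt_eqF.
by lra.
Qed.

Let rho1 s n : avg n.+1 (fun w => rho s n (f w)) = 1.
Proof.
rewrite -[RHS](wavg_cst S_gt0 n 1) -(rho_avg s n (fun=> 1)).
by apply: eq_wavg => w _; rewrite mulr1.
Qed.

Let DE s n : D s n = avg n.+1 (fun w => rho s n (f w) * ln (rho s n (f w))).
Proof. by rewrite (rho_avg s n (fun t => ln (rho s n t))). Qed.

Let hellinger s n :
  avg n.+1 (fun w => (Num.sqrt (rho s n (f w)) - 1) ^+ 2) <= D s n.
Proof.
have -> : avg n.+1 (fun w => (Num.sqrt (rho s n (f w)) - 1) ^+ 2) =
  avg n.+1 (fun w => 2 * (rho s n (f w) - Num.sqrt (rho s n (f w)))).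
  (* The density has mean 1, so this null term may be added; it turns the square into twice [rho]
     minus its square root. *)
  have h : avg n.+1 (fun w => rho s n (f w) - 1) = 0.
    by rewrite wavgB rho1 wavg_cst// subrr.
  rewrite -[LHS]addr0 -h -wavgD; apply: eq_wavg => w wn.
  by rewrite -{2 3}(sqr_sqrtr (rho_ge0 s wn)); ring.
by rewrite DE; apply: (wavg_le S_gt0) => w wn; apply/xlnx/rho_ge0.
Qed.

Let D_ge0 s n : 0 <= D s n.
Proof.
apply: le_trans (hellinger s n); rewrite -(wavg_cst S_gt0 n.+1 0).
by apply: (wavg_le S_gt0) => w _; exact: sqr_ge0.
Qed.

Lemma wentropy_increment_ge0 n : 0 <= wentropy n.+1 - wentropy n.
Proof. by rewrite -D_sum mulr_ge0 ?invr_ge0 ?(ltW q_gt0) ?sumr_ge0. Qed.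

Let D_le s n : D s n <= q * (wentropy n.+1 - wentropy n).
Proof.
rewrite -D_sum mulVKf ?gt_eqF// (bigD1 s)//= lerDl.
by apply: sumr_ge0 => i _.
Qed.

(** The difference is the average of [phi * (rho - 1)]. With [y] the square root of [rho],
    [|y - 1| * (y + 1)] is split by the inequality between the means with weight [lam];
    [(y + 1) ^+ 2 <= 2 * (rho + 1)], which has average 4, and the other square is bounded by
    [hellinger]. *)
Let first_letter s n (phi : T -> R) (B lam : R) : 0 < lam ->
  (forall t, `|phi t| <= B) ->
  `|avg n (fun u => phi (f (s :: u))) - avg n.+1 (fun w => phi (f w))| <=
  B * ((q * (wentropy n.+1 - wentropy n) / lam + 4 * lam) / 2).
Proof.
move=> lam0 phiB; rewrite -rho_avg -wavgB.
apply: (le_trans (ler_norm_wavg S_gt0 _ _)).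
have B0 : 0 <= B by apply: le_trans (phiB (f [::])).
apply: (@le_trans _ _ (avg n.+1 (fun w =>
   B * (((Num.sqrt (rho s n (f w)) - 1) ^+ 2 / lam +
         2 * (rho s n (f w) + 1) * lam) / 2)))).
  apply: (wavg_le S_gt0) => w wn; rewrite -{2}(mul1r (phi (f w))) -mulrBl normrM mulrC.
  apply: ler_pM => //; have r0 := rho_ge0 s wn.
  set y := Num.sqrt _; have y0 : 0 <= y by exact: sqrtr_ge0.
  have -> : rho s n (f w) = y ^+ 2 by rewrite sqr_sqrtr.
  have -> : y ^+ 2 - 1 = (y - 1) * (y + 1) by ring.
  rewrite normrM (ger0_norm (addr_ge0 y0 ler01)).
  have : 0 <= (`|y - 1| / lam - (y + 1)) ^+ 2 * lam by rewrite mulr_ge0 ?sqr_ge0// ltW.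
  have -> : (`|y - 1| / lam - (y + 1)) ^+ 2 * lam =
     (`|y - 1| ^+ 2 / lam - 2 * (`|y - 1| * (y + 1)) + (y + 1) ^+ 2 * lam).
    by field; rewrite gt_eqF.
  rewrite real_normK ?num_real// => h.
  have : 0 <= lam * (y - 1) ^+ 2 by rewrite mulr_ge0 ?sqr_ge0 ?ltW.
  by nra.
rewrite wavgZ ler_wpM2l//.
rewrite (_ : avg _ _ = (avg n.+1 (fun w => (Num.sqrt (rho s n (f w)) - 1) ^+ 2) / lam
   + 4 * lam) / 2); last first.
  transitivity (2^-1 * avg n.+1 (fun w => lam^-1 * (Num.sqrt (rho s n (f w)) - 1) ^+ 2 +
     (2 * lam) * (rho s n (f w) + 1))).
    by rewrite -wavgZ; apply: eq_wavg => w _; ring.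
  rewrite wavgD !wavgZ wavgD rho1 wavg_cst//; ring.
rewrite ler_pM2r ?invr_gt0// lerD2r ler_pM2r ?invr_gt0//.
exact: le_trans (hellinger s n) (D_le s n).
Qed.

(* [lam] is a free parameter: optimizing it would give Pinsker's bound by the
   square root of the entropy increment, but the linear form sums better. *)
Lemma entropy_letter_bound s s' n (phi : T -> R) (B lam : R) : 0 < lam ->
  (forall t, `|phi t| <= B) ->
  `|avg n (fun u => phi (f (s :: u))) - avg n (fun u => phi (f (s' :: u)))| <=
  B * (q * (wentropy n.+1 - wentropy n) / lam + 4 * lam).
Proof.
move=> lam0 phiB; have h1 := first_letter s n lam0 phiB.
have h2 := first_letter s' n lam0 phiB.
rewrite distrC in h2.
have := ler_normD (avg n (fun u => phi (f (s :: u))) - avg n.+1 (fun w => phi (f w)))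
  (avg n.+1 (fun w => phi (f w)) - avg n (fun u => phi (f (s' :: u)))).
rewrite addrA subrK => /le_trans; apply.
by apply: le_trans (lerD h1 h2) _; rewrite -mulrDr -splitr.
Qed.

(** Jensen's inequality for the logarithm, in the form [ln x >= 1 - 1 / x]. It remains to see that
    the average of the inverse probabilities counts the values taken, at most one for each element
    of [J]. *)
Lemma wentropy_le_ln (J : finType) (g : seq S -> J) n :
  (forall u w, size u = n -> size w = n -> g u = g w -> f u = f w) ->
  wentropy n <= ln #|J|%:R.
Proof.
move=> gf.
have J0 : 0 < #|J|%:R :> R by rewrite ltr0n; apply/card_gt0P; exists (g (nseq n (enum_val (Ordinal S_gt0)))).
rewrite /wentropy -subr_ge0 opprK.
have -> : ln #|J|%:R + avg n (fun w => ln (wprob n (f w))) =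
   avg n (fun w => ln (#|J|%:R * wprob n (f w))).
  rewrite -{1}(wavg_cst S_gt0 n (ln _)) -wavgD; apply: eq_wavg => w wn.
  by rewrite lnM// posrE// wprob_gt0.
apply: (@le_trans _ _ (avg n (fun w => 1 - (#|J|%:R * wprob n (f w))^-1))); last first.
  apply: (wavg_le S_gt0) => w wn; set x := _ * _.
  have x0 : 0 < x by rewrite mulr_gt0// wprob_gt0.
  have : ln x^-1 <= x^-1 - 1 by apply: ln_le_subr1; rewrite invr_gt0.
  by rewrite lnV ?posrE//; lra.
rewrite wavgB wavg_cst// subr_ge0.
under eq_wavg do rewrite invfM.
rewrite wavgZ ler_pdivrMl// mulr1.
rewrite /wavg mulr_sumr (partition_big (fun w : n.-tuple S => g w) xpredT)//=.
have -> : #|J|%:R = \sum_(j : J) 1 :> R by rewrite sumr_const.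
apply: ler_sum => j _.
have [/existsP[w0 /eqP gw0]|] := boolP [exists w : n.-tuple S, g w == j]; last first.
  by move=> /existsPn gj; rewrite big1// => w gwj; have := gj w; rewrite gwj.
have p0 : 0 < wprob n (f w0) by rewrite wprob_gt0// size_tuple.
rewrite (eq_bigr (fun=> q ^- n / wprob n (f w0))); last first.
  by move=> w /eqP gw; congr (_ / wprob _ _); apply: gf; rewrite ?size_tuple// gw gw0.
rewrite -big_distrl/= ler_pdivrMr// mul1r /wprob /wavg.
rewrite big_mkcond/= mulr_sumr; apply: ler_sum => w _.
case: ifPn => [/eqP gw|_]; last by rewrite mulr_ge0// invr_ge0 exprn_ge0// ltW.
by rewrite (_ : f w = f w0) ?eqxx ?mulr1//; apply: gf; rewrite ?size_tuple// gw gw0.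
Qed.

End entropy.

(** * Signatures of words *)

Definition rdiff {S T : Type} {V : zmodType} (act : T -> S -> T) l (u : T -> V) x : V :=
  u (act x l) - u x.

Section subword_count.
Context {S : finType}.
Implicit Types (w I : seq S).

(* The number of occurrences of [I] as a scattered subword of [w]. *)
Fixpoint subw w I : nat :=
  match w, I with
  | _, [::] => 1
  | [::], _ :: _ => 0
  | l :: w', i :: I' => (subw w' I + (i == l) * subw w' I')%N
  end.

Lemma subw0 w : subw w [::] = 1%N. Proof. by case: w. Qed.

Lemma subw_le w I : (subw w I <= (size w).+1 ^ size I)%N.
Proof.
elim: w I => [|l w IH] [|i I] //=; rewrite ?expn_gt0 ?exp1n//.
have := IH (i :: I); have := IH I; rewrite /= !expnS.
set a := subw w I; set b := subw w (i :: I); move=> ha hb.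
apply: (@leq_trans (b + a)%N); first by rewrite leq_add2l; case: eqP; rewrite ?mul1n.
apply: (@leq_trans ((size w).+1 * (size w).+1 ^ size I + (size w).+1 ^ size I)%N).
  exact: leq_add.
by rewrite addnC -mulSn leq_mul2l; case: (size I) => // k; rewrite leq_exp2r// leqnSn orbT.
Qed.

Definition signature d w : {ffun {bseq d of S} -> nat} :=
  [ffun I : {bseq d of S} => subw w I].

Lemma signatureP d u w :
  reflect (forall I, (size I <= d)%N -> subw u I = subw w I)
    (signature d u == signature d w).
Proof.
apply: (iffP eqP) => [+ I Id|uw].
  by move=> /ffunP/(_ (Bseq Id)); rewrite !ffunE.
by apply/ffunP => I; rewrite !ffunE uw// size_bseq.
Qed.

(** [subw (s :: u) (i :: I)] is [subw u (i :: I)] plus possibly [subw u I]: a system that is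
    triangular in the length of the subword, hence solvable by induction on that length. *)
Lemma signature_cons d s u w :
  (signature d (s :: u) == signature d (s :: w)) =
  (signature d u == signature d w).
Proof.
apply/signatureP/signatureP => uw [|i I]; rewrite ?subw0//=.
  elim: I i => [|j I IH] i Id.
    by have := uw [:: i] Id; rewrite /= !subw0 => /addIn.
  by have := uw [:: i, j & I] Id; rewrite /= (IH _ (ltnW Id)) => /addIn.
by move=> Id; rewrite !uw// ltnW.
Qed.

Lemma signature_inj_count d n :
  exists g : seq S -> {ffun {bseq d of S} -> 'I_(n.+1 ^ d).+1},
  forall u w, size u = n -> size w = n -> g u = g w -> signature d u = signature d w.
Proof.
exists (fun w => [ffun I : {bseq d of S} => inord (subw w I)]) => u w un wn.
move=> /ffunP uw; apply/ffunP => I; have := uw I; rewrite !ffunE => /(congr1 val)/=.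
have b v : size v = n -> (subw v I < (n.+1 ^ d).+1)%N.
  move=> vn; rewrite ltnS (leq_trans (subw_le _ _))// vn.
  by rewrite leq_pexp2l// size_bseq.
by rewrite !inordK ?b.
Qed.

Lemma wentropy_signature_le {R : realType} d : (0 < #|S|)%N ->
  exists2 C : R, 0 < C & forall n,
  wentropy (signature d) n <= C * (1 + ln (n.+1)%:R).
Proof.
move=> S0; exists (#|{: {bseq d of S}}|%:R * (d%:R + 1)).
  rewrite mulr_gt0 ?ltr_wpDl// ltr0n; apply/card_gt0P.
  by exists [bseq].
move=> n; have [g gP] := signature_inj_count d n.
apply: (le_trans (wentropy_le_ln S0 gP)).
rewrite card_ffun card_ord natrX lnXn ?ltr0n// -[leLHS]mulr_natl -mulrA.
rewrite ler_pM2l; last first.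
  by rewrite ltr0n; apply/card_gt0P; exists [bseq].
have n0 : 0 <= ln (n.+1%:R : R) by rewrite ln_ge0// ler1n.
apply: (@le_trans _ _ (ln (2 * n.+1%:R ^+ d))).
  rewrite ler_ln ?posrE ?mulr_gt0 ?exprn_gt0 ?ltr0n//.
  rewrite -natrX -natrM ler_nat mul2n -addnn -addn1 leq_add2l.
  by rewrite expn_gt0.
rewrite lnM ?posrE ?exprn_gt0 ?ltr0n// lnXn ?ltr0n// -[_ *+ d]mulr_natl.
have : ln (2 : R) <= 1 by apply: le_trans (ln_le_subr1 _) _; lra.
have : 0 <= d%:R :> R by [].
lra.
Qed.

Context {T : Type} (act : T -> S -> T) {V : zmodType}.
Implicit Type u : T -> V.
Local Notation rdiff := (rdiff act).

(** Translation by a letter [l] is the identity plus [rdiff l]. Expanding the product over the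
    letters of [w] gives one iterated difference for each scattered subword: a noncommutative Newton
    formula, finite because differences of order [d.+1] vanish. *)
Lemma subword_expansion d u : (forall I, size I = d.+1 -> foldr rdiff u I =1 (fun=> 0)) ->
  forall w x, u (foldl act x w) =
    \sum_(k < d.+1) \sum_(I : k.-tuple S) foldr rdiff u I x *+ subw w I.
Proof.
move=> u0; elim=> [|l w IH] x /=.
  rewrite big_ord_recl/= [X in _ + X]big1 ?addr0; last first.
    by move=> i _; rewrite big1// => -[[|a I] sI].
  rewrite (bigD1 [tuple]) //= big1 ?addr0 // => w.
  by rewrite (tuple0 w) (_ : [tuple] == [tuple]).
rewrite IH.
have rd (J : seq S) : foldr rdiff u J (act x l) =
    foldr rdiff u J x + rdiff l (foldr rdiff u J) x by rewrite /rdiff subrKC.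
transitivity (\sum_(k < d.+1) (\sum_(I : k.-tuple S) foldr rdiff u I x *+ subw w I
    + \sum_(I : k.-tuple S) rdiff l (foldr rdiff u I) x *+ subw w I)).
  apply: eq_bigr => k _; rewrite -big_split/=; apply: eq_bigr => I _.
  by rewrite rd mulrnDl.
(* The term of top order vanishes by hypothesis; the other differences by [l], of order [k], are
   matched with the subwords of length [k.+1] that begin with [l]. *)
rewrite big_split/= [in X in _ + X]big_ord_recr/= [X in _ + (_ + X)]big1 ?addr0; last first.
  by move=> I _; rewrite [rdiff _ _ _](u0 (l :: I)) ?mul0rn//= size_tuple.
rewrite [in LHS]big_ord_recl [in RHS]big_ord_recl -addrA; congr (_ + _).
  by apply: eq_bigr => I _; rewrite (tuple0 I) /= subw0.
rewrite -big_split/=; apply: eq_bigr => k _.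
rewrite (big_tuple_cons _ (fun I => foldr rdiff u I x *+ subw w I)).
rewrite (big_tuple_cons _ (fun I => foldr rdiff u I x *+ subw (l :: w) I))/=.
under [RHS]eq_bigr do under eq_bigr do rewrite mulrnDr.
under [RHS]eq_bigr do rewrite big_split/=.
rewrite big_split/=; congr (_ + _).
rewrite exchange_big/=; apply: eq_bigr => I _.
rewrite (bigD1 l)//= eqxx mul1n big1 ?addr0// => i /negbTE il.
by rewrite il mul0n mulr0n.
Qed.

Lemma signature_act d u : (forall I, size I = d.+1 -> foldr rdiff u I =1 (fun=> 0)) ->
  forall w w' x, signature d w = signature d w' ->
    u (foldl act x w) = u (foldl act x w').
Proof.
move=> u0 w w' x /eqP/signatureP ww'; rewrite !(subword_expansion u0).
apply: eq_bigr => k _; apply: eq_bigr => I _; rewrite ww'// size_tuple.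
by rewrite -ltnS.
Qed.

End subword_count.

(** * Calculus on row vectors *)

Section row_vectors.
Context {R : realType}.

Lemma rV_norm_leP n (v : 'rV[R]_n) (e : R) : 0 <= e ->
  reflect (forall i, `|v 0 i| <= e) (`|v| <= e).
Proof.
move=> e0; rewrite [`|v|]/Num.norm/= mx_normrE; apply: (iffP idP) => [ve i|ve].
  by apply: le_trans ve; exact: (le_bigmax _ (fun ij => `|v ij.1 ij.2|) (0, i)).
by apply: bigmax_le => // -[i j] _ /=; rewrite (ord1 i).
Qed.

Lemma coord_le_norm n (v : 'rV[R]_n) i : `|v 0 i| <= `|v|.
Proof. exact/rV_norm_leP. Qed.

Lemma cvg_sumr (T I : Type) (F : set_system T) {FF : Filter F}
    (W : normedModType R) (r : seq I) (f : I -> T -> W) (l : I -> W) :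
  (forall i, f i @ F --> l i) ->
  (fun t => \sum_(i <- r) f i t) @ F --> \sum_(i <- r) l i.
Proof.
move=> fl; elim: r => [|i r IH].
  by under eq_fun do rewrite big_nil; rewrite big_nil; exact: cvg_cst.
under eq_fun do rewrite big_cons; rewrite big_cons.
by apply: cvgD => //; exact: fl.
Qed.

Lemma cvg_rVP (T : Type) (F : set_system T) {FF : Filter F} n (f : T -> 'rV[R]_n)
    (l : 'rV[R]_n) :
  (f @ F --> l) <-> (forall i, (fun t => f t 0 i) @ F --> l 0 i).
Proof.
split=> [fl i|fl].
  apply: (@continuous_cvg _ _ _ F FF f (fun v : 'rV[R]_n => v 0 i) l) => //.
  exact: coord_continuous.
apply/cvgrPdist_le => e e0.
have : \forall t \near F, forall i, `|l 0 i - f t 0 i| <= e.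
  by apply: filter_forall => i; move/cvgrPdist_le : (fl i) => /(_ _ e0).
apply: filterS => t lt; apply/rV_norm_leP => [|i]; first exact: ltW.
by rewrite !mxE.
Qed.

Lemma rV_continuousP (T : topologicalType) n (f : T -> 'rV[R]_n) :
  continuous f <-> forall i, continuous (fun t => f t 0 i).
Proof.
split=> [cf i x|cf x]; first exact: (cvg_rVP _ _).1 (cf x) i.
by apply/cvg_rVP => i; exact: cf.
Qed.

Lemma cvg_shift0 (V : normedModType R) (x v : V) :
  h *: v + x @[h --> (0 : R)] --> x.
Proof.
have h : (fun h : R => h *: v + x) @ (0 : R) --> 0 *: v + x.
  by apply: cvgD; [apply: cvgZr_tmp; exact: cvg_id|exact: cvg_cst].
by move: h; rewrite scale0r add0r.
Qed.

Lemma is_deriveP (V W : normedModType R) (f : V -> W) x v l :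
  is_derive x v f l <-> h^-1 *: (f (h *: v + x) - f x) @[h --> 0^'] --> l.
Proof.
split=> [[df <-]|fl]; first exact: df.
by apply: DeriveDef; [apply/cvg_ex; exists l|apply/cvg_lim].
Qed.

Lemma is_derive_rVP (V : normedModType R) n (f : V -> 'rV[R]_n) x v (l : 'rV[R]_n) :
  is_derive x v f l <-> forall i, is_derive x v (fun t => f t 0 i) (l 0 i).
Proof.
split=> [/is_deriveP/cvg_rVP fl i|fl].
  by apply/is_deriveP; have := fl i; under eq_fun do rewrite !mxE.
apply/is_deriveP/cvg_rVP => i; have /is_deriveP := fl i.
by under [X in _ -> X @ _ --> _]eq_fun do rewrite !mxE.
Qed.

Lemma derivable_rVP (V : normedModType R) n (f : V -> 'rV[R]_n) x v :
  derivable f x v <-> forall i, derivable (fun t => f t 0 i) x v.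
Proof.
rewrite derivable_mxP; split=> H i; first exact: H.
by move=> j; rewrite (ord1 i).
Qed.

Lemma derive_rVE (V : normedModType R) n (f : V -> 'rV[R]_n) x v i :
  derivable f x v -> ('D_v f x) 0 i = 'D_v (fun t => f t 0 i) x.
Proof. by move=> df; rewrite derive_mx// mxE. Qed.

Lemma is_derive_comp_affine (V' V W : normedModType R) (f : V -> W)
    (L : V' -> V) x v w l :
  (forall h : R, L (h *: w + x) = h *: v + L x) ->
  is_derive (L x) v f l -> is_derive x w (f \o L) l.
Proof.
move=> LE /is_deriveP fl; apply/is_deriveP.
by under eq_fun do rewrite /= LE.
Qed.

Lemma is_derive_line (V W : normedModType R) (f : V -> W) x v (t : R) l :
  is_derive (x + t *: v) v f l -> is_derive t 1 (fun s : R => f (x + s *: v)) l.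
Proof.
apply: (@is_derive_comp_affine _ _ _ f (fun s : R => x + s *: v)) => h.
by rewrite /= scalerDl [h *: 1]mulr1 addrCA.
Qed.

Lemma is_derive_affine (V : normedModType R) (x v : V) (t : R) :
  is_derive t 1 (fun s : R => x + s *: v) v.
Proof. by apply: (@is_derive_line _ _ id); exact: is_derive_id. Qed.

Lemma is_derive_comp1 (W : normedModType R) (f : R -> W) (g : R -> R) x l d :
  is_derive (g x) 1 f l -> is_derive x 1 g d -> is_derive x 1 (f \o g) (d *: l).
Proof.
move=> [df fl] [dg gd].
have df' : differentiable f (g x) by exact/derivable1_diffP.
have dg' : differentiable g x by exact/derivable1_diffP.
apply: DeriveDef; first by apply/derivable1_diffP; exact: differentiable_comp.
rewrite deriveE; last exact: differentiable_comp.
rewrite diff_comp//= diff1E// diff1E//= !derive1E fl gd.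
by rewrite [1 *: _]mul1r.
Qed.

Lemma is_deriveZv (V W : normedModType R) (f : V -> W) x v l (c : R) :
  is_derive x v f l -> is_derive x (c *: v) f (c *: l).
Proof.
move=> fl; apply/is_deriveP.
have : is_derive (0 : R) 1 ((fun s : R => f (x + s *: v)) \o (fun t => c * t)) (c *: l).
  apply: is_derive_comp1.
    by apply: is_derive_line; rewrite mulr0 scale0r addr0.
  rewrite (_ : ( *%R c) = c \*: (@id R))//; apply: is_derive_eq.
  by rewrite [_ *: _]mulr1.
move=> /is_deriveP; under eq_fun do rewrite /= addr0 mulr0 scale0r addr0.
under eq_fun => h do rewrite [h *: 1]mulr1 mulrC -scalerA [x + _]addrC.
exact.
Qed.

Lemma is_derive_continuous (W : normedModType R) (f : R -> W) (x : R) l :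
  is_derive x 1 f l -> {for x, continuous f}.
Proof. by move=> [df _]; apply/differentiable_continuous/derivable1_diffP. Qed.

Lemma MVT01 (f df : R -> R) :
  (forall t : R, is_derive t 1 f (df t)) ->
  exists2 c, 0 <= c <= 1 & f 1 - f 0 = df c.
Proof.
move=> fd; have cf : {within `[0, 1], continuous f}.
  apply/continuous_subspaceT => x; exact: is_derive_continuous (fd x).
have [c] := MVT_segment ler01 (fun x _ => fd x) cf.
by rewrite in_itv/= subr0 mulr1 => c01 ->; exists c.
Qed.

Lemma is_derive0_cst n (f : R -> 'rV[R]_n) (s t : R) :
  (forall t : R, is_derive t 1 f 0) -> f s = f t.
Proof.
move=> fd; apply/rowP => i.
apply: (@is_derive_0_is_cst R (fun t => f t 0 i)) => u.
by have /is_derive_rVP/(_ i) := fd u; rewrite mxE.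
Qed.

End row_vectors.

Section C1.
Context {R : realType} {n : nat}.
Local Notation e_ i := (delta_mx 0 i : 'rV[R]_n).

(** Only directional derivatives enter, as in [is_Ck]. Linearity in the direction and the chain rule
    are recovered from the mean value formula that follows. *)
Definition is_C1 (f : 'rV[R]_n -> R) :=
  forall v, (forall x, derivable f x v) /\ continuous ('D_v f).

Let trunc (h : 'rV[R]_n) k : 'rV[R]_n := \row_i (if (i < k)%N then h 0 i else 0).

Let truncS (h : 'rV[R]_n) (k : 'I_n) : trunc h k.+1 = trunc h k + h 0 k *: e_ k.
Proof.
apply/rowP => i; rewrite !mxE eqxx/= ltnS leq_eqVlt.
rewrite (_ : (i == k :> nat) = (i == k))//.
by case: eqVneq => [->|ik]/=; rewrite ?ltnn ?mulr1 ?add0r ?mulr0 ?addr0.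
Qed.

(** The coordinates are changed one at a time on the way from [x] to [x + h], each time with the
    mean value theorem in one variable; hence one intermediate point per coordinate. *)
Lemma C1_mvt (f : 'rV[R]_n -> R) : is_C1 f -> forall x h,
  exists2 xi : 'I_n -> 'rV[R]_n, (forall i, `|xi i - x| <= `|h|) &
    f (x + h) - f x = \sum_i h 0 i * 'D_(e_ i) f (xi i).
Proof.
move=> f1 x h.
have step (k : 'I_n) : exists2 y : 'rV[R]_n, `|y - x| <= `|h| &
    f (x + trunc h k.+1) - f (x + trunc h k) = h 0 k * 'D_(e_ k) f y.
  have [c c01 E] := @MVT01 R (fun t => f ((x + trunc h k) + t *: (h 0 k *: e_ k)))
    (fun t => h 0 k * 'D_(e_ k) f ((x + trunc h k) + t *: (h 0 k *: e_ k)))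
    ltac:(by move=> t; apply: is_derive_line; apply: is_deriveZv;
          exact: derivableP ((f1 _).1 _)).
  exists (x + trunc h k + c *: (h 0 k *: e_ k)); last first.
    by rewrite -E scale1r scale0r addr0 truncS addrA.
  rewrite -(addrA x) [x + _]addrC addrK; apply/rV_norm_leP => // i.
  rewrite !mxE eqxx/=; case: eqVneq => [->|ik]/=.
    rewrite ltnn add0r mulr1 normrM (le_trans _ (coord_le_norm h k))//.
    by rewrite ler_piMl// ger0_norm//; case/andP: c01.
  by rewrite !mulr0 addr0; case: ifP => _; rewrite ?normr0 ?coord_le_norm.
have /choice[xi xiP] : forall k : 'I_n, exists y, `|y - x| <= `|h| /\
    f (x + trunc h k.+1) - f (x + trunc h k) = h 0 k * 'D_(e_ k) f y.
  by move=> k; have [y] := step k; exists y.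
exists xi => [i|]; first by have [] := xiP i.
rewrite -(eq_bigr _ (fun k _ => (xiP k).2)).
rewrite -(big_mkord xpredT (fun k => f (x + trunc h k.+1) - f (x + trunc h k))).
rewrite telescope_sumr//; congr (f (x + _) - f _).
  by apply/rowP => i; rewrite mxE ltn_ord.
by rewrite (_ : trunc h 0 = 0) ?addr0//; apply/rowP => i; rewrite !mxE.
Qed.

Lemma C1_comp f (y : R -> 'rV[R]_n) (t : R) v : is_C1 f -> is_derive t 1 y v ->
  is_derive t 1 (f \o y) (\sum_i v 0 i * 'D_(e_ i) f (y t)).
Proof.
move=> f1 yv; apply/is_deriveP.
have yc := is_derive_continuous yv; move/is_deriveP in yv.
have /choice[xi xiP] : forall h : R, exists xi : 'I_n -> 'rV[R]_n,
    (forall i, `|xi i - y t| <= `|y (h *: 1 + t) - y t|) /\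
    f (y (h *: 1 + t)) - f (y t) =
      \sum_i (y (h *: 1 + t) - y t) 0 i * 'D_(e_ i) f (xi i).
  move=> h; have [xi xi1 xi2] := C1_mvt f1 (y t) (y (h *: 1 + t) - y t).
  by exists xi; split=> //; rewrite -xi2 [y t + _]addrC subrK.
rewrite (_ : (fun h : R => _) = fun h => \sum_i
    (h^-1 * (y (h *: 1 + t) - y t) 0 i) * 'D_(e_ i) f (xi h i)); last first.
  apply/funext => h; rewrite /= (xiP _).2 scaler_sumr.
  by apply: eq_bigr => i _; rewrite [LHS]mulrA.
apply: cvg_sumr => i; apply: cvgM.
  by move/cvg_rVP : yv => /(_ i); under [X in X @ _ --> _ -> _]eq_fun do rewrite mxE.
have xit : xi h i @[h --> 0^'] --> y t.
  apply/cvgrPdist_le => e e0.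
  have yt : y (h *: 1 + t) @[h --> (0 : R)^'] --> y t.
    apply: cvg_within_filter.
    apply: (@cvg_comp _ _ _ (fun h : R => h *: 1 + t) y _ (nbhs t)) => //.
    exact: cvg_shift0.
  move/cvgrPdist_le : yt => /(_ _ e0); apply: filterS => h yh.
  by rewrite distrC (le_trans ((xiP h).1 i))// distrC.
apply: (@cvg_comp _ _ _ (xi ^~ i) ('D_(e_ i) f) _ _ _ xit).
exact: (f1 (e_ i)).2.
Qed.

Lemma C1_derive f x v : is_C1 f -> 'D_v f x = \sum_i v 0 i * 'D_(e_ i) f x.
Proof.
move=> f1; have d0 := is_derive_affine x v 0.
have := C1_comp f1 d0; rewrite /= scale0r addr0 => d1.
have [_ <-] := d1.
have [_ ] : is_derive (0 : R) 1 (fun s : R => f (x + s *: v)) ('D_v f x).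
  by apply: is_derive_line; rewrite scale0r addr0; apply/derivableP/(f1 _).1.
by move=> <-.
Qed.

End C1.

Lemma cvg_pair_nbhs (T : Type) (U V : topologicalType) (F : set_system T)
    {FF : Filter F} (f : T -> U) (g : T -> V) (a : U) (b : V) :
  f @ F --> a -> g @ F --> b -> (fun t => (f t, g t)) @ F --> (a, b).
Proof.
by move=> fa gb; exact: (@cvg_pair _ _ _ F (nbhs a) (nbhs b) _ _ _ f g fa gb).
Qed.

Lemma pair_scaleD (R : realType) (V W : normedModType R) (h : R) (v x : V) (w y : W) :
  h *: (v, w) + (x, y) = (h *: v + x, h *: w + y).
Proof. by []. Qed.

Section smooth_slices.
Context {R : realType}.

Lemma is_Ck_comp_affine (V' V W : normedModType R) (L L0 : V' -> V) (f : V -> W) k :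
  continuous L -> (forall (h : R) w x, L (h *: w + x) = h *: L0 w + L x) ->
  is_Ck k f -> is_Ck k (f \o L).
Proof.
move=> cL LE; elim: k f => [|k IH] f /= [cf df].
  by split=> // x; apply: (continuous_comp (cL x)); exact: cf.
split=> [x|w]; first by apply: (continuous_comp (cL x)); exact: cf.
have D x : is_derive x w (f \o L) ('D_(L0 w) f (L x)).
  by apply: (is_derive_comp_affine (fun h => LE h w x)); apply: derivableP; exact: (df _).1.
split=> [x|]; first by have [] := D x.
rewrite (_ : 'D_w (f \o L) = 'D_(L0 w) f \o L); first exact: IH (df _).2.
by apply/funext => x; have [_] := D x.
Qed.

Lemma is_Ck_continuous (V W : normedModType R) (f : V -> W) k :
  is_Ck k f -> continuous f.
Proof. by case: k => [|k] []. Qed.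

Lemma is_Ck_coord (V : normedModType R) n (f : V -> 'rV[R]_n) k i :
  is_Ck k f -> is_Ck k (fun x => f x 0 i).
Proof.
elim: k f => [|k IH] f /= [cf df].
  by split=> //; exact: (rV_continuousP _).1 cf i.
split=> [|v]; first exact: (rV_continuousP _).1 cf i.
have [dfv fk] := df v.
split=> [x|]; first exact: (derivable_rVP _ _ _).1 (dfv x) i.
rewrite (_ : 'D_v _ = fun x => 'D_v f x 0 i); first exact: IH.
by apply/funext => x; rewrite derive_rVE.
Qed.

Lemma is_Ck_C1 n (f : 'rV[R]_n -> R) k : is_Ck k.+1 f -> is_C1 f.
Proof.
by move=> [_ fk] v; have [dv /is_Ck_continuous] := fk v.
Qed.

End smooth_slices.

Lemma linear_rV_sum {R : realType} n (W : lmodType R) (f : 'rV[R]_n -> W) v :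
  linear f -> f v = \sum_i v 0 i *: f (delta_mx 0 i).
Proof.
move=> lf; pose F : {linear _ -> _} := HB.pack f (GRing.isLinear.Build _ _ _ _ f lf).
rewrite -[f]/(F : _ -> _) {1}(row_sum_delta v) linear_sum.
by apply: eq_bigr => i _; rewrite linearZ.
Qed.

Section linear_functions.
Context {R : pzRingType} {U W : lmodType R} (f : U -> W) (lf : linear f).
Lemma lin0 : f 0 = 0.
Proof. by have := lf (-1) 0 0; rewrite scaler0 addr0 scaleN1r addNr. Qed.
Lemma linD u v : f (u + v) = f u + f v.
Proof. by have := lf 1 u v; rewrite !scale1r. Qed.
Lemma linZ a u : f (a *: u) = a *: f u.
Proof. by have := lf a u 0; rewrite lin0 !addr0. Qed.
Lemma linN u : f (- u) = - f u.
Proof. by rewrite -!scaleN1r linZ. Qed.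
Lemma linB u v : f (u - v) = f u - f v.
Proof. by rewrite linD linN. Qed.
End linear_functions.

(** * Left-invariant fields in exponential coordinates *)

Section exp_group.
Context {R : realType} {N : nat} (op : 'rV[R]_N -> 'rV[R]_N -> 'rV[R]_N).
Hypothesis hop : is_exp_lie_group op.
Local Notation pt := 'rV[R]_N.
Local Notation e_ i := (delta_mx 0 i : pt).
Implicit Types x y z u v w : pt.

Lemma opA x y z : op x (op y z) = op (op x y) z. Proof. exact: exp_opA hop x y z. Qed.
Lemma op0x x : op 0 x = x. Proof. exact: exp_op0x. Qed.
Lemma opx0 x : op x 0 = x. Proof. exact: exp_opx0. Qed.
Lemma opNx x : op (- x) x = 0. Proof. exact: exp_opNx. Qed.
Lemma opxN x : op x (- x) = 0. Proof. by rewrite -{1}(opprK x) opNx. Qed.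
Lemma opKx x y : op (- x) (op x y) = y. Proof. by rewrite opA opNx op0x. Qed.
Lemma opxK x y : op (op x y) (- y) = x. Proof. by rewrite -opA opxN opx0. Qed.
Lemma opNK x y : op x (op (- x) y) = y. Proof. by rewrite opA opxN op0x. Qed.
Lemma opKN x y : op (op x (- y)) y = x. Proof. by rewrite -opA opNx opx0. Qed.
Lemma oppop x y : - op x y = op (- y) (- x).
Proof. by rewrite -[LHS]opx0 -(opxN x) -{1}(opNK y (- x)) !opA -[op (op (- _) _) y]opA opNx op0x. Qed.

Lemma op_continuous : continuous (fun p : pt * pt => op p.1 p.2).
Proof. exact: is_Ck_continuous (exp_op_smooth hop 0). Qed.

Lemma cvg_op (T : Type) (F : set_system T) {FF : Filter F} (f g : T -> pt) x y :
  f @ F --> x -> g @ F --> y -> (fun t => op (f t) (g t)) @ F --> op x y.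
Proof.
move=> fx gy; apply: (@continuous2_cvg _ _ _ _ F FF f g op x y) => //.
have h := op_continuous (x := (x, y)); exact: h.
Qed.

Let opi i (p : pt * pt) := op p.1 p.2 0 i.

Let opi_smooth i k : is_Ck k (opi i).
Proof. exact: is_Ck_coord (exp_op_smooth hop k). Qed.

Let slice1 z k (f : pt * pt -> R) : is_Ck k f -> is_Ck k (fun x => f (x, z)).
Proof.
apply: (@is_Ck_comp_affine _ _ _ _ (fun x => (x, z)) (fun x => (x, 0))).
  move=> x; apply: (@cvg_pair_nbhs _ _ _ (nbhs x) _ id (cst z) x z) => //.
  exact: cvg_cst.
by move=> h w x; rewrite pair_scaleD scaler0 add0r.
Qed.

Let slice2 x k (f : pt * pt -> R) : is_Ck k f -> is_Ck k (fun z => f (x, z)).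
Proof.
apply: (@is_Ck_comp_affine _ _ _ _ (fun z => (x, z)) (fun z => (0, z))).
  move=> z; apply: (@cvg_pair_nbhs _ _ _ (nbhs z) _ (cst x) id x z) => //.
  exact: cvg_cst.
by move=> h w z; rewrite pair_scaleD scaler0 add0r.
Qed.

Lemma op_C1l z i : is_C1 (fun x => op x z 0 i).
Proof. exact: is_Ck_C1 (slice1 z (opi_smooth i 1)). Qed.

Lemma op_C1r x i : is_C1 (fun z => op x z 0 i).
Proof. exact: is_Ck_C1 (slice2 x (opi_smooth i 1)). Qed.

(** The partial differentials of the group law with respect to its second factor, and for [dopl] its
    first. *)
Definition dopr w (p : pt * pt) : pt := \row_i 'D_(0, w) (opi i) p.
Definition dopl w (p : pt * pt) : pt := \row_i 'D_(w, 0) (opi i) p.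

Lemma dopr_continuous w : continuous (dopr w).
Proof.
apply/rV_continuousP => i; have [_ /(_ (0, w))[_ [cw _]]] := opi_smooth i 1.
by under eq_fun do rewrite mxE.
Qed.

Lemma doprE w x z i : 'D_w (fun z => op x z 0 i) z = dopr w (x, z) 0 i.
Proof.
rewrite mxE; apply: (@derive_val _ _ _ _ _ (opi i \o pair x)).
apply: (@is_derive_comp_affine _ _ _ _ (opi i) (fun z => (x, z)) z (0, w)).
  by move=> h; rewrite pair_scaleD scaler0 add0r.
by apply: derivableP; exact: ((opi_smooth i 1).2 _).1.
Qed.

Lemma doplE w x z i : 'D_w (fun x => op x z 0 i) x = dopl w (x, z) 0 i.
Proof.
rewrite mxE; apply: (@derive_val _ _ _ _ _ (opi i \o pair^~ z)).
apply: (@is_derive_comp_affine _ _ _ _ (opi i) (fun x => (x, z)) x (w, 0)).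
  by move=> h; rewrite pair_scaleD scaler0 add0r.
by apply: derivableP; exact: ((opi_smooth i 1).2 _).1.
Qed.

Lemma dopr_sum w p : dopr w p = \sum_k w 0 k *: dopr (e_ k) p.
Proof.
case: p => x z; apply/rowP => i; rewrite -doprE (C1_derive _ _ (op_C1r x i)) summxE.
by apply: eq_bigr => k _; rewrite mxE doprE.
Qed.

Lemma dopl_sum w p : dopl w p = \sum_k w 0 k *: dopl (e_ k) p.
Proof.
case: p => x z; apply/rowP => i; rewrite -doplE (C1_derive _ _ (op_C1l z i)) summxE.
by apply: eq_bigr => k _; rewrite mxE doplE.
Qed.

Lemma dopr_linear p : linear (dopr^~ p).
Proof.
move=> a u v; rewrite dopr_sum [in RHS](dopr_sum u) [in RHS](dopr_sum v).
rewrite scaler_sumr -big_split; apply: eq_bigr => k _ /=.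
by rewrite !mxE scalerDl scalerA.
Qed.

Lemma dopl_linear p : linear (dopl^~ p).
Proof.
move=> a u v; rewrite dopl_sum [in RHS](dopl_sum u) [in RHS](dopl_sum v).
rewrite scaler_sumr -big_split; apply: eq_bigr => k _ /=.
by rewrite !mxE scalerDl scalerA.
Qed.

Lemma is_derive_opr x (u : R -> pt) (t : R) w :
  is_derive t 1 u w -> is_derive t 1 (fun s => op x (u s)) (dopr w (x, u t)).
Proof.
move=> uw; apply/is_derive_rVP => i.
rewrite -doprE (C1_derive _ _ (op_C1r x i)).
exact: C1_comp (op_C1r x i) uw.
Qed.

Lemma is_derive_opl z (u : R -> pt) (t : R) w :
  is_derive t 1 u w -> is_derive t 1 (fun s => op (u s) z) (dopl w (u t, z)).
Proof.
move=> uw; apply/is_derive_rVP => i.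
rewrite -doplE (C1_derive _ _ (op_C1l z i)).
exact: C1_comp (op_C1l z i) uw.
Qed.

(* The left-invariant field extending [v]. *)
Fact lfield_subproof : {b | b = fun x v : pt => dopr v (x, 0)}.
Proof. by eexists. Qed.
Definition lfield : pt -> pt -> pt := sval lfield_subproof.

Lemma lfield_def x v : lfield x v = dopr v (x, 0).
Proof. by rewrite /lfield (svalP lfield_subproof). Qed.

Lemma lfieldE x v : lie_derive op v id x = lfield x v.
Proof.
rewrite lfield_def /lie_derive derive1E; apply: derive_val.
have := @is_derive_opr x (fun t => 0 + t *: v) 0 v (is_derive_affine 0 v 0).
by rewrite scale0r addr0; under eq_fun do rewrite add0r.
Qed.

Lemma is_derive_lfield x (u : R -> pt) (t : R) w : is_derive t 1 u w -> u t = 0 ->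
  is_derive t 1 (fun s => op x (u s)) (lfield x w).
Proof. by move=> uw ut; rewrite lfield_def -ut; exact: is_derive_opr. Qed.

Lemma is_derive_scale v (t : R) : is_derive t 1 (fun s : R => s *: v) v.
Proof.
by have := is_derive_affine 0 v t; under eq_fun do rewrite add0r.
Qed.

Lemma is_derive_flow x v (t : R) :
  is_derive t 1 (fun s : R => op x (s *: v)) (lfield (op x (t *: v)) v).
Proof.
have : is_derive t 1 (fun s : R => (s - t) *: v) v.
  have := is_derive_affine (- (t *: v)) v t.
  by under eq_fun => s do rewrite addrC -scalerBl.
move=> /(is_derive_lfield (op x (t *: v))); rewrite subrr scale0r => /(_ erefl).
by under eq_fun do rewrite -opA (exp_op hop) subrKC.
Qed.

Lemma lfield_linear x : linear (lfield x).
Proof. by move=> a u v; rewrite !lfield_def dopr_linear. Qed.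

Lemma lfield0 v : lfield 0 v = v.
Proof.
have [_ <-] := is_derive_lfield 0 (is_derive_scale v 0) (scale0r v).
by under eq_fun do rewrite op0x; have [_ ->] := is_derive_scale v 0.
Qed.

Lemma lfield_self (t : R) v : lfield (t *: v) v = v.
Proof.
have := is_derive_flow 0 v t; rewrite op0x => -[_ <-].
by under eq_fun do rewrite op0x; have [_ ->] := is_derive_scale v t.
Qed.

Lemma lfield_continuous v : continuous (lfield^~ v).
Proof.
rewrite (_ : lfield^~ v = fun x => dopr v (x, 0)); last first.
  by apply/funext => x; rewrite lfield_def.
move=> x.
apply: (@cvg_comp _ _ _ (fun x : pt => (x, 0 : pt)) (dopr v) _ (nbhs (x, 0 : pt))).
  apply: (@cvg_pair_nbhs _ _ _ (nbhs x) _ id (cst (0 : pt)) x 0) => //.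
  exact: cvg_cst.
exact: dopr_continuous.
Qed.

Lemma lfield_C1 v i : is_C1 (fun x => lfield x v 0 i).
Proof.
have [_ /(_ (0, v))[_ h]] := opi_smooth i 2.
have := is_Ck_C1 (@slice1 0 1 _ h); rewrite (_ : (fun x => _) = (fun x => lfield x v 0 i))//.
by apply/funext => x; rewrite lfield_def mxE.
Qed.

Definition Ad x y := op (op x y) (- x).

Lemma Ad_op x y z : Ad x (op y z) = op (Ad x y) (Ad x z).
Proof. by rewrite /Ad !opA opKN. Qed.

(** Powers of a group element are its multiples, so [g t] is [t] times the difference quotient of
    [g] at 0 with increment [t / n.+1], for every [n]. *)
Lemma one_parameter (g : R -> pt) v : (forall s t, g (s + t) = op (g s) (g t)) ->
  is_derive (0 : R) 1 g v -> forall t, g t = t *: v.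
Proof.
move=> gD /is_deriveP gv t.
have g0 : g 0 = 0 by have := opKx (g 0) (g 0); rewrite -gD addr0 opNx.
have gM n (h : R) : g (n%:R * h) = n%:R *: g h.
  elim: n => [|n IH]; first by rewrite mul0r g0 scale0r.
  rewrite -natr1 mulrDl mul1r gD IH -{2}(scale1r (g h)).
  by rewrite (exp_op hop).
have [->|t0] := eqVneq t 0; first by rewrite g0 scale0r.
have gt n : g t = t *: ((t / n.+1%:R)^-1 *: (g ((t / n.+1%:R) *: 1 + 0) - g 0)).
  rewrite g0 subr0 addr0 [_ *: 1]mulr1 scalerA invfM invrK mulrA mulfV// mul1r.
  by rewrite -gM mulrC divfK// pnatr_eq0.
have cv : (fun n : nat => t / n.+1%:R) @ \oo --> (0 : R)^'.
  move=> A [e /= e0 eA].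
  have : (fun n : nat => t / n.+1%:R) @ \oo --> (0 : R).
    by rewrite -(mulr0 t); exact: (cvgMl_tmp cvg_harmonic).
  move=> /cvgr0_norm_lt/(_ _ e0); apply: filterS => n te.
  apply: eA => /=; first by rewrite sub0r normrN.
  by rewrite mulf_neq0// invr_eq0 pnatr_eq0.
have : (fun n : nat => t *: ((t / n.+1%:R)^-1 *: (g ((t / n.+1%:R) *: 1 + 0) - g 0)))
   @ \oo --> t *: v.
  apply: cvgZl_tmp.
  exact: (cvg_comp _ _ cv gv).
under eq_fun do rewrite -gt.
move=> gl; apply: (@cvg_unique _ (@norm_hausdorff _ _) _ _ _ _ _ gl).
exact: (@cvg_cst _ (g t) _ \oo).
Qed.

Lemma Ad_continuous (T : Type) (F : set_system T) {FF : Filter F} (f g : T -> pt) x y :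
  f @ F --> x -> g @ F --> y -> (fun t => Ad (f t) (g t)) @ F --> Ad x y.
Proof.
move=> fx gy; apply: cvg_op; first exact: cvg_op.
exact: cvgN.
Qed.

Let is_derive_Ad x y :
  is_derive (0 : R) 1 (fun t : R => Ad x (t *: y)) (dopl (lfield x y) (x, - x)).
Proof.
have := is_derive_opl (- x) (is_derive_lfield x (is_derive_scale y 0) (scale0r y)).
by rewrite scale0r opx0.
Qed.

(** Conjugation maps a one-parameter subgroup to another one, which is again a line. Its direction
    is a derivative, linear in [y]; this is what makes [Ad x] linear. *)
Let AdZ' x y (t : R) : Ad x (t *: y) = t *: dopl (lfield x y) (x, - x).
Proof.
apply: (@one_parameter (fun t => Ad x (t *: y))); last exact: is_derive_Ad.
by move=> s r; rewrite -(exp_op hop) Ad_op.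
Qed.

Let AdE x y : Ad x y = dopl (lfield x y) (x, - x).
Proof. by rewrite -(scale1r (Ad x y)) -{1}(scale1r y) AdZ' !scale1r. Qed.

Lemma AdZ x y (t : R) : Ad x (t *: y) = t *: Ad x y.
Proof. by rewrite AdZ' -AdE. Qed.

Lemma Ad_linear x : linear (Ad x).
Proof. by move=> a u v; rewrite !AdE lfield_linear dopl_linear. Qed.

Lemma Ad_opl x y z : Ad (op x y) z = Ad x (Ad y z).
Proof. by rewrite /Ad oppop !opA. Qed.

Lemma Ad0 y : Ad 0 y = y. Proof. by rewrite /Ad op0x oppr0 opx0. Qed.

Lemma Ad_comm x y : op x y = op (Ad x y) x. Proof. by rewrite /Ad opKN. Qed.

(** Inversion is [-] in these coordinates. Applied to the product
    [op (s *: Ad x v) x = op x (s *: v)], it exchanges the factors and thus relates the fields at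
    [x] and at [- x]. *)
Lemma lfield_Ad x v : lfield x v = lfield (- x) (Ad x v).
Proof.
have d1 := is_derive_lfield x (is_derive_scale v 0) (scale0r v).
have d2 := is_derive_lfield (- x) (is_derive_scale (- Ad x v) 0) (scale0r _).
have : is_derive (0 : R) 1 (fun t : R => - op (- x) (t *: - Ad x v))
   (- lfield (- x) (- Ad x v)) by exact: is_deriveN.
rewrite (_ : (fun t : R => - _) = fun s : R => op x (s *: v)); last first.
  by apply/funext => t; rewrite oppop opprK scalerN opprK -AdZ -Ad_comm.
have [_ <-] := d1; case=> _ ->.
by rewrite (linN (lfield_linear _)) opprK.
Qed.

(** The bilinear term in the Taylor expansion of the group law at 0. It is antisymmetric because
    [lfield (s *: u) u = u], and it turns out to be half of the Lie bracket. *)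
Fact bform_subproof :
  {b | b = fun u v : pt => lie_derive op u (lie_derive op v id) 0}.
Proof. by eexists. Qed.
Definition bform : pt -> pt -> pt := sval bform_subproof.

Lemma bform_def u v : bform u v = lie_derive op u (lie_derive op v id) 0.
Proof. by rewrite /bform (svalP bform_subproof). Qed.

Lemma is_derive_bform u v : is_derive (0 : R) 1 (fun s : R => lfield (s *: u) v) (bform u v).
Proof.
rewrite bform_def /lie_derive derive1E.
rewrite (_ : (fun t : R => _) = fun s : R => lfield (s *: u) v); last first.
  by apply/funext => t; rewrite op0x -[RHS]lfieldE.
apply: derivableP; apply/derivable_rVP => i.
by have [] := C1_comp (lfield_C1 v i) (is_derive_scale u 0).
Qed.

Let bformE u v i : bform u v 0 i = \sum_k u 0 k * 'D_(e_ k) (fun x => lfield x v 0 i) 0.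
Proof.
have /is_derive_rVP/(_ i)[_ <-] := is_derive_bform u v.
by have [_] := C1_comp (lfield_C1 v i) (is_derive_scale u 0); rewrite scale0r.
Qed.

Lemma bform_linearl v : linear (bform^~ v).
Proof.
pose d k i := 'D_(e_ k) (fun x => lfield x v 0 i) 0.
have E u : bform u v = \row_i \sum_k u 0 k * d k i.
  by apply/rowP => i; rewrite bformE mxE.
move=> a u w; rewrite !E; apply/rowP => i; rewrite !mxE mulr_sumr -big_split.
by apply: eq_bigr => k _; rewrite !mxE mulrDl mulrA.
Qed.

Lemma bform_linearr u : linear (bform u).
Proof.
move=> a v w; have [_ <-] := is_derive_bform u (a *: v + w).
under eq_fun do rewrite lfield_linear.
have h : is_derive (0 : R) 1 (a \*: (fun s : R => lfield (s *: u) v) +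
   (fun s : R => lfield (s *: u) w)) (a *: bform u v + bform u w).
  apply: is_deriveD; last exact: is_derive_bform.
  by apply: is_deriveZ; exact: is_derive_bform.
by have [_] := h.
Qed.

Let bformxx u : bform u u = 0.
Proof.
have [_ <-] := is_derive_bform u u; under eq_fun do rewrite lfield_self.
by rewrite derive_cst.
Qed.

Lemma bformC u v : bform u v = - bform v u.
Proof.
have := bformxx (u + v).
rewrite (linD (bform_linearl _)) !(linD (bform_linearr _)).
by rewrite !bformxx add0r addr0 => /eqP; rewrite addr_eq0 => /eqP.
Qed.

(* [lie_bracket], made opaque: its definition by limits is costly to unfold. *)
Fact lbr_subproof : {b | b = lie_bracket op}.
Proof. by eexists. Qed.
Definition lbr : pt -> pt -> pt := sval lbr_subproof.

Lemma lbrE u v : lie_bracket op u v = lbr u v.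
Proof. by rewrite /lbr (svalP lbr_subproof). Qed.

Local Notation br := lbr.

Lemma bracketE u v : br u v = 2 *: bform u v.
Proof. by rewrite -lbrE /lie_bracket -!bform_def [bform v u]bformC opprK scaler_nat mulr2n. Qed.

Lemma bracket_linearl v : linear (br^~ v).
Proof. by move=> a u w; rewrite !bracketE bform_linearl scalerDr !scalerA mulrC. Qed.

Lemma bracket_linearr u : linear (br u).
Proof. by move=> a v w; rewrite !bracketE bform_linearr scalerDr !scalerA mulrC. Qed.

Let cvg_dnbhs_id : h @[h --> (0 : R)^'] --> (0 : R).
Proof. exact: cvg_within. Qed.

(* Follows from [lfield x v = lfield (- x) (Ad x v)], differentiated at 0. *)
Lemma is_derive_Ad0 u v : is_derive (0 : R) 1 (fun s : R => Ad (s *: u) v) (br u v).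
Proof.
apply/is_deriveP.
pose a s := Ad (s *: u) v.
have av : a @ (0 : R)^' --> v.
  have : a @ (0 : R)^' --> Ad 0 v; last by rewrite Ad0.
  apply: Ad_continuous; last exact: cvg_cst.
  by rewrite -(scale0r u); apply: cvgZr_tmp.
(* As [lfield (s *: u) v = lfield (s *: - u) (a s)], the increment of [a] splits into two increments
   of fields; the second is expanded in the basis because its argument [a s] varies too. *)
have aE s : a s - v = (lfield (s *: u) v - v) -
    \sum_k a s 0 k *: (lfield (s *: - u) (e_ k) - e_ k).
  rewrite lfield_Ad -scalerN -/(a s).
  under eq_bigr do rewrite scalerBr; rewrite sumrB -row_sum_delta.
  rewrite -(linear_rV_sum _ (lfield_linear _)).
  by rewrite opprB [RHS]addrC subrKA.
rewrite (_ : (fun h : R => _) = fun h : R => h^-1 *: (lfield (h *: u) v - v) -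
    \sum_k a h 0 k *: (h^-1 *: (lfield (h *: - u) (e_ k) - e_ k))); last first.
  apply/funext => h; rewrite /= addr0 [h *: 1]mulr1 scale0r Ad0 -/(a h) aE scalerBr.
  congr (_ - _); rewrite scaler_sumr; apply: eq_bigr => k _.
  by rewrite !scalerA mulrC.
have -> : br u v = bform u v - \sum_k v 0 k *: bform (- u) (e_ k).
  rewrite -(linear_rV_sum v (bform_linearr _)).
  rewrite -lbrE /lie_bracket -!bform_def; congr (_ - _).
  by rewrite [RHS]bformC (linN (bform_linearr _)) opprK.
have lf w y : h^-1 *: (lfield (h *: w) y - y) @[h --> (0 : R)^'] --> bform w y.
  have /is_deriveP := is_derive_bform w y.
  by under eq_fun do rewrite addr0 [_ *: 1]mulr1 scale0r lfield0.
apply: cvgB; first exact: lf.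
apply: cvg_sumr => k; apply: cvgZ; last exact: lf.
by move/cvg_rVP : av => /(_ k).
Qed.

End exp_group.

Section linear_derivative.
Context {R : realType}.

Lemma lin_sum (U W : lmodType R) (f : U -> W) (I : Type) (r : seq I) (P : pred I)
    (u : I -> U) : linear f -> f (\sum_(i <- r | P i) u i) = \sum_(i <- r | P i) f (u i).
Proof. by move=> lf; apply: big_morph; [exact: linD|exact: lin0]. Qed.

Lemma cvg_lin (T : Type) (F : set_system T) {FF : Filter F} n (W : normedModType R)
    (f : 'rV[R]_n -> W) (g : T -> 'rV[R]_n) (l : 'rV[R]_n) :
  linear f -> g @ F --> l -> (fun t => f (g t)) @ F --> f l.
Proof.
move=> lf /cvg_rVP gl; rewrite (linear_rV_sum l lf).
under eq_fun do rewrite (linear_rV_sum _ lf).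
by apply: cvg_sumr => i; apply: cvgZr_tmp; exact: gl.
Qed.

Lemma is_derive_lin n (W : normedModType R) (f : 'rV[R]_n -> W)
    (g : R -> 'rV[R]_n) (t : R) w :
  linear f -> is_derive t 1 g w -> is_derive t 1 (fun s => f (g s)) (f w).
Proof.
move=> lf /is_deriveP gw; apply/is_deriveP.
under eq_fun do rewrite -linB// -linZ//.
exact: cvg_lin.
Qed.

Lemma is_derive_shift0 (W : normedModType R) (f : R -> W) (t : R) l :
  is_derive (0 : R) 1 (fun s => f (s + t)) l -> is_derive t 1 f l.
Proof.
move=> /is_deriveP; under eq_fun do rewrite addr0 add0r.
by move=> h; apply/is_deriveP.
Qed.

Lemma cvg_bilin (T : Type) (F : set_system T) {FF : Filter F} n m (W : normedModType R)
    (b : 'rV[R]_n -> 'rV[R]_m -> W) (f : T -> 'rV[R]_n) (g : T -> 'rV[R]_m)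
    (x : 'rV[R]_n) (y : 'rV[R]_m) :
  (forall v, linear (b^~ v)) -> (forall u, linear (b u)) ->
  f @ F --> x -> g @ F --> y -> (fun t => b (f t) (g t)) @ F --> b x y.
Proof.
move=> bl br /cvg_rVP fx gy; rewrite (linear_rV_sum x (bl y)).
under eq_fun do rewrite (linear_rV_sum _ (bl _)).
by apply: cvg_sumr => i; apply: cvgZ; [exact: fx|exact: cvg_lin].
Qed.

Lemma is_derive_bilin n m (W : normedModType R) (b : 'rV[R]_n -> 'rV[R]_m -> W)
    (f : R -> 'rV[R]_n) (g : R -> 'rV[R]_m) (t : R) x y :
  (forall v, linear (b^~ v)) -> (forall u, linear (b u)) ->
  is_derive t 1 f x -> is_derive t 1 g y ->
  is_derive t 1 (fun s => b (f s) (g s)) (b x (g t) + b (f t) y).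
Proof.
move=> bl br fx gy; apply/is_deriveP.
have gt : g (h *: 1 + t) @[h --> (0 : R)^'] --> g t.
  have := is_derive_continuous gy; apply: cvg_comp.
  apply: cvg_within_filter; exact: cvg_shift0.
move/is_deriveP in fx; move/is_deriveP in gy.
rewrite (_ : (fun h : R => _) = fun h : R =>
    b (h^-1 *: (f (h *: 1 + t) - f t)) (g (h *: 1 + t)) +
    b (f t) (h^-1 *: (g (h *: 1 + t) - g t))); last first.
  apply/funext => h; rewrite (linZ (bl _)) (linZ (br _)) -scalerDr; congr (_ *: _).
  by rewrite (linB (bl _)) (linB (br _)) subrKA.
apply: cvgD; first exact: cvg_bilin.
exact: cvg_lin.
Qed.

Lemma is_derive_sumr (W : normedModType R) (I : Type) (r : seq I) (f : I -> R -> W)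
    (t : R) (l : I -> W) : (forall i, is_derive t 1 (f i) (l i)) ->
  is_derive t 1 (fun s => \sum_(i <- r) f i s) (\sum_(i <- r) l i).
Proof.
move=> fl; apply/is_deriveP.
under eq_fun do rewrite -sumrB scaler_sumr.
by apply: cvg_sumr => i; have /is_deriveP := fl i.
Qed.

Lemma is_derive_scalel (W : normedModType R) (c : R -> R) (w : W) (t d : R) :
  is_derive t 1 c d -> is_derive t 1 (fun s => c s *: w) (d *: w).
Proof.
move=> /is_deriveP cd; apply/is_deriveP.
under eq_fun do rewrite -scalerBl scalerA.
exact: cvgZr_tmp.
Qed.

Lemma is_derive_pow_fact l (t : R) :
  is_derive t 1 (fun t => t ^+ l.+1 / l.+1`!%:R) (t ^+ l / l`!%:R).
Proof.
have : is_derive t 1 ((l.+1`!%:R)^-1 \*: (@GRing.exp R)^~ l.+1)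
    ((l.+1`!%:R)^-1 *: (l.+1%:R * t ^+ l)).
  apply: is_deriveZ; apply: DeriveDef; first exact: exprn_derivable.
  by rewrite exp_derive [_ *: 1]mulr1.
rewrite (_ : _ \*: _ = fun t => t ^+ l.+1 / l.+1`!%:R); last first.
  by apply/funext => s /=; rewrite [_ *: _]mulrC.
suff -> : (l.+1`!%:R)^-1 *: (l.+1%:R * t ^+ l) = t ^+ l / l`!%:R by [].
rewrite factS natrM [_ *: _]mulrC; field.
by rewrite pnatr_eq0 -lt0n fact_gt0 addrC natr1 pnatr_eq0.
Qed.

(** The linear map [q] vanishes exactly on [W], so [q \o f] has zero derivative and is constant. *)
Lemma vspace_primitive n (W : {vspace 'rV[R]_n}) (f df : R -> 'rV[R]_n) (t0 : R) :
  (forall t : R, is_derive t 1 f (df t)) -> (forall t, df t \in W) ->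
  f t0 \in W -> forall t, f t \in W.
Proof.
move=> fd dfW f0 t; pose q u := u - projv W u.
have lq : linear q.
  by move=> a u v; rewrite /q linearP scalerBr opprD addrACA.
have qP u : (u \in W) = (q u == 0).
  apply/idP/eqP => [uW|/eqP]; first by rewrite /q projv_id// subrr.
  by rewrite subr_eq0 => /eqP ->; exact: memv_proj.
have qf : q (f t0) = q (f t).
  apply: (@is_derive0_cst _ _ (q \o f)) => s.
  have := is_derive_lin lq (fd s).
  by have := dfW s; rewrite qP => /eqP ->.
by rewrite qP -qf -qP.
Qed.

End linear_derivative.

(** * The filtration of the Lie algebra *)

Section filtration.
Context {R : realType} {N : nat} (op : 'rV[R]_N -> 'rV[R]_N -> 'rV[R]_N).
Hypothesis hop : is_exp_lie_group op.
Local Notation pt := 'rV[R]_N.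
Local Notation e_ i := (delta_mx 0 i : pt).
Local Notation br := (lbr op).
Local Notation Ad := (Ad op).
Local Notation lfield := (lfield op).
Implicit Types x y z u v w : pt.

Let brl v : linear (br^~ v) := bracket_linearl hop v.
Let brr u : linear (br u) := bracket_linearr hop u.

Lemma is_derive_Ad u v (t : R) :
  is_derive t 1 (fun s : R => Ad (s *: u) v) (Ad (t *: u) (br u v)).
Proof.
apply: is_derive_shift0.
under eq_fun => s do rewrite addrC -(exp_op hop) (Ad_opl hop).
exact: is_derive_lin (Ad_linear hop _) (is_derive_Ad0 hop u v).
Qed.

Lemma Ad_bracket x y z : Ad x (br y z) = br (Ad x y) (Ad x z).
Proof.
have [_ <-] := is_derive_lin (Ad_linear hop x) (is_derive_Ad0 hop y z).
have [_ <-] := is_derive_Ad0 hop (Ad x y) (Ad x z).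
suff -> : (fun s : R => Ad x (Ad (s *: y) z)) =
  (fun s : R => Ad (s *: Ad x y) (Ad x z)) by [].
apply/funext => s.
have AdAd a b : Ad x (Ad a b) = Ad (Ad x a) (Ad x b).
  transitivity (Ad x (op (op a b) (- a))) => //.
  by rewrite [LHS](Ad_op hop) (linN (Ad_linear hop x)) [Ad x (op a b)](Ad_op hop).
by rewrite AdAd (AdZ hop).
Qed.

(** The derivative at 0 of [Ad_bracket] along the one-parameter subgroup of [x]. *)
Lemma jacobi x y z : br x (br y z) = br (br x y) z + br y (br x z).
Proof.
have [_ <-] := is_derive_Ad0 hop x (br y z).
under eq_fun do rewrite Ad_bracket.
have [_ ->] := is_derive_bilin brl brr (is_derive_Ad0 hop x y) (is_derive_Ad0 hop x z).
by rewrite scale0r !(Ad0 hop).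
Qed.

(** The span of the brackets of two bases contains all brackets, hence contains [C] by minimality;
    so every element of [C] is a combination of brackets. *)
Lemma bracket_space_ind (A B C : {vspace pt}) (P : pt -> Prop) :
  is_bracket_space op A B C ->
  P 0 -> (forall a u v, P u -> P v -> P (a *: u + v)) ->
  (forall u v, u \in A -> v \in B -> P (br u v)) -> forall w, w \in C -> P w.
Proof.
move=> ABC P0 PD Pbr w wC.
pose X := [seq br a b | a <- vbasis A, b <- vbasis B].
have brX u v : u \in A -> v \in B -> lie_bracket op u v \in <<X>>%VS.
  rewrite lbrE; move=> /coord_vbasis -> /coord_vbasis ->.
  rewrite (lin_sum _ _ _ (brl _)); apply: memv_suml => i _.
  rewrite (linZ (brl _)) (lin_sum _ _ _ (brr _)) memvZ// memv_suml// => j _.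
  rewrite (linZ (brr _)) memvZ// memv_span//.
  by apply: allpairs_f; apply: mem_nth; rewrite size_tuple.
have wX : w \in <<X>>%VS by have /ABC/subvP/(_ w wC) := brX.
rewrite (@coord_span _ _ _ (in_tuple X) w wX).
elim/big_ind : _ => [//|u v Pu Pv|i _]; first by rewrite -[u]scale1r; exact: PD.
rewrite -[_ *: _]addr0; apply: PD => //.
have /allpairsP[[a b] /= [aA bB ->]] : X`_i \in X by rewrite mem_nth.
by apply: Pbr; exact: vbasis_mem.
Qed.

Context (s : nat) (V : nat -> {vspace pt}).
Hypothesis hV : is_stratification op s V.

(** The descending filtration by degree; [filt 0] and [filt 1] are both the full space, and
    [filt s.+1] is 0. The estimates need only the information that certain terms have higher
    degree. *)
Definition filt k : {vspace pt} := (\sum_(i < s | (k <= i.+1)%N) V i.+1)%VS.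
Local Notation F := filt.

Lemma filt_ind k (P : pt -> Prop) :
  P 0 -> (forall a u v, P u -> P v -> P (a *: u + v)) ->
  (forall i v, (0 < i <= s)%N -> (k <= i)%N -> v \in V i -> P v) ->
  forall w, w \in F k -> P w.
Proof.
move=> P0 PD PV w /memv_sumP[vs vsV ->].
elim/big_ind : _ => [//|u v Pu Pv|i ki]; first by rewrite -[u]scale1r; exact: PD.
by apply: (PV i.+1); rewrite ?ltn_ord//; exact: vsV.
Qed.

Lemma filt_sub k l : (k <= l)%N -> (F l <= F k)%VS.
Proof.
move=> kl; apply/subv_sumP => i li; apply: (sumv_sup i) => //.
exact: leq_trans li.
Qed.

Lemma mem_filt_sub k l w : (k <= l)%N -> w \in F l -> w \in F k.
Proof. by move=> /filt_sub /subvP; apply. Qed.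

Lemma layer_filt k : (0 < k <= s)%N -> (V k <= F k)%VS.
Proof. by case: k => // k ks; apply: (sumv_sup (Ordinal ks)). Qed.

Lemma filt_full k w : (k <= 1)%N -> w \in F k.
Proof.
move=> k1; apply: (@mem_filt_sub k 1) => //; rewrite /filt.
under eq_bigl do rewrite ltnS leq0n.
by rewrite (strat_full hV) memvf.
Qed.

Lemma filt0 k w : (s < k)%N -> w \in F k -> w = 0.
Proof.
move=> sk; rewrite /filt big1 ?memv0; first by move/eqP.
by move=> i ki; have := leq_trans sk ki; rewrite ltnNge ltn_ord.
Qed.

Let bracket_V1 u v j : u \in V 1 -> v \in F j -> br u v \in F j.+1.
Proof.
move=> uV; move: v.
apply: (filt_ind (P := fun v => br u v \in F j.+1)) => [|a v1 v2 h1 h2|i v /andP[i0 is_] ji vV].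
- by rewrite (lin0 (brr _)) mem0v.
- by rewrite (linD (brr _)) (linZ (brr _)) memvD// memvZ.
have [iles|ils] := eqVneq i s.
  have := (strat_last hV 0%VS).1 (subvv _) u v uV; rewrite -iles lbrE => /(_ vV).
  by rewrite memv0 => /eqP ->; exact: mem0v.
have {}ils : (i < s)%N by rewrite ltn_neqAle ils.
have := strat_bracket hV (i := i); rewrite i0 ils => /(_ isT (V i.+1))[+ _].
move=> /(_ (subvv _) u v uV vV); rewrite lbrE => h; apply: (@mem_filt_sub _ i.+1) => //.
by apply: (subvP (layer_filt _)).
Qed.

(** Induction on the degree of the left entry: [V i.+2] consists of combinations of brackets of [a]
    in [V 1] and [b] in [V i.+1], and Jacobi's identity reduces the bracket of [br a b] with [v] to
    brackets with [a] and with [b]. *)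
Let bracket_V i : (0 < i <= s)%N -> forall u v j, u \in V i -> v \in F j ->
  br u v \in F (i + j).
Proof.
case: i => // i; elim: i => [|i IH] ils u v j; first by rewrite add1n; exact: bracket_V1.
have ils' : (0 < i.+1 < s)%N by [].
have ils1 : (0 < i.+1 <= s)%N by exact: ltnW ils'.
move=> uV; move: u uV v j.
apply: (bracket_space_ind (P := fun u => forall v j, v \in F j -> br u v \in F (i.+2 + j))
  (strat_bracket hV ils')) => [v j vF|a u1 u2 h1 h2 v j vF|a b aV bV v j vF].
- by rewrite (lin0 (brl _)) mem0v.
- by rewrite (linD (brl _)) (linZ (brl _)) memvD ?memvZ ?h1 ?h2.
have -> : br (br a b) v = br a (br b v) - br b (br a v) by rewrite (jacobi a b v) addrK.
apply: memvB.
  by rewrite addSn; apply: bracket_V1 => //; exact: IH.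
rewrite addSn -addnS; apply: IH => //.
exact: bracket_V1.
Qed.

Lemma bracket_filt i j u v : u \in F i -> v \in F j -> br u v \in F (i + j).
Proof.
move=> + vF; move: u.
apply: (filt_ind (P := fun u => br u v \in F (i + j))) => [|a u1 u2 h1 h2|k u ks ik uV].
- by rewrite (lin0 (brl _)) mem0v.
- by rewrite (linD (brl _)) (linZ (brl _)) memvD ?memvZ.
- apply: (@mem_filt_sub _ (k + j)); first by rewrite leq_add2r.
  exact: bracket_V.
Qed.

Local Notation adn l v := (iter l (br v)).

Lemma iter_bracketS l v w : adn l v (br v w) = adn l.+1 v w.
Proof. by rewrite -iterSr. Qed.

(** Differentiation in [t] gives on both sides the same expressions with [w] replaced by [br v w],
    which is one degree deeper. The induction on the depth [j] starts from [filt s.+1 = 0]. *)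
Lemma Ad_exp j v w (t : R) : w \in F (s.+1 - j) ->
  Ad (t *: v) w = \sum_(l < j) (t ^+ l / l`!%:R) *: adn l v w.
Proof.
elim: j w t => [|j IH] w t wF.
  rewrite subn0 in wF; rewrite big_ord0 (filt0 (ltnSn s) wF).
  exact: lin0 (Ad_linear hop _).
apply/eqP; rewrite -subr_eq0; apply/eqP.
pose f t := Ad (t *: v) w - \sum_(l < j.+1) (t ^+ l / l`!%:R) *: adn l v w.
have f0t : f 0 = f t.
  apply: is_derive0_cst => r; rewrite /f.
  have brF : br v w \in F (s.+1 - j).
    apply: (@mem_filt_sub _ (1 + (s.+1 - j.+1))); first by lia.
    by apply: bracket_filt => //; exact: filt_full.
  have E : Ad (r *: v) (br v w) -
     (0 + \sum_(l < j) (r ^+ l / l`!%:R) *: adn l.+1 v w) = 0.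
    rewrite add0r (IH _ _ brF) -sumrB big1// => l _.
    by rewrite iter_bracketS subrr.
  apply: is_derive_eq E; apply: is_deriveB; first exact: is_derive_Ad.
  under eq_fun do rewrite big_ord_recl expr0.
  apply: (is_deriveD (is_derive_cst ((1 / 0`!%:R) *: w) r 1)).
  by apply: is_derive_sumr => l; apply: is_derive_scalel; exact: is_derive_pow_fact.
rewrite -/(f t) -f0t /f scale0r (Ad0 hop) big_ord_recl expr0 divr1 scale1r big1 ?addr0 ?subrr// => l _.
by rewrite expr0n mul0r scale0r.
Qed.

(** At the identity the differential of the product is the sum. The motion of the second factor is
    treated by [C1_mvt], whose intermediate points tend to 0. *)
Lemma is_derive_op0 (p q : R -> pt) p' q' : p 0 = 0 -> q 0 = 0 ->
  is_derive (0 : R) 1 p p' -> is_derive (0 : R) 1 q q' ->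
  is_derive (0 : R) 1 (fun t => op (p t) (q t)) (p' + q').
Proof.
move=> p0 q0 pd qd; apply/is_deriveP/cvg_rVP => i.
have pc := is_derive_continuous pd; have qc := is_derive_continuous qd.
move/is_deriveP/cvg_rVP in pd; move/is_deriveP/cvg_rVP in qd.
have cvg1 (f : R -> pt) : {for 0, continuous f} -> f (h *: 1 + 0) @[h --> (0 : R)^'] --> f 0.
  by apply: cvg_comp; apply: cvg_within_filter; exact: cvg_shift0.
have /choice[xi xiP] : forall h : R, exists xi : 'I_N -> pt,
    (forall k, `|xi k| <= `|q (h *: 1 + 0)|) /\
    op (p (h *: 1 + 0)) (q (h *: 1 + 0)) 0 i - p (h *: 1 + 0) 0 i =
      \sum_k q (h *: 1 + 0) 0 k * dopr op (e_ k) (p (h *: 1 + 0), xi k) 0 i.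
  move=> h; have [xi xi1 xi2] := C1_mvt (op_C1r hop (p (h *: 1 + 0)) i) 0 (q (h *: 1 + 0)).
  exists xi; split=> [k|]; first by have := xi1 k; rewrite subr0.
  rewrite add0r (opx0 hop) in xi2; rewrite xi2.
  by apply: eq_bigr => k _; rewrite doprE.
rewrite (_ : (fun h : R => _) = fun h : R => (h^-1 *: (p (h *: 1 + 0) - p 0)) 0 i +
    \sum_k (h^-1 *: (q (h *: 1 + 0) - q 0)) 0 k *
      dopr op (e_ k) (p (h *: 1 + 0), xi h k) 0 i); last first.
  apply/funext => h; rewrite p0 q0 (op0x hop) !subr0 !mxE.
  rewrite -(subrK (p (h *: 1 + 0) 0 i) (op _ _ _ _)) (xiP h).2 mulrDr addrC.
  congr (_ + _); rewrite mulr_sumr; apply: eq_bigr => k _.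
  have -> : (h^-1 *: q (h *: 1 + 0)) 0 k = h^-1 * q (h *: 1 + 0) 0 k by rewrite mxE.
  by rewrite mulrA.
have -> : (p' + q') 0 i = p' 0 i + \sum_k q' 0 k * dopr op (e_ k) (0, 0) 0 i.
  rewrite mxE -{1}(lfield0 hop q') (linear_rV_sum q' (lfield_linear hop 0)).
  by rewrite summxE; congr (_ + _); apply: eq_bigr => k _; rewrite mxE lfield_def.
apply: cvgD; first exact: pd.
apply: cvg_sumr => k; apply: cvgM; first exact: qd.
have xi0 : xi h k @[h --> (0 : R)^'] --> (0 : pt).
  apply/cvgrPdist_le => e e0; have := cvg1 _ qc; rewrite q0.
  move=> /cvgrPdist_le/(_ _ e0); apply: filterS => h.
  by rewrite !sub0r !normrN; apply: le_trans; exact: (xiP h).1.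
have pxi : (p (h *: 1 + 0), xi h k) @[h --> (0 : R)^'] --> ((0 : pt), (0 : pt)).
  by apply: cvg_pair_nbhs => //; have := cvg1 _ pc; rewrite p0.
have dc : dopr op (e_ k) p 0 i @[p --> ((0 : pt), (0 : pt))] --> dopr op (e_ k) (0, 0) 0 i.
  have h := (rV_continuousP (dopr op (e_ k))).1 (@dopr_continuous _ _ _ hop (e_ k)) i.
  exact: h.
exact: (cvg_comp _ _ pxi dc).
Qed.

(** The left logarithmic derivative of [r *: v] when [v] moves in the direction [w]. By [ldrD] it is
    a cocycle for [Ad] in the time [r], hence a primitive of [Ad (- r *: v) w]; integrating the
    exponential series then gives [dlog]. *)
Let ldr v w (r : R) : pt := dopr op (r *: w) (- (r *: v), r *: v).

Let is_derive_ldr v w (r : R) :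
  is_derive (0 : R) 1 (fun e : R => op (- (r *: v)) (r *: (v + e *: w))) (ldr v w r).
Proof.
have := @is_derive_opr _ _ op hop (- (r *: v)) (fun e => r *: v + e *: (r *: w)) 0 _
  (is_derive_affine _ _ 0).
rewrite scale0r addr0.
by under eq_fun do rewrite scalerA mulrC -scalerA -scalerDr.
Qed.

Let ldrD v w (a b : R) : ldr v w (b + a) = Ad (- a *: v) (ldr v w b) + ldr v w a.
Proof.
have [_ <-] := is_derive_ldr v w (b + a).
apply: derive_val.
rewrite (_ : (fun e : R => _) = fun e : R =>
   op (Ad (- a *: v) (op (- (b *: v)) (b *: (v + e *: w))))
      (op (- (a *: v)) (a *: (v + e *: w)))); last first.
  apply/funext => e; rewrite /(Ad _ _) scaleNr opprK !(opA hop).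

  have h1 : - ((b + a) *: v) = op (- (a *: v)) (- (b *: v)).
    by rewrite -!scaleNr (exp_op hop) -opprD addrC.
  have h2 : (b + a) *: (v + e *: w) = op (b *: (v + e *: w)) (a *: (v + e *: w)).
    by rewrite (exp_op hop).
  by rewrite h1 h2 !(opA hop) (opxK hop).
apply: is_derive_op0.
- by rewrite scale0r addr0 (opNx hop) (lin0 (Ad_linear hop _)).
- by rewrite scale0r addr0 (opNx hop).
- exact: is_derive_lin (Ad_linear hop _) (is_derive_ldr v w b).
- exact: is_derive_ldr.
Qed.

Let is_derive_ldr_time v w (t : R) : is_derive t 1 (ldr v w) (Ad (- t *: v) w).
Proof.
apply: is_derive_shift0; apply/is_deriveP.
under eq_fun do rewrite addr0 add0r ldrD addrK -(linZ (Ad_linear hop _)).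
apply: cvg_lin; first exact: Ad_linear.
have : dopr op w (- (h *: v), h *: v) @[h --> (0 : R)^'] --> dopr op w (0, 0).
  apply: (@cvg_comp _ _ _ (fun h : R => (- (h *: v), h *: v)) (dopr op w) _ (nbhs (0 : pt, 0 : pt))).
    have h0 : h *: v @[h --> (0 : R)^'] --> (0 : pt).
      have := @cvg_shift0 R _ 0 v; under eq_fun do rewrite addr0.
      exact: cvg_within_filter.
    apply: cvg_pair_nbhs => //.
    have h1 : - (h *: v) @[h --> (0 : R)^'] --> - (0 : pt) by exact: cvgN.
    by rewrite oppr0 in h1.
  exact: dopr_continuous.
rewrite -lfield_def (lfield0 hop); apply: cvg_trans; apply: near_eq_cvg.
near=> h; have h0 : h != 0 by near: h; exact: nbhs_dnbhs_neq.
by rewrite [h *: 1]mulr1 /ldr (linZ (dopr_linear hop _)) scalerA mulVf// scale1r.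
Unshelve. all: by end_near. Qed.

(* The differential at [w] of [x |-> (- v) x] at [v], that is of the left
   logarithm: the series [(1 - exp (- ad v)) / ad v]. *)
Definition dlog v w : pt :=
  \sum_(l < s.+1) ((-1) ^+ l / l.+1`!%:R) *: adn l v w.

Lemma dopr_dlog v w : dopr op w (- v, v) = dlog v w.
Proof.
have -> : dopr op w (- v, v) = ldr v w 1 by rewrite /ldr !scale1r.
pose f t := ldr v w t - \sum_(l < s.+1) ((- t) ^+ l.+1 / l.+1`!%:R) *: - adn l v w.
have f01 : f 0 = f 1.
  apply: is_derive0_cst => t; rewrite /f.
  have E : Ad (- t *: v) w -
     \sum_(l < s.+1) ((-1) *: ((- t) ^+ l / l`!%:R)) *: - adn l v w = 0.
    rewrite (@Ad_exp s.+1) ?subnn ?filt_full// -sumrB big1// => l _.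
    by rewrite scaleN1r scalerN scaleNr opprK subrr.
  apply: is_derive_eq E; apply: is_deriveB; first exact: is_derive_ldr_time.
  apply: is_derive_sumr => l; apply: is_derive_scalel.
  by apply: (is_derive_comp1 (is_derive_pow_fact _ _)).
move/eqP: f01; rewrite /f /ldr scale0r (lin0 (dopr_linear hop _)) big1 ?subr0; last first.
  by move=> l _; rewrite oppr0 expr0n mul0r scale0r.
rewrite eq_sym subr_eq0 => /eqP ->; apply: eq_bigr => l _.
by rewrite scalerN -scaleNr exprS mulN1r mulNr opprK.
Qed.

Lemma is_derive_left_log v w :
  is_derive (0 : R) 1 (fun e : R => op (- v) (v + e *: w)) (dlog v w).
Proof.
have := is_derive_ldr v w 1.
by rewrite -dopr_dlog /ldr !scale1r; under eq_fun do rewrite scale1r.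
Qed.

Lemma lfield_dlog v w : lfield v (dlog v w) = w.
Proof.
have h0 : op (- v) (v + 0 *: w) = 0 by rewrite scale0r addr0 (opNx hop).
have [_ <-] := is_derive_lfield hop v (is_derive_left_log v w) h0.
under eq_fun do rewrite (opNK hop).
by apply: derive_val; exact: is_derive_affine.
Qed.

Definition dlog_rem v w : pt := w - dlog v w.

Lemma dlog_linear v : linear (dlog v).
Proof.
have lb l : linear (adn l v).
  elim: l => // l IH a x y; by rewrite /= IH (linD (brr _)) (linZ (brr _)).
move=> a x y; rewrite /dlog scaler_sumr -big_split; apply: eq_bigr => l _ /=.
by rewrite (lb l a x y) scalerDr !scalerA mulrC.
Qed.

(** [lfield v] inverts [dlog v], which is the identity minus [dlog_rem v]. The Neumann series is
    finite because [dlog_rem v] raises the degree. *)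
Lemma lfieldE_iter v w j : w \in F (s.+1 - j) ->
  lfield v w = \sum_(i < j) iter i (dlog_rem v) w.
Proof.
elim: j w => [|j IH] w wF.
  by rewrite subn0 in wF; rewrite big_ord0 (filt0 (ltnSn s) wF) (lin0 (lfield_linear hop _)).
have adF i : adn i.+1 v w \in F (s.+1 - j).
  elim: i => [|i IHi] /=.
    apply: (@mem_filt_sub _ (1 + (s.+1 - j.+1))); first by lia.
    exact: bracket_filt (filt_full _ _) wF.
  apply: (@mem_filt_sub _ (1 + (s.+1 - j))); first by lia.
  exact: bracket_filt (filt_full _ _) IHi.
rewrite big_ord_recl/=; under eq_bigr do rewrite -iterS iterSr.
rewrite -IH; last first.
  rewrite /dlog_rem /dlog big_ord_recl expr0 divr1 scale1r /= opprD addrA subrr add0r.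
  by rewrite memvN; apply: memv_suml => l _; apply/memvZ/adF.
rewrite -[in LHS](subrK (dlog v w) w) (linD (lfield_linear hop _)) lfield_dlog addrC.
by [].
Qed.

End filtration.

Section filtration_consequences.
Context {R : realType} {N : nat} (op : 'rV[R]_N -> 'rV[R]_N -> 'rV[R]_N).
Hypothesis hop : is_exp_lie_group op.
Local Notation pt := 'rV[R]_N.
Local Notation e_ i := (delta_mx 0 i : pt).
Local Notation br := (lbr op).
Local Notation Ad := (Ad op).
Local Notation lfield := (lfield op).
Implicit Types x y v : pt.
Context (s : nat) (V : nat -> {vspace pt}).
Hypothesis hV : is_stratification op s V.
Local Notation F := (@filt _ _ s V).
Local Notation dlog := (dlog op s).
Local Notation dlog_rem := (dlog_rem op s).

Let brl v : linear (br^~ v) := bracket_linearl hop v.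
Let brr u : linear (br u) := bracket_linearr hop u.
Let bF := bracket_filt hop hV.
Let fullF := filt_full hV.

Lemma lfield_sum v w : lfield v w = \sum_(i < s.+1) iter i (dlog_rem v) w.
Proof. by apply: (lfieldE_iter hop hV); rewrite subnn fullF. Qed.

Lemma bracket_filt_diff k x y a b : x - y \in F k -> a - b \in F k.+1 ->
  br x a - br y b \in F k.+1.
Proof.
move=> xy ab; have -> : br x a - br y b = br (x - y) a + br y (a - b).
  by rewrite (linB (brl _)) (linB (brr _)) subrKA.
apply: memvD; first by have := bF xy (fullF a (leqnn 1)); rewrite addn1.
by apply: (mem_filt_sub (leqnSn _)); have := bF (fullF y (leqnn 1)) ab; rewrite add1n.
Qed.

Lemma lfield_filt_diff k x y a : x - y \in F k -> lfield x a - lfield y a \in F k.+1.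
Proof.
move=> xy; rewrite !lfield_sum -sumrB; apply: memv_suml => i _.
have h b c : b - c \in F k.+1 -> dlog_rem x b - dlog_rem y c \in F k.+1.
  move=> bc; rewrite /(dlog_rem _ _).
  have -> : b - dlog x b - (c - dlog y c) = (b - c) - (dlog x b - dlog y c).
    by move: (dlog x b) (dlog y c) => d d'; apply/rowP => n; rewrite !mxE; ring.
  apply: memvB => //; rewrite /dlog -sumrB; apply: memv_suml => l _.
  rewrite -scalerBr memvZ//; elim: (l : nat) => [//|j IH] /=.
  exact: bracket_filt_diff.
by elim: (i : nat) => [|j IH] /=; [rewrite subrr mem0v|exact: h].
Qed.

Lemma is_derive_flow_diff x w a (t : R) :
  is_derive t 1 (fun t : R => op (x + w) (t *: a) - op x (t *: a) - w)
    (lfield (op (x + w) (t *: a)) a - lfield (op x (t *: a)) a).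
Proof.
have h := is_deriveB (is_derive_flow hop (x + w) a t) (is_derive_flow hop x a t).
have := is_deriveB h (is_derive_cst w t 1).
by rewrite subr0.
Qed.

(** Right translations are unipotent for the filtration. The flow difference is a primitive of a
    difference of fields, and [lfield_filt_diff] gains one degree at each integration until [k.+1]
    is reached. *)
Lemma op_filt_diff k x w a : w \in F k -> op (x + w) a - op x a - w \in F k.+1.
Proof.
move=> wF; pose f (t : R) := op (x + w) (t *: a) - op x (t *: a) - w.
have f0 : f 0 = 0 by rewrite /f scale0r !(opx0 hop) [x + w]addrC addrK subrr.
suff h t : f t \in F k.+1 by have := h 1; rewrite /f scale1r.
suff h j : (j <= k.+1)%N -> forall t, f t \in F j by exact: h.
elim: j => [_ r|j IH jk r]; first exact: fullF.
apply: (vspace_primitive (t0 := 0) (fun t => is_derive_flow_diff x w a t)) => [r'|]; last first.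
  by rewrite -/(f 0) f0 mem0v.
apply: lfield_filt_diff.
rewrite -[X in X \in _](subrK w) memvD//; first by apply: IH; exact: ltnW.
exact: mem_filt_sub wF.
Qed.

Lemma op_add_filt2 x y : op x y - x - y \in F 2.
Proof.
have := op_filt_diff 0 y (fullF x (leqnn 1)); rewrite add0r (op0x hop).
by rewrite addrAC.
Qed.

(** Inversion being [-], this is [op_filt_diff] at the point [- x] with the increment [- w], after a
    change of sign. *)
Lemma op_filt_right k x w : w \in F k -> op (- x) (x + w) - w \in F k.+1.
Proof.
move=> wF; have := op_filt_diff (- x) x (w := - w) (k := k).
rewrite memvN => /(_ wF); rewrite (opNx hop) subr0 opprK -memvN opprD.
by rewrite (oppop hop) opprD !opprK.
Qed.

Lemma filt_right k x w : w \in F k -> op (- x) (x + w) \in F k.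
Proof.
move=> wF; rewrite -[op _ _](subrK w) memvD//.
exact: mem_filt_sub (op_filt_right x wF).
Qed.

(** [Ad a b - b] is the bracket plus terms with at least two factors [a], of degree at least
    [2 * i + j]; [op_filt_diff] then replaces the remaining product with [- b] by a sum. *)
Lemma commutator_filt i j a b : (0 < i)%N -> a \in F i -> b \in F j ->
  op (op a b) (op (- a) (- b)) - br a b \in F (i + j).+1.
Proof.
move=> i0 aF bF'; rewrite (opA hop) -[op (op a b) (- a)]/(Ad a b).
pose z := Ad a b - b.
have zE : z - br a b \in F (i + j).+1.
  have bfull : b \in F (s.+1 - s.+2) by apply: fullF; lia.
  have := Ad_exp hop hV a 1 bfull; rewrite scale1r => E; rewrite /z E.
  rewrite !big_ord_recl/= !expr1n !divr1 !scale1r.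
  set S := \sum_(_ < _) _; have -> : b + (br a b + S) - b - br a b = S.
    by move: (br a b) S => c S; apply/rowP => n; rewrite !mxE; ring.
  apply: memv_suml => l _; apply: memvZ.
  have h k : iter k.+2 (br a) b \in F (i + j).+1.
    elim: k => [|k IH] /=.
      by apply: (@mem_filt_sub _ _ _ _ _ (i + (i + j))); [lia|apply: bF => //; exact: bF].
    by apply: (@mem_filt_sub _ _ _ _ _ (i + (i + j).+1)); [lia|exact: bF].
  exact: h.
have zF : z \in F (i + j).
  rewrite -(subrK (br a b) z) memvD//; last exact: bF.
  exact: mem_filt_sub zE.
have := op_filt_diff b (- b) zF; rewrite (opxN hop) subr0.
have -> : b + z = Ad a b by rewrite /z addrC subrK.
move=> h; have -> : op (Ad a b) (- b) - br a b = (op (Ad a b) (- b) - z) + (z - br a b).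
  by rewrite subrKA.
exact: memvD.
Qed.

(** Polynomials described by differences: the values have degree at least [r], and each of [p]
    successive right differences gains one degree. This class is stable under brackets, translations
    and primitives. *)
Fixpoint diff_filt p r (u : pt -> pt) : Prop :=
  (forall x, u x \in F r) /\
  if p is p'.+1 then forall a, diff_filt p' r.+1 (rdiff op a u) else True.

Lemma diff_filtD p r u u' c : diff_filt p r u -> diff_filt p r u' ->
  diff_filt p r (fun x => c *: u x + u' x).
Proof.
elim: p r u u' => [|p IH] r u u' /= [uF du] [uF' du'].
  by split=> // x; rewrite memvD// memvZ.
split=> [x|a]; first by rewrite memvD// memvZ.
have := IH _ _ _ (du a) (du' a); congr diff_filt; apply/funext => x.
by rewrite /rdiff scalerBr addrACA opprD.
Qed.

Lemma diff_filt0 p r : diff_filt p r (fun=> 0).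
Proof.
elim: p r => [|p IH] r; split=> [x|]; rewrite ?mem0v// => a.
by have := IH r.+1; congr diff_filt; apply/funext => x; rewrite /rdiff subrr.
Qed.

Lemma diff_filt_sum p r (I : Type) (l : seq I) (c : I -> R) (u : I -> pt -> pt) :
  (forall i, diff_filt p r (u i)) -> diff_filt p r (fun x => \sum_(i <- l) c i *: u i x).
Proof.
move=> uF; elim: l => [|i l IH].
  by under eq_fun do rewrite big_nil; exact: diff_filt0.
under eq_fun do rewrite big_cons; exact: diff_filtD.
Qed.

Lemma diff_filtW p r r' u : (r' <= r)%N -> diff_filt p r u -> diff_filt p r' u.
Proof.
elim: p r r' u => [|p IH] r r' u rr [uF du]; split=> [x|]; rewrite ?(mem_filt_sub rr)//.
by move=> a; exact: IH (du a).
Qed.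

Lemma diff_filt_pred p r u : diff_filt p.+1 r u -> diff_filt p r u.
Proof.
elim: p r u => [|p IH] r u [uF du]; first by [].
by split=> // a; apply: IH; exact: du.
Qed.

Lemma diff_filt_cst p a : diff_filt p 1 (fun=> a).
Proof.
case: p => [|p]; split=> [x|]; rewrite ?fullF// => x.
by have := diff_filt0 p 2; congr diff_filt; apply/funext => y; rewrite /rdiff subrr.
Qed.

(** A Leibniz rule: the difference of a bracket is a sum of three brackets, and the one with both
    entries differenced has a degree to spare. *)
Lemma diff_filt_bracket p r r' u u' : diff_filt p r u -> diff_filt p r' u' ->
  diff_filt p (r + r') (fun x => br (u x) (u' x)).
Proof.
elim: p r r' u u' => [|p IH] r r' u u' du du'.
  by split=> // x; apply: bF; [exact: du.1|exact: du'.1].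
split=> [x|a]; first by apply: bF; [exact: du.1|exact: du'.1].
have h1 := IH _ _ _ _ (du.2 a) (diff_filt_pred du').
have h2 := IH _ _ _ _ (diff_filt_pred du) (du'.2 a).
have h3 := diff_filtW _ (IH _ _ _ _ (du.2 a) (du'.2 a)).
have {}h3 := h3 (r + r').+1 ltac:(by rewrite addSn addnS; lia).
rewrite addSn in h1; rewrite addnS in h2.
have := diff_filtD 1 h1 (diff_filtD 1 h2 h3).
congr diff_filt; apply/funext => x; rewrite /rdiff !scale1r.
rewrite !(linB (brl _)) !(linB (brr _)).
move: (br _ _) (br _ _) (br _ _) (br _ _) => b1 b2 b3 b4.
by apply/rowP => n; rewrite !mxE; ring.
Qed.

Lemma diff_filt_shift p r u b : diff_filt p r u -> diff_filt p r (fun x => u (op x b)).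
Proof.
case: p => [|p] /= [uF du]; split=> // a.
have := diff_filtD (-1) (du b) (du (op a b)).
congr diff_filt; apply/funext => x; rewrite /rdiff (opA hop) scaleN1r opprB.
by rewrite [LHS]addrC subrKA.
Qed.

Lemma diff_filt_primitive p r (z w : R -> pt -> pt) :
  (forall x (t : R), is_derive t 1 (z^~ x) (w t x)) -> (forall x, z 0 x = 0) ->
  (forall t, diff_filt p r (w t)) -> forall t, diff_filt p r (z t).
Proof.
elim: p r z w => [|p IH] r z w zw z0 wF t.
  split=> // x; apply: (vspace_primitive (zw x) (t0 := 0)) => [u|]; last by rewrite z0 mem0v.
  by have [] := wF u.
split=> [x|a].
  apply: (vspace_primitive (zw x) (t0 := 0)) => [u|]; last by rewrite z0 mem0v.
  by have [] := wF u.
have d x (u : R) : is_derive u 1 (fun t => rdiff op a (z t) x) (rdiff op a (w u) x).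
  by apply: is_deriveB; exact: zw.
apply: (IH _ (fun t => rdiff op a (z t)) (fun t => rdiff op a (w t)) d) => [x|u].
  by rewrite /rdiff !z0 subrr.
by have [_ wa] := wF u; exact: wa.
Qed.

(** [op x a - x] is the integral of a field along the flow, and by [lfield_sum] the field is a
    combination of iterated brackets with [op x (t *: a)]. So the claim for [p] differences yields
    the claim for [p.+1]. *)
Lemma diff_filt_id p : diff_filt p 0 id.
Proof.
elim: p => [|p IH]; first by split=> // x; exact: fullF.
split=> [x|a]; first exact: fullF.
have wF t : diff_filt p 1 (fun x => lfield (op x (t *: a)) a).
  under eq_fun do rewrite lfield_sum.
  have h u : diff_filt p 1 u -> diff_filt p 1 (fun x => dlog_rem (op x (t *: a)) (u x)).
    move=> uF.
    have hl l : diff_filt p 1 (fun x => iter l (br (op x (t *: a))) (u x)).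
      elim: l => [//|l IHl] /=.
      by have := diff_filt_bracket (diff_filt_shift (t *: a) IH) IHl; rewrite add0n.
    rewrite /dlog_rem; under eq_fun do rewrite addrC -scaleN1r.
    apply: diff_filtD => //.
    exact: (diff_filt_sum _ _ (fun l : 'I_s.+1 => hl l)).
  have hi i : diff_filt p 1 (fun x => iter i (dlog_rem (op x (t *: a))) a).
    by elim: i => [|i IHi] /=; [exact: diff_filt_cst|exact: h].
  have := diff_filt_sum (index_enum 'I_s.+1) (fun=> 1) (fun i : 'I_s.+1 => hi i).
  congr diff_filt; apply/funext => x; apply: eq_bigr => i _.
  by rewrite scale1r.
have d x (t : R) : is_derive t 1 (fun t => op x (t *: a) - x) (lfield (op x (t *: a)) a).
  by have := is_deriveB (is_derive_flow hop x a t) (is_derive_cst x t 1); rewrite subr0.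
have := @diff_filt_primitive p 1 (fun t x => op x (t *: a) - x) _ d _ wF 1.
by rewrite /rdiff /= scale1r; apply => x; rewrite scale0r (opx0 hop) subrr.
Qed.

Lemma rdiff_id_eq0 (S : Type) (a : S -> pt) (I : seq S) : size I = s.+1 ->
  foldr (rdiff (fun x l => op x (a l))) id I =1 (fun=> 0).
Proof.
move=> sI x; apply: (@filt0 _ _ s V _ _ (ltnSn s)).
have h p r u J : diff_filt p r u -> size J = p ->
    forall x, foldr (rdiff (fun x l => op x (a l))) u J x \in F (r + p).
  elim/last_ind: J p r u => [|J l IH] p r u du; first by move=> p0; move: du; rewrite -p0 addn0 => -[].
  rewrite size_rcons; case: p du => // p [_ du] [Jp] y.
  by rewrite foldr_rcons -addSnnS; apply: IH => //; exact: (du (a l)).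
by have := h _ _ _ _ (diff_filt_id s.+1) sI x; rewrite add0n.
Qed.

End filtration_consequences.

Lemma norm_delta_le1 {R : realType} n (i : 'I_n) : `|delta_mx 0 i : 'rV[R]_n| <= 1.
Proof. by apply/rV_norm_leP => // j; rewrite mxE; case: andP => _; rewrite ?normr1 ?normr0. Qed.

(** * Chow's theorem *)

Section chow.
Context {R : realType} {N : nat} (op : 'rV[R]_N -> 'rV[R]_N -> 'rV[R]_N).
Hypothesis hop : is_exp_lie_group op.
Local Notation pt := 'rV[R]_N.
Local Notation e_ i := (delta_mx 0 i : pt).
Local Notation br := (lbr op).
Implicit Types x y z v : pt.
Context (s : nat) (V : nat -> {vspace pt}).
Hypothesis hV : is_stratification op s V.
Local Notation F := (@filt _ _ s V).
Local Notation m := (\dim (V 1%N)).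
Hypothesis V1e : forall j : 'I_N, (j < m)%N -> e_ j \in V 1%N.

Let brl v : linear (br^~ v) := bracket_linearl hop v.
Let brr u : linear (br u) := bracket_linearr hop u.

(** The first [m] coordinate vectors lie in a space of dimension [m], hence span it; the dimension
    is counted with the help of the complementary coordinate vectors. *)
Lemma layer1_coord0 u (i : 'I_N) : u \in V 1%N -> (m <= i)%N -> u 0 i = 0.
Proof.
pose X (P : pred 'I_N) : seq pt := [seq e_ j | j <- enum P].
have XV : (<<X [pred j : 'I_N | (j < m)%N]>> <= V 1)%VS.
  by apply/span_subvP => _ /mapP[j + ->]; rewrite mem_enum; exact: V1e.
have XE : (<<X [pred j : 'I_N | (j < m)%N]>> == V 1)%VS.
  rewrite eqEdim XV/=.
  have full : (fullv <= <<X [pred j : 'I_N | (j < m)%N]>> +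
                        <<X [pred j : 'I_N | (m <= j)%N]>>)%VS.
    apply/subvP => u' _; rewrite (row_sum_delta u') memv_suml// => j _.
    rewrite memvZ//; have [jm|mj] := ltnP j m.
      by apply: (subvP (addvSl _ _)); apply/memv_span/map_f; rewrite mem_enum.
    by apply: (subvP (addvSr _ _)); apply/memv_span/map_f; rewrite mem_enum.
  have mN : (m <= N)%N.
    by have := dimvS (subvf (V 1%N)); rewrite dimvf dim_matrix mul1r.
  have : (N <= \dim <<X [pred j : 'I_N | (j < m)%N]>> + (N - m))%N.
    have := dimvS full; rewrite dimvf dim_matrix mul1r => /leq_trans; apply.
    apply: leq_trans (dimv_add_leqif _ _) _; rewrite leq_add2l.
    apply: leq_trans (dim_span _) _; rewrite size_map -cardE.
    have := cardC [pred j : 'I_N | (j < m)%N]; rewrite card_ord.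
    have -> : #|[predC [pred j : 'I_N | (j < m)%N]]| = #|[pred j : 'I_N | (m <= j)%N]|.
      by apply: eq_card => j; rewrite !inE -leqNgt.
    have : (m <= #|[pred j : 'I_N | (j < m)%N]|)%N.
      have wI : injective (widen_ord mN) by move=> a b /(congr1 val) /= /val_inj.
      rewrite -{1}(card_ord m) -(fintype.card_image wI 'I_m).
      by apply/subset_leq_card/fintype.subsetP => _ /fintype.imageP[k _ ->]; rewrite inE /=.
    move=> mc mcN; rewrite -(leq_add2l m) subnKC// -[leqRHS]mcN leq_add2r//.
  move=> H; rewrite -(leq_add2r (N - m)) subnKC//.
move=> uV mi; have {uV} : u \in <<X [pred j : 'I_N | (j < m)%N]>>%VS by rewrite (eqP XE).
move=> /coord_span ->; rewrite summxE big1// => k _; rewrite mxE.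
have kP : (k < size (X [pred j : 'I_N | (j < m)%N]))%N by rewrite size_map -cardE.
have /mapP[j + /= ->] := mem_nth 0 kP; rewrite mem_enum inE => jm; rewrite mxE.
case: (eqVneq i j) => [ij|]; last by rewrite andbF mulr0.
by move: jm mi; rewrite ij ltnNge => /negbTE ->.
Qed.

Definition chain x (l : seq (R * 'I_N)) := foldl (fun x p => op x (p.1 *: e_ p.2)) x l.

Definition hsmall (r : R) (l : seq (R * 'I_N)) :=
  all (fun p : R * 'I_N => (p.2 < m)%N && (`|p.1| <= r)) l.

Lemma chain_op x l : chain x l = op x (chain 0 l).
Proof.
elim/last_ind: l => [|l q IH]; first by rewrite /= (opx0 hop).
by rewrite /chain !foldl_rcons -!/(chain _ _) IH (opA hop).
Qed.

Lemma chain_cat x l l' : chain x (l ++ l') = chain (chain x l) l'.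
Proof. exact: foldl_cat. Qed.

Definition reach p (r : R) y := exists l, [/\ (size l <= p)%N, hsmall r l & y = chain 0 l].

Lemma reach_op p q r x y : reach p r x -> reach q r y -> reach (p + q) r (op x y).
Proof.
move=> [l [lp lr ->]] [l' [lp' lr' ->]]; exists (l ++ l'); split.
- by rewrite size_cat leq_add.
- by rewrite /hsmall all_cat; apply/andP.
- by rewrite chain_cat [RHS]chain_op.
Qed.

Lemma reach_opp p r x : reach p r x -> reach p r (- x).
Proof.
move=> [l [lp lr ->]]; exists (rev [seq (- q.1, q.2) | q <- l]); split.
- by rewrite size_rev size_map.
- rewrite /hsmall all_rev all_map; apply: sub_all lr => q /=.
  by rewrite normrN.
elim/last_ind: l {lp lr} => [|l q IH]; first by rewrite /= oppr0.
rewrite map_rcons rev_rcons /= -/(chain _ _) [RHS]chain_op (op0x hop) -IH.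
by rewrite /chain foldl_rcons (oppop hop) scaleNr.
Qed.

Lemma reach_mono p q r r' x : (p <= q)%N -> r <= r' -> reach p r x -> reach q r' x.
Proof.
move=> pq rr [l [lp lr xl]]; exists l; split=> //; first exact: leq_trans lp pq.
by apply: sub_all lr => -[t j] /= /andP[-> /le_trans]; exact.
Qed.

Lemma op_small (e : R) : 0 < e -> exists2 d : R, 0 < d &
  forall x y, `|x| <= d -> `|y| <= d -> `|op x y| <= e.
Proof.
move=> e0; have h := @op_continuous _ _ _ hop (0, 0).
have /cvgrPdist_le/(_ _ e0) : op z.1 z.2 @[z --> ((0 : pt), (0 : pt))] --> op 0 0 by exact: h.
move=> /nbhs_ballP[d /= d0 dP]; exists (d / 2) => [|x y xd yd]; first by rewrite divr_gt0.
have dd : d / 2 < d by rewrite ltr_pdivrMr// ltr_pMr// ltr1n.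
have := dP (x, y); rewrite /= (op0x hop) sub0r normrN; apply; split;
  by rewrite -ball_normE /ball_ /= sub0r normrN (le_lt_trans _ dd).
Qed.

Lemma reach_small p (e : R) : 0 < e -> exists2 r : R, 0 < r &
  forall y, reach p r y -> `|y| <= e.
Proof.
elim: p e => [|p IH] e e0.
  by exists 1 => // y [l [+ _ ->]]; rewrite leqn0 size_eq0 => /eqP -> /=; rewrite normr0 ltW.
have [d d0 dP] := op_small e0; have [r r0 rP] := IH d d0.
exists (Num.min r d) => [|y [l [lp lr ->]]]; first by rewrite lt_min r0 d0.
case/lastP: l lp lr => [|l q]; first by rewrite /= normr0 ltW.
rewrite size_rcons ltnS /hsmall all_rcons => lp /andP[/andP[_ qr] lr].
rewrite /chain foldl_rcons; apply: dP.
  apply: rP; exists l; split=> //; apply: sub_all lr => -[t j] /= /andP[-> /le_trans].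
  by apply; rewrite ge_min lexx.
rewrite normrZ (le_trans (ler_piMr _ (norm_delta_le1 _)))//.
by apply: (le_trans qr); rewrite ge_min lexx orbT.
Qed.

(* The direction [v], of degree [k], is followed up to higher degree by
   horizontal chains of bounded length. *)
Definition attained k v := v \in F k /\ exists p, forall r : R, 0 < r ->
  exists2 d : R, 0 < d & forall t : R, `|t| <= d ->
    exists2 y, reach p r y & y - t *: v \in F k.+1.

Lemma attained0 k : attained k 0.
Proof.
split; first exact: mem0v.
exists 0%N => r r0; exists 1 => // t _; exists 0; first by exists [::].
by rewrite scaler0 subr0 mem0v.
Qed.

Lemma attainedD k a u v : attained k u -> attained k v -> attained k (a *: u + v).
Proof.
move=> [uF [p up]] [vF [q vq]]; split; first by rewrite memvD// memvZ.
exists (p + q)%N => r r0.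
have [d d0 dP] := up r r0; have [d' d'0 dP'] := vq r r0.
have a1 : 0 < `|a| + 1 by rewrite ltr_wpDl.
exists (Num.min (d / (`|a| + 1)) d') => [|t]; first by rewrite lt_min divr_gt0.
rewrite le_min => /andP[td td'].
have [|y yr yF] := dP (t * a).
  rewrite normrM; apply: le_trans (_ : `|t| * (`|a| + 1) <= _).
    by rewrite ler_wpM2l// lerDl.
  by rewrite -ler_pdivlMr.
have [y' yr' yF'] := dP' _ td'.
exists (op y y'); first exact: reach_op.
have yk : y \in F k.
  by rewrite -(subrK ((t * a) *: u) y) memvD ?memvZ// (mem_filt_sub _ yF).
have := op_filt_diff hop hV 0 y' yk; rewrite add0r (op0x hop) => h.
have -> : op y y' - t *: (a *: u + v) =
   (op y y' - y' - y) + ((y - (t * a) *: u) + (y' - t *: v)).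
  by apply/rowP => n; rewrite !mxE; ring.
by rewrite memvD// memvD.
Qed.

(** A group commutator of two moves of size the square root of [|t|] is [t] times the bracket up to
    higher degree; the sign of [t] is carried by the horizontal factor. *)
Lemma attained_bracket k (j : 'I_N) v : (j < m)%N -> (0 < k)%N -> attained k v ->
  attained k.+1 (br (e_ j) v).
Proof.
move=> jm k0 [vF [p vp]].
have s0 := strat_gt0 hV.
have ejF : e_ j \in F 1 by exact: (filt_full hV).
split; first by have := bracket_filt hop hV ejF vF; rewrite add1n.
exists ((1 + p) + (1 + p))%N => r r0; have [d d0 dP] := vp r r0.
exists (Num.min (d ^+ 2) (r ^+ 2)) => [|t]; first by rewrite lt_min !exprn_gt0.
rewrite le_min => /andP[td tr].
pose sg := Num.sqrt `|t|.
have sg0 : 0 <= sg by exact: sqrtr_ge0.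
have sgE (c : R) : 0 < c -> `|t| <= c ^+ 2 -> sg <= c.
  by move=> c0 tc; rewrite -[leRHS]gtr0_norm// -sqrtr_sqr ler_wsqrtr.
have [|y yr yF] := dP sg; first by rewrite ger0_norm// sgE.
pose a := Num.sg t * sg.
have ar : reach 1 r (a *: e_ j).
  exists [:: (a, j)]; split=> //=; last by rewrite (op0x hop).
  rewrite andbT jm/= normrM (ger0_norm sg0) (le_trans _ (sgE _ r0 tr))//.
  by rewrite ler_piMl// normr_sg lern1 leq_b1.
exists (op (op (a *: e_ j) y) (op (- (a *: e_ j)) (- y))).
  by apply: reach_op; apply: reach_op => //; exact: reach_opp.
have yk : y \in F k.
  by rewrite -(subrK (sg *: v) y) memvD ?memvZ// (mem_filt_sub _ yF).
have := commutator_filt hop hV (ltn0Sn 0) (memvZ a ejF) yk; rewrite add1n => h.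
have E : t *: br (e_ j) v = br (a *: e_ j) (sg *: v).
  rewrite (linZ (brl _)) (linZ (brr _)) scalerA /a -mulrA -expr2 sqr_sqrtr//.
  by rewrite -numEsg.
rewrite E -(subrKA (br (a *: e_ j) y)) memvD// -(linB (brr _)).
have := bracket_filt hop hV (memvZ a ejF) yF; rewrite add1n; exact.
Qed.

Lemma layer_attained k v : (0 < k <= s)%N -> v \in V k -> attained k v.
Proof.
case: k => // k; elim: k v => [|k IH] v ks vV.
  have -> : v = \sum_(j < N) v 0 j *: e_ j by exact: row_sum_delta.
  elim/big_ind : _ => [|u u' hu hu'|j _]; first exact: attained0.
    by rewrite -[u]scale1r; exact: attainedD.
  have [jm|mj] := ltnP j m; last first.
    by rewrite (layer1_coord0 vV mj) scale0r; exact: attained0.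
  rewrite -[_ *: _]addr0; apply: attainedD; last exact: attained0.
  split; first exact: (filt_full hV).
  exists 1%N => r r0; exists r => // t tr; exists (t *: e_ j); last by rewrite subrr mem0v.
  by exists [:: (t, j)]; split=> //=; rewrite ?jm ?tr// (op0x hop).
have ks' : (0 < k.+1 < s)%N by [].
have ks1 : (0 < k.+1 <= s)%N by exact: ltnW ks'.
apply: (bracket_space_ind hop (strat_bracket hV ks')) vV => [|a u u' hu hu'|u u' uV uV'].
- exact: attained0.
- exact: attainedD.
- rewrite (linear_rV_sum u (brl u')); elim/big_ind : _ => [|w w' hw hw'|j _].
  + exact: attained0.
  + by rewrite -[w]scale1r; exact: attainedD.
  + have [jm|mj] := ltnP j m; last first.
      by rewrite (layer1_coord0 uV mj) scale0r; exact: attained0.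
    rewrite -[_ *: _]addr0; apply: attainedD; last exact: attained0.
    by apply: attained_bracket => //; exact: IH.
Qed.

Lemma attained_sum k (X : seq pt) : (forall v, v \in X -> attained k v) ->
  exists p, forall r : R, 0 < r -> exists2 d : R, 0 < d &
    forall c : nat -> R, (forall i, `|c i| <= d) ->
    exists2 y, reach p r y & y - \sum_(i < size X) c i *: X`_i \in F k.+1.
Proof.
elim: X => [|v X IH] XF.
  exists 0%N => r r0; exists 1 => // c _; exists 0; first by exists [::].
  by rewrite big_ord0 subr0 mem0v.
have [vF [p vp]] := XF v (mem_head _ _).
have [|q Xq] := IH; first by move=> u uX; apply: XF; rewrite inE uX orbT.
exists (p + q)%N => r r0; have [d d0 dP] := vp r r0; have [d' d'0 dP'] := Xq r r0.
exists (Num.min d d') => [|c cd]; first by rewrite lt_min d0.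
have [|y yr yF] := dP (c 0%N); first by rewrite (le_trans (cd _))// ge_min lexx.
have [|y' yr' yF'] := dP' (c \o S).
  by move=> i; rewrite (le_trans (cd _))// ge_min lexx orbT.
exists (op y y'); first exact: reach_op.
have yk : y \in F k.
  by rewrite -(subrK (c 0%N *: v) y) memvD ?memvZ// (mem_filt_sub _ yF).
have := op_filt_diff hop hV 0 y' yk; rewrite add0r (op0x hop) => h.
rewrite /= big_ord_recl/=.
set T := \sum_(_ < _) _; have -> : op y y' - (c 0%N *: v + T) =
   (op y y' - y' - y) + ((y - c 0%N *: v) + (y' - T)).
  by move: T => T; apply/rowP => n; rewrite !mxE; ring.
by rewrite memvD// memvD.
Qed.

Lemma linear_bounded n (W : normedModType R) (f : 'rV[R]_n -> W) : linear f ->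
  exists2 C : R, 0 < C & forall v : 'rV[R]_n, `|f v| <= C * `|v : 'rV[R]_n|.
Proof.
move=> lf; exists (1 + \sum_i `|f (delta_mx 0 i)|) => [|v].
  by rewrite ltr_pwDl// sumr_ge0.
rewrite (linear_rV_sum v lf) mulrDl mul1r (le_trans (ler_norm_sum _ _ _))//.
rewrite mulr_suml ler_wpDl// ler_sum// => i _; rewrite normrZ mulrC ler_wpM2l//.
exact: coord_le_norm.
Qed.

Let filt_split k : (0 < k <= s)%N -> (F k <= V k + F k.+1)%VS.
Proof.
case: k => // k ks; apply/subv_sumP => i; rewrite ltnS leq_eqVlt => /predU1P[ki|ki].
  by rewrite -ki addvSl.
by apply: subv_trans (addvSr _ _); apply: (sumv_sup i).
Qed.

(** The filtration is climbed down from [filt s.+1 = 0]: the component of [z] in [V j] is matched by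
    a short chain ending at [y], and [op (- y) z] lies in [filt j.+1], where the induction
    hypothesis applies. *)
Lemma chow : exists p, forall r : R, 0 < r -> exists2 d : R, 0 < d &
  forall z, `|z| <= d -> reach p r z.
Proof.
suff h k : (k <= s.+1)%N -> exists p, forall r : R, 0 < r -> exists2 d : R, 0 < d &
    forall z, z \in F (s.+1 - k) -> `|z| <= d -> reach p r z.
  have [p hp] := h s.+1 (leqnn _); exists p => r r0; have [d d0 dP] := hp r r0.
  by exists d => // z; apply: dP; rewrite subnn; exact: (filt_full hV).
elim: k => [_|k IH ks].
  exists 0%N => r r0; exists 1 => // z; rewrite subn0 => /(filt0 (ltnSn s)) -> _.
  by exists [::].
have [p IHp] := IH (ltnW ks).
(* [filt 1] and [filt 0] coincide, so the last step of the induction is free. *)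
have [ke|kns] := eqVneq k s.
  exists p => r r0; have [d d0 dP] := IHp r r0; exists d => // z zF.
  by apply: dP; apply: (filt_full hV); lia.
have {}ks : (k < s)%N by lia.
pose j := (s.+1 - k.+1)%N; have js : (0 < j <= s)%N by rewrite /j; lia.
have jk : (s.+1 - k = j.+1)%N by rewrite /j; lia.
rewrite jk in IHp; rewrite -/j.
pose X := vbasis (V j).
have [|q Xq] := @attained_sum j X.
  by move=> v vX; apply: layer_attained => //; exact: vbasis_mem.
exists (q + p)%N => r r0.
have [d' d'0 dP'] := IHp r r0.
(* The sizes are chosen backwards: [op (- y) z] has to enter the ball of radius [d'], so [y] and [z]
   have to stay below [e], and chains with steps at most [r'] do so. *)
have [e e0 eP] := op_small d'0.
have [r' r'0 rP'] := reach_small q e0.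
have r1 : 0 < Num.min r r' by rewrite lt_min r0.
have [d d0 dP] := Xq _ r1.
pose c z (i : nat) : R := if insub i is Some i' then
   coord X i' (addv_pi1 (V j) (F j.+1) z) else 0.
have [C C0 cC] : exists2 C : R, 0 < C & forall z i, `|c z i| <= C * `|z|.
  have /choice[Cf CfP] : forall i' : 'I_(\dim (V j)), exists C : R, 0 < C /\
      forall z, `|coord X i' (addv_pi1 (V j) (F j.+1) z)| <= C * `|z|.
    move=> i'; have [|C C0 CP] := @linear_bounded N R
      (fun z => coord X i' (addv_pi1 (V j) (F j.+1) z)).
      by move=> a u v; rewrite !linearP.
    by exists C.
  exists (1 + \sum_i Cf i) => [|z i].
    by rewrite ltr_pwDl// sumr_ge0// => i _; rewrite ltW//; have [] := CfP i.
  have Cf0 i' : 0 <= Cf i' by rewrite ltW//; have [] := CfP i'.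
  rewrite /c; case: insubP => [i' _ _|_].
    rewrite (le_trans ((CfP i').2 z))// ler_wpM2r//.
    by rewrite (bigD1 i')//= addrCA lerDl addr_ge0// sumr_ge0.
  by rewrite normr0 mulr_ge0// addr_ge0// sumr_ge0.
exists (Num.min (d / C) e) => [|z zF]; first by rewrite lt_min divr_gt0.
rewrite le_min => /andP[zd ze].
have [|y yr yF] := dP (c z).
  by move=> i; rewrite (le_trans (cC _ _))// mulrC -ler_pdivlMr.
have zy : z - y \in F j.+1.
  have zVF := subvP (filt_split js) _ zF.
  have E := addv_pi1_pi2 zVF.
  rewrite -{1}E -memvN opprB.
  have E1 : addv_pi1 (V j) (F j.+1) z = \sum_(i < size X) c z i *: X`_i.
    rewrite {1}(coord_vbasis (memv_pi1 _ _ _)) size_tuple; apply: eq_bigr => i _.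
    by rewrite /c valK.
  rewrite E1 opprD addrA memvB// ?memv_pi2//.
rewrite -(opNK hop y z); apply: reach_op.
  by apply: reach_mono yr => //; rewrite ge_min lexx.
apply: dP'.
  by rewrite -(subrK y z) addrC; exact: filt_right.
apply: eP => //; rewrite normrN; apply: rP'; apply: reach_mono yr => //.
by rewrite ge_min lexx orbT.
Qed.

End chow.

Section continuity.
Context {R : realType}.

Lemma ctsD (V W : normedModType R) (f g : V -> W) :
  continuous f -> continuous g -> continuous (fun x => f x + g x).
Proof. by move=> cf cg x; apply: cvgD; [exact: cf|exact: cg]. Qed.

Lemma ctsN (V W : normedModType R) (f : V -> W) :
  continuous f -> continuous (fun x => - f x).
Proof. by move=> cf x; apply: cvgN; exact: cf. Qed.

Lemma ctsB (V W : normedModType R) (f g : V -> W) :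
  continuous f -> continuous g -> continuous (fun x => f x - g x).
Proof. by move=> cf cg; apply: ctsD => //; exact: ctsN. Qed.

Lemma ctsM (V : normedModType R) (f g : V -> R) :
  continuous f -> continuous g -> continuous (fun x => f x * g x).
Proof. by move=> cf cg x; apply: cvgM; [exact: cf|exact: cg]. Qed.

Lemma cts_cst (V W : normedModType R) (a : W) : continuous (fun _ : V => a).
Proof. by move=> x; exact: cvg_cst. Qed.

Lemma cts_sum (V W : normedModType R) (I : Type) (r : seq I)
    (P : pred I) (f : I -> V -> W) :
  (forall i, P i -> continuous (f i)) -> continuous (fun x => \sum_(i <- r | P i) f i x).
Proof.
move=> cf; elim: r => [|i r IH].
  by rewrite (_ : (fun x => _) = fun=> 0); [exact: cts_cst|apply/funext => x; rewrite big_nil].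
rewrite (_ : (fun x => _) = fun x => (if P i then f i x else 0) + \sum_(j <- r | P j) f j x).
  apply: ctsD => //; have := cf i; case: (P i) => [/(_ isT)//|_]; exact: cts_cst.
by apply/funext => x; rewrite big_cons; case: ifP; rewrite ?add0r.
Qed.

Lemma cts_coord n i : continuous (fun x : 'rV[R]_n => x 0 i).
Proof. by apply: (rV_continuousP (@id 'rV[R]_n)).1 => x; exact: cvg_id. Qed.

Lemma cts_distP (V W : normedModType R) (f : V -> W) : continuous f <->
  forall x e, 0 < e -> exists2 d : R, 0 < d & forall y, `|x - y| <= d -> `|f x - f y| <= e.
Proof.
split=> [cf x e e0|h x].
  have /cvgrPdist_le/(_ _ e0) /nbhs_ballP[r /= r0 rP] := cf x.
  exists (r / 2) => [|y xy]; first by rewrite divr_gt0.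
  by apply: rP; rewrite -ball_normE /ball_ /= (le_lt_trans xy)// ltr_pdivrMr// ltr_pMr// ltr1n.
have : f @ x --> f x; last exact.
apply/cvgrPdist_le => eps eps0; have [d d0 dP] := h x eps eps0.
apply/nbhs_ballP; exists d => //= y; rewrite -ball_normE /ball_ /= => xy.
by apply: dP; exact: ltW.
Qed.

End continuity.

Section Ck_algebra.
Context {R : realType} {V : normedModType R}.
Implicit Types (f g : V -> R) (k : nat).

Lemma is_Ck_le k l (W : normedModType R) (f : V -> W) : (k <= l)%N -> is_Ck l f -> is_Ck k f.
Proof.
elim: l k f => [|l IH] [|k] f //=; first by move=> _ [].
rewrite ltnS => kl [cf df]; split=> // v; have [fd fk] := df v; split=> //.
exact: IH fk.
Qed.

Lemma is_Ck_cst k (W : normedModType R) (a : W) : is_Ck k (fun _ : V => a).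
Proof.
elim: k a => [|k IH] a /=; first by split=> //; exact: cst_continuous.
split=> [|v]; first exact: cst_continuous.
split=> [x|]; first exact: derivable_cst.
by rewrite (_ : 'D_v _ = fun=> 0) //; apply/funext => x; rewrite derive_cst.
Qed.

Lemma is_CkD k (W : normedModType R) (f g : V -> W) :
  is_Ck k f -> is_Ck k g -> is_Ck k (fun x => f x + g x).
Proof.
elim: k f g => [|k IH] f g /= [cf df] [cg dg].
  by split=> // x; apply: cvgD; [exact: cf|exact: cg].
split=> [x|v]; first by apply: cvgD; [exact: cf|exact: cg].
have [fd fk] := df v; have [gd gk] := dg v.
split=> [x|]; first exact: derivableD.
rewrite (_ : 'D_v _ = fun x => 'D_v f x + 'D_v g x); first exact: IH.
by apply/funext => x; rewrite -deriveD.
Qed.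

Lemma is_CkM k f g : is_Ck k f -> is_Ck k g -> is_Ck k (fun x => f x * g x).
Proof.
elim: k f g => [|k IH] f g hf hg.
  by case: hf hg => [cf _] [cg _]; split=> // x; apply: cvgM; [exact: cf|exact: cg].
have fk := is_Ck_le (leqnSn k) hf; have gk := is_Ck_le (leqnSn k) hg.
case: hf hg => [cf df] [cg dg]; split=> [x|v].
  by apply: cvgM; [exact: cf|exact: cg].
have [fd dfk] := df v; have [gd dgk] := dg v.
split=> [x|]; first exact: derivableM.
rewrite (_ : 'D_v _ = fun x => f x * 'D_v g x + g x * 'D_v f x).
  by apply: is_CkD; exact: IH.
by apply/funext => x; rewrite [LHS]deriveM.
Qed.

Lemma is_CkV k f : (forall x, f x != 0) -> is_Ck k f -> is_Ck k (fun x => (f x)^-1).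
Proof.
move=> f0; elim: k => [|k IH] hf.
  by case: hf => [cf _]; split=> // x; apply: cvgV => //; exact: cf.
have fk := IH (is_Ck_le (leqnSn k) hf).
case: hf => [cf df]; split=> [x|v]; first by apply: cvgV => //; exact: cf.
have [fd dfk] := df v.
split=> [x|]; first exact: derivableV.
rewrite (_ : 'D_v _ = fun x => (- 1) * ((f x)^-1 * (f x)^-1) * 'D_v f x).
  by apply: is_CkM => //; apply: is_CkM; [exact: is_Ck_cst|exact: is_CkM].
by apply/funext => x; rewrite deriveV// -exprVn expr2 mulN1r.
Qed.

Lemma is_Ck_prod k (I : Type) (r : seq I) (f : I -> V -> R) :
  (forall i, is_Ck k (f i)) -> is_Ck k (fun x => \prod_(i <- r) f i x).
Proof.
move=> fk; elim: r => [|i r IH].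
  by rewrite (_ : (fun x => _) = fun=> 1); [exact: is_Ck_cst|apply/funext => x; rewrite big_nil].
rewrite (_ : (fun x => _) = fun x => f i x * \prod_(j <- r) f j x); first exact: is_CkM.
by apply/funext => x; rewrite big_cons.
Qed.

End Ck_algebra.

(** * Smooth cutoff functions *)

Section bump.
Context {R : realType}.

Let dnbhs0 : h @[h --> (0 : R)^'] --> (0 : R).
Proof. exact: nbhs_dnbhs. Qed.

Lemma pow_le_exp n (y : R) : 0 <= y -> y ^+ n.+1 <= n.+1%:R ^+ n.+1 * expR y.
Proof.
move=> y0; have n0 : 0 < n.+1%:R :> R by [].
have E : expR y = expR (y / n.+1%:R) ^+ n.+1.
  by rewrite -expRM_natl mulrC divfK// lt0r_neq0.
rewrite E -exprMn; apply: lerXn2r; rewrite ?nnegrE// ?pmulr_rge0// ?expR_ge0//.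
rewrite -ler_pdivrMl// mulrC; apply: le_trans (expR_ge1Dx _).
by rewrite lerDr.
Qed.

(** The derivative of [flat n] is a combination of [flat n.+1] and [flat n.+2], so one induction on
    the order proves all members of the family smooth. *)
Definition flat n (x : R) : R := if 0 < x then (x^-1) ^+ n * expR (- x^-1) else 0.

Let flat_le n (x : R) : `|flat n x| <= n.+2%:R ^+ n.+2 * x ^+ 2.
Proof.
rewrite /flat; case: ifPn => x0; last by rewrite normr0 mulr_ge0// exprn_even_ge0.
have xV : 0 < x^-1 by rewrite invr_gt0.
rewrite ger0_norm; last by rewrite mulr_ge0 ?exprn_ge0 ?expR_ge0// ltW.
have := pow_le_exp n.+1 (ltW xV); rewrite expRN.
rewrite ler_pdivrMr ?expR_gt0// => h.
have -> : x^-1 ^+ n = x^-1 ^+ n.+2 * x ^+ 2.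
  by rewrite -addn2 exprD -mulrA -exprMn mulVf ?gt_eqF// expr1n mulr1.
by rewrite (mulrAC _ _ (expR _)) ler_pM2r// exprn_gt0.
Qed.

Let is_derive_flat n (x : R) :
  is_derive x 1 (flat n) (- n%:R * flat n.+1 x + flat n.+2 x).
Proof.
have [x0|x0|->] := ltgtP x 0.
- rewrite /flat ltNge ltW//= mulr0 addr0.
  apply: (@near_eq_is_derive _ _ _ (fun=> 0)).
    near=> y; rewrite ltNge (_ : y <= 0)//.
    by apply/ltW; near: y; exact: lt_nbhsl.
- have E : is_derive x 1 (fun y : R => (y^-1) ^+ n * expR (- y^-1))
     (- n%:R * flat n.+1 x + flat n.+2 x).
    have dV : is_derive x 1 (fun y : R => y^-1) (- x ^- 2 *: 1).
      have xn0 : @id R x != 0 by rewrite /= gt_eqF.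
      by have := is_deriveV xn0 (is_derive_id x 1).
    have dN : is_derive x 1 (fun y : R => - y^-1) (- (- x ^- 2 *: 1)) by exact: is_deriveN.
    have dE : is_derive x 1 (fun y : R => expR (- y^-1)) ((- (- x ^- 2 *: 1)) *: expR (- x^-1)).
      apply: (@is_derive_comp1 _ _ expR (fun y => - y^-1)) => //.
    have dX : is_derive x 1 (fun y : R => (y^-1) ^+ n) ((n%:R * x^-1 ^+ n.-1) *: (- x ^- 2 *: 1)).
      case: n => [|n].
        by rewrite mul0r scale0r; apply: is_derive_cst.
      have := is_deriveX n.+1 dV; congr is_derive.
      by apply/funext => y; rewrite exprfctE.
    apply: is_derive_eq (is_deriveM dX dE) _.
    rewrite /flat x0 !scaler1 opprK /GRing.scale/= -!exprVn.
    by case: n {dX} => [|n]; rewrite /= ?mul0r ?mulr0; rewrite !exprS; ring.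
  apply: (@near_eq_is_derive _ _ _ (fun y : R => (y^-1) ^+ n * expR (- y^-1))) => //.
  near=> y; rewrite /flat (_ : 0 < y)//.
  by near: y; exact: lt_nbhsr.
- rewrite /flat ltxx mulr0 addr0; apply/is_deriveP.
  apply: (@squeeze_cvgr _ _ _ _ (fun h : R => - (n.+2%:R ^+ n.+2 * `|h|)) (fun h : R => n.+2%:R ^+ n.+2 * `|h|)).
  + near=> h; rewrite -ler_norml scaler1 addr0 -/(flat n h) ltxx subr0.
    have h0 : h != 0 by near: h; exact: nbhs_dnbhs_neq.
    rewrite normrZ normfV ler_pdivrMl ?normr_gt0//.
    apply: le_trans (flat_le n h) _.
    by rewrite [leRHS]mulrCA -normrM -expr2 ger0_norm// sqr_ge0.
  + rewrite -[X in _ --> X]oppr0; apply: cvgN; rewrite -[X in _ --> X](mulr0 (n.+2%:R ^+ n.+2)); apply: cvgMr.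
    by rewrite -[X in _ --> X](normr0 R); apply: cvg_norm; exact: dnbhs0.
  + rewrite -[X in _ --> X](mulr0 (n.+2%:R ^+ n.+2)); apply: cvgMr.
    by rewrite -[X in _ --> X](normr0 R); apply: cvg_norm; exact: dnbhs0.
Unshelve. all: by end_near. Qed.

Lemma is_Ck_flat k n : is_Ck k (flat n).
Proof.
elim: k n => [|k IH] n.
  by split=> // x; exact: is_derive_continuous (is_derive_flat n x).
split=> [x|v]; first exact: is_derive_continuous (is_derive_flat n x).
have dv x : is_derive x v (flat n) (v *: (- n%:R * flat n.+1 x + flat n.+2 x)).
  rewrite -[X in is_derive _ X](mulr1 v); exact: is_deriveZv (is_derive_flat n x).
split=> [x|]; first by have [] := dv x.
rewrite (_ : 'D_v _ = fun x => v * (- n%:R * flat n.+1 x + flat n.+2 x)).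
  by apply: is_CkM; [exact: is_Ck_cst|apply: is_CkD => //; apply: is_CkM => //; exact: is_Ck_cst].
by apply/funext => x; have [_ ->] := dv x.
Qed.

Let flat_ge0 (x : R) : 0 <= flat 0 x.
Proof. by rewrite /flat; case: ifP => // _; rewrite mulr_ge0// expR_ge0. Qed.

Let flat_gt0 (x : R) : 0 < x -> 0 < flat 0 x.
Proof. by move=> x0; rewrite /flat x0 mul1r expR_gt0. Qed.

Let flat_eq0 (x : R) : x <= 0 -> flat 0 x = 0.
Proof. by move=> x0; rewrite /flat ltNge x0. Qed.

Definition sstep (x : R) : R := flat 0 x * (flat 0 x + flat 0 (1 - x))^-1.

Lemma smooth_sstep : smooth sstep.
Proof.
move=> k; have fk : is_Ck k (fun x : R => flat 0 (1 - x)).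
  apply: (@is_Ck_comp_affine _ R^o R^o R^o (fun x => 1 - x) (fun x => - x) (flat 0)).
  - by move=> x; apply: cvgB; [exact: cvg_cst|exact: cvg_id].
  - by move=> h w x; rewrite /GRing.scale/=; ring.
  - exact: is_Ck_flat.
apply: is_CkM; first exact: is_Ck_flat.
apply: is_CkV; last by apply: is_CkD => //; exact: is_Ck_flat.
move=> x; rewrite gt_eqF//; have [x0|x0] := ltP 0 x.
  by rewrite ltr_pwDl ?flat_gt0.
by rewrite ltr_wpDl ?flat_gt0// subr_gt0 (le_lt_trans x0).
Qed.

Lemma sstep0 (x : R) : x <= 0 -> sstep x = 0.
Proof. by move=> x0; rewrite /sstep flat_eq0// mul0r. Qed.

Lemma sstep1 (x : R) : 1 <= x -> sstep x = 1.
Proof.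
move=> x1; rewrite /sstep (flat_eq0 (x := 1 - x)) ?addr0 ?mulfV ?subr_le0//.
by rewrite gt_eqF// flat_gt0// (lt_le_trans _ x1).
Qed.

Lemma smooth_cutoff n (B : R) : 0 <= B -> exists psi : 'rV[R]_n -> R, [/\ smooth psi,
  (forall x, `|x| <= B -> psi x = 1) & (forall x, B + 1 < `|x| -> psi x = 0)].
Proof.
move=> B0; exists (fun x => \prod_i (sstep (B + 1 + x 0 i) * sstep (B + 1 - x 0 i))); split.
- move=> k; apply: is_Ck_prod => i; apply: is_CkM.
    apply: (@is_Ck_comp_affine _ 'rV[R]_n R^o R^o (fun x : 'rV[R]_n => B + 1 + x 0 i) (fun x => x 0 i) sstep).
    + by apply: ctsD; [exact: cts_cst|exact: cts_coord].
    + by move=> h w x; rewrite !mxE addrCA.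
    + exact: smooth_sstep.
  apply: (@is_Ck_comp_affine _ 'rV[R]_n R^o R^o (fun x : 'rV[R]_n => B + 1 - x 0 i) (fun x => - x 0 i) sstep).
  + by apply: ctsB; [exact: cts_cst|exact: cts_coord].
  + by move=> h w x; rewrite !mxE scalerN opprD addrCA.
  + exact: smooth_sstep.
- move=> x xB; rewrite big1// => i _.
  have := le_trans (coord_le_norm x i) xB; rewrite ler_norml => /andP[h1 h2].
  by rewrite !sstep1 ?mulr1//; lra.
- move=> x xB; have [i xi] : exists i, B + 1 < `|x 0 i|.
    apply: contrapT => /forallNP h; move: xB; rewrite ltNge => /negP; apply.
    by apply/rV_norm_leP => [|i]; [rewrite addr_ge0|rewrite leNgt; apply/negP/h].
  rewrite (bigD1 i)//=; move: xi; rewrite ltr_normr => /orP[xi|xi].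
    by rewrite (sstep0 (x := B + 1 - _)) ?mulr0 ?mul0r//; lra.
  by rewrite (sstep0 (x := B + 1 + _)) ?mul0r//; lra.
Qed.

End bump.

Section compact_uniformity.
Context {R : realType}.

(** Only [x] is confined to [K], while [y] is any nearby point; uniform continuity on [K] would not
    be enough. *)
Lemma unif_cts_compact (U W : normedModType R) (f : U -> W) (K : set U) (e : R) :
  continuous f -> compact K -> 0 < e -> exists2 d : R, 0 < d &
    forall x y, K x -> `|x - y| <= d -> `|f x - f y| <= e.
Proof.
move=> cf /compact_near_coveringP cK e0.
have /cK : forall x, K x -> \forall x' \near x & d \near (0 : R)^'+,
    forall y, `|x' - y| <= d -> `|f x' - f y| <= e.
  move=> x Kx; have e2 : 0 < e / 2 by rewrite divr_gt0.
  have /cvgrPdist_le/(_ _ e2) /nbhs_ballP[r /= r0 rP] := cf x.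
  have r2 : 0 < r / 2 by rewrite divr_gt0.
  exists (ball x (r / 2), `]0, (r / 2)[%classic) => /=.
    split; first exact: nbhsx_ballx.
    near=> t; rewrite /= in_itv/=; apply/andP; split; near: t; [exact: nbhs_right_gt|exact: nbhs_right_lt].
  move=> [x' d] /= [xx' /= d0] y yd; rewrite in_itv/= in d0; case/andP: d0 => d0 dr.
  rewrite -ball_normE /ball_ /= in xx'.
  rewrite -(subrKA (f x)) (le_trans (ler_normD _ _))// [leRHS]splitr lerD//.
    rewrite distrC; apply: rP; rewrite -ball_normE /ball_ /= (lt_le_trans xx')//; lra.
  apply: rP; rewrite -ball_normE /ball_ /= -(subrKA x') (le_lt_trans (ler_normD _ _))//.
  by rewrite [ltRHS]splitr ltr_leD// (le_trans yd)// ltW.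
move=> [d /= d0 dP]; exists (d / 2) => [|x y Kx xy]; first by rewrite divr_gt0.
apply: (dP (d / 2)) => //=; last by rewrite divr_gt0.
by rewrite sub0r normrN gtr0_norm ?divr_gt0// ltr_pdivrMr// ltr_pMr// ltr1n.
Unshelve. all: by end_near. Qed.

Lemma compact_ball n (B : R) : compact [set x : 'rV[R]_n | `|x| <= B].
Proof.
apply: bounded_closed_compact.
  exists B; split; first exact: num_real.
  by move=> M BM x /= xB; rewrite (le_trans xB)// ltW.
rewrite (_ : [set _ | _] = (fun x : 'rV[R]_n => `|x|) @^-1` [set t : R | t <= B])//.
by apply: (continuous_closedP _).1; [exact: norm_continuous|exact: closed_le].
Qed.

Lemma compact_bounded_norm (V : normedModType R) (K : set V) : compact K ->
  exists2 B : R, 0 < B & forall x, K x -> `|x| <= B.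
Proof.
move=> /compact_bounded [M [Mr MP]]; exists (`|M| + 1) => [|x Kx].
  by rewrite ltr_wpDl.
by apply: (MP (`|M| + 1)) => //; rewrite (le_lt_trans (ler_norm M))// ltrDl.
Qed.

Lemma bounded_on_ball n (W : normedModType R) (f : 'rV[R]_n -> W) (B : R) : continuous f ->
  exists2 C : R, 0 < C & forall x, `|x| <= B -> `|f x| <= C.
Proof.
move=> cf; have [|C C0 CP] := @compact_bounded_norm W (f @` [set x | `|x| <= B]).
  by apply: continuous_compact; [exact: continuous_subspaceT|exact: compact_ball].
by exists C => // x xB; apply: CP; exists x.
Qed.

End compact_uniformity.

Section C1_algebra.
Context {R : realType} {n : nat}.
Implicit Types f g : 'rV[R]_n -> R.

Lemma C1_continuous f : is_C1 f -> continuous f.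
Proof.
move=> f1; apply/cts_distP => x e e0.
have [C C0 CP] : exists2 C : R, 0 < C & forall i y, `|y| <= `|x| + 1 -> `|'D_(delta_mx 0 i) f y| <= C.
  have /choice[c cP] : forall i, exists c : R, 0 < c /\ forall y, `|y| <= `|x| + 1 -> `|'D_(delta_mx 0 i) f y| <= c.
    move=> i; have [_ ci] := f1 (delta_mx 0 i).
    by have [c c0 cP] := bounded_on_ball (`|x| + 1) ci; exists c.
  exists (1 + \sum_i c i) => [|i y yx].
    by rewrite ltr_pwDl// sumr_ge0// => i _; rewrite ltW//; have [] := cP i.
  rewrite (le_trans ((cP i).2 _ yx))// (bigD1 i)//= addrCA lerDl addr_ge0//.
  by rewrite sumr_ge0// => j _; rewrite ltW//; have [] := cP j.
pose K := n%:R * C + 1; have K0 : 0 < K by rewrite ltr_wpDl// mulr_ge0// ltW.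
exists (Num.min 1 (e / K)) => [|y]; first by rewrite lt_min ltr01 divr_gt0.
rewrite distrC le_min => /andP[yx yx'].
have [xi xiP E] := C1_mvt f1 x (y - x).
rewrite [x + _]addrC subrK in E; rewrite distrC E.
apply: le_trans (ler_norm_sum _ _ _) _.
apply: le_trans (_ : \sum_(i < n) (`|y - x| * C) <= _).
  apply: ler_sum => i _; rewrite normrM ler_pM// ?coord_le_norm// CP//.
  by rewrite -(subrK x (xi i)) (le_trans (ler_normD _ _))// addrC lerD2l (le_trans (xiP i)).
rewrite sumr_const card_ord -mulr_natl mulrCA.
apply: le_trans (_ : `|y - x| * K <= _); last by rewrite -ler_pdivlMr.
by rewrite ler_wpM2l// lerDl.
Qed.

Lemma C1M f g : is_C1 f -> is_C1 g -> is_C1 (fun x => f x * g x).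
Proof.
move=> f1 g1 v; have [fd fc] := f1 v; have [gd gc] := g1 v.
have cf := C1_continuous f1; have cg := C1_continuous g1.
split=> [x|]; first exact: derivableM.
rewrite (_ : 'D_v _ = fun x => f x * 'D_v g x + g x * 'D_v f x).
  by apply: ctsD; apply: ctsM.
by apply/funext => x; rewrite [LHS]deriveM.
Qed.

Lemma C1_sum (I : Type) (r : seq I) (f : I -> 'rV[R]_n -> R) :
  (forall i, is_C1 (f i)) -> is_C1 (fun x => \sum_(i <- r) f i x).
Proof.
move=> f1; elim: r => [|i r IH] v.
  rewrite (_ : (fun x => _) = fun=> 0); last by apply/funext => x; rewrite big_nil.
  split=> [x|]; first exact: derivable_cst.
  rewrite (_ : 'D_v _ = fun=> 0); first exact: cst_continuous.
  by apply/funext => x; rewrite derive_cst.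
rewrite (_ : (fun x => _) = fun x => f i x + \sum_(j <- r) f j x); last first.
  by apply/funext => x; rewrite big_cons.
have [fd fc] := f1 i v; have [gd gc] := IH v.
split=> [x|]; first exact: derivableD.
rewrite (_ : 'D_v _ = fun x => 'D_v (f i) x + 'D_v (fun x => \sum_(j <- r) f j x) x).
  exact: ctsD.
by apply/funext => x; rewrite [LHS]deriveD.
Qed.

End C1_algebra.

(** The mean value theorem is applied twice to [p], the left side with [t * r] in place of [t]: both
    [p] and its derivative [q] vanish at 0. *)
Lemma second_difference {R : realType} (u du ddu : R -> R) (t w : R) :
  (forall s : R, is_derive s 1 u (du s)) -> (forall s : R, is_derive s 1 du (ddu s)) ->
  (forall s, `|s| <= `|t| -> `|ddu s - ddu 0| <= w) ->
  `|u t + u (- t) - 2 * u 0 - t ^+ 2 * ddu 0| <= 2 * w * t ^+ 2.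
Proof.
move=> hu hdu hw.
have lin (c s : R) : is_derive s 1 (fun r : R => c * r) c.
  have := is_deriveM (is_derive_cst c s 1) (is_derive_id s 1); move=> h.
  by apply: is_derive_eq h _; rewrite /GRing.scale/= mulr0 addr0 mulr1.
have comp (f df : R -> R) c (s : R) : (forall s : R, is_derive s 1 f (df s)) ->
    is_derive s 1 (fun r => f (c * r)) (c * df (c * s)).
  by move=> hf; exact: (@is_derive_comp1 _ _ f (fun r => c * r) _ _ _ (hf _) (lin c s)).
pose p r := u (t * r) + u (- t * r) - 2 * u 0 - t ^+ 2 * ddu 0 * r ^+ 2.
pose q r := t * du (t * r) - t * du (- t * r) - 2 * t ^+ 2 * ddu 0 * r.
pose q' r := t ^+ 2 * ((ddu (t * r) - ddu 0) + (ddu (- t * r) - ddu 0)).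
have hp (s : R) : is_derive s 1 p (q s).
  have h1 := comp _ _ t s hu; have h2 := comp _ _ (- t) s hu.
  have h3 : is_derive s 1 (fun r : R => t ^+ 2 * ddu 0 * r ^+ 2) (t ^+ 2 * ddu 0 * (2 * s)).
    have h := is_deriveM (is_derive_cst (t ^+ 2 * ddu 0) s 1) (is_deriveM (is_derive_id s 1) (is_derive_id s 1)).
    have : is_derive s 1 (fun r : R => t ^+ 2 * ddu 0 * (r * r)) (t ^+ 2 * ddu 0 * (2 * s)).
      by apply: is_derive_eq h _; rewrite /GRing.scale/=; ring.
    by under eq_fun do rewrite -expr2.
  have := is_deriveB (is_deriveB (is_deriveD h1 h2) (is_derive_cst (2 * u 0) s 1)) h3.
  by move=> h; apply: is_derive_eq h _; rewrite /q; ring.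
have hq (s : R) : is_derive s 1 q (q' s).
  have h1 := is_deriveM (is_derive_cst t s 1) (comp _ _ t s hdu).
  have h2 := is_deriveM (is_derive_cst t s 1) (comp _ _ (- t) s hdu).
  have := is_deriveB (is_deriveB h1 h2) (lin (2 * t ^+ 2 * ddu 0) s).
  by move=> h; apply: is_derive_eq h _; rewrite /q' /GRing.scale/=; ring.
have [c /andP[c0 c1] E] := MVT01 hp.
have [c' /andP[c'0 c'1] E'] := MVT01 (fun s => comp _ _ c s hq).
have p1 : p 1 = u t + u (- t) - 2 * u 0 - t ^+ 2 * ddu 0 by rewrite /p !mulr1 expr1n mulr1.
have p0 : p 0 = 0 by rewrite /p !mulr0 expr0n /=; ring.
have q0 : q (c * 0) = 0 by rewrite /q !mulr0; ring.
move: E'; rewrite q0 mulr1 !subr0 -p1 => E'; move: E; rewrite p0 subr0 => ->.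
rewrite E' normrM (ger0_norm c0) /q' normrM (ger0_norm (sqr_ge0 t)).
have cc : 0 <= c * c' <= 1 by rewrite mulr_ge0// mulr_ile1.
case/andP: cc => cc0 cc1.
have h1 : `|ddu (t * (c * c')) - ddu 0| <= w.
  by apply: hw; rewrite normrM (ger0_norm cc0) ler_piMr.
have h2 : `|ddu (- t * (c * c')) - ddu 0| <= w.
  by apply: hw; rewrite normrM (ger0_norm cc0) normrN ler_piMr.
apply: le_trans (_ : 1 * (t ^+ 2 * (w + w)) <= _); last by rewrite mul1r; lra.
apply: ler_pM => //; first by rewrite mulr_ge0 ?sqr_ge0.
apply: ler_wpM2l; first exact: sqr_ge0.
by rewrite (le_trans (ler_normD _ _))// lerD.
Qed.

(** * Horizontal derivatives *)

Section invariant_fields.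
Context {R : realType} {N : nat} (op : 'rV[R]_N -> 'rV[R]_N -> 'rV[R]_N).
Hypothesis hop : is_exp_lie_group op.
Local Notation pt := 'rV[R]_N.
Local Notation e_ i := (delta_mx 0 i : pt).
Implicit Types (x y z v a : pt) (f : pt -> R) (B e : R).
Local Notation X := (lie_derive op).

Lemma is_derive_flow_comp f x v (t : R) : is_C1 f ->
  is_derive t 1 (fun s : R => f (op x (s *: v)))
    (\sum_i lfield op (op x (t *: v)) v 0 i * 'D_(e_ i) f (op x (t *: v))).
Proof. by move=> f1; exact: (C1_comp f1 (is_derive_flow hop x v t)). Qed.

Lemma lie_deriveE f x v : is_C1 f -> X v f x = \sum_i lfield op x v 0 i * 'D_(e_ i) f x.
Proof.
move=> f1; rewrite /lie_derive derive1E.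
have [_ ->] := is_derive_flow_comp x v 0 f1.
by rewrite scale0r (opx0 hop).
Qed.

Lemma is_derive_lie f x v (t : R) : is_C1 f ->
  is_derive t 1 (fun s : R => f (op x (s *: v))) (X v f (op x (t *: v))).
Proof. by move=> f1; rewrite lie_deriveE//; exact: is_derive_flow_comp. Qed.

Lemma lie_derive_C1 f v : is_Ck 2 f -> is_C1 (X v f).
Proof.
move=> f2; have f1 := is_Ck_C1 f2.
rewrite (_ : X v f = fun x => \sum_i lfield op x v 0 i * 'D_(e_ i) f x).
  apply: C1_sum => i; apply: C1M; first exact: lfield_C1.
  by apply: (@is_Ck_C1 _ _ _ 0); have [_ /(_ (e_ i))[]] := f2.
by apply/funext => x; exact: lie_deriveE.
Qed.

Lemma lie_derive_continuous f v : is_C1 f -> continuous (X v f).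
Proof.
move=> f1; rewrite (_ : X v f = fun x => \sum_i lfield op x v 0 i * 'D_(e_ i) f x).
  apply: cts_sum => i _; apply: ctsM; first exact: C1_continuous (lfield_C1 hop v i).
  by have [] := f1 (e_ i).
by apply/funext => x; exact: lie_deriveE.
Qed.

Lemma lie_derive_near0 f v x : (\forall y \near x, f y = 0) -> X v f x = 0.
Proof.
move=> fx0; rewrite /lie_derive derive1E.
have -> : 'D_1 (fun t : R => f (op x (t *: v))) 0 = 'D_1 (fun=> 0 : R) (0 : R).
  apply: near_eq_derive.
  have : (fun t : R => op x (t *: v)) @ (0 : R) --> x.
    rewrite -[X in _ --> X](opx0 hop); apply: (cvg_op hop); first exact: cvg_cst.
    rewrite -[X in _ --> X](scale0r v).
    by apply: cvgZ; [exact: cvg_id|exact: cvg_cst].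
  by move/(_ _ fx0).
by rewrite derive_cst.
Qed.

Definition bsupp B f := forall x, B < `|x| -> f x = 0.

Lemma bsupp_lie_derive B f v : bsupp B f -> bsupp B (X v f).
Proof.
move=> fB x Bx; apply: lie_derive_near0; apply/nbhs_ballP.
exists (`|x| - B) => [|y]; first by rewrite /= subr_gt0.
rewrite -ball_normE /ball_ /= => xy; apply: fB.
have := ler_normB x y; have := ler_normD (x - y) y; rewrite subrK; lra.
Qed.

Lemma op_bounded B B' : exists2 C : R, 0 < C &
  forall x y, `|x| <= B -> `|y| <= B' -> `|op x y| <= C.
Proof.
have cK : compact ([set x : pt | `|x| <= B] `*` [set x : pt | `|x| <= B']).
  by apply: compact_setX; exact: (@compact_ball R N).
have [|C C0 CP] := @compact_bounded_norm R pt ((fun p : pt * pt => op p.1 p.2) @`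
    ([set x : pt | `|x| <= B] `*` [set x : pt | `|x| <= B'])).
  by apply: continuous_compact => //; apply: continuous_subspaceT; exact: op_continuous.
by exists C => // x y xB yB; apply: CP; exists (x, y).
Qed.

Lemma op_near_id B e : 0 < e -> exists2 d : R, 0 < d & forall x a, `|x| <= B -> `|a| <= d ->
  `|x - op x a| <= e /\ `|x - op a x| <= e.
Proof.
move=> e0.
have cK (P Q : set pt) : compact P -> compact Q -> compact (P `*` Q) by exact: compact_setX.
have c0 : compact [set (0 : pt)] by exact: compact_set1.
have [d1 d10 h1] := unif_cts_compact (@op_continuous _ _ _ hop) (cK _ _ (@compact_ball R N B) c0) e0.
have [d2 d20 h2] := unif_cts_compact (@op_continuous _ _ _ hop) (cK _ _ c0 (@compact_ball R N B)) e0.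
exists (Num.min d1 d2) => [|x a xB]; first by rewrite lt_min d10.
rewrite le_min => /andP[a1 a2]; split.
  have := h1 (x, 0) (x, a); rewrite /= (opx0 hop); apply => //.
  suff : Num.max `|x - x| `|0 - a| <= d1 by [].
  by rewrite subrr normr0 sub0r normrN ge_max a1 ltW.
have := h2 (0, x) (a, x); rewrite /= (op0x hop); apply => //.
suff : Num.max `|0 - a| `|x - x| <= d2 by [].
by rewrite subrr normr0 sub0r normrN ge_max a2 ltW.
Qed.

Lemma bsupp_op B B' : exists2 C : R, 0 < C & forall f, bsupp B f -> forall a, `|a| <= B' ->
  bsupp C (fun x => f (op x a)) /\ bsupp C (fun x => f (op a x)).
Proof.
have [C C0 CP] := op_bounded B B'; have [D D0 DP] := op_bounded B' B.
exists (Num.max C D) => [|f fB a aB]; first by rewrite lt_max C0.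
split=> x; rewrite gt_max => /andP[xC xD]; apply: fB; rewrite ltNge; apply/negP => h.
  by have := CP _ (- a) h; rewrite normrN (opxK hop) => /(_ aB); rewrite leNgt xC.
by have := DP (- a) _ _ h; rewrite normrN (opKx hop) => /(_ aB); rewrite leNgt xD.
Qed.

Lemma unif_translate B f e : continuous f -> bsupp B f -> 0 < e ->
  exists2 d : R, 0 < d & forall x a, `|a| <= d ->
    `|f x - f (op x a)| <= e /\ `|f x - f (op a x)| <= e.
Proof.
move=> cf fB e0; have [C C0 CP] := bsupp_op B 1.
have [d d0 dP] := unif_cts_compact cf (@compact_ball R N (Num.max B C)) e0.
have [d' d'0 dP'] := op_near_id (Num.max B C) d0.
exists (Num.min d' 1) => [|x a]; first by rewrite lt_min d'0 ltr01.
rewrite le_min => /andP[ad a1]; have [xB|] := leP `|x| (Num.max B C).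
  have [h1 h2] := dP' x a xB ad.
  by split; apply: dP.
rewrite gt_max => /andP[Bx Cx]; have [h1 h2] := CP f fB a a1.
by rewrite h1// h2// fB// subrr normr0 ltW.
Qed.

Lemma taylor2 B f v e : is_Ck 2 f -> bsupp B f -> 0 < e ->
  exists2 d : R, 0 < d & forall x (t : R), `|t| <= d ->
    `|f (op x (t *: v)) + f (op x (- t *: v)) - 2 * f x - t ^+ 2 * X v (X v f) x| <= e * t ^+ 2.
Proof.
move=> f2 fB e0; have f1 := is_Ck_C1 f2; have Xf1 := lie_derive_C1 v f2.
have e2 : 0 < e / 2 by rewrite divr_gt0.
have XXB : bsupp B (X v (X v f)) by do 2 apply: bsupp_lie_derive.
have [d d0 dP] := unif_translate (lie_derive_continuous (v := v) Xf1) XXB e2.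
exists (d / (`|v| + 1)) => [|x t td]; first by rewrite divr_gt0// ltr_wpDl.
have sd (s : R) : `|s| <= `|t| -> `|X v (X v f) (op x (s *: v)) - X v (X v f) (op x (0 *: v))| <= e / 2.
  move=> st; have sv : `|s *: v| <= d.
    rewrite normrZ; apply: le_trans (_ : `|t| * (`|v| + 1) <= _).
      by apply: ler_pM => //; rewrite lerDl.
    by rewrite -ler_pdivlMr// ltr_wpDl.
  by have [h _] := dP x _ sv; rewrite scale0r (opx0 hop) distrC.
have := second_difference (fun s => is_derive_lie x v s f1) (fun s => is_derive_lie x v s Xf1) sd.
by rewrite scale0r (opx0 hop) (_ : 2 * (e / 2) = e)//; field.
Qed.

End invariant_fields.

(** * Binomial small-ball estimates *)

Section central_binomial.
Context {R : realType}.

(** The law of the sum of [n.*2] fair bits. *)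
Definition bprob n k : R := 'C(n.*2, k)%:R / 4 ^+ n.

Lemma bin_le_central n k : ('C(n.*2, k) <= 'C(n.*2, n))%N.
Proof.
have incr i : (i < n)%N -> ('C(n.*2, i) <= 'C(n.*2, i.+1))%N.
  move=> i_n; rewrite -(leq_pmul2l (ltn0Sn i)) mul_bin_left leq_mul2r; apply/orP; right.
  by rewrite -addnn; lia.
have le j : (j <= n)%N -> ('C(n.*2, n - j) <= 'C(n.*2, n))%N.
  elim: j => [|j IH] jn; first by rewrite subn0.
  apply: leq_trans (IH (ltnW jn)); have -> : (n - j = (n - j.+1).+1)%N by lia.
  by apply: incr; lia.
have [kn|nk] := leqP k n; first by rewrite -(subKn kn) le// leq_subr.
have [k2|k2] := leqP k n.*2; last by rewrite bin_small.
rewrite -bin_sub// (_ : n.*2 - k = n - (k - n))%N; first by apply: le; lia.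
by rewrite -addnn; lia.
Qed.

(** Consecutive central terms have ratio [(2n + 1) / (2n + 2)], and
    [(2n + 1) (2n + 3) <= (2n + 2) ^ 2]. *)
Lemma central_binomial_sqr n : (bprob n n) ^+ 2 * n.*2.+1%:R <= 1.
Proof.
elim: n => [|n IH]; first by rewrite /bprob bin0 expr0 divr1 expr1n mul1r.
have E : bprob n.+1 n.+1 = bprob n n * (n.*2.+1%:R / n.*2.+2%:R).
  have E1 : (n.+1 * 'C(n.+1.*2, n.+1) = 2 * n.*2.+1 * 'C(n.*2, n))%N.
    have h := mul_bin_diag n.*2.+1 n; rewrite /= in h.
    have sym : 'C(n.*2.+1, n) = 'C(n.*2.+1, n.+1).
      by rewrite -[RHS]bin_sub; [congr binomial; lia|lia].
    by rewrite doubleS binS sym addnn -mul2n mulnCA -h mulnA.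
  rewrite /bprob exprS; have /(congr1 (fun i => i%:R : R)) := E1; rewrite !natrM => E2.
  have n0 : (n.+1%:R : R) != 0 by [].
  have -> : ('C(n.+1.*2, n.+1)%:R : R) = 2 * n.*2.+1%:R * 'C(n.*2, n)%:R / n.+1%:R.
    by rewrite -E2 mulrAC divff ?mul1r.
  have -> : (n.*2.+2%:R : R) = 2 * n.+1%:R by rewrite -natrM mul2n.
  have p0 : (4 : R) ^+ n != 0 by rewrite expf_neq0.
  move: ((4 : R) ^+ n) p0 (n.+1%:R : R) n0 => p p0 c c0.
  by field; rewrite c0 p0.
rewrite E exprMn -mulrA; apply: le_trans IH; apply: ler_wpM2l; first exact: sqr_ge0.
have -> : (n.+1.*2.+1%:R : R) = n.*2.+1%:R + 2 by rewrite doubleS -addn2 natrD.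
have -> : (n.*2.+2%:R : R) = n.*2.+1%:R + 1 by rewrite natr1.
move: (n.*2.+1%:R : R) (ltr0Sn R n.*2) => a a0.
have a1 : 0 < a + 1 by lra.
rewrite expr_div_n mulrAC ler_pdivrMr ?exprn_gt0//; nra.
Qed.

Lemma bprob_ge0 n k : 0 <= bprob n k. Proof. by rewrite divr_ge0. Qed.

Lemma bprob_mul_le n i j : bprob n i * bprob n j <= n.*2.+1%:R^-1.
Proof.
have le k : bprob n k <= bprob n n by rewrite ler_pM2r ?invr_gt0 ?exprn_gt0// ler_nat bin_le_central.
apply: le_trans (ler_pM (bprob_ge0 _ _) (bprob_ge0 _ _) (le i) (le j)) _.
by rewrite -[leRHS]mul1r ler_pdivlMr// -expr2 central_binomial_sqr.
Qed.

(** The case distinction is needed because subtraction on [nat] is truncated: the probability of a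
    negative index is 0. *)
Definition bprob_sub n i a : R := if (a <= i)%N then bprob n (i - a) else 0.

Lemma bprobS n i :
  bprob n.+1 i = 4^-1 * (bprob_sub n i 0 + 2 * bprob_sub n i 1 + bprob_sub n i 2).
Proof.
have E (a b c : R) : 4^-1 * (a / 4 ^+ n + 2 * (b / 4 ^+ n) + c / 4 ^+ n) = (a + 2 * b + c) / 4 ^+ n.+1.
  by rewrite exprS invfM; ring.
rewrite /bprob_sub /bprob doubleS /= subn0.
case: i => [|[|i]].
- by rewrite !bin0 !mulr0 !addr0 exprS invfM; ring.
- rewrite /= !bin1 subnn bin0 -[X in _ * (_ + X)](mul0r (4 ^+ n)^-1) E addr0 mulr1 -natrD.
  by congr (_%:R / _); lia.
- rewrite /= E subn1 subn2 /= -natrM -!natrD; congr (_%:R / _).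
  by rewrite !binS; lia.
Qed.

End central_binomial.

Section two_binomials.
Context {R : realType} (m' : nat).
Local Notation m := m'.+2.
Local Notation Q := (bool * bool)%type.
Local Notation S := (m.-tuple Q).

(** A step in one direction is coded by two fair bits, with sum 0, 1 or 2 and weights 1/4, 1/2, 1/4.
    The number of bits after [n] steps is then exactly binomial. *)
Definition nbits (q : Q) : nat := q.1 + q.2.
Definition nsum (c : nat) (w : seq S) : nat := \sum_(l <- w) nbits (nth (true, true) l c).

Let sumQ (g : nat -> R) : \sum_(q : Q) g (nbits q) = g 0%N + 2 * g 1%N + g 2%N.
Proof.
rewrite -(pair_bigA _ (fun a b : bool => g (nbits (a, b))))/= !big_bool/= /nbits/=.
by rewrite addn0 add0n addn0; ring.
Qed.

Let avg_letter (g : nat -> nat -> R) :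
  (#|{: S}|%:R : R)^-1 * \sum_(l : S) g (nbits (nth (true, true) l 0)) (nbits (nth (true, true) l 1)) =
  4^-1 * \sum_(q : Q) (4^-1 * \sum_(q' : Q) g (nbits q) (nbits q')).
Proof.
have Q4 : #|{: Q}| = 4%N by rewrite card_prod card_bool.
have Q0 : (0 < #|{: Q}|)%N by rewrite Q4.
rewrite card_tuple natrX -exprVn.
transitivity (wavg m (fun l : seq Q => g (nbits (nth (true, true) l 0)) (nbits (nth (true, true) l 1))) : R).
  by rewrite /wavg exprVn.
rewrite wavgS// Q4; congr (_ * _); apply: eq_bigr => q _.
rewrite wavgS// Q4; congr (_ * _); apply: eq_bigr => q' _ /=.
by rewrite wavg_cst.
Qed.

(** The bits in the first two slots of the letters are independent, so the joint law is a product of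
    two binomial laws. *)
Lemma wavg_nsum n i j :
  wavg n (fun w : seq S => ((nsum 0 w == i) && (nsum 1 w == j))%:R : R) = bprob n i * bprob n j.
Proof.
have S0 : (0 < #|{: S}|)%N by rewrite card_tuple expn_gt0 card_prod card_bool.
elim: n i j => [|n IH] i j.
  rewrite wavg0 /nsum !big_nil /bprob expr0 !divr1 !bin0n -natrM -mulnb.
  by rewrite ![0%N == _]eq_sym.
rewrite wavgS//.
pose G a b := bprob_sub n i a * bprob_sub n j b : R.
transitivity ((#|{: S}|%:R : R)^-1 * \sum_(l : S) G (nbits (nth (true, true) l 0)) (nbits (nth (true, true) l 1))).
  congr (_ * _); apply: eq_bigr => l _; rewrite /G /bprob_sub.
  have E a b k : (a + b == k)%N = (a <= k)%N && (b == k - a)%N by lia.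
  rewrite (eq_wavg (F' := fun w => ((nbits (nth (true, true) l 0) <= i)%N && (nbits (nth (true, true) l 1) <= j)%N)%:R *
      ((nsum 0 w == i - nbits (nth (true, true) l 0))%N && (nsum 1 w == j - nbits (nth (true, true) l 1))%N)%:R)); last first.
    by move=> w _; rewrite /nsum !big_cons !E andbACA -natrM mulnb.
  rewrite wavgZ// IH.
  by do 2 case: ifP => _; rewrite ?mul1r ?mul0r ?mulr0.
rewrite avg_letter /G.
under eq_bigr => q _ do rewrite -mulr_sumr (sumQ (bprob_sub n j)) mulrCA -bprobS.
by rewrite -mulr_suml (sumQ (bprob_sub n i)) mulrA -bprobS.
Qed.

Lemma count_progression (a e L : R) M : 0 < e -> 0 <= L ->
  \sum_(i < M) ((`|a + e * i%:R| <= L)%R)%:R <= 2 * L / e + 1 :> R.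
Proof.
move=> e0 L0; set P := fun i : nat => `|a + e * i%:R| <= L.
have LE : 0 <= 2 * L / e by rewrite divr_ge0 ?mulr_ge0// ltW.
rewrite -(big_mkord xpredT (fun i => (P i)%:R : R)).
have -> : \sum_(0 <= i < M) (P i)%:R = (size [seq i <- iota 0 M | P i])%:R :> R.
  rewrite -natr_sum; congr (_%:R); rewrite size_filter -sum1_count [RHS]big_mkcond /=.
  by rewrite /index_iota subn0; apply: eq_bigr => i _; case: (P i).
case E : [seq i <- iota 0 M | P i] => [|i0 l]; first by rewrite addr_ge0.
rewrite -E; set T := Num.truncn (2 * L / e).
apply: le_trans (_ : T.+1%:R <= _); last first.
  by rewrite -natr1 lerD2r; have /andP[] := truncn_itv LE.
rewrite ler_nat -(size_iota i0 T.+1); apply: uniq_leq_size.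
  by rewrite filter_uniq// iota_uniq.
have Pi0 : P i0 by have : i0 \in [seq i <- iota 0 M | P i]; [rewrite E mem_head|rewrite mem_filter => /andP[]].
move=> i; rewrite mem_filter mem_iota => /andP[Pi /andP[_ iM]]; rewrite mem_iota.
have i0i : (i0 <= i)%N.
  have : sorted leq [seq i <- iota 0 M | P i].
    by apply: sorted_filter; [exact: leq_trans|exact: iota_sorted].
  rewrite E /= (path_sortedE leq_trans) => /andP[/allP h _].
  have : i \in i0 :: l by rewrite -E mem_filter Pi mem_iota iM.
  by rewrite inE => /predU1P[->//|/h].
rewrite i0i/= addnS ltnS -leq_subLR.
have : (i - i0)%:R <= 2 * L / e :> R.
  rewrite ler_pdivlMr// natrB//; move: Pi Pi0; rewrite /P !ler_norml => /andP[h1 h2] /andP[h3 h4].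
  by nra.
by rewrite -truncn_ge_nat.
Qed.

(** At most [(2 * L / e + 1) ^+ 2] lattice points lie in the window, each with probability at most
    [1 / (2n + 1)]. *)
Lemma two_binomials_small_ball n (a0 a1 e L : R) : 0 < e -> 0 <= L ->
  wavg n (fun w : seq S => ((`|a0 + e * (nsum 0 w)%:R| <= L) && (`|a1 + e * (nsum 1 w)%:R| <= L))%:R : R)
  <= (2 * L / e + 1) ^+ 2 / n.*2.+1%:R.
Proof.
move=> e0 L0.
have S0 : (0 < #|{: S}|)%N by rewrite card_tuple expn_gt0 card_prod card_bool.
set P0 := fun i : nat => `|a0 + e * i%:R| <= L; set P1 := fun i : nat => `|a1 + e * i%:R| <= L.
have nsum_le c w : (nsum c w < ((size w).*2).+1)%N.
  rewrite ltnS /nsum; elim: w => [|l w IH]; first by rewrite big_nil.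
  have -> : (size (l :: w)).*2 = (2 + (size w).*2)%N by rewrite /= doubleS.
  rewrite big_cons; apply: leq_add => //.
  by rewrite /nbits; case: (nth _ _ _) => [[] []].
have -> : wavg n (fun w : seq S => (P0 (nsum 0 w) && P1 (nsum 1 w))%:R : R) =
    wavg n (fun w : seq S => \sum_(i < n.*2.+1) \sum_(j < n.*2.+1)
      (P0 i)%:R * (P1 j)%:R * ((nsum 0 w == i) && (nsum 1 w == j))%:R).
  apply: eq_wavg => w sw; have h c : (nsum c w < n.*2.+1)%N by rewrite -sw.
  rewrite (bigD1 (Ordinal (h 0%N)))//= (bigD1 (Ordinal (h 1%N)))//= !eqxx mulr1.
  rewrite big1 ?big1 ?addr0 -?natrM ?mulnb//.
    move=> i ii; apply: big1 => j _; rewrite (_ : nsum 0 w == i = false) ?mulr0//.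
    by apply: contra_neqF ii => /eqP E; exact/val_inj.
  move=> j jj; rewrite (_ : nsum 1 w == j = false) ?andbF ?mulr0//.
  by apply: contra_neqF jj => /eqP E; exact/val_inj.
rewrite wavg_sum//; under eq_bigr => i _ do (rewrite wavg_sum//; under eq_bigr => j _ do rewrite wavgZ// wavg_nsum).
apply: le_trans (_ : \sum_(i < n.*2.+1) \sum_(j < n.*2.+1) (P0 i)%:R * (P1 j)%:R * n.*2.+1%:R^-1 <= _).
  by apply: ler_sum => i _; apply: ler_sum => j _; rewrite ler_wpM2l ?mulr_ge0// bprob_mul_le.
under eq_bigr => i _ do rewrite -mulr_suml -mulr_sumr.
rewrite -mulr_suml ler_pM2r ?invr_gt0// -mulr_suml expr2.
have c0 := count_progression a0 n.*2.+1 e0 L0; have c1 := count_progression a1 n.*2.+1 e0 L0.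
by apply: ler_pM => //; apply: sumr_ge0.
Qed.

End two_binomials.

(** * Selection of good scales *)

Section good_scale.
Context {R : realType}.
Local Notation dec k l := (2^-1 ^+ ((k - l) + (l - k)) : R).

Lemma sum_dist_le k M : \sum_(K < M) dec k K <= 4.
Proof.
suff h : \sum_(K < M) dec k K <= 2 * 2^-1 ^+ (k.+1 - M) + 1 - 2^-1 ^+ (M - k.+1).
  apply: le_trans h _; have : (2^-1 : R) ^+ (k.+1 - M) <= 1 by apply: exprn_ile1; lra.
  have : 0 <= (2^-1 : R) ^+ (M - k.+1) by rewrite exprn_ge0.
  by lra.
elim: M => [|M IH].
  rewrite big_ord0 sub0n expr0; have : 0 <= (2^-1 : R) ^+ (k.+1 - 0) by rewrite exprn_ge0.
  by lra.
rewrite big_ord_recr/=; have [Mk|kM] := leqP M k.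
  move: IH; have -> : (M - k.+1 = 0)%N by lia.
  have -> : (M.+1 - k.+1 = 0)%N by lia.
  have -> : (M - k = 0)%N by lia.
  rewrite subSS addn0 subSn// exprS expr0; lra.
move: IH; have -> : (k.+1 - M = 0)%N by lia.
have -> : (k.+1 - M.+1 = 0)%N by lia.
have -> : (k - M = 0)%N by lia.
have -> : (M - k = (M - k.+1).+1)%N by lia.
have -> : (M.+1 - k.+1 = (M - k.+1).+1)%N by lia.
by rewrite add0n exprS expr0; lra.
Qed.

(** Otherwise all the scales from [K0] to [K0.*2] are bad. Summing over these [K0.+1] scales and
    exchanging the sums by [sum_dist_le] gives [16 C (K0 + 1) <= 4 C (4 K0 + 3)], which is
    absurd. *)
Lemma good_scale (D : nat -> R) C : (forall k, 0 <= D k) ->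
  (forall n, \sum_(k < n) D k <= C * n.+1%:R) -> 0 < C -> forall K0, exists2 K, (K0 <= K)%N &
  \sum_(k < K.*2) dec k K * D k <= 16 * C.
Proof.
move=> D0 DC C0 K0; apply: contrapT => H.
have bad K : (K0 <= K)%N -> 16 * C <= \sum_(k < K.*2) dec k K * D k.
  move=> KK; rewrite leNgt; apply/negP => h; apply: H; exists K => //; exact: ltW.
pose M := (K0 + K0.+1)%N.
have lo : 16 * C * K0.+1%:R <= \sum_(K < M) \sum_(k < M.*2) dec k K * D k.
  rewrite /M big_split_ord/= -[leLHS]add0r lerD//.
    by apply: sumr_ge0 => K _; apply: sumr_ge0 => k _; rewrite mulr_ge0// exprn_ge0.
  rewrite mulr_natr -{1}(card_ord K0.+1) -sumr_const; apply: ler_sum => K _.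
  apply: le_trans (bad (K0 + K)%N (leq_addr _ _)) _.
  have KM : ((K0 + K).*2 <= M.*2)%N by rewrite leq_double leq_add2l ltnW.
  rewrite -(subnKC KM) big_split_ord/= lerDl.
  by apply: sumr_ge0 => k _; rewrite mulr_ge0// exprn_ge0.
have hi : \sum_(K < M) \sum_(k < M.*2) dec k K * D k <= 4 * (C * M.*2.+1%:R).
  rewrite exchange_big/=; apply: le_trans (_ : \sum_(k < M.*2) 4 * D k <= _).
    by apply: ler_sum => k _; rewrite -mulr_suml ler_wpM2r// sum_dist_le.
  by rewrite -mulr_sumr ler_pM2l.
have := le_trans lo hi; apply/negP; rewrite -ltNge.
have -> : (M.*2.+1%:R : R) = 4 * K0.+1%:R - 1.
  by rewrite -natrM -[in RHS](natrB _ (n := 1))//; congr (_%:R); rewrite /M; lia.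
by rewrite mulrBr mulr1 mulrBr mulrCA mulrA -subr_gt0; nra.
Qed.

Lemma sum_blocks (g : nat -> R) J :
  \sum_(0 <= n < 4 ^ J) g n = g 0%N + \sum_(k < J) \sum_(4 ^ k <= n < 4 ^ k.+1) g n.
Proof.
elim: J => [|J IH]; first by rewrite big_nat1 big_ord0 addr0.
rewrite (big_cat_nat (n := 4 ^ J))//=; last by rewrite leq_exp2l.
by rewrite IH big_ord_recr/= addrA.
Qed.

Lemma telescope_le (H : nat -> R) a b : (a <= b)%N ->
  \sum_(a <= n < b) (H n.+1 - H n) = H b - H a.
Proof.
move=> ab; rewrite -(subnKC ab); elim: (b - a)%N => [|k IH]; first by rewrite addn0 big_geq// subrr.
rewrite addnS big_nat_recr ?leq_addr//= IH; ring.
Qed.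

End good_scale.

(** * Random walks and their potentials *)

Section random_walk.
Context {R : realType} {N : nat} (op : 'rV[R]_N -> 'rV[R]_N -> 'rV[R]_N).
Hypothesis hop : is_exp_lie_group op.
Local Notation pt := 'rV[R]_N.
Local Notation Q := (bool * bool)%type.
Implicit Types (x y z v a : pt) (f F : pt -> R) (e : R) (vs : seq pt).

(** The values are -1, 0 and 1. The null step allows a walk that begins with a move to be compared
    with one that begins by staying, see [stepw0]. *)
Definition xi (q : Q) : R := (nbits q)%:R - 1.

(** One letter moves along all the directions of [vs] in succession, so that one step of the walk is
    a composition of the averages [avgstep]. *)
Fixpoint stepw e vs (l : seq Q) : pt :=
  match vs, l with
  | v :: vs', q :: l' => op ((e * xi q) *: v) (stepw e vs' l')
  | _, _ => 0
  end.

Definition avgstep e v f x := 4^-1 * (f (op x (e *: v)) + 2 * f x + f (op x (- e *: v))).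

Let Q4 : #|{: Q}| = 4%N. Proof. by rewrite card_prod card_bool. Qed.
Let Q0 : (0 < #|{: Q}|)%N. Proof. by rewrite Q4. Qed.

Lemma sum_xi (g : R -> R) : \sum_(q : Q) g (xi q) = g 1 + 2 * g 0 + g (- 1).
Proof.
rewrite -(pair_bigA _ (fun a b : bool => g (xi (a, b))))/= !big_bool/= /xi/nbits/=.
have -> : (1 + 1)%:R - 1 = 1 :> R by rewrite natrD; ring.
by rewrite addn0 !add0n !subrr sub0r; ring.
Qed.

Lemma avg_stepw e vs f x :
  wavg (size vs) (fun l => f (op x (stepw e vs l))) = foldr (avgstep e) f vs x.
Proof.
elim: vs x => [|v vs IH] x /=; first by rewrite wavg0 (opx0 hop).
rewrite wavgS// Q4.
under eq_bigr => q _.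
  under eq_wavg do rewrite (opA hop).
  rewrite IH; over.
rewrite (sum_xi (fun r => foldr (avgstep e) f vs (op x ((e * r) *: v)))).
by rewrite mulr1 mulr0 scale0r (opx0 hop) mulrN1.
Qed.

Lemma avgstepB e v f g x : avgstep e v (fun y => f y - g y) x = avgstep e v f x - avgstep e v g x.
Proof. by rewrite /avgstep; ring. Qed.

Lemma avgstepZ e v f c x : avgstep e v (fun y => c * f y) x = c * avgstep e v f x.
Proof. by rewrite /avgstep; ring. Qed.

Lemma avgstep_norm_le e v f (c : R) x : (forall y, `|f y| <= c) -> `|avgstep e v f x| <= c.
Proof.
move=> fc; rewrite /avgstep.
have h1 := fc (op x (e *: v)); have h2 := fc x; have h3 := fc (op x (- e *: v)).
by move: h1 h2 h3; rewrite !ler_norml => /andP[? ?] /andP[? ?] /andP[? ?]; apply/andP; split; lra.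
Qed.

Local Notation X := (lie_derive op).

Lemma avgstep_sub e v f x :
  4 / e ^+ 2 * (avgstep e v f x - f x) =
  (f (op x (e *: v)) + f (op x (- e *: v)) - 2 * f x) / e ^+ 2.
Proof. by rewrite mulrAC; congr (_ / _); rewrite /avgstep; field. Qed.

(* Telescoping: [A_v (A_vs f) - f = A_v (A_vs f - f) + (A_v f - f)]. *)
Lemma walk_taylor B f vs (eta : R) : is_Ck 2 f -> (forall v, v \in vs -> continuous (X v (X v f))) ->
  bsupp B f -> 0 < eta ->
  exists2 d : R, 0 < d & forall e, 0 < e -> e <= d -> forall x,
    `|4 / e ^+ 2 * (foldr (avgstep e) f vs x - f x) - \sum_(v <- vs) X v (X v f) x| <= eta.
Proof.
move=> f2 fX fB; elim: vs fX eta => [|v vs IH] fX eta eta0.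
  by exists 1 => // e _ _ x; rewrite big_nil/= subrr mulr0 subrr normr0 ltW.
have eta4 : 0 < eta / 4 by rewrite divr_gt0.
have [|d d0 dP] := IH _ _ eta4; first by move=> w wvs; apply: fX; rewrite inE wvs orbT.
have [d' d'0 dP'] := taylor2 hop v f2 fB eta4.
pose G x := \sum_(v <- vs) X v (X v f) x.
have cG : continuous G.
  rewrite /G; elim: (vs) (fX) => [|w ws IHw] fX'.
    by rewrite (_ : (fun x => _) = fun=> 0); [exact: cts_cst|apply/funext => x; rewrite big_nil].
  rewrite (_ : (fun x => _) = fun x => X w (X w f) x + \sum_(v <- ws) X v (X v f) x).
    apply: ctsD; first by apply: fX'; rewrite !inE eqxx orbT.
    by apply: IHw => u; rewrite !inE => /predU1P[->|h]; apply: fX'; rewrite !inE ?eqxx ?h ?orbT.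
  by apply/funext => x; rewrite big_cons.
have GB : bsupp B G.
  by move=> x xB; rewrite /G big1// => w _; apply: (bsupp_lie_derive (B := B) hop) => //; exact: (bsupp_lie_derive hop).
have [d'' d''0 dP''] := unif_translate hop cG GB eta4.
have v1 : 0 < `|v| + 1 by rewrite ltr_wpDl.
exists (Num.min d (Num.min d' (d'' / (`|v| + 1)))) => [|e e0]; first by rewrite !lt_min d0 d'0 divr_gt0.
rewrite !le_min => /andP[ed /andP[ed' ed'']] x /=.
set g := foldr (avgstep e) f vs in dP *.
have e2 : 0 < e ^+ 2 by rewrite exprn_gt0.
pose r y := 4 / e ^+ 2 * (g y - f y) - G y.
have rE : 4 / e ^+ 2 * (avgstep e v g x - f x) - \sum_(w <- v :: vs) X w (X w f) x =
  avgstep e v r x + (avgstep e v G x - G x) +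
  ((f (op x (e *: v)) + f (op x (- e *: v)) - 2 * f x) / e ^+ 2 - X v (X v f) x).
  have -> : avgstep e v r x = 4 / e ^+ 2 * (avgstep e v g x - avgstep e v f x) - avgstep e v G x.
    by rewrite /r avgstepB avgstepZ avgstepB.
  rewrite -avgstep_sub big_cons -/(G x).
  move: (4 / e ^+ 2) (avgstep e v g x) (avgstep e v f x) (avgstep e v G x) (G x) (X v (X v f) x) => c1 c2 c3 c4 c5 c6.
  by ring.
have h1 : `|avgstep e v r x| <= eta / 4 by apply: avgstep_norm_le => y; exact: dP.
have h3 : `|(f (op x (e *: v)) + f (op x (- e *: v)) - 2 * f x) / e ^+ 2 - X v (X v f) x| <= eta / 4.
  have /dP' : `|e| <= d' by rewrite gtr0_norm.
  move=> /(_ x) h.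
  move: (f (op x (e *: v)) + _ - _) (X v (X v f) x) h => a1 a2 h.
  have -> : a1 / e ^+ 2 - a2 = (a1 - e ^+ 2 * a2) / e ^+ 2.
    by rewrite mulrBl [e ^+ 2 * a2]mulrC mulfK ?gt_eqF.
  by rewrite normrM normfV (gtr0_norm e2) ler_pdivrMr.
have small a : a = e *: v \/ a = - e *: v -> `|a| <= d''.
  have : `|e *: v| <= d''.
    rewrite normrZ gtr0_norm//; apply: le_trans (_ : e * (`|v| + 1) <= _).
      by rewrite ler_pM2l// lerDl.
    by rewrite -ler_pdivlMr.
  by move=> h [->//|->]; rewrite scaleNr normrN.
have h2 : `|avgstep e v G x - G x| <= eta / 2.
  have [g1 _] := dP'' x _ (small _ (or_introl erefl)).
  have [g2 _] := dP'' x _ (small _ (or_intror erefl)).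
  move: g1 g2; rewrite /avgstep; move: (G (op x (e *: v))) (G (op x (- e *: v))) (G x) => a1 a2 a3.
  by rewrite !ler_norml => /andP[? ?] /andP[? ?]; apply/andP; split; lra.
rewrite rE; apply: le_trans (ler_normD _ _) _; apply: le_trans (lerD (ler_normD _ _) h3) _.
apply: le_trans (lerD (lerD h1 h2) (lexx _)) _.
by rewrite (_ : _ + _ = eta)//; field.
Qed.

Section walk.
Variables (e : R) (vs : seq pt).
Local Notation S := ((size vs).-tuple Q).
Local Notation q := (#|{: S}|%:R : R).
Let S0 : (0 < #|{: S}|)%N. Proof. by rewrite card_tuple expn_gt0 Q4. Qed.

Definition act x (l : S) := op x (stepw e vs l).
Definition walkn n f x : R := wavg n (fun w : seq S => f (foldl act x w)).

Lemma walkn0 f x : walkn 0 f x = f x. Proof. exact: wavg0. Qed.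

Lemma walknS n f x : walkn n.+1 f x = q^-1 * \sum_(l : S) walkn n f (act x l).
Proof. exact: wavgS. Qed.

Lemma walkn_add n n' f x : walkn (n + n') f x = walkn n (walkn n' f) x.
Proof. by rewrite /walkn wavg_cat//; under eq_wavg do (under eq_wavg do rewrite foldl_cat). Qed.

Lemma avg_act f x : q^-1 * \sum_(l : S) f (act x l) = foldr (avgstep e) f vs x.
Proof.
by rewrite -avg_stepw /wavg card_tuple natrX -exprVn.
Qed.

Lemma foldr_avgstep_sum (I : Type) (r : seq I) (c : R) (g : I -> pt -> R) (k : I -> R) x :
  foldr (avgstep e) (fun y => c * \sum_(i <- r) (g i y - k i)) vs x =
  c * \sum_(i <- r) (foldr (avgstep e) (g i) vs x - k i).
Proof.
rewrite -avg_act -mulr_sumr mulrCA; congr (_ * _).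
rewrite exchange_big/= mulr_sumr; apply: eq_bigr => i _.
rewrite -avg_act sumrB mulrBr; congr (_ - _).
by rewrite sumr_const -(mulr_natl (k i)) mulrA mulVf ?mul1r// pnatr_eq0 -lt0n.
Qed.

(** The Green potential truncated at time [M] and normalized at 0, so that only differences have to
    be estimated. The factor [e ^+ 2 / 4] is half the variance of a step in one direction. *)
Definition green M f x := - (e ^+ 2 / 4) * \sum_(0 <= n < M) (walkn n f x - walkn n f 0).

Lemma green0 M f : green M f 0 = 0.
Proof. by rewrite /green big1 ?mulr0// => n _; rewrite subrr. Qed.

Lemma greenE M f x : e != 0 ->
  4 / e ^+ 2 * (foldr (avgstep e) (green M f) vs x - green M f x) = f x - walkn M f x.
Proof.
move=> e0; rewrite /green foldr_avgstep_sum -mulrBr -sumrB mulrA.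
have -> : 4 / e ^+ 2 * - (e ^+ 2 / 4) = -1 by field.
rewrite mulN1r -sumrN.
rewrite (eq_bigr (fun n => - (walkn n.+1 f x - walkn n f x))); last first.
  move=> n _; have -> : foldr (avgstep e) [eta walkn n f] vs x = walkn n.+1 f x.
    by rewrite walknS -(avg_act (walkn n f)).
  by ring.
rewrite sumrN telescope_le// walkn0; ring.
Qed.

Lemma cts_translate f a : continuous f -> continuous (fun x => f (op x a)).
Proof.
move=> cf; apply/cts_distP => x eps eps0.
have [d d0 dP] := (cts_distP f).1 cf (op x a) eps eps0.
have ca : continuous (fun x => op x a).
  by apply/rV_continuousP => i; exact: C1_continuous (op_C1l hop a i).
have [d' d'0 dP'] := (cts_distP _).1 ca x d d0.
by exists d' => // y xy; apply: dP; exact: dP'.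
Qed.

Lemma foldl_act x w : foldl act x w = op x (foldl act 0 w).
Proof.
elim/last_ind: w => [|w l IH]; first by rewrite (opx0 hop).
by rewrite !foldl_rcons IH /act (opA hop).
Qed.

Lemma walkn_continuous n f : continuous f -> continuous (walkn n f).
Proof.
move=> cf; rewrite /walkn /wavg; apply: ctsM; first exact: cts_cst.
apply: cts_sum => w _; rewrite (_ : (fun x => _) = fun x => f (op x (foldl act 0 w))).
  exact: cts_translate.
by apply/funext => x; rewrite foldl_act.
Qed.

Lemma green_continuous M f : continuous f -> continuous (green M f).
Proof.
move=> cf; rewrite /green; apply: ctsM; first exact: cts_cst.
by apply: cts_sum => n _; apply: ctsB; [exact: walkn_continuous|exact: cts_cst].
Qed.

(* Conjugation turns a right translation by [r] into a left one by [Ad x r]. *)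
Lemma green_left M f x r (c : R) : (forall y, `|f (op (Ad op x r) y) - f y| <= c) ->
  `|green M f (op x r) - green M f x| <= e ^+ 2 / 4 * M%:R * c.
Proof.
move=> fc; have e4 : 0 <= e ^+ 2 / 4 by rewrite divr_ge0 ?sqr_ge0.
rewrite /green -mulrBr -sumrB normrM normrN (ger0_norm e4) -mulrA; apply: ler_wpM2l => //.
apply: le_trans (ler_norm_sum _ _ _) _.
rewrite mulr_natl -[X in _ *+ X]subn0 -sumr_const_nat.
apply: ler_sum => n _; rewrite opprB addrA subrK /walkn -wavgB//.
apply: le_trans (ler_norm_wavg S0 _ _) _.
rewrite -[leRHS](wavg_cst S0 n); apply: wavg_le => // w _.
by rewrite foldl_act [op x r](Ad_comm hop) -(opA hop) -foldl_act.
Qed.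

Lemma stepw0 : exists l : S, stepw e vs l = 0.
Proof.
suff [l /eqP sl E] : exists2 l, size l = size vs & stepw e vs l = 0 by exists (Tuple sl).
elim: vs => [|v ws [l sl E]]; first by exists [::].
exists ((true, false) :: l) => /=; first by rewrite sl.
by rewrite E /xi /nbits/= subrr mulr0 scale0r (opx0 hop).
Qed.

Lemma stepw_sign v (b : bool) : v \in vs ->
  exists l : S, stepw e vs l = (if b then e else - e) *: v.
Proof.
move=> vvs; suff [l /eqP sl E] : exists2 l, size l = size vs & stepw e vs l = (if b then e else - e) *: v.
  by exists (Tuple sl).
have h0 ws : exists2 l, size l = size ws & stepw e ws l = 0.
  elim: ws => [|w ws [l sl E]]; first by exists [::].
  exists ((true, false) :: l) => /=; first by rewrite sl.
  by rewrite E /xi /nbits/= subrr mulr0 scale0r (opx0 hop).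
elim: vs vvs => // w ws IH; rewrite inE => /predU1P[->|/IH[l sl E]].
  have [l sl E] := h0 ws; exists ((b, b) :: l) => /=; first by rewrite sl.
  rewrite E (opx0 hop); congr (_ *: _); rewrite /xi /nbits/=.
  by case: (b); rewrite /= ?addn0 ?sub0r ?mulrN1// natrD addrK mulr1.
exists ((true, false) :: l) => /=; first by rewrite sl.
by rewrite E /xi /nbits/= subrr mulr0 scale0r (op0x hop).
Qed.

Section entropy_gradient.
Context (s : nat) (V : nat -> {vspace pt}).
Hypothesis hV : is_stratification op s V.
Local Notation sgn := (signature (S := S) s).
Local Notation H := (@wentropy R S _ sgn).

(* The endpoint of a walk depends only on its signature. *)
Lemma entropy_gradient n f c (lam : R) l l' x : 0 < lam -> (forall y, `|f y| <= c) ->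
  `|walkn n f (act x l) - walkn n f (act x l')| <= c * (q * (H n.+1 - H n) / lam + 4 * lam).
Proof.
move=> lam0 fc.
(* [xget] chooses a word for each signature; the default [[::]] is for signatures that no word
   has. *)
pose phi t := f (foldl act x (xget [::] [set w : seq S | sgn w = t])).
have phiE w : phi (sgn w) = f (foldl act x w).
  rewrite /phi; congr f.
  apply: (@signature_act S pt act _ s id) => [I sI y|].
    exact: (@rdiff_id_eq0 _ _ _ hop _ _ hV S (fun l => stepw e vs l) I sI y).
  exact: (@xgetPex _ [::] [set w0 : seq S | sgn w0 = sgn w] (ex_intro _ w erefl)).
have E l0 : walkn n f (act x l0) = wavg n (fun u => phi (sgn (l0 :: u))).
  by apply: eq_wavg => w _; rewrite phiE.
rewrite !E; apply: entropy_letter_bound => //.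
  by move=> s0 u w; exact: signature_cons.
by move=> t; exact: fc.
Qed.

End entropy_gradient.

End walk.

End random_walk.

(** * Horizontal increments of the potential summed over time *)

Section gradient.
Context {R : realType} {N : nat} (op : 'rV[R]_N -> 'rV[R]_N -> 'rV[R]_N).
Hypothesis hop : is_exp_lie_group op.
Local Notation pt := 'rV[R]_N.
Local Notation Q := (bool * bool)%type.
Implicit Types (x y z v a : pt) (f F : pt -> R) (e : R).
Context (s : nat) (V : nat -> {vspace pt}).
Hypothesis hV : is_stratification op s V.
Variables (v0 v1 : pt) (ws : seq pt).
Local Notation vs := (v0 :: v1 :: ws).
Local Notation S := ((size vs).-tuple Q).
Local Notation q := (#|{: S}|%:R : R).
Local Notation sgn := (signature (S := S) s).
Local Notation H := (@wentropy R S _ sgn).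
(** Two characters of the group that read off the first two directions; along the walk each of them
    is a sum of independent steps. *)
Variables (ell : 'I_2 -> pt -> R).
Hypothesis ell_op : forall c x y, ell c (op x y) = ell c x + ell c y.
Hypothesis ellZ : forall c (a : R) x, ell c (a *: x) = a * ell c x.
Hypothesis ell_vs : forall c i, (i < size vs)%N -> ell c (nth 0 vs i) = (i == c)%:R.

Let S0 : (0 < #|{: S}|)%N.
Proof. by rewrite card_tuple expn_gt0 card_prod card_bool. Qed.

Let ell0 c : ell c 0 = 0.
Proof. by rewrite -(scale0r (0 : pt)) ellZ mul0r. Qed.

Lemma ell_stepw c e us l : size l = size us -> ell c (stepw op e us l) =
  \sum_(i < size us) (e * xi (nth (true, true) l i)) * ell c (nth 0 us i).
Proof.
elim: us l => [|u us IH] [|b l] //=; first by rewrite big_ord0.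
by move=> [sl]; rewrite ell_op ellZ IH// big_ord_recl.
Qed.

Lemma ell_walk c e x (w : seq S) :
  ell c (foldl (act op e (vs := vs)) x w) = ell c x + e * ((nsum c w)%:R - (size w)%:R).
Proof.
elim: w x => [|l w IH] x /=; first by rewrite /nsum big_nil subrr mulr0 addr0.
rewrite IH /act ell_op ell_stepw ?size_tuple// /nsum big_cons.
have cs : (c < size vs)%N by case: (c) => -[|[]].
rewrite (bigD1 (Ordinal cs))//= big1 => [|i ic]; last first.
  rewrite ell_vs// (_ : (i == c :> nat) = false) ?mulr0//.
  by apply: contra_neqF ic => /eqP E; exact/val_inj.
have -> : ell c (nth 0 vs c) = 1 by rewrite ell_vs// eqxx.
by rewrite /xi natrD -natr1; ring.
Qed.

Lemma walk_decay e n f (c L : R) x : 0 < e -> 0 <= L -> (forall y, `|f y| <= c) ->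
  (forall y, f y != 0 -> forall i, `|ell i y| <= L) ->
  `|walkn op e vs n f x| <= c * ((2 * L / e + 1) ^+ 2 / n.*2.+1%:R).
Proof.
move=> e0 L0 fc fL; have c0 : 0 <= c by apply: le_trans (fc 0).
apply: le_trans (ler_norm_wavg S0 _ _) _.
pose j0 : 'I_2 := ord0; pose j1 : 'I_2 := ord_max.
pose a j := ell j x - e * n%:R.
apply: le_trans (_ : wavg n (fun w : seq S => c * ((`|a j0 + e * (nsum 0 w)%:R| <= L) && (`|a j1 + e * (nsum 1 w)%:R| <= L))%:R) <= _).
  apply: wavg_le => // w sw.
  have [->|fn0] := eqVneq (f (foldl (act op e (vs:=vs)) x w)) 0; first by rewrite normr0 mulr_ge0.
  have h0 := fL _ fn0 j0; have h1 := fL _ fn0 j1.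
  rewrite ell_walk sw in h0; rewrite ell_walk sw in h1.
  have -> : a j0 + e * (nsum 0 w)%:R = ell j0 x + e * ((nsum j0 w)%:R - n%:R) by rewrite /a; ring.
  have -> : a j1 + e * (nsum 1 w)%:R = ell j1 x + e * ((nsum j1 w)%:R - n%:R) by rewrite /a; ring.
  by rewrite h0 h1 mulr1.
rewrite wavgZ; apply: ler_wpM2l => //; exact: two_binomials_small_ball.
Qed.

Let H_incr n : 0 <= H n.+1 - H n.
Proof. by apply: wentropy_increment_ge0 => // t u w; exact: signature_cons. Qed.

Let H_mono (a b : nat) : (a <= b)%N -> H a <= H b.
Proof.
move=> ab; rewrite -subr_ge0 -(telescope_le H ab); apply: sumr_ge0 => i _; exact: H_incr.
Qed.

(** The entropy gained in a time block, enlarged downwards because some of the steps before the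
    block are set aside for the decay estimate; [D 0] starts at time 1. *)
Let D k := H (4 ^ k.+1) - H (4 ^ k.-1).

Let D_ge0 k : 0 <= D k.
Proof. by rewrite subr_ge0 H_mono// leq_exp2l//; lia. Qed.

Let D_sum : exists2 C : R, 0 < C & forall n, \sum_(k < n) D k <= C * n.+1%:R.
Proof.
have [C C0 CP] := @wentropy_signature_le S R s S0.
(* Every interval between consecutive powers of 4 is counted at most twice, so the sum telescopes up
   to two terms. *)
have tel n : \sum_(k < n) D k <= H (4 ^ n) + H (4 ^ n.-1) - 2 * H 0.
  elim: n => [|n IH]; first by rewrite big_ord0 expn0; have := H_mono (leq0n 1); lra.
  by rewrite big_ord_recr/= /D; move: IH; rewrite /=; lra.
have H4 n : H (4 ^ n) <= 4 * C * n.+1%:R.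
  apply: le_trans (CP _) _; rewrite -mulrA mulrCA; apply: ler_wpM2l; first exact: ltW.
  apply: le_trans (_ : 1 + ln (4 ^+ n.+1) <= _).
    rewrite lerD2l ler_ln ?posrE ?exprn_gt0// -natrX ler_nat expnS.
    have := expn_gt0 4 n; lia.
  rewrite lnXn// -(mulr_natr (ln 4)); have : ln 4 <= 4 - 1 :> R by exact: ln_le_subr1.
  have : 1 <= n.+1%:R :> R by rewrite ler1n.
  move: (ln 4) (n.+1%:R) => u c c1 u3; nra.
exists (8 * C + 2 * `|H 0|) => [|n]; first by rewrite ltr_pwDl ?mulr_gt0// mulr_ge0.
apply: le_trans (tel n) _.
have n1 : (n.-1.+1)%:R <= n.+1%:R :> R by rewrite ler_nat; lia.
have h1 := H4 n; have h2 := H4 n.-1.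
have h3 : 4 * C * n.-1.+1%:R <= 4 * C * n.+1%:R by rewrite ler_wpM2l// mulr_ge0// ltW.
have h4 : - H 0 <= `|H 0| by rewrite -normrN ler_norm.
have h5 : `|H 0| <= `|H 0| * n.+1%:R by rewrite ler_peMr// ler1n.
rewrite [leRHS]mulrDl; have -> : 8 * C * n.+1%:R = 4 * C * n.+1%:R + 4 * C * n.+1%:R by ring.
have -> : 2 * `|H 0| * n.+1%:R = `|H 0| * n.+1%:R + `|H 0| * n.+1%:R by ring.
move: h1 h2 h3 h4 h5.
move: (`|H 0| * n.+1%:R) (4 * C * n.+1%:R) (4 * C * n.-1.+1%:R) (`|H 0|) (H 0) (H (4 ^ n)) (H (4 ^ n.-1)).
by move=> c1 c2 c3 c4 c5 c6 c7 *; lra.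
Qed.

Section gradient_sum.
Variables (e L : R) (f : pt -> R) (x : pt) (l l' : S).
Hypothesis e_gt0 : 0 < e.
Hypothesis L_ge0 : 0 <= L.
Hypothesis f1 : forall y, `|f y| <= 1.
Hypothesis fL : forall y, f y != 0 -> forall i, `|ell i y| <= L.
Let g n := `|walkn op e vs n f (act op e x l) - walkn op e vs n f (act op e x l')|.

(** The last [n2] steps turn [f] into a function bounded by [beta]; the entropy of the other
    [n - n2] steps controls the dependence on the first letter. The free parameter of the entropy
    bound is [2 ^- k]. *)
Let block (a b n2 k : nat) (beta : R) : (n2 <= a <= b)%N ->
  (forall y, `|walkn op e vs n2 f y| <= beta) ->
  \sum_(a <= n < b) g n <=
  beta * (q * (H (b - n2) - H (a - n2)) * 2 ^+ k + 4 * 2 ^- k * (b - a)%:R).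
Proof.
move=> /andP[na ab] fb.
have p2 : (0 : R) < 2 ^- k by rewrite invr_gt0 exprn_gt0.
apply: le_trans (_ : \sum_(a <= n < b)
    (beta * (q * 2 ^+ k) * (H (n.+1 - n2) - H (n - n2)) + beta * (4 * 2 ^- k)) <= _).
  rewrite big_nat_cond [leRHS]big_nat_cond; apply: ler_sum => n /andP[/andP[an nb] _].
  have nn2 : (n2 <= n)%N := leq_trans na an.
  have E y : walkn op e vs n f y = walkn op e vs (n - n2) (walkn op e vs n2 f) y.
    by rewrite -walkn_add subnK.
  rewrite /g !E.
  apply: le_trans (@entropy_gradient R N op hop e vs s V hV (n - n2) _ _ _ l l' x p2 fb) _.
  by rewrite invrK subSn// le_eqVlt; apply/orP; left; apply/eqP; ring.
rewrite big_split/= -mulr_sumr sumr_const_nat (telescope_le (fun n => H (n - n2)))//.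
by rewrite -mulr_natr le_eqVlt; apply/orP; left; apply/eqP; ring.
Qed.

(** Blocks with [k <= K], up to the order of the diffusion time [4 ^ K = e ^- 2], use the trivial
    bound 1 on [f]. For later ones, half of the time at which the block starts is spent on the
    decay, a factor [4 ^ (K - k)]. Both cases give the same weight; the summand 2 is the term
    [n = 0]. *)
Lemma gradient_sum K P : e = 2 ^- K ->
  \sum_(0 <= n < 4 ^ (K + P)) g n <= 2 + \sum_(k < K + P)
    (2 * L + 1) ^+ 2 * (2 ^+ K * 2^-1 ^+ ((k - K) + (K - k))) * (q * D k + 12).
Proof.
move=> eK; rewrite sum_blocks; apply: lerD.
  rewrite /g !walkn0 (le_trans (ler_normB _ _))// (_ : 2 = 1 + 1)//; exact: lerD.
have L1 : 1 <= 2 * L + 1 by rewrite lerDr mulr_ge0.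
have CL : 1 <= (2 * L + 1) ^+ 2 by rewrite exprn_ege1.
suff h (k : nat) : \sum_(4 ^ k <= n < 4 ^ k.+1) g n <=
    (2 * L + 1) ^+ 2 * (2 ^+ K * 2^-1 ^+ ((k - K) + (K - k))) * (q * D k + 12).
  by apply: ler_sum => k _; exact: h.
have qD : 0 <= q * D k + 12 by rewrite addr_ge0// mulr_ge0.
have p2 i : (0 : R) < 2 ^+ i by rewrite exprn_gt0.
have E4 i : (4 : R) ^+ i = 2 ^+ i * 2 ^+ i by rewrite -exprMn; congr (_ ^+ _); ring.
have len : ((4 ^ k.+1 - 4 ^ k)%N%:R : R) = 3 * (2 ^+ k * 2 ^+ k).
  by rewrite natrB ?leq_exp2l// !natrX -E4 exprS; ring.
have [kK|Kk] := leqP k K.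
  have -> : (k - K + (K - k) = K - k)%N by lia.
  apply: le_trans (block (n2 := 0) k (beta := 1) _ _) _.
  - by apply/andP; split=> //; rewrite leq_exp2l// leqnSn.
  - by move=> y; rewrite walkn0.
  rewrite !subn0 mul1r len.
  have -> : 2 ^+ K * 2^-1 ^+ (K - k) = 2 ^+ k :> R.
    by rewrite -{1}(subnK kK) exprD mulrAC -exprMn mulfV// expr1n mul1r.
  have -> : 4 * 2 ^- k * (3 * (2 ^+ k * 2 ^+ k)) = 12 * 2 ^+ k :> R.
    by field; rewrite gt_eqF.
  apply: le_trans (_ : 1 * 2 ^+ k * (q * D k + 12) <= _); last first.
    apply: ler_wpM2r => //; apply: ler_wpM2r => //; exact: ltW.
  rewrite mul1r [leRHS]mulrDr [12 * _]mulrC lerD2r mulrC; apply: ler_wpM2l; first exact: ltW.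
  by apply: ler_wpM2l => //; rewrite /D lerD2l lerN2 H_mono// leq_exp2l//; lia.
case: k Kk qD len => // k Kk qD len.
have -> : (k.+1 - K + (K - k.+1) = k.+1 - K)%N by lia.
set beta := (2 * L / e + 1) ^+ 2 / (2 * 4 ^ k).*2.+1%:R.
have b0 : 0 <= beta by rewrite divr_ge0// sqr_ge0.
apply: le_trans (block (n2 := 2 * 4 ^ k) k.+1 (beta := beta) _ _) _.
- by rewrite leq_exp2l// expnS; lia.
- by move=> y; rewrite -[beta]mul1r; exact: walk_decay.
rewrite len.
have -> : 4 * 2 ^- k.+1 * (3 * (2 ^+ k.+1 * 2 ^+ k.+1)) = 12 * 2 ^+ k.+1 :> R.
  by field; rewrite gt_eqF.
apply: le_trans (_ : beta * 2 ^+ k.+1 * (q * D k.+1 + 12) <= _).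
  rewrite -[leRHS]mulrA; apply: ler_wpM2l => //; rewrite [leRHS]mulrDr [12 * _]mulrC lerD2r mulrC.
  apply: ler_wpM2l; first exact: ltW.
  apply: ler_wpM2l => //; rewrite /D /=; apply: lerB; apply: H_mono; first exact: leq_subr.
  by rewrite expnS; lia.
apply: ler_wpM2r => //.
(* The choice [n2 = 2 * 4 ^ k] makes the denominator at least [4 ^ k.+1]. *)
have be : beta <= (2 * L + 1) ^+ 2 * (4 ^+ K / 4 ^+ k.+1).
  have l1 : (2 * L / e + 1) <= (2 * L + 1) * 2 ^+ K.
    have K1 : 1 <= 2 ^+ K :> R by rewrite exprn_ege1//; lra.
    by rewrite eK invrK [leRHS]mulrDl mul1r lerD2l.
  have l0 : 0 <= 2 * L / e + 1 by rewrite addr_ge0// divr_ge0 ?mulr_ge0// ltW.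
  rewrite /beta mulrA E4 -expr2 -exprMn; apply: ler_pM; rewrite ?invr_ge0 ?sqr_ge0//.
    by rewrite lerXn2r ?nnegrE// (le_trans l0).
  rewrite lef_pV2 ?posrE ?exprn_gt0// -natrX ler_nat expnS -mul2n; lia.
apply: le_trans (ler_wpM2r (ltW (p2 _)) be) _; rewrite -mulrA; apply: ler_wpM2l; first exact: sqr_ge0.
have E2 : 2 ^+ k.+1 = 2 ^+ K * 2 ^+ (k.+1 - K) :> R by rewrite -exprD subnKC// ltnW.
rewrite !E4 E2 exprVn.
have := p2 K; have := p2 (k.+1 - K)%N; move: (2 ^+ K) (2 ^+ (k.+1 - K)) => a b b0' a0.
by rewrite le_eqVlt; apply/orP; left; apply/eqP; field; rewrite !gt_eqF.
Qed.

End gradient_sum.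

(** At a good scale the weighted sum of the [D k] is under control for [k < K.*2], whence the
    requirement [P <= K] on the time horizon [4 ^ (K + P)]. From [e ^+ 2 * 2 ^+ K] one power of [e]
    survives. *)
Lemma green_step L : 0 <= L -> exists2 C : R, 0 < C &
  forall P K0, exists K, [/\ (P <= K)%N, (K0 <= K)%N & forall f, (forall y, `|f y| <= 1) ->
    (forall y, f y != 0 -> forall i, `|ell i y| <= L) ->
    forall x v (b : bool), v \in vs ->
    `|green op (2 ^- K) vs (4 ^ (K + P)) f (op x ((if b then 2 ^- K else - 2 ^- K) *: v))
      - green op (2 ^- K) vs (4 ^ (K + P)) f x| <= C * 2 ^- K].
Proof.
move=> L0; have [C C0 CP] := D_sum.
exists (2 + (2 * L + 1) ^+ 2 * (q * (16 * C) + 48)) => [|P K0].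
  by rewrite ltr_pwDl// mulr_ge0 ?sqr_ge0// addr_ge0// mulr_ge0// mulr_ge0// ltW.
have [K KK DK] := good_scale D_ge0 CP C0 (maxn P K0).
exists K; split; [by lia|by lia|move=> f f1 fL x v b vvs].
set e : R := 2 ^- K.
have e0 : 0 < e by rewrite invr_gt0 exprn_gt0.
have e1 : e <= 1 by rewrite /e -exprVn exprn_ile1//; lra.
have [l lE] := stepw_sign hop e b vvs; have [l0 l0E] := stepw0 hop e vs.
rewrite /green -mulrBr -sumrB normrM normrN.
have e4 : 0 <= e ^+ 2 / 4 by rewrite divr_ge0 ?sqr_ge0.
rewrite (ger0_norm e4).
have PK : (P <= K)%N by lia.
apply: le_trans (_ : e ^+ 2 / 4 * (2 + \sum_(k < K + P)
    (2 * L + 1) ^+ 2 * (2 ^+ K * 2^-1 ^+ ((k - K) + (K - k))) * (q * D k + 12)) <= _).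
  apply: ler_wpM2l => //; apply: le_trans (ler_norm_sum _ _ _) _.
  apply: le_trans (gradient_sum x l l0 e0 L0 f1 fL (K := K) P erefl).
  rewrite le_eqVlt; apply/orP; left; apply/eqP; apply: eq_bigr => n _.
  by rewrite /act lE l0E (opx0 hop); congr `|_|; ring.
have -> : \sum_(k < K + P) (2 * L + 1) ^+ 2 * (2 ^+ K * 2^-1 ^+ (k - K + (K - k))) * (q * D k + 12) =
    (2 * L + 1) ^+ 2 * 2 ^+ K * (q * (\sum_(k < K + P) 2^-1 ^+ (k - K + (K - k)) * D k)
      + 12 * \sum_(k < K + P) 2^-1 ^+ (k - K + (K - k))).
  rewrite mulrDr !mulr_sumr -big_split/=; apply: eq_bigr => k _; ring.
have h1 : \sum_(k < K + P) 2^-1 ^+ (k - K + (K - k)) * D k <= 16 * C.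
  apply: le_trans DK; have KP : (K + P <= K.*2)%N by lia.
  rewrite -(subnKC KP) [leRHS]big_split_ord/= lerDl.
  by apply: sumr_ge0 => k _; rewrite mulr_ge0// exprn_ge0.
have h2 : \sum_(k < K + P) 2^-1 ^+ (k - K + (K - k)) <= 4 :> R.
  apply: le_trans (sum_dist_le K (K + P)); rewrite le_eqVlt; apply/orP; left; apply/eqP.
  by apply: eq_bigr => k _; rewrite addnC.
set s1 := \sum_(k < K + P) _ * D k in h1 *; set s2 := \sum_(k < K + P) _ in h2 *.
have h3 : q * s1 + 12 * s2 <= q * (16 * C) + 48.
  by apply: lerD; [apply: ler_wpM2l|lra].
have eK : e * 2 ^+ K = 1 by rewrite /e mulVf// expf_neq0.
have CL : 0 <= (2 * L + 1) ^+ 2 by exact: sqr_ge0.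
apply: le_trans (_ : e ^+ 2 / 4 * (2 + (2 * L + 1) ^+ 2 * 2 ^+ K * (q * (16 * C) + 48)) <= _).
  apply: ler_wpM2l => //; rewrite lerD2l; apply: ler_wpM2l => //.
  by rewrite mulr_ge0// exprn_ge0.
have X0 : 0 <= q * (16 * C) + 48 by rewrite addr_ge0// mulr_ge0// mulr_ge0// ltW.
have -> : e ^+ 2 / 4 * (2 + (2 * L + 1) ^+ 2 * 2 ^+ K * (q * (16 * C) + 48)) =
   e * (e / 2 + (2 * L + 1) ^+ 2 * (q * (16 * C) + 48) * (e * 2 ^+ K) / 4) by field.
rewrite eK mulr1 mulrC; apply: ler_wpM2r; first exact: ltW.
have Y0 : 0 <= (2 * L + 1) ^+ 2 * (q * (16 * C) + 48) by rewrite mulr_ge0.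
move: ((2 * L + 1) ^+ 2 * (q * (16 * C) + 48)) Y0 => Y Y0; lra.
Qed.

End gradient.

(** * Approximate solutions of the Poisson equation *)

Section green_approx.
Context {R : realType} {N : nat} (op : 'rV[R]_N -> 'rV[R]_N -> 'rV[R]_N).
Hypothesis hop : is_exp_lie_group op.
Local Notation pt := 'rV[R]_N.
Local Notation e_ i := (delta_mx 0 i : pt).
Implicit Types (x y z v a : pt) (f F h : pt -> R) (e : R).
Context (s : nat) (V : nat -> {vspace pt}).
Hypothesis hV : is_stratification op s V.
Local Notation m := (\dim (V 1%N)).
Hypothesis V1e : forall j : 'I_N, (j < m)%N -> e_ j \in V 1%N.

Definition hidx : seq 'I_N := [seq j : 'I_N <- enum 'I_N | (j < m)%N].
Definition hbasis : seq pt := [seq e_ j | j <- hidx].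

Let mN : (m <= N)%N.
Proof. by have := dimvS (subvf (V 1%N)); rewrite dimvf dim_matrix mul1r. Qed.

Let val_hidx : map val hidx = iota 0 m.
Proof.
rewrite -(filter_map val (fun i => i < m)%N) val_enum_ord.
by have := @filter_iota_ltn 0 N m mN; rewrite add0n.
Qed.

Lemma size_hbasis : size hbasis = m.
Proof. by rewrite size_map -(size_map val) val_hidx size_iota. Qed.

Lemma nth_hbasis (j : 'I_N) : (j < m)%N -> nth 0 hbasis j = e_ j.
Proof.
move=> jm; have js : (j < size hidx)%N.
  by rewrite -(size_map val) val_hidx size_iota.
rewrite (nth_map j)//; congr delta_mx; apply: val_inj.
by rewrite -(nth_map j 0%N val)// val_hidx nth_iota.
Qed.

Lemma mem_hbasis (j : 'I_N) : (j < m)%N -> e_ j \in hbasis.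
Proof. by move=> jm; rewrite -(nth_hbasis jm) mem_nth// size_hbasis. Qed.

Lemma hbasisP v : v \in hbasis -> exists2 j : 'I_N, (j < m)%N & v = e_ j.
Proof. by move=> /mapP[j]; rewrite mem_filter => /andP[jm _] ->; exists j. Qed.

(* The coordinates of the projection on the first layer are characters. *)
Definition hcoord (j : 'I_N) x : R := daddv_pi (V 1%N) (filt s V 2) x 0 j.

Let V1_filt2 : (V 1 :&: filt s V 2 = 0)%VS.
Proof.
have s0 := strat_gt0 hV; have /directv_sumP/(_ (Ordinal s0) isT) <- := strat_direct hV.
congr (_ :&: _)%VS; apply: eq_bigl => i; rewrite ltnS lt0n.
by rewrite -(inj_eq val_inj).
Qed.

Let hcoord_filt2 j x : x \in filt s V 2 -> hcoord j x = 0.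
Proof.
move=> xF; have := daddv_pi_add V1_filt2 (subvP (addvSr _ _) _ xF).
rewrite [X in _ + X]daddv_pi_id//; last by rewrite capvC.
by move=> /eqP; rewrite -subr_eq0 addrK => /eqP E; rewrite /hcoord E mxE.
Qed.

Lemma hcoordZ j (a : R) x : hcoord j (a *: x) = a * hcoord j x.
Proof. by rewrite /hcoord linearZ mxE. Qed.

Lemma hcoordD j x y : hcoord j (x + y) = hcoord j x + hcoord j y.
Proof. by rewrite /hcoord linearD mxE. Qed.

Lemma hcoord_op j x y : hcoord j (op x y) = hcoord j x + hcoord j y.
Proof.
have h := hcoord_filt2 j (op_add_filt2 hop hV x y).
have E : op x y = (op x y - x - y) + (x + y) by rewrite -[op x y - x - y]addrA -opprD subrK.
by rewrite E hcoordD h add0r hcoordD.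
Qed.

Lemma hcoord_delta j (i : 'I_N) : (i < m)%N -> hcoord j (e_ i) = (i == j)%:R.
Proof. by move=> im; rewrite /hcoord daddv_pi_id ?V1e// mxE eqxx/= eq_sym. Qed.

Lemma hcoord_bound B : exists2 L : R, 0 < L & forall j x, `|x| <= B -> `|hcoord j x| <= L.
Proof.
have [C C0 CP] : exists2 C : R, 0 < C & forall x, `|daddv_pi (V 1%N) (filt s V 2) x| <= C * `|x|.
  have [//|C C0 CP] := @linear_bounded R N pt (daddv_pi (V 1%N) (filt s V 2)).
    by move=> a u v; rewrite linearP.
  by exists C.
exists (C * `|B| + 1) => [|j x xB]; first by rewrite ltr_wpDl// mulr_ge0// ltW.
rewrite (le_trans (coord_le_norm _ _))// (le_trans (CP x))// ler_wpDr// ler_wpM2l ?(ltW C0)//.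
by rewrite (le_trans xB)// ler_norm.
Qed.

(** As many steps of size [e] as fit in [|t|] are made, at the price [C * e] each; the remainder is
    at most [e] and costs [eta]. *)
Lemma multi_step h v x (t e C Rad eta : R) : 0 < e -> 0 <= C -> 0 <= eta -> `|t| <= 1 ->
  (forall t, `|t| <= 1 -> `|op x (t *: v)| <= Rad) ->
  (forall y (b : bool), `|y| <= Rad -> `|h (op y ((if b then e else - e) *: v)) - h y| <= C * e) ->
  (forall y r, `|y| <= Rad -> `|r| <= e -> `|h (op y (r *: v)) - h y| <= eta) ->
  `|h (op x (t *: v)) - h x| <= C * `|t| + eta.
Proof.
move=> e0 C0 eta0 t1 hR hs hr.
have [sg [sg1 tE]] : exists b : bool, (forall c : R, 0 <= c -> `|(if b then c else - c)| = c) /\ t = (if b then `|t| else - `|t|).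
  have [t0|t0] := leP 0 t; [exists true|exists false].
    by split => [c|]; [exact: ger0_norm|rewrite ger0_norm].
  by split => [c c0|]; [rewrite normrN ger0_norm|rewrite ltr0_norm// opprK].
pose u (c : R) := (if sg then c else - c).
have uD c c' : u c + u c' = u (c + c') by rewrite /u; case: (sg); rewrite ?opprD.
have un c : 0 <= c -> `|u c| = c by exact: sg1.
have te0 : 0 <= `|t| / e by rewrite divr_ge0// ltW.
have step i : i%:R * e <= `|t| -> `|h (op x (u (i%:R * e) *: v)) - h x| <= C * (i%:R * e).
  elim: i => [_|i IH ie].
    by rewrite /u mul0r oppr0 if_same scale0r (opx0 hop) subrr normr0 mulr0.
  have ie' : i%:R * e <= `|t| by apply: le_trans ie; rewrite ler_pM2r// ler_nat.
  have -> : u (i.+1%:R * e) = u (i%:R * e) + u e by rewrite uD -natr1 mulrDl mul1r.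
  rewrite -(exp_op hop) (opA hop) -(subrKA (h (op x (u (i%:R * e) *: v)))).
  apply: le_trans (ler_normD _ _) _; rewrite -natr1 mulrDl mul1r mulrDr addrC; apply: lerD.
    exact: IH.
  have ie0 : 0 <= i%:R * e by rewrite mulr_ge0// ltW.
  by apply: hs; apply: hR; rewrite (un _ ie0) (le_trans ie').
pose r := Num.truncn (`|t| / e); have /andP[r1 r2] := truncn_itv te0.
have re : r%:R * e <= `|t| by rewrite -ler_pdivlMr.
have re2 : `|t| - r%:R * e <= e.
  by rewrite lerBlDr addrC -[X in _ + X]mul1r -mulrDl natr1 -ler_pdivrMr// ltW.
rewrite -(subrKA (h (op x (u (r%:R * e) *: v)))); apply: le_trans (ler_normD _ _) _.
rewrite addrC; apply: lerD.
  by apply: le_trans (step r re) _; apply: ler_wpM2l.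
have -> : t *: v = (u (r%:R * e) + u (`|t| - r%:R * e)) *: v by rewrite uD addrC subrK {1}tE.
rewrite -(exp_op hop) (opA hop); apply: hr.
  have re0 : 0 <= r%:R * e by rewrite mulr_ge0// ltW.
  by apply: hR; rewrite (un _ re0) (le_trans re).
by rewrite un// subr_ge0.
Qed.

(* An almost solution, at the scale [e], of the Poisson equation. *)
Definition almost_green F C (eta Rad : R) := exists e h, [/\ 0 < e <= eta, continuous h, h 0 = 0,
  forall x, `|x| <= Rad -> `|4 / e ^+ 2 * (foldr (avgstep op e) h hbasis x - h x) - F x| <= eta &
  forall (j : 'I_N) x t, (j < m)%N -> `|x| <= Rad -> `|t| <= 1 ->
    `|h (op x (t *: e_ j)) - h x| <= C * `|t| + eta].

Let horizontal_ball Rad : exists2 C : R, 0 < C &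
  forall x (j : 'I_N) (t : R), `|x| <= Rad -> `|t| <= 1 -> `|op x (t *: e_ j)| <= C.
Proof.
have [C C0 CP] := op_bounded hop Rad 1; exists C => // x j t xR t1; apply: CP => //.
by rewrite normrZ (le_trans (ler_piMr _ (norm_delta_le1 j))).
Qed.

Let Ad_small B (d : R) : 0 < d -> exists2 d' : R, 0 < d' &
  forall y r, `|y| <= B -> `|r| <= d' -> `|Ad op y r| <= d.
Proof.
move=> d0.
have cA : continuous (fun p : pt * pt => Ad op p.1 p.2).
  by move=> p; apply: (Ad_continuous hop); [exact: cvg_fst|exact: cvg_snd].
have cK : compact ([set y : pt | `|y| <= B] `*` [set (0 : pt)]).
  by apply: compact_setX; [exact: (@compact_ball R N)|exact: compact_set1].
have [d' d'0 dP] := unif_cts_compact cA cK d0.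
exists d' => // y r yB rd; have := dP (y, 0) (y, r).
rewrite /= (lin0 (Ad_linear hop y)) sub0r normrN; apply=> //.
suff : Num.max `|y - y| `|0 - r| <= d' by [].
by rewrite subrr normr0 sub0r normrN ge_max rd ltW.
Qed.

Lemma pow2_small (a : R) : 0 < a -> exists K0, forall K, (K0 <= K)%N -> 2 ^- K <= a.
Proof.
move=> a0; exists (Num.truncn a^-1).+1 => K KK.
rewrite -[a]invrK lef_pV2 ?posrE ?invr_gt0 ?exprn_gt0//.
have a1 : 0 <= a^-1 by rewrite invr_ge0 ltW.
have /andP[_ h] := truncn_itv a1.
apply: le_trans (ltW h) _; apply: le_trans (_ : K%:R <= _); first by rewrite ler_nat.
by rewrite -natrX ler_nat ltnW// ltn_expl.
Qed.

Lemma green_approx_ge2 B : (1 < m)%N -> exists2 C : R, 0 < C &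
  forall F, continuous F -> (forall y, `|F y| <= 1) -> bsupp B F ->
  forall eta Rad, 0 < eta -> 0 < Rad -> almost_green F C eta Rad.
Proof.
move=> m2; have [L L0 LP] := hcoord_bound B.
case E : hbasis (size_hbasis) => [|v0 [|v1 ws]] /= sz; [by rewrite -sz in m2|by rewrite -sz in m2|].
pose ell (c : 'I_2) := hcoord (widen_ord (leq_trans m2 mN) c).
have ellvs (c : 'I_2) i : (i < size (v0 :: v1 :: ws))%N -> ell c (nth 0 (v0 :: v1 :: ws) i) = (i == c)%:R.
  rewrite -E size_hbasis => im; have iN := leq_trans im mN.
  rewrite (nth_hbasis (j := Ordinal iN))// /ell hcoord_delta//; congr (_%:R).
have [C C0 CP] := green_step hop hV (fun c => hcoord_op _) (fun c => hcoordZ _) ellvs (ltW L0).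
exists C => // F cF F1 FB eta Rad eta0 Rad0.
have fL y : F y != 0 -> forall i, `|ell i y| <= L.
  move=> Fy i; apply: LP; rewrite leNgt; apply/negP => /FB Fy0; by rewrite Fy0 eqxx in Fy.
have CL : 0 < (2 * L + 1) ^+ 2 by rewrite exprn_gt0// ltr_wpDl// mulr_ge0// ltW.
(* The error in [greenE] is the walk at time [4 ^ (K + P)], of order [(2 * L + 1) ^+ 2 / 4 ^ P]; [P]
   makes it smaller than [eta]. *)
have [P PP] := pow2_small (divr_gt0 eta0 CL).
have {}PP := PP P (leqnn P).
have [Rad' Rad'0 RP] := horizontal_ball Rad.
have p4 i : (0 : R) < 4 ^+ i by rewrite exprn_gt0.
(* Increments shorter than a step are left to [green_left], whose factor [e ^+ 2 / 4 * 4 ^ (K + P)]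
   equals [4 ^ P / 4]; hence the oscillation [eta / 4 ^ P]. *)
have [d d0 dP] := unif_translate hop cF FB (divr_gt0 eta0 (p4 P)).
have [d' d'0 dP'] := Ad_small Rad' d0.
have mn0 : 0 < Num.min eta d' by rewrite lt_min eta0.
have [K0 K0P] := pow2_small mn0.
have [K [PK K0K KP]] := CP P K0.
have := K0P K K0K; rewrite le_min => /andP[e_eta e_d'].
set e : R := 2 ^- K in KP e_eta e_d' *.
have e0 : 0 < e by rewrite invr_gt0 exprn_gt0.
have E4 i : (4 : R) ^+ i = 2 ^+ i * 2 ^+ i by rewrite -exprMn; congr (_ ^+ _); ring.
have eE : e ^+ 2 = (4 ^+ K)^-1 by rewrite E4 /e expr2 invfM.
exists e, (green op e (v0 :: v1 :: ws) (4 ^ (K + P)) F); rewrite /almost_green E; split.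
- by rewrite e0.
- exact: (green_continuous hop).
- exact: green0.
- move=> x xR; rewrite (greenE hop)// ?gt_eqF// addrAC subrr sub0r normrN.
  apply: le_trans (walk_decay (fun c => hcoord_op _) (fun c => hcoordZ _) ellvs _ _ e0 (ltW L0) F1 fL) _.
  rewrite mul1r.
  have L1 : 2 * L / e + 1 <= (2 * L + 1) * 2 ^+ K.
    have K1 : 1 <= 2 ^+ K :> R by rewrite exprn_ege1//; lra.
    by rewrite /e invrK [leRHS]mulrDl mul1r lerD2l.
  have L2 : 0 <= 2 * L / e + 1 by rewrite addr_ge0// divr_ge0 ?mulr_ge0// ltW.
  have pP : 2 ^- P * 2 ^- P <= 2 ^- P :> R.
    by rewrite ler_piMl ?invr_ge0 ?exprn_ge0// -exprVn exprn_ile1//; lra.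
  apply: le_trans (_ : (2 * L + 1) ^+ 2 * 2 ^- P <= _); last first.
    by rewrite mulrC -ler_pdivlMr.
  apply: le_trans (_ : (2 * L + 1) ^+ 2 * (2 ^- P * 2 ^- P) <= _); last first.
    by apply: ler_wpM2l => //; exact: ltW.
  apply: le_trans (_ : ((2 * L + 1) * 2 ^+ K) ^+ 2 / 4 ^+ (K + P) <= _).
    apply: ler_pM; rewrite ?invr_ge0 ?sqr_ge0//.
      by rewrite lerXn2r ?nnegrE// (le_trans L2).
    by rewrite lef_pV2 ?posrE// -natrX ler_nat -addnn ltnW// ltnS leq_addr.
  rewrite E4 exprD exprMn expr2 le_eqVlt; apply/orP; left; apply/eqP.
  have p2 i : (2 : R) ^+ i != 0 by rewrite expf_neq0.
  by have := p2 K; have := p2 P; move: (2 ^+ K) (2 ^+ P) => a b b0 a0; field; rewrite a0 b0.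
- move=> j x t jm xR t1.
  apply: (multi_step (e := e) (Rad := Rad')) => //; [exact: ltW|exact: ltW| | |].
  + by move=> t' t'1; exact: RP.
  + by move=> y b _; apply: KP => //; rewrite -E mem_hbasis.
  + move=> y r yR re; apply: le_trans (@green_left _ _ _ hop _ _ _ _ _ _ (eta / 4 ^+ P) _) _.
      move=> z; rewrite distrC; have [] // := dP z (Ad op y (r *: e_ j)).
      apply: dP' => //; rewrite normrZ (le_trans (ler_piMr _ (norm_delta_le1 j)))//.
      exact: le_trans re e_d'.
    rewrite eE natrX exprD.
    have := gt_eqF (p4 K); have := gt_eqF (p4 P); move: (4 ^+ K) (4 ^+ P) => a b b0 a0.
    have -> : a^-1 / 4 * (a * b) * (eta / b) = eta / 4 by field; rewrite a0 b0.
    by rewrite ler_pdivrMr// ler_peMr// ?ltW//; lra.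
Qed.

(** [h0] is a convolution along the orbits of [v] with the positive part of the coordinate, the
    fundamental solution of the second difference. In the given ball the discrete equation then
    holds without error. *)
Lemma green_approx_1 B : m = 1%N -> exists2 C : R, 0 < C &
  forall F, continuous F -> (forall y, `|F y| <= 1) -> bsupp B F ->
  forall eta Rad, 0 < eta -> 0 < Rad -> almost_green F C eta Rad.
Proof.
move=> m1; have [L L0 LP] := hcoord_bound B.
have N0 : (0 < N)%N by rewrite -m1.
pose j0 : 'I_N := Ordinal N0; pose v := e_ j0.
have j0m : (j0 < m)%N by rewrite m1.
have hb : hbasis = [:: v].
  case E : hbasis (size_hbasis) (nth_hbasis j0m) => [|v0 [|v1 ws]] /= sz; rewrite m1 // in sz.
  by move=> ->.
pose ell := hcoord j0.
have ellv : ell v = 1 by rewrite /ell hcoord_delta// eqxx.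
have ell_line x (c : R) : ell (op x (c *: v)) = ell x + c by rewrite /ell hcoord_op hcoordZ -/ell ellv mulr1.
exists (2 * L + 1) => [|F cF F1 FB eta Rad eta0 Rad0]; first by rewrite ltr_wpDl// mulr_ge0// ltW.
have FL y : L < `|ell y| -> F y = 0.
  move=> Ly; apply: FB; rewrite ltNge; apply/negP => /(LP j0); rewrite leNgt -/ell.
  by move=> /negP; apply.
have [Rad' Rad'0 RP] := horizontal_ball Rad.
have [Q Q0 QP] := hcoord_bound (Num.max Rad Rad').
(* [M] steps of size [e] cover at least the length [W - 2], which leads from any point with
   [|ell x| <= Q + 1] out of the slab [|ell x| <= L] where [F] lives. *)
pose W := L + Q + 4.
have W0 : 0 < W by rewrite /W; lra.
have W1 : 0 < W + 1 by lra.
have [d d0 dP] := unif_translate hop cF FB (divr_gt0 eta0 (exprn_gt0 2 W1)).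
have mn0 : 0 < Num.min 1 (Num.min eta d) by rewrite !lt_min ltr01 eta0.
pose e := Num.min 1 (Num.min eta d).
have [e1 ee ed] : [/\ e <= 1, e <= eta & e <= d].
  by rewrite /e; split; rewrite !ge_min lexx ?orbT.
have e0 : 0 < e by [].
pose M := Num.truncn ((W - 1) / e).
have WM0 : 0 <= (W - 1) / e by rewrite divr_ge0 ?ltW// /W; lra.
have /andP[M1 M2] := truncn_itv WM0; rewrite -/M in M1 M2.
have Me : M%:R * e <= W by rewrite -ler_pdivlMr// (le_trans M1)// ler_pM2r ?invr_gt0//; lra.
have Me' : W - 1 <= M.+1%:R * e by rewrite -ler_pdivrMr// ltW.
have Me'' : W - 2 <= M%:R * e by move: Me'; rewrite -natr1 mulrDl mul1r; lra.
pose T k x := F (op x (- (k%:R * e) *: v)).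
pose h0 x := e ^+ 2 * \sum_(k < M.+1) k%:R * T k x.
have T_small k x : `|T k x| <= ((`|ell x - e * k%:R| <= L)%R)%:R.
  rewrite /T; have [h|h] := leP `|ell x - e * k%:R| L; first exact: F1.
  by rewrite FL ?normr0// ell_line [_ * e]mulrC.
have step x : `|ell x| <= Q + 1 -> h0 (op x (e *: v)) - h0 x = e ^+ 2 * \sum_(j < M) T j x.
  move=> xQ; rewrite /h0 -mulrBr; congr (_ * _).
  rewrite big_ord_recl/= mul0r add0r [X in _ - X]big_ord_recr/=.
  have -> : T M x = 0.
    rewrite /T FL// ell_line; move: xQ; rewrite ler_norml => /andP[q1 q2].
    by rewrite ltr_normr; apply/orP; right; move: Me''; rewrite /W; lra.
  rewrite mulr0 addr0 -sumrB; apply: eq_bigr => j _.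
  have -> : T (lift ord0 j) (op x (e *: v)) = T j x.
    rewrite /T /= -(opA hop) (exp_op hop); congr (F (op x (_ *: v))).
    by rewrite /bump/= add1n -natr1; ring.
  by rewrite /bump/= add1n -natr1; ring.
have ell_Q x : `|x| <= Num.max Rad Rad' -> `|ell x| <= Q by exact: QP.
have back x : op (op x (- e *: v)) (e *: v) = x.
  by rewrite -(opA hop) (exp_op hop) addNr scale0r (opx0 hop).
have sum_le x : `|e ^+ 2 * \sum_(j < M) T j x| <= (2 * L + 1) * e.
  rewrite normrM ger0_norm ?sqr_ge0// expr2 -mulrA mulrC; apply: ler_wpM2r; first exact: ltW.
  apply: le_trans (_ : e * (2 * L / e + 1) <= _); last first.
    by rewrite mulrDr mulr1 mulrC divfK ?gt_eqF// lerD2l.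
  apply: ler_wpM2l; first exact: ltW.
  apply: le_trans (ler_norm_sum _ _ _) _; apply: le_trans (count_progression (- ell x) M e0 (ltW L0)).
  apply: ler_sum => k _; have <- : `|ell x - e * k%:R| = `|- ell x + e * k%:R| by rewrite -normrN opprB addrC.
  exact: T_small.
have cT k : continuous (T k) by exact: (cts_translate hop).
exists e, (fun x => h0 x - h0 0); rewrite /almost_green hb; split.
- by rewrite e0.
- apply: ctsB; last exact: cts_cst.
  apply: ctsM; first exact: cts_cst.
  by apply: cts_sum => k _; apply: ctsM => //; exact: cts_cst.
- by rewrite subrr.
- move=> x xR; have xQ := ell_Q x (le_trans xR (_ : Rad <= Num.max Rad Rad')).
  have {}xQ : `|ell x| <= Q by apply: xQ; rewrite le_max lexx.
  rewrite (avgstep_sub) /=.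
  have s1 : h0 (op x (e *: v)) - h0 x = e ^+ 2 * \sum_(j < M) T j x by apply: step; lra.
  have s2 : h0 x - h0 (op x (- e *: v)) = e ^+ 2 * \sum_(j < M) T j (op x (- e *: v)).
    have := step (op x (- e *: v)); rewrite back; apply; rewrite ell_line.
    by rewrite (le_trans (ler_normD _ _))// normrN (gtr0_norm e0) lerD.
  have s3 : \sum_(j < M) T j x = F x + \sum_(j < M) T j (op x (- e *: v)).
    have T0 : T 0%N x = F x by rewrite /T mul0r oppr0 scale0r (opx0 hop).
    have TM : T M x = 0.
      rewrite /T FL// ell_line; move: xQ; rewrite ler_norml => /andP[q1 q2].
      by rewrite ltr_normr; apply/orP; right; move: Me''; rewrite /W; lra.
    have <- : \sum_(j < M.+1) T j x = \sum_(j < M) T j x by rewrite big_ord_recr/= TM addr0.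
    rewrite big_ord_recl/= T0.
    congr (_ + _); apply: eq_bigr => j _; rewrite /T -(opA hop) (exp_op hop) /bump/= add1n -natr1.
    by congr (F (op x (_ *: v))); ring.
  have -> : h0 (op x (e *: v)) - h0 0 + (h0 (op x (- e *: v)) - h0 0) - 2 * (h0 x - h0 0) =
     (h0 (op x (e *: v)) - h0 x) - (h0 x - h0 (op x (- e *: v))) by ring.
  by rewrite s1 s2 s3 -mulrBr addrK mulrAC mulfV ?mul1r ?subrr ?normr0 ?ltW// expf_neq0// gt_eqF.
- move=> j x t jm xR t1; have -> : j = j0 by apply/val_inj => /=; move: jm; rewrite m1 ltnS leqn0 => /eqP.
  rewrite -/v.
  have L21 : 0 <= 2 * L + 1 by rewrite addr_ge0 ?mulr_ge0 ?(ltW L0).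
  apply: (@multi_step (fun y => h0 y - h0 0) v x t e _ Rad' eta e0 L21 (ltW eta0) t1) => [t' t'1|y b yR|y r yR re].
  + exact: RP.
  + have yQ : `|ell y| <= Q by apply: ell_Q; rewrite le_max yR orbT.
    rewrite opprB addrA subrK; case: b.
      by rewrite step ?sum_le//; lra.
    have := step (op y (- e *: v)); rewrite back distrC => ->; first exact: sum_le.
    rewrite ell_line (le_trans (ler_normD _ _))// normrN (gtr0_norm e0) lerD//.
  + rewrite opprB addrA subrK /h0 -mulrBr -sumrB normrM ger0_norm ?sqr_ge0//.
    apply: le_trans (_ : e ^+ 2 * \sum_(k < M.+1) M%:R * (eta / (W + 1) ^+ 2) <= _).
      apply: ler_wpM2l; first exact: sqr_ge0.
      apply: le_trans (ler_norm_sum _ _ _) _; apply: ler_sum => k _.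
      rewrite -mulrBr normrM normr_nat; apply: ler_pM => //; first by rewrite ler_nat -ltnS.
      have comm : op (op y (r *: v)) (- (k%:R * e) *: v) = op (op y (- (k%:R * e) *: v)) (r *: v).
        by rewrite -!(opA hop) !(exp_op hop) addrC.
      rewrite /T comm distrC.
      have [] // := dP (op y (- (k%:R * e) *: v)) (r *: v).
      rewrite normrZ (le_trans (ler_piMr _ (norm_delta_le1 _)))//; exact: le_trans re ed.
    rewrite sumr_const card_ord -(mulr_natl (M%:R * _)).
    have h1 : e * M.+1%:R <= W + 1 by rewrite -natr1 mulrDr mulr1 mulrC; lra.
    have h2 : e * M%:R <= W by rewrite mulrC.
    have -> : e ^+ 2 * (M.+1%:R * (M%:R * (eta / (W + 1) ^+ 2))) = (e * M.+1%:R) * (e * M%:R) * (eta / (W + 1) ^+ 2) by ring.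
    have h3 : (e * M.+1%:R) * (e * M%:R) <= (W + 1) ^+ 2.
      by rewrite expr2; apply: ler_pM => //; rewrite ?mulr_ge0// ?ltW//; lra.
    apply: le_trans (ler_wpM2r _ h3) _; first by rewrite divr_ge0 ?sqr_ge0// ltW.
    by rewrite mulrCA mulfV ?mulr1// expf_neq0// gt_eqF.
Qed.

End green_approx.

Section pushforward.
Context d d' (X : measurableType d) (Y : measurableType d') (R : realType).
Variables (mu : {measure set X -> \bar R}) (phi : X -> Y) (mphi : measurable_fun setT phi).

Definition pushm : {measure set Y -> \bar R} :=
  measure_function_pushforward__canonical__measure_function_Measure mu mphi.

Lemma int_push (nu : {measure set Y -> \bar R}) (f : Y -> \bar R) :
  (forall A, measurable A -> nu A = mu (phi @^-1` A)) ->
  measurable_fun setT f -> (forall y, 0 <= f y)%E ->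
  (\int[nu]_y f y = \int[mu]_x f (phi x))%E.
Proof.
move=> E mf f0; rewrite (@eq_measure_integral _ _ _ _ pushm) => [|A mA _]; last exact: E.
by rewrite (ge0_integral_pushforward mphi mu measurableT mf)//.
Qed.

End pushforward.

(** * Invariance of Lebesgue measure under right translations *)

Section translation.
Context {R : realType}.
Local Open Scope ereal_scope.
Local Notation lebR := (@lebesgue_measure R).

Lemma int_translate1 (a : R) (f : R -> \bar R) : measurable_fun setT f ->
  (forall x, 0 <= f x) -> \int[lebR]_x f (x + a)%R = \int[lebR]_x f x.
Proof.
move=> mf f0.
have ma : measurable_fun [set: measurableTypeR R] (fun x : measurableTypeR R => (x + a)%R : measurableTypeR R).
  exact: measurable_funD.
apply/esym; have := @int_push _ _ (measurableTypeR R) (measurableTypeR R) R lebR _ ma lebR f.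
apply=> // A mA.
apply: (@lebesgue_measure_unique _ (@pushm _ _ (measurableTypeR R) (measurableTypeR R) R lebR _ ma)) => // _ [[x y] _ <-] /=.
rewrite /pushforward.
have -> : (fun x : R => x + a)%R @^-1` `]x, y]%classic = `](x - a)%R, (y - a)%R]%classic.
  by apply/seteqP; split => z /=; rewrite !in_itv/= ltrBlDr lerBrDr.
rewrite !lebesgue_measure_itv/= !lte_fin ltrD2r -!EFinD.
by case: ifP => // _; congr EFin; rewrite opprB addrA subrK.
Qed.

Lemma int_leb_S n (f : 'rV[R]_n.+1 -> \bar R) : measurable_fun setT f ->
  (forall x, 0 <= f x) ->
  \int[leb n.+1]_x f x = \int[lebR]_t \int[leb n]_w f (rV_cons (t, w)).
Proof.
move=> mf f0; rewrite (int_push (mu := lebR \x leb n) (@measurable_rV_cons R n))//.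
rewrite fubini_tonelli1//.
by apply: measurableT_comp => //; exact: measurable_rV_cons.
Qed.

Lemma measurable_rVD d (T : measurableType d) n (f g : T -> 'rV[R]_n) :
  measurable_fun setT f -> measurable_fun setT g -> measurable_fun setT (fun t => f t + g t)%R.
Proof.
move=> mf mg; apply: measurable_rV => i.
rewrite (_ : (fun _ => _) = (fun t => f t 0 i + g t 0 i)%R); last first.
  by apply/funext => t; rewrite mxE.
by apply: measurable_funD; apply: (measurableT_comp (measurable_coord i)).
Qed.

Lemma measurable_rVZ d (T : measurableType d) n (c : T -> R) (f : T -> 'rV[R]_n) :
  measurable_fun setT c -> measurable_fun setT f -> measurable_fun setT (fun t => c t *: f t)%R.
Proof.
move=> mc mf; apply: measurable_rV => i.
rewrite (_ : (fun _ => _) = (fun t => c t * f t 0 i)%R); last first.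
  by apply/funext => t; rewrite mxE.
by apply: measurable_funM => //; apply: (measurableT_comp (measurable_coord i)).
Qed.

Lemma measurable_translate n (a : 'rV[R]_n) : measurable_fun setT (fun x : 'rV[R]_n => x + a)%R.
Proof. by apply: measurable_rVD => //; exact: measurable_cst. Qed.

Lemma rV_unconsK n : cancel (@rV_uncons R n) (@rV_cons R n).
Proof.
move=> v; apply/rowP => i; rewrite /rV_cons /rV_uncons.
case: (@split_ordP 1 n i) => j ->.
  rewrite [LHS](row_mxEl (const_mx (v 0 0)%R : 'rV_1) (rsubmx (v : 'rV_(1 + n)))) mxE.
  by congr (v _ _); apply/val_inj; rewrite ord1.
by rewrite [LHS](row_mxEr (const_mx (v 0 0)%R : 'rV_1) (rsubmx (v : 'rV_(1 + n)))) mxE.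
Qed.

Lemma int_translate n (a : 'rV[R]_n) (f : 'rV[R]_n -> \bar R) : measurable_fun setT f ->
  (forall x, 0 <= f x) -> \int[leb n]_x f (x + a)%R = \int[leb n]_x f x.
Proof.
elim: n a f => [|n IH] a f mf f0.
  by congr (integral _ _ _); apply/funext => x; rewrite (thinmx0 a) addr0.
have mfa : measurable_fun setT (fun x : 'rV[R]_n.+1 => f (x + a)%R).
  by apply: measurableT_comp => //; exact: measurable_translate.
have mfc : measurable_fun setT (f \o @rV_cons R n).
  by apply: measurableT_comp => //; exact: measurable_rV_cons.
rewrite (int_leb_S mfa (fun x => f0 _)) (int_leb_S mf f0).
pose a' := @rsubmx R 1 1 n a.
have addE t w : (rV_cons (t, w) + a = rV_cons (t + a 0 0, w + a'))%R.
  have [h1 h2] := rV_consK (t, w).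
  rewrite -[LHS]rV_unconsK; congr rV_cons; rewrite /rV_uncons mxE h1; congr pair.
  by rewrite linearD /= h2.
transitivity (\int[lebR]_t \int[leb n]_w f (rV_cons (t + a 0 0, w))%R).
  apply: eq_integral => t _.
  under eq_integral => w _ do rewrite addE.
  rewrite (IH a' (fun w => f (rV_cons (t + a 0 0, w))%R))//.
  exact: (measurableT_comp mfc (measurable_pair1 _)).
rewrite (int_translate1 (a 0 0)%R (f := fun t => \int[leb n]_w f (rV_cons (t, w))))//.
- exact: (@measurable_fun_fubini_tonelli_F _ _ _ _ _ (leb n) _ mfc (fun z => f0 _)).
- by move=> t; exact: integral_ge0.
Qed.

(* Averaging over [x + s *: v], [0 <= s <= 1], absorbs the displacement. *)
Lemma int_shear n (v : 'rV[R]_n) (p : 'rV[R]_n -> R) (f : 'rV[R]_n -> \bar R) :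
  measurable_fun setT p -> (forall x (s : R), p (x + s *: v)%R = p x) ->
  measurable_fun setT f -> (forall x, 0 <= f x) ->
  \int[leb n]_x f (x + p x *: v)%R = \int[leb n]_x f x.
Proof.
move=> mp pv mf f0.
pose rho (s : R) : \bar R := (\1_(`[0%R, 1%R]%classic : set R) s)%:E.
have rho0 s : 0 <= rho s by rewrite lee_fin.
have mrho : measurable_fun setT rho by apply/measurable_EFinP; exact: measurable_indic.
have rho1 : \int[lebR]_s rho s = 1.
  transitivity (lebR `[0%R, 1%R]%classic); first by rewrite integral_indic// setIT.
  by rewrite lebesgue_measure_itv/= lte_fin ltr01 oppr0 adde0.
have rho1a (a : R) : \int[lebR]_s rho (s - a)%R = 1 by rewrite int_translate1.
have mshift (q : 'rV[R]_n -> R) : measurable_fun setT q ->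
    measurable_fun setT (fun z : R * 'rV[R]_n => f (z.2 + (z.1 + q z.2) *: v)%R).
  move=> mq; apply: measurableT_comp => //; apply: measurable_rVD; first exact: measurable_snd.
  apply: measurable_rVZ; last exact: measurable_cst.
  apply: measurable_funD; first exact: measurable_fst.
  exact: (measurableT_comp mq measurable_snd).
have mrp : measurable_fun setT (fun z : R * 'rV[R]_n => rho (z.1 - p z.2)%R).
  apply: measurableT_comp => //; apply: measurable_funB; first exact: measurable_fst.
  exact: (measurableT_comp mp measurable_snd).
have mf2 : measurable_fun setT (fun z : R * 'rV[R]_n => f (z.2 + z.1 *: v)%R).
  apply: measurableT_comp => //; apply: measurable_rVD; first exact: measurable_snd.
  by apply: measurable_rVZ; [exact: measurable_fst|exact: measurable_cst].
pose H1 := fun z : R * 'rV[R]_n => rho (z.1 - p z.2)%R * f (z.2 + z.1 *: v)%R.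
pose H2 := fun z : R * 'rV[R]_n => rho (z.1 - p z.2)%R * f z.2.
have mH1 : measurable_fun setT H1 by exact: emeasurable_funM.
have mH2 : measurable_fun setT H2.
  by apply: emeasurable_funM => //; exact: (measurableT_comp mf measurable_snd).
have H10 z : 0 <= H1 z by exact: mule_ge0.
have H20 z : 0 <= H2 z by exact: mule_ge0.
have line (x : 'rV[R]_n) : measurable_fun setT (fun s : R => f (x + s *: v)%R).
  exact: (measurableT_comp mf2 (measurable_pair2 x)).
have mS : measurable_fun setT (fun x : 'rV[R]_n => f (x + p x *: v)%R).
  by apply: measurableT_comp => //; apply: measurable_rVD => //; apply: measurable_rVZ => //; exact: measurable_cst.
transitivity (\int[leb n]_x \int[lebR]_s (rho s * f (x + (s + p x) *: v)%R)).
  pose H0 := fun z : R * 'rV[R]_n => rho z.1 * f (z.2 + (z.1 + p z.2) *: v)%R.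
  have mH0 : measurable_fun setT H0.
    apply: emeasurable_funM; last exact: mshift.
    exact: (measurableT_comp mrho measurable_fst).
  have H00 z : 0 <= H0 z by exact: mule_ge0.
  rewrite -(@fubini_tonelli _ _ _ _ _ lebR (leb n) H0 mH0 H00).
  transitivity (\int[lebR]_s (rho s * \int[leb n]_x f (x + p x *: v)%R)).
    by rewrite ge0_integralZr ?rho1 ?mul1e//; exact: integral_ge0.
  apply: eq_integral => s _; rewrite /H0/= ge0_integralZl//; last first.
    exact: (measurableT_comp (mshift p mp) (measurable_pair1 s)).
  congr (_ * _); rewrite -(int_translate (s *: v)%R mS)//.
  by apply: eq_integral => x _; rewrite pv -addrA -scalerDl.
transitivity (\int[leb n]_x \int[lebR]_s H1 (s, x)).
  apply: eq_integral => x _.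
  have := @int_translate1 (p x) (fun s => H1 (s, x)).
  rewrite /H1/= => <-//; first by apply: eq_integral => s _; rewrite addrK.
    exact: (measurableT_comp mH1 (measurable_pair2 x)).
  by move=> s; exact: mule_ge0.
rewrite -(@fubini_tonelli _ _ _ _ _ lebR (leb n) H1 mH1 H10).
transitivity (\int[lebR]_s \int[leb n]_x H2 (s, x)).
  apply: eq_integral => s _.
  have := @int_translate n (s *: v)%R (fun x => H2 (s, x)).
  rewrite /H2/= => <-//; first by apply: eq_integral => x _; rewrite /H1/= pv.
    exact: (measurableT_comp mH2 (measurable_pair1 s)).
  by move=> x; exact: mule_ge0.
rewrite (@fubini_tonelli _ _ _ _ _ lebR (leb n) H2 mH2 H20); apply: eq_integral => x _.
rewrite /H2/= ge0_integralZr//; first by rewrite rho1a mul1e.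
exact: (measurableT_comp mrp (measurable_pair2 x)).
Qed.

End translation.

Section open_measurable.
Context {R : realType} {n : nat}.
Local Notation pt := 'rV[R]_n.

Lemma measurable_cube (a : pt) (r : R) : measurable [set x : pt | forall i, `|a 0 i - x 0 i| < r].
Proof.
rewrite (_ : [set x | _] = \bigcap_(i in [set: 'I_n]) ((fun x : pt => x 0 i) @^-1` `](a 0 i - r), (a 0 i + r)[)).
  apply: fin_bigcap_measurable => [|i _]; first exact: finite_finset.
  rewrite -[X in measurable X]setTI; apply: measurable_coord => //; exact: measurable_itv.
apply/seteqP; split => x /= h i.
  by move=> _; rewrite /= in_itv/= -ltr_distl distrC; exact: h.
by have := h i I; rewrite /= in_itv/= -ltr_distl distrC.
Qed.

(** The sigma-algebra is generated by coordinates, so an open set is written as a countable union of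
    cubes with rational centres. *)
Lemma open_rV_measurable (U : set pt) : open U -> measurable U.
Proof.
move=> oU.
pose c (k : 'rV[rat]_n * nat) : pt := map_mx ratr k.1.
pose A (k : 'rV[rat]_n * nat) : set pt := [set x | forall i, `|c k 0 i - x 0 i| < k.2.+1%:R^-1].
pose F k : set pt := if `[< A k `<=` U >] then A k else set0.
have -> : U = \bigcup_k F k.
  apply/seteqP; split => [x Ux|x [k _]]; last first.
    by rewrite /F; case: ifPn => // /asboolP; exact.
  have /nbhs_ballP[r /= r0 rU] : nbhs x U by exact: open_nbhs_nbhs.
  have [N Nr] : exists N : nat, 2 * N.+1%:R^-1 < r.
    exists (Num.truncn (2 / r)).+1.
    have r2 : 0 <= 2 / r by rewrite divr_ge0// ltW.
    have /andP[_ h] := truncn_itv r2.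
    rewrite mulrC ltr_pdivrMl// -ltr_pdivrMr//; apply: lt_trans h _.
    by rewrite ltr_nat.
  have N0 : 0 < N.+1%:R^-1 :> R by rewrite invr_gt0.
  have /choice[q qP] : forall i : 'I_n, exists q : rat, `|ratr q - x 0 i| < N.+1%:R^-1.
    move=> i; have [|q] := @rat_in_itvoo R (x 0 i - N.+1%:R^-1) (x 0 i + N.+1%:R^-1).
      by rewrite ltrBlDr -addrA ltrDl addr_gt0.
    by rewrite in_itv/= => qi; exists q; rewrite ltr_distl.
  exists (\row_i q i, N) => //; rewrite /F; case: ifPn => [_ i /=|/asboolP h].
    by rewrite /c !mxE.
  exfalso; apply: h => y yA; apply: rU; rewrite -ball_normE /ball_ /=.
  apply: le_lt_trans Nr; apply/rV_norm_leP => [|i]; first by rewrite mulr_ge0// ltW.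
  have := yA i; have := qP i; rewrite /c !mxE /= => h1 h2.
  rewrite -(subrKA (ratr (q i))) (le_trans (ler_normD _ _))// distrC mulr2n mulrDl mul1r lerD// ltW//.
apply: countable_bigcupT_measurable => [|k]; first exact: countableP.
by rewrite /F; case: ifP => _; [exact: measurable_cube|exact: measurable0].
Qed.

Lemma continuous_rV_measurable (f : pt -> R) : continuous f -> measurable_fun setT f.
Proof.
move=> cf; apply: (measurability _ (RGenOpens.measurableE R)).
move=> _ [_ [a [b ->] <-]]; rewrite setTI; apply: open_rV_measurable.
by apply: open_comp => // x _; exact: cf.
Qed.

Lemma continuous_rV_measurable_rV k (f : pt -> 'rV[R]_k) : continuous f -> measurable_fun setT f.
Proof.
move=> cf; apply: measurable_rV => i; apply: continuous_rV_measurable.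
exact: (rV_continuousP f).1 cf i.
Qed.

End open_measurable.

Section unipotent.
Context {R : realType} {N : nat} (op : 'rV[R]_N -> 'rV[R]_N -> 'rV[R]_N).
Hypothesis hop : is_exp_lie_group op.
Local Notation pt := 'rV[R]_N.
Implicit Types (x y z v w a : pt).
Context (s : nat) (V : nat -> {vspace pt}).
Hypothesis hV : is_stratification op s V.
Local Notation F := (@filt _ _ s V).

Lemma linear_rV_measurable k (f : pt -> 'rV[R]_k) : linear f -> measurable_fun setT f.
Proof.
move=> lf; have [C C0 CP] := linear_bounded lf.
apply: continuous_rV_measurable_rV; apply/cts_distP => x e e0.
exists (e / C) => [|y xy]; first by rewrite divr_gt0.
rewrite -(linB lf) (le_trans (CP _))// mulrC -ler_pdivlMr//.
Qed.

(** One shear for each basis vector of [W]. The coefficients depend on [x] modulo [W] only, so the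
    shears do not disturb one another. *)
Lemma int_shears (W : {vspace pt}) (p : pt -> pt) (f : pt -> \bar R) :
  measurable_fun setT p -> (forall x, p x \in W) ->
  (forall x w, w \in W -> p (x + w) = p x) ->
  measurable_fun setT f -> (forall x, 0 <= f x)%E ->
  (\int[leb N]_x f (x + p x)%R = \int[leb N]_x f x)%E.
Proof.
move=> mp pW pinv mf f0.
pose c j x := coord (vbasis W) j (p x).
have pE x : p x = \sum_(j < \dim W) c j x *: (vbasis W)`_j by exact: coord_vbasis.
have mc j : measurable_fun setT (c j).
  pose g (v : pt) : 'rV[R]_1 := \row__ (coord (vbasis W) j v).
  have mg : measurable_fun setT g.
    by apply: linear_rV_measurable => a u v; apply/rowP => i; rewrite !mxE linearP.
  rewrite (_ : c j = (fun v : 'rV[R]_1 => v 0 0) \o (g \o p)); last first.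
    by apply/funext => x; rewrite /= mxE.
  by apply: (measurableT_comp (measurable_coord 0)); exact: measurableT_comp.
suff h (r : seq 'I_(\dim W)) (g : pt -> \bar R) : measurable_fun setT g -> (forall x, 0 <= g x)%E ->
    (\int[leb N]_x g (x + \sum_(j <- r) c j x *: (vbasis W)`_j)%R = \int[leb N]_x g x)%E.
  by rewrite -[RHS](h (index_enum _))//; apply: eq_integral => x _; rewrite {1}pE.
elim: r g => [|j r IH] g mg g0.
  by apply: eq_integral => x _; rewrite big_nil addr0.
have cinv i x w : w \in W -> c i (x + w) = c i x by move=> wW; rewrite /c pinv.
have bW i : (vbasis W)`_i \in W.
  by have [iW|Wi] := ltnP i (size (vbasis W)); [rewrite vbasis_mem// mem_nth|rewrite nth_default// mem0v].
pose G x := g (x + \sum_(i <- r) c i x *: (vbasis W)`_i).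
have mG : measurable_fun setT G.
  apply: measurableT_comp => //; apply: measurable_rVD => //.
  elim: (r) => [|i r' IHr].
    by rewrite (_ : (fun x => _) = fun=> 0); [exact: measurable_cst|apply/funext => x; rewrite big_nil].
  rewrite (_ : (fun x => _) = fun x => c i x *: (vbasis W)`_i + \sum_(i <- r') c i x *: (vbasis W)`_i); last first.
    by apply/funext => x; rewrite big_cons.
  by apply: measurable_rVD => //; apply: measurable_rVZ => //; exact: measurable_cst.
rewrite -(IH g mg g0) -(@int_shear _ _ (vbasis W)`_j (c j) G)//; last first.
- by move=> x; exact: g0.
- by move=> x t; rewrite cinv// memvZ.
apply: eq_integral => x _; rewrite /G big_cons addrA; congr (g (_ + _)).
by apply: eq_bigr => i _; rewrite cinv// memvZ.
Qed.

(** The component [p] of [g] in the lowest degree [k] is constant along [filt k], since there the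
    increments of [g] lie in [filt k.+1]. It is removed by shears, and the rest [g'] has the same
    triangular form in degree [k.+1]. *)
Lemma int_unipotent k (g : pt -> pt) (f : pt -> \bar R) : (0 < k <= s.+1)%N -> measurable_fun setT g ->
  (forall x, g x \in F k) ->
  (forall j x w, (k <= j)%N -> w \in F j -> g (x + w) - g x \in F j.+1) ->
  measurable_fun setT f -> (forall x, 0 <= f x)%E ->
  (\int[leb N]_x f (x + g x)%R = \int[leb N]_x f x)%E.
Proof.
move=> /andP[k0 ks]; rewrite -(subKn ks); move: k k0 ks g f.
suff h i k : (i <= s)%N -> (k = s.+1 - i)%N -> forall (g : pt -> pt) (f : pt -> \bar R),
  measurable_fun setT g -> (forall x, g x \in F k) ->
  (forall j x w, (k <= j)%N -> w \in F j -> g (x + w) - g x \in F j.+1) ->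
  measurable_fun setT f -> (forall x, 0 <= f x)%E ->
  (\int[leb N]_x f (x + g x)%R = \int[leb N]_x f x)%E.
  by move=> k k0 ks g f; apply: (h (s.+1 - k)%N _ _ erefl); lia.
elim: i k => [|i IH] k is_ kE g f mg gF gD mf f0.
  apply: eq_integral => x _; have := gF x; rewrite kE subn0 => /(filt0 (ltnSn s)) ->.
  by rewrite addr0.
have k1 : (0 < k <= s)%N by lia.
pose pi := addv_pi1 (V k) (F k.+1).
have VFk : (F k <= V k + F k.+1)%VS.
  apply/subv_sumP => j; rewrite leq_eqVlt => /predU1P[kj|kj]; first by rewrite kj addvSl.
  by apply: subv_trans (addvSr _ _); apply: (sumv_sup j).
have piV u : pi u \in V k.
  exact: memv_pi1.
have pirem u : u \in F k -> u - pi u \in F k.+1.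
  move=> /(subvP VFk) /addv_pi1_pi2 E; rewrite -[X in X - _]E addrC addKr; exact: memv_pi2.
have pi0 u : u \in F k.+1 -> pi u = 0.
  move=> uF; have := addv_pi1_pi2 (subvP (addvSr (V k) _) _ uF).
  by rewrite addv_pi2_id// => /eqP; rewrite -subr_eq0 addrK => /eqP.
pose p x := pi (g x).
have mpi : measurable_fun setT pi by apply: linear_rV_measurable => a u v; rewrite linearP.
have mp : measurable_fun setT p by exact: measurableT_comp.
have VF : (V k <= F k)%VS by exact: layer_filt.
have pinv x w : w \in F k -> p (x + w) = p x.
  move=> wF; have := pi0 _ (gD k x w (leqnn k) wF).
  by rewrite /p linearB/= => /eqP; rewrite subr_eq0 => /eqP.
have pF x : p x \in F k by apply: (subvP VF); exact: piV.
pose g' z := g (z - p z) - p (z - p z).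
have g'E x : x + g x = (x + p x) + g' (x + p x).
  rewrite /g'; have -> : x + p x - p (x + p x) = x by rewrite pinv// addrK.
  by rewrite -addrA [p x + _]addrC subrK.
pose f' z := f (z + g' z).
have mg' : measurable_fun setT g'.
  have mz : measurable_fun setT (fun z => z - p z).
    apply: measurable_rVD => //; rewrite (_ : (fun z => _) = fun z => (-1 : R) *: p z).
      by apply: measurable_rVZ => //; exact: measurable_cst.
    by apply/funext => z; rewrite scaleN1r.
  apply: (measurableT_comp (f := fun y => g y - p y)) => //.
  apply: measurable_rVD => //; rewrite (_ : (fun z => _) = fun z => (-1 : R) *: p z).
    by apply: measurable_rVZ => //; exact: measurable_cst.
  by apply/funext => z; rewrite scaleN1r.
have mf' : measurable_fun setT f' by apply: measurableT_comp => //; exact: measurable_rVD.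
transitivity (\int[leb N]_x f' (x + p x)%R)%E.
  by apply: eq_integral => x _; rewrite /f' g'E.
rewrite (@int_shears (F k) p f')//; last by move=> x; exact: f0.
apply: (IH k.+1) => //; [by lia|by lia|..].
- by move=> x; exact: pirem.
- move=> j x w kj wF; have wFk : w \in F k by exact: mem_filt_sub (ltnW kj) wF.
  have E : x + w - p (x + w) = x - p x + w by rewrite pinv// addrAC.
  rewrite /g' E [p (_ + w)]pinv// opprB addrA subrK; apply: gD => //; exact: ltnW.
Qed.

Lemma op_measurable a : measurable_fun setT (fun x => op x a).
Proof.
apply: continuous_rV_measurable_rV; apply/rV_continuousP => i.
exact: C1_continuous (op_C1l hop a i).
Qed.

Lemma ge0_haar a (f : pt -> \bar R) : measurable_fun setT f -> (forall x, 0 <= f x)%E ->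
  (\int[leb N]_x f (op x a) = \int[leb N]_x f x)%E.
Proof.
move=> mf f0; rewrite -[RHS](@int_unipotent 1 (fun x => op x a - x) f)//.
- by apply: eq_integral => x _; rewrite addrC subrK.
- apply: measurable_rVD; first exact: op_measurable.
  rewrite (_ : -%R = fun z : pt => (-1 : R) *: z); last by apply/funext => z; rewrite scaleN1r.
  by apply: measurable_rVZ => //; exact: measurable_cst.
- by move=> x; apply: (filt_full hV).
- move=> j x w _ wF; have := op_filt_diff hop hV x a wF.
  suff -> : op (x + w) a - op x a - w = op (x + w) a - (x + w) - (op x a - x) by [].
  by apply/rowP => n; rewrite !mxE; ring.
Qed.

Lemma haar a (f : pt -> \bar R) : measurable_fun setT f ->
  (\int[leb N]_x f (op x a) = \int[leb N]_x f x)%E.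
Proof.
move=> mf; rewrite [LHS]integralE [RHS]integralE; congr (_ - _)%E.
  rewrite -[RHS](ge0_haar a); [|exact: measurable_funepos|by []].
  by apply: eq_integral => x _; exact: (congr1 (fun u => u x) (funepos_comp f (fun x => op x a))).
rewrite -[RHS](ge0_haar a); [|exact: measurable_funeneg|by []].
by apply: eq_integral => x _; exact: (congr1 (fun u => u x) (funeneg_comp f (fun x => op x a))).
Qed.

End unipotent.

(** * Integrals of bounded functions with bounded support *)

Section integral.
Context {R : realType} {N : nat}.
Local Notation pt := 'rV[R]_N.
Implicit Types (x y z v a : pt) (f g u : pt -> R).

Definition rint f : R := \int[leb N]_x f x.

Definition cball (B : R) : set pt := [set x | `|x| <= B].

Lemma measurable_cball B : measurable (cball B).
Proof.
have mn : measurable_fun setT (fun x : pt => `|x|).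
  by apply: continuous_rV_measurable; exact: norm_continuous.
have := mn measurableT `]-oo, B]%classic (measurable_itv _); rewrite setTI.
by congr measurable; apply/seteqP; split=> x; rewrite /= in_itv.
Qed.

Lemma leb_cball B : (leb N (cball B) < +oo)%E.
Proof.
pose b : pt := const_mx `|B|; pose a : pt := const_mx (- `|B|).
pose D := [set v : pt | forall i, a 0 i <= v 0 i <= b 0 i].
have DE : D = cball `|B|.
  apply/seteqP; split=> x; rewrite /cball/D/= => h.
    by apply/rV_norm_leP => // i; have := h i; rewrite !mxE ler_norml.
  by move=> i; rewrite !mxE -ler_norml (le_trans (coord_le_norm _ _)).
apply: (@le_lt_trans _ _ (leb N D)).
  rewrite DE; apply: le_measure; rewrite ?inE; [exact: measurable_cball|exact: measurable_cball|].
  by move=> x /le_trans; apply; exact: ler_norm.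
by rewrite leb_box ?ltry// => i; rewrite !mxE ge0_cp.
Qed.

(* Bounded measurable functions with bounded support, and measurable functions
   that are bounded on bounded sets. *)
Definition bms f := measurable_fun setT f /\
  exists B M : R, forall x, `|f x| <= M /\ (B < `|x| -> f x = 0).
Definition lbm g := measurable_fun setT g /\
  forall B, exists M : R, forall x, `|x| <= B -> `|g x| <= M.

Lemma bms_integrable f : bms f -> (leb N).-integrable setT (EFin \o f).
Proof.
move=> [mf [B [M fBM]]].
have i1 : (leb N).-integrable (cball B) (EFin \o f).
  apply: measurable_bounded_integrable; [exact: measurable_cball|exact: leb_cball|exact: measurable_funTS|].
  exists M; split; first exact: num_real.
  by move=> r Mr x _ /=; rewrite (le_trans (fBM x).1)// ltW.
move/(integrable_mkcond _ (measurable_cball B)): i1; apply: eq_integrable => // x _.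
rewrite patchE; case: ifPn => // /negP xB /=.
by rewrite (fBM x).2// ltNge; apply/negP => h; apply: xB; rewrite inE.
Qed.

Lemma bmsD f g : bms f -> bms g -> bms (fun x => f x + g x).
Proof.
move=> [mf [B [M fP]]] [mg [B' [M' gP]]]; split; first exact: measurable_funD.
exists (Num.max B B'), (M + M') => x; split.
  by rewrite (le_trans (ler_normD _ _))// lerD ?(fP x).1 ?(gP x).1.
by rewrite gt_max => /andP[xB xB']; rewrite (fP x).2// (gP x).2// addr0.
Qed.

Lemma bmsM f g : bms f -> lbm g -> bms (fun x => f x * g x).
Proof.
move=> [mf [B [M fP]]] [mg gP]; split; first exact: measurable_funM.
have [M' gP'] := gP B; exists B, (`|M| * `|M'|) => x; split; last first.
  by move=> xB; rewrite (fP x).2// mul0r.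
have [xB|xB] := ltP B `|x|; first by rewrite (fP x).2// mul0r normr0.
by rewrite normrM ler_pM//; [apply: le_trans (fP x).1 _|apply: le_trans (gP' x xB) _]; exact: ler_norm.
Qed.

Lemma bms_lbm f : bms f -> lbm f.
Proof. by move=> [mf [B [M fP]]]; split=> // B'; exists M => x _; have [] := fP x. Qed.

Lemma lbm_cst c : lbm (fun=> c).
Proof. by split=> // B; exists `|c|. Qed.

Lemma cts_lbm g : continuous g -> lbm g.
Proof.
move=> cg; split=> [|B]; first exact: continuous_rV_measurable.
by have [C _ CP] := bounded_on_ball B cg; exists C.
Qed.

Lemma lbmD f g : lbm f -> lbm g -> lbm (fun x => f x + g x).
Proof.
move=> [mf fP] [mg gP]; split=> [|B]; first exact: measurable_funD.
have [M hM] := fP B; have [M' hM'] := gP B; exists (M + M') => x xB.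
by rewrite (le_trans (ler_normD _ _))// lerD ?hM ?hM'.
Qed.

Lemma lbmM f g : lbm f -> lbm g -> lbm (fun x => f x * g x).
Proof.
move=> [mf fP] [mg gP]; split=> [|B]; first exact: measurable_funM.
have [M hM] := fP B; have [M' hM'] := gP B; exists (M * M') => x xB.
by rewrite normrM ler_pM// ?hM ?hM'.
Qed.

Lemma bmsZ c f : bms f -> bms (fun x => c * f x).
Proof.
move=> hf; rewrite (_ : (fun x => _) = fun x => f x * c); first by apply: bmsM => //; exact: lbm_cst.
by apply/funext => x; rewrite mulrC.
Qed.

Lemma bmsB f g : bms f -> bms g -> bms (fun x => f x - g x).
Proof.
move=> hf hg; rewrite (_ : (fun x => _) = fun x => f x + -1 * g x); first by apply: bmsD => //; exact: bmsZ.
by apply/funext => x; rewrite mulN1r.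
Qed.

Lemma cts_bms B f : continuous f -> bsupp B f -> bms f.
Proof.
move=> cf fB; split; first exact: continuous_rV_measurable.
have [C C0 CP] := bounded_on_ball B cf; exists B, C => x; split; last exact: fB.
by have [xB|/CP//] := ltP B `|x|; rewrite fB// normr0 ltW.
Qed.

Lemma bms0 : bms (fun=> 0).
Proof. by split=> //; exists 0, 0 => x; rewrite normr0. Qed.

Lemma rintD f g : bms f -> bms g -> rint (fun x => f x + g x) = rint f + rint g.
Proof. by move=> hf hg; apply: RintegralD => //; exact: bms_integrable. Qed.

Lemma rintB f g : bms f -> bms g -> rint (fun x => f x - g x) = rint f - rint g.
Proof. by move=> hf hg; apply: RintegralB => //; exact: bms_integrable. Qed.

Lemma rintZ c f : bms f -> rint (fun x => c * f x) = c * rint f.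
Proof. by move=> hf; apply: RintegralZl => //; exact: bms_integrable. Qed.

Lemma rint0 : rint (fun=> 0) = 0.
Proof. by rewrite /rint Rintegral_cst// mul0r. Qed.

Lemma rint_le B : exists2 C : R, 0 < C & forall f (M : R), bms f -> bsupp B f -> 0 <= M ->
  (forall x, `|x| <= B -> `|f x| <= M) -> `|rint f| <= C * M.
Proof.
exists (1 + fine (leb N (cball B))) => [|f M hf fB M0 fM].
  by rewrite ltr_pwDl// fine_ge0.
have E : f = f \_ (cball B).
  apply/funext => x; rewrite patchE; case: ifPn => // /negP xB.
  by rewrite fB// ltNge; apply/negP => h; apply: xB; rewrite inE.
have fi : (leb N).-integrable (cball B) (EFin \o f).
  by apply: integrableS (bms_integrable hf) => //; exact: measurable_cball.
rewrite /rint E -Rintegral_mkcond (le_trans (le_normr_Rintegral _ _))//; first exact: measurable_cball.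
apply: (@le_trans _ _ (\int[leb N]_(x in cball B) M)).
  apply: le_Rintegral => //; [exact: measurable_cball|exact: integrable_norm fi|].
  apply: measurable_bounded_integrable; [exact: measurable_cball|exact: leb_cball|exact: measurable_cst|].
  by exists M; split=> [|r Mr x _ /=]; [exact: num_real|rewrite ger0_norm// ltW].
rewrite Rintegral_cst; last exact: measurable_cball.
by rewrite mulrC ler_wpM2r// lerDr.
Qed.

End integral.

(** * Weak solutions of the Poisson equation *)

Section adjoint.
Context {R : realType} {N : nat} (op : 'rV[R]_N -> 'rV[R]_N -> 'rV[R]_N).
Hypothesis hop : is_exp_lie_group op.
Local Notation pt := 'rV[R]_N.
Local Notation e_ i := (delta_mx 0 i : pt).
Implicit Types (x y z v w a : pt) (f g h u psi : pt -> R).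
Context (s : nat) (V : nat -> {vspace pt}).
Hypothesis hV : is_stratification op s V.
Local Notation m := (\dim (V 1%N)).
Hypothesis V1e : forall j : 'I_N, (j < m)%N -> e_ j \in V 1%N.

Lemma bms_op f a : bms f -> bms (fun x => f (op x a)).
Proof.
move=> [mf [B [M fP]]]; split; first by apply: measurableT_comp => //; exact: op_measurable.
have [C C0 CP] := bsupp_op hop B `|a|.
exists C, M => x; split; first by have [] := fP (op x a).
by have [h _] := CP f (fun y => (fP y).2) a (lexx _); exact: h.
Qed.

Lemma lbm_op f a : lbm f -> lbm (fun x => f (op x a)).
Proof.
move=> [mf fP]; split=> [|B]; first by apply: measurableT_comp => //; exact: op_measurable.
have [C C0 CP] := op_bounded hop B `|a|; have [M MP] := fP C.
by exists M => x xB; apply: MP; exact: CP.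
Qed.

Lemma rint_op f a : measurable_fun setT f -> rint (fun x => f (op x a)) = rint f.
Proof. by move=> mf; congr fine; rewrite -[RHS](haar hop hV a)//; exact: measurableT_comp. Qed.

Lemma rint_adj u psi a : lbm u -> bms psi ->
  rint (fun x => u x * psi (op x a)) = rint (fun x => u (op x (- a)) * psi x).
Proof.
move=> hu hpsi; rewrite -[RHS](rint_op a); last first.
  by apply: measurable_funM; [have [] := lbm_op (- a) hu|have [] := hpsi].
by congr rint; apply/funext => x; rewrite (opxK hop).
Qed.

Lemma bms_avgstep e v psi : bms psi -> bms (avgstep op e v psi).
Proof. by move=> h; apply: bmsZ; apply: bmsD; [apply: bmsD; [exact: bms_op|exact: bmsZ]|exact: bms_op]. Qed.

Lemma lbm_avgstep e v u : lbm u -> lbm (avgstep op e v u).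
Proof.
move=> h; apply: lbmM; first exact: lbm_cst.
by apply: lbmD; [apply: lbmD; [exact: lbm_op|apply: lbmM => //; exact: lbm_cst]|exact: lbm_op].
Qed.

Lemma bmsMl u psi : lbm u -> bms psi -> bms (fun x => u x * psi x).
Proof.
move=> hu hp; rewrite (_ : (fun x => _) = fun x => psi x * u x); first exact: bmsM.
by apply/funext => x; rewrite mulrC.
Qed.

Lemma rint_avgstep e v u psi : lbm u -> bms psi ->
  rint (fun x => u x * avgstep op e v psi x) = rint (fun x => avgstep op e v u x * psi x).
Proof.
move=> hu hp.
have hp1 := bms_op (e *: v) hp; have hp2 := bms_op (- e *: v) hp.
have hu1 := lbm_op (e *: v) hu; have hu2 := lbm_op (- e *: v) hu.
have E1 : (fun x => u x * avgstep op e v psi x) = fun x => 4^-1 * (u x * psi (op x (e *: v)) +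
    2 * (u x * psi x) + u x * psi (op x (- e *: v))).
  by apply/funext => x; rewrite /avgstep; move: (psi _) (psi (op x (e *: v))) (psi x) => a b c; ring.
have E2 : (fun x => avgstep op e v u x * psi x) = fun x => 4^-1 * (u (op x (e *: v)) * psi x +
    2 * (u x * psi x) + u (op x (- e *: v)) * psi x).
  by apply/funext => x; rewrite /avgstep; move: (u _) (u (op x (e *: v))) (u x) => a b c; ring.
have b1 := bmsMl hu hp1; have b2 := bmsMl hu hp2; have b0 := bmsZ 2 (bmsMl hu hp).
have c1 := bmsMl hu1 hp; have c2 := bmsMl hu2 hp.
rewrite E1 E2 !rintZ; [|by apply: bmsD => //; exact: bmsD|by apply: bmsD => //; exact: bmsD].
rewrite !rintD//; [|exact: bmsD|exact: bmsD].
rewrite (rint_adj (e *: v) hu hp) (rint_adj (- e *: v) hu hp) -!scaleNr opprK.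
by congr (_ * _); rewrite addrAC [RHS]addrC addrA.
Qed.

(** Each [avgstep] is symmetric because the inverse of a step is again a step; only the order of
    composition is reversed. *)
Lemma rint_walk e vs u psi : lbm u -> bms psi ->
  rint (fun x => u x * foldr (avgstep op e) psi vs x) =
  rint (fun x => foldr (avgstep op e) u (rev vs) x * psi x).
Proof.
move=> + hp; elim: vs u => [|v vs IH] u hu //=.
rewrite rint_avgstep//; last by elim: (vs) => [|w ws IHw] //=; exact: bms_avgstep.
by rewrite IH ?rev_cons ?foldr_rcons//; exact: lbm_avgstep.
Qed.

Definition sublap psi x := \sum_(v <- hbasis V) lie_derive op v (lie_derive op v psi) x.

Lemma chain_diff g (P : pt -> Prop) (K r : R) x l : hsmall V r l ->
  (forall (j : 'I_N) y t, (j < m)%N -> P y -> P (op y (t *: e_ j)) -> `|t| <= r ->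
     `|g (op y (t *: e_ j)) - g y| <= K) ->
  (forall k, P (chain op x (take k l))) ->
  `|g (chain op x l) - g x| <= (size l)%:R * K.
Proof.
move=> + hg; elim: l x => [|[t j] l IH] x; first by rewrite /= subrr normr0 mul0r.
move=> /andP[/andP[/= jm tr] lr] hP.
have x0 : P x by have := hP 0%N; rewrite take0.
have x1 : P (op x (t *: e_ j)) by have := hP 1%N; rewrite /= take0.
have h1 := hg j x t jm x0 x1 tr.
have h2 := IH (op x (t *: e_ j)) lr (fun k => hP k.+1).
rewrite -(subrKA (g (op x (t *: e_ j)))) (le_trans (ler_normD _ _))//.
by rewrite (le_trans (lerD h2 h1))// -natr1 mulrDl mul1r.
Qed.

Lemma opN_near_id B e : 0 < e -> exists2 d : R, 0 < d &
  forall x y, `|x| <= B -> `|x - y| <= d -> `|op (- x) y| <= e.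
Proof.
move=> e0; pose Q : set (pt * pt) := [set x | `|x| <= B] `*` [set x | `|x| <= B].
have cQ : compact Q by apply: compact_setX; exact: (@compact_ball R N).
have [d d0 dP] := unif_cts_compact (op_continuous hop) cQ e0.
exists d => // x y xB xy; have := dP (- x, x) (- x, y).
have -> : `|((- x, x) : pt * pt) - (- x, y)| = `|x - y|.
  by rewrite prod_normE/= subrr normr0; apply/max_idPr.
move=> h; have : Q (- x, x) by split; rewrite /= ?normrN.
by move=> /h/(_ xy); rewrite /= (opNx hop) sub0r normrN.
Qed.

(* Chow's theorem turns horizontal Lipschitz bounds into equicontinuity. *)
Lemma chow_equicontinuous (C B e : R) : 0 < C -> 0 < e -> exists d eta Rad, [/\ 0 < d, 0 < eta &
  forall g, (forall (j : 'I_N) y t, (j < m)%N -> `|y| <= Rad -> `|t| <= 1 ->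
       `|g (op y (t *: e_ j)) - g y| <= C * `|t| + eta) ->
    forall x y, `|x| <= B -> `|x - y| <= d -> `|g x - g y| <= e].
Proof.
move=> C0 e0; have [p hp] := chow hop hV V1e.
have [Rad Rad0 RadP] := op_bounded hop B 1.
have [r1 r10 r1P] := reach_small hop V p ltr01.
have p0 : 0 < p%:R + 1 :> R by rewrite ltr_wpDl.
pose eta : R := e / 2 / (p%:R + 1); pose r := Num.min (Num.min r1 1) (eta / C).
have eta0 : 0 < eta by rewrite !divr_gt0.
have r0 : 0 < r by rewrite !lt_min r10 ltr01 divr_gt0.
have [dz dz0 dzP] := hp r r0; have [d d0 dP] := opN_near_id B dz0.
exists d, eta, Rad; split=> // g gP x y xB xy.
have [l [lp lr lE]] := dzP _ (dP x y xB xy).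
have yE : y = chain op x l by rewrite chain_op// -lE (opNK hop).
rewrite distrC {1}yE.
apply: le_trans (@chain_diff g (fun z => `|z| <= Rad) (C * r + eta) r x l lr _ _) _.
- move=> j z t jm zR _ tr; rewrite (le_trans (gP j z t jm zR _))//.
    by rewrite (le_trans tr)// !ge_min lexx orbT.
  by rewrite lerD2r ler_wpM2l// ltW.
- move=> k; rewrite chain_op//; apply: RadP => //.
  apply: r1P; exists (take k l); split=> //.
    by rewrite size_take_min (leq_trans (geq_minr _ _)).
  apply/allP => q /mem_take ql; have /allP/(_ q ql)/andP[-> h] := lr.
  by rewrite (le_trans h)// !ge_min lexx.
have Cr : C * r <= eta by rewrite mulrC -ler_pdivlMr// ge_min lexx orbT.
have lp' : (size l)%:R <= p%:R + 1 :> R by rewrite ler_wpDr// ler_nat.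
have cr0 : 0 <= C * r + eta by rewrite addr_ge0// ltW// mulr_gt0.
apply: le_trans (ler_pM _ cr0 lp' (lerD Cr (lexx eta))) _ => //.
suff -> : (p%:R + 1) * (eta + eta) = e by [].
by rewrite /eta; field; exact: lt0r_neq0.
Qed.

Lemma chow_connected x : exists2 l, hsmall V 1 l & x = chain op 0 l.
Proof.
have [p hp] := chow hop hV V1e; have [d d0 dP] := hp 1 ltr01.
pose n := (Num.truncn (`|x| / d)).+1.
have n0 : 0 < n%:R :> R by [].
have hn k : reach op V (k * p) 1 (k%:R *: (n%:R^-1 *: x)).
  elim: k => [|k IH]; first by rewrite scale0r; exists [::].
  have -> : k.+1%:R *: (n%:R^-1 *: x) = op (k%:R *: (n%:R^-1 *: x)) (1 *: (n%:R^-1 *: x)).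
    by rewrite (exp_op hop) natr1.
  rewrite mulSn addnC; apply: reach_op => //; rewrite scale1r; apply: dP.
  rewrite normrZ gtr0_norm ?invr_gt0// mulrC ler_pdivrMr// mulrC -ler_pdivrMr//.
  by apply: ltW; rewrite truncnS_gt.
by have [l [_ lr lE]] := hn n; exists l => //; rewrite -lE scalerA mulfV ?scale1r// lt0r_neq0.
Qed.

(** A single horizontal chain from 0 to [x] serves for all [g], so the bound is uniform in [g] and
    [eta]. *)
Lemma chow_bounded (C : R) x : 0 < C -> exists M Rad, forall g eta, 0 < eta <= 1 -> g 0 = 0 ->
  (forall (j : 'I_N) y t, (j < m)%N -> `|y| <= Rad -> `|t| <= 1 ->
       `|g (op y (t *: e_ j)) - g y| <= C * `|t| + eta) -> `|g x| <= M.
Proof.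
move=> C0; have [l lr ->] := chow_connected x.
pose Rad : R := \sum_(k < (size l).+1) `|chain op 0 (take k l)|.
exists ((size l)%:R * (C * 1 + 1)), Rad => g eta /andP[eta0 eta1] g0 gP.
have hk (k : 'I_(size l).+1) : `|chain op 0 (take k l)| <= Rad.
  by rewrite /Rad (bigD1 k)//= ler_wpDr// sumr_ge0.
have := @chain_diff g (fun z => `|z| <= Rad) (C * 1 + eta) 1 0 l lr.
rewrite g0 subr0 => h; apply: le_trans (h _ _) _; last by rewrite ler_wpM2l// lerD2l.
  by move=> j y t jm yR _ t1; rewrite (le_trans (gP j y t jm yR t1))// lerD2r ler_wpM2l// ltW.
move=> k; have [kl|kl] := ltnP k (size l).+1; first exact: (hk (Ordinal kl)).
by have := hk ord_max; rewrite /= take_size take_oversize// ltnW.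
Qed.

End adjoint.

Lemma eq0_small {R : realType} (a A : R) :
  (forall e, 0 < e -> e <= 1 -> `|a| <= A * e) -> a = 0.
Proof.
move=> h; apply/eqP; rewrite -normr_le0; apply/ler_addgt0Pr => e e0; rewrite add0r.
have A0 : 0 < `|A| + 1 by rewrite ltr_wpDl.
have d0 : 0 < Num.min 1 (e / (`|A| + 1)) by rewrite lt_min ltr01 divr_gt0.
apply: le_trans (h _ d0 _) _; first by rewrite ge_min lexx.
apply: (@le_trans _ _ ((`|A| + 1) * (e / (`|A| + 1)))).
  apply: (@le_trans _ _ ((`|A| + 1) * Num.min 1 (e / (`|A| + 1)))).
    apply: ler_wpM2r; first exact: ltW.
    by rewrite (le_trans (ler_norm _))// lerDl.
  by rewrite ler_pM2l// ge_min lexx orbT.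
by rewrite mulrC divfK// lt0r_neq0.
Qed.

(** * Weak solutions as limits of the discrete potentials *)

Section limit.
Context {R : realType} {N : nat} (op : 'rV[R]_N -> 'rV[R]_N -> 'rV[R]_N).
Hypothesis hop : is_exp_lie_group op.
Local Notation pt := 'rV[R]_N.
Local Notation e_ i := (delta_mx 0 i : pt).
Implicit Types (x y z v w a : pt) (f g h u psi : pt -> R).
Context (s : nat) (V : nat -> {vspace pt}).
Hypothesis hV : is_stratification op s V.
Local Notation m := (\dim (V 1%N)).
Hypothesis V1e : forall j : 'I_N, (j < m)%N -> e_ j \in V 1%N.
Local Notation hb := (hbasis V).
Local Notation L := (sublap op V).

Definition hlip C g := forall (j : 'I_N) x (t : R), (j < m)%N ->
  `|g (op x (t *: e_ j)) - g x| <= C * `|t|.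

Lemma hlip_small C g (r : R) : 0 < r -> (forall (j : 'I_N) x (t : R), (j < m)%N -> `|t| <= r ->
  `|g (op x (t *: e_ j)) - g x| <= C * `|t|) -> hlip C g.
Proof.
move=> r0 h j x t jm; pose n := (Num.truncn (`|t| / r)).+1.
have n0 : 0 < n%:R :> R by [].
have t1 : `|t / n%:R| <= r.
  by rewrite normrM normfV (ger0_norm (ler0n _ n)) ler_pdivrMr// mulrC -ler_pdivrMr// ltW// truncnS_gt.
have hk k : `|g (op x ((k%:R * (t / n%:R)) *: e_ j)) - g x| <= k%:R * (C * `|t / n%:R|).
  elim: k => [|k IH]; first by rewrite !mul0r scale0r (opx0 hop) subrr normr0.
  have -> : op x ((k.+1%:R * (t / n%:R)) *: e_ j) =
      op (op x ((k%:R * (t / n%:R)) *: e_ j)) ((t / n%:R) *: e_ j).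
    by rewrite -(opA hop) (exp_op hop) -natr1 mulrDl mul1r.
  rewrite -(subrKA (g (op x ((k%:R * (t / n%:R)) *: e_ j)))) (le_trans (ler_normD _ _))//.
  by rewrite -natr1 [in leRHS]mulrDl mul1r addrC lerD// h.
have := hk n; rewrite [n%:R * (t / _)]mulrC divfK ?lt0r_neq0// => h'; apply: le_trans h' _.
rewrite normrM normfV (ger0_norm (ler0n _ n)) mulrCA mulrA -mulrA.
by rewrite [n%:R * _]mulrC divfK// lt0r_neq0.
Qed.

Lemma hlip_continuous C g : 0 < C -> hlip C g -> continuous g.
Proof.
move=> C0 hg; apply/cts_distP => x e e0.
have [d [eta [Rad [d0 eta0 dP]]]] := chow_equicontinuous hop hV V1e `|x| C0 e0.
exists d => // y xy; apply: (dP g) => // j z t jm _ _.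
by rewrite (le_trans (hg _ _ _ jm))// lerDl ltW.
Qed.

Lemma bsupp_walk vs : (forall v, v \in vs -> `|v| <= 1) -> forall B, exists B' : R,
  B <= B' /\ forall e f, 0 < e <= 1 -> bsupp B f -> bsupp B' (foldr (avgstep op e) f vs).
Proof.
elim: vs => [_ B|v vs IH vs1 B]; first by exists B.
have [|C [BC CP]] := IH _ B; first by move=> w ws; apply: vs1; rewrite inE ws orbT.
have [D D0 DP] := bsupp_op hop C 1.
exists (Num.max C D); split=> [|e f e1 fB]; first by rewrite le_max BC.
move=> x; rewrite gt_max => /andP[xC xD] /=.
have fC := CP e f e1 fB; move: e1 => /andP[e0 e1].
have h (b : R) : `|b| <= 1 -> foldr (avgstep op e) f vs (op x (b *: v)) = 0.
  move=> b1; have [] := DP _ fC (b *: v) => [|+ _]; last exact.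
  by rewrite normrZ mulr_ile1// vs1// inE eqxx.
rewrite /avgstep !h ?normrN ?gtr0_norm//.
by rewrite (fC x xC) mulr0 !addr0 mulr0.
Qed.

Lemma hb_le1 v : v \in hb -> `|v| <= 1.
Proof. by move=> /hbasisP[j _ ->]; exact: norm_delta_le1. Qed.

Lemma sublap_continuous psi : is_Ck 2 psi -> continuous (L psi).
Proof.
move=> p2; apply: cts_sum => v _; apply: lie_derive_continuous => //; exact: lie_derive_C1.
Qed.

Lemma sublap_bsupp B psi : bsupp B psi -> bsupp B (L psi).
Proof.
move=> pB x xB; rewrite /sublap big1// => v _.
by rewrite (bsupp_lie_derive hop v (bsupp_lie_derive hop v pB)).
Qed.

Lemma green_approx B : exists2 C : R, 0 < C &
  forall F, continuous F -> (forall y, `|F y| <= 1) -> bsupp B F ->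
  forall eta Rad, 0 < eta -> 0 < Rad -> almost_green op V F C eta Rad.
Proof.
have : (0 < m)%N by rewrite lt0n dimv_eq0 (strat_neq0 hV)//= (strat_gt0 hV).
rewrite leq_eqVlt => /predU1P[m1|m2]; last exact: (green_approx_ge2 hop hV V1e B m2).
exact: (green_approx_1 hop hV V1e B (esym m1)).
Qed.

Lemma rint_walk_sub e h psi : 0 < e -> lbm h -> bms psi ->
  rint (fun x => h x * (4 / e ^+ 2 * (foldr (avgstep op e) psi (rev hb) x - psi x))) =
  rint (fun x => (4 / e ^+ 2 * (foldr (avgstep op e) h hb x - h x)) * psi x).
Proof.
move=> e0 hh hp; set c := 4 / e ^+ 2.
have b1 vs : bms (foldr (avgstep op e) psi vs) by elim: vs => //= v vs; exact: bms_avgstep.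
have b2 vs : lbm (foldr (avgstep op e) h vs) by elim: vs => //= v vs; exact: lbm_avgstep.
transitivity (c * (rint (fun x => h x * foldr (avgstep op e) psi (rev hb) x) - rint (fun x => h x * psi x))).
  rewrite -rintB -?rintZ; [|by apply: bmsB; exact: bmsMl|exact: bmsMl|exact: bmsMl].
  by congr rint; apply/funext => x; rewrite mulrCA mulrBr.
rewrite (rint_walk hop hV)// revK -rintB -?rintZ; [|by apply: bmsB; exact: bmsMl|exact: bmsMl|exact: bmsMl].
by congr rint; apply/funext => x; rewrite -mulrA mulrBl.
Qed.

(** The right sides [F i] need to converge only when paired with the test function [psi]; all
    compactness comes from the uniform horizontal bounds on the potentials. *)
Lemma green_limit B : exists2 C : R, 0 < C & forall F : nat -> pt -> R,
  (forall i, continuous (F i)) -> (forall i y, `|F i y| <= 1) -> (forall i, bsupp B (F i)) ->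
  exists2 h, hlip C h & forall psi B' c, is_Ck 2 psi -> bsupp B' psi ->
    (forall e, 0 < e -> exists i0, forall i, (i0 <= i)%N -> `|rint (fun x => F i x * psi x) - c| <= e) ->
    rint (fun x => h x * L psi x) = c.
Proof.
have [C C0 CP] := green_approx B; exists C => // F Fc F1 FB.
have i0 i : 0 < i.+1%:R :> R by [].
have /choice[eh ehP] : forall i, exists eh : R * (pt -> R), [/\ 0 < eh.1 <= i.+1%:R^-1, continuous eh.2, eh.2 0 = 0,
  forall x, `|x| <= i.+1%:R -> `|4 / eh.1 ^+ 2 * (foldr (avgstep op eh.1) eh.2 hb x - eh.2 x) - F i x| <= i.+1%:R^-1 &
  forall (j : 'I_N) x t, (j < m)%N -> `|x| <= i.+1%:R -> `|t| <= 1 ->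
    `|eh.2 (op x (t *: e_ j)) - eh.2 x| <= C * `|t| + i.+1%:R^-1].
  move=> i; have iV : 0 < i.+1%:R^-1 :> R by rewrite invr_gt0.
  by have [e [h hP]] := CP (F i) (Fc i) (F1 i) (FB i) _ _ iV (i0 i); exists (e, h).
pose h i := (eh i).2.
(* Limits along an ultrafilter replace the extraction of subsequences: they exist at all points at
   once as soon as the values at each point are bounded. *)
have [U [UU Uoo]] := ultraFilterLemma (F := \oo%classic : set_system nat) _.
have Uge (a : R) : \forall i \near U, a <= i.+1%:R.
  apply: Uoo; exists (Num.truncn a) => // i /= ai.
  by rewrite (le_trans (ltW (truncnS_gt a)))// ler_nat.
have UgeV (a : R) : 0 < a -> \forall i \near U, i.+1%:R^-1 <= a.
  move=> a0; apply: filterS (Uge a^-1) => i h1.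
  by rewrite -[a]invrK lef_pV2 ?posrE ?invr_gt0.
have /choice[hh hhP] : forall x, exists p : R, forall e, 0 < e -> \forall i \near U, `|h i x - p| <= e.
  move=> x; have [M [Rad MP]] := chow_bounded hop hV V1e x C0.
  have hM : \forall i \near U, `|h i x| <= M.
    near=> i; have [_ _ h0 _ hi] := ehP i.
    apply: (MP (h i) i.+1%:R^-1) => //.
      by rewrite invr_gt0 i0/= invf_le1// ler1n.
    move=> j y t jm yR t1; apply: hi => //; apply: le_trans yR _.
    by near: i.
  have [p [_ pP]] : `[- M, M]%classic `&` cluster ((fun i => h i x) @ U) !=set0.
    apply: (@segment_compact R (- M) M); apply: filterS hM => i.
    by rewrite /= in_itv/= ler_norml.
  exists p => e e0.
  have [//|h1] := in_ultra_setVsetC [set i | `|h i x - p| <= e] UU.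
  have [] := pP (~` [set t | `|t - p| <= e]) (ball p e) h1 (nbhsx_ballx _ _ e0).
  by move=> t [/= h2 h3]; exfalso; apply: h2; move: h3; rewrite -ball_normE /ball_/= distrC => /ltW.
have equi B' (e : R) : 0 < e -> exists2 d : R, 0 < d &
    \forall i \near U, forall x y, `|x| <= B' -> `|x - y| <= d -> `|h i x - h i y| <= e.
  move=> e0; have [d [eta [Rad [d0 eta0 dP]]]] := chow_equicontinuous hop hV V1e B' C0 e0.
  exists d => //; near=> i; apply: dP => j y t jm yR t1; have [_ _ _ _ hi] := ehP i.
  apply: le_trans (hi j y t jm _ t1) _; first by apply: le_trans yR _; near: i.
  by rewrite lerD2l; near: i; exact: UgeV.
have hhequi B' (e : R) : 0 < e -> exists2 d : R, 0 < d &
    forall x y, `|x| <= B' -> `|x - y| <= d -> `|hh x - hh y| <= e.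
  move=> e0; have [d d0 dP] := equi B' _ e0; exists d => // x y xB xy.
  apply/ler_addgt0Pr => r r0; have r2 : 0 < r / 2 by rewrite divr_gt0.
  have [i [[h1 h2] h3]] := filter_ex (filterI (filterI (hhP x _ r2) (hhP y _ r2)) dP).
  have h4 := h3 x y xB xy; move: h1 h2 h4; rewrite /= !ler_norml.
  by move=> /andP[? ?] /andP[? ?] /andP[? ?]; apply/andP; split; lra.
have unif B' (e : R) : 0 < e -> \forall i \near U, forall x, `|x| <= B' -> `|h i x - hh x| <= e.
  move=> e0; have e3 : 0 < e / 3 by rewrite divr_gt0.
  have [d d0 dP] := equi B' _ e3; have [d' d'0 dP'] := hhequi B' _ e3.
  apply: ((compact_near_coveringP [set x : pt | `|x| <= B']).1 (@compact_ball R N B') _ U (fun i x => `|h i x - hh x| <= e)) => x xB.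
  exists (ball x (Num.min d d'), [set i | (forall x y, `|x| <= B' -> `|x - y| <= d -> `|h i x - h i y| <= e / 3) /\ `|h i x - hh x| <= e / 3]).
    split; first by apply: nbhsx_ballx; rewrite lt_min d0.
    by apply: filterI => //; exact: hhP.
  move=> [y i] /= [+ [h1 h2]]; rewrite -ball_normE /ball_/= lt_min => /andP[yd yd'].
  have h3 := h1 x y xB (ltW yd); have h4 := dP' x y xB (ltW yd').
  by move: h2 h3 h4; rewrite !ler_norml => /andP[? ?] /andP[? ?] /andP[? ?]; apply/andP; split; lra.
have hhlip : hlip C hh.
  apply: (hlip_small ltr01) => j x t jm t1; apply/ler_addgt0Pr => r r0.
  have r3 : 0 < r / 3 by rewrite divr_gt0.
  have [i [[[h1 h2] h3] h4]] := filter_ex (filterI (filterI (filterI (hhP x _ r3) (hhP (op x (t *: e_ j)) _ r3)) (UgeV _ r3)) (Uge `|x|)).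
  have [_ _ _ _ /(_ j x t jm h4 t1) h5] := ehP i.
  move: h1 h2 h3 h5; rewrite /= -/(h i) !ler_norml.
  move: (h i (op x _)) (h i x) (hh (op x _)) (hh x) (C * `|t|) (i.+1%:R^-1) => b1 b2 b3 b4 b5 b6.
  by move=> /andP[? ?] /andP[? ?] ? /andP[? ?]; apply/andP; split; lra.
have hhc : continuous hh by exact: hlip_continuous hhlip.
exists hh => // psi B' c p2 pB hc.
have [|B1 [B'1 B1P]] := @bsupp_walk (rev hb) _ B'; first by move=> v; rewrite mem_rev; exact: hb_le1.
have pB1 : bsupp B1 psi by move=> x /(le_lt_trans B'1); exact: pB.
have pc : continuous psi by exact: is_Ck_continuous p2.
have bp := cts_bms pc pB; have Lc := sublap_continuous p2; have LB := sublap_bsupp pB1.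
have bL := cts_bms Lc LB.
have [K K0 KP] := @rint_le R N B1.
have [M M0 MP] := bounded_on_ball B1 hhc.
have [Mp Mp0 MpP] := bounded_on_ball B1 pc.
have [ML ML0 MLP] := bounded_on_ball B1 Lc.
(* There are four errors: from the limit to [h i], from [L psi] to its discrete version, from the
   exact discrete equation to the approximate one, and from the pairing with [F i] to its limit. *)
apply/eqP; rewrite -subr_eq0; apply/eqP; apply: (@eq0_small _ _ (K * ML + K * (M + 1) + K * Mp + 1)) => e e0 e1.
have [|d d0 dP] := @walk_taylor _ _ op hop _ psi (rev hb) e p2 _ pB e0.
  by move=> v _; apply: lie_derive_continuous => //; exact: lie_derive_C1.
have [i1 i1P] := hc e e0.
have [i [[[[[h1 h2] h3] h4] h5] h6]] := filter_ex (filterI (filterI (filterI (filterI (filterI (unif B1 e e0) (UgeV _ e0)) (UgeV _ d0)) (Uge B1)) (Uge i1.+1%:R)) (UgeV _ ltr01)).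
have [/andP[ei0 ei1] hic hi0 hiF _] := ehP i; rewrite -/(h i) in hic hi0 hiF.
set ei := (eh i).1 in ei0 ei1 hiF.
have hil := cts_lbm hic; have hhl := cts_lbm hhc.
(* The directions are reversed because this is the adjoint of the discrete operator that acts on
   [h i]. *)
pose Le psi x := 4 / ei ^+ 2 * (foldr (avgstep op ei) psi (rev hb) x - psi x).
have bLe : bms (Le psi).
  apply: bmsZ; apply: bmsB => //.
  by elim: (rev hb) => //= v vs; exact: bms_avgstep.
have LeB : bsupp B1 (Le psi).
  have ei01 : 0 < ei <= 1 by rewrite ei0 (le_trans ei1).
  by move=> x xB; rewrite /Le (B1P ei psi ei01 pB x xB) pB1// subrr mulr0.
have hiM x : `|x| <= B1 -> `|h i x| <= M + 1.
  move=> xB; have := h1 x xB; have := MP x xB; rewrite !ler_norml => /andP[? ?] /andP[? ?].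
  by apply/andP; split; lra.
have t1 : `|rint (fun x => hh x * L psi x) - rint (fun x => h i x * L psi x)| <= K * (e * ML).
  rewrite -rintB; [|exact: bmsMl|exact: bmsMl].
  apply: KP; [by apply: bmsB; exact: bmsMl|by move=> x xB; rewrite LB// !mulr0 subrr|by rewrite mulr_ge0// ltW|].
  by move=> x xB; rewrite -mulrBl normrM ler_pM ?MLP// distrC h1.
have t2 : `|rint (fun x => h i x * L psi x) - rint (fun x => h i x * Le psi x)| <= K * ((M + 1) * e).
  rewrite -rintB; [|exact: bmsMl|exact: bmsMl].
  apply: KP; [by apply: bmsB; exact: bmsMl|by move=> x xB; rewrite LB// LeB// !mulr0 subrr|by rewrite mulr_ge0 ?addr_ge0// ltW|].
  move=> x xB; rewrite -mulrBr normrM ler_pM ?hiM// distrC /L /sublap -big_rev.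
  by apply: dP => //; exact: le_trans ei1 h3.
have bFi : lbm (F i) by exact: cts_lbm.
have b3 : lbm (fun x => 4 / ei ^+ 2 * (foldr (avgstep op ei) (h i) hb x - h i x)).
  apply: lbmM; first exact: lbm_cst.
  have hm : lbm (fun x => -1 * h i x) by apply: lbmM => //; exact: lbm_cst.
  rewrite (_ : (fun x => _) = fun x => foldr (avgstep op ei) (h i) hb x + -1 * h i x).
    by apply: lbmD => //; elim: (hb) => //= v vs; exact: lbm_avgstep.
  by apply/funext => x; rewrite mulN1r.
have t3 : `|rint (fun x => h i x * Le psi x) - rint (fun x => F i x * psi x)| <= K * (e * Mp).
  rewrite rint_walk_sub// -rintB; [|exact: bmsMl|exact: bmsMl].
  apply: KP; [by apply: bmsB; exact: bmsMl|by move=> x xB; rewrite pB1// !mulr0 subrr|by rewrite mulr_ge0// ltW|].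
  move=> x xB; rewrite -mulrBl normrM ler_pM ?MpP//.
  by apply: le_trans h2; apply: hiF; exact: le_trans xB h4.
have t5 : `|rint (fun x => F i x * psi x) - c| <= e by apply: i1P; move: h5; rewrite /= ler_nat ltnS.
move: t1 t2 t3 t5; move: (rint _) (rint (fun x => h i x * _)) (rint (fun x => h i x * Le psi x)) (rint _) => a1 a2 a3 a4.
by rewrite !ler_norml => /andP[? ?] /andP[? ?] /andP[? ?] /andP[? ?]; apply/andP; split; lra.
Unshelve. all: by end_near. Qed.

End limit.

Lemma sum_seq_le {R : realType} (T : eqType) (r : seq T) (F : T -> R) K :
  (forall v, v \in r -> F v <= K) -> \sum_(v <- r) F v <= (size r)%:R * K.
Proof.
elim: r => [|v r IH] h; first by rewrite big_nil mul0r.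
rewrite big_cons -natr1 mulrDl mul1r addrC lerD ?h ?inE ?eqxx// IH// => w wr.
by rewrite h// inE wr orbT.
Qed.

Section local_continuity.
Context {R : realType} {U W : normedModType R}.

Lemma cts_mul_supp (S : set U) (f g : U -> R) : continuous f -> (forall x, ~ S x -> f x = 0) ->
  closed S -> (forall x, S x -> {for x, continuous g}) -> continuous (fun x => f x * g x).
Proof.
move=> cf fS Sc cg x; have [Sx|nSx] := pselect (S x).
  by apply: cvgM; [exact: cf|exact: cg].
have nS : \forall y \near x, ~ S y.
  by have := closed_openC Sc; rewrite openE => /(_ x nSx).
have : f x * g y @[y --> x] --> f x * g x by rewrite fS// mul0r; under eq_cvg do rewrite mul0r; exact: cvg_cst.
apply: cvg_trans; apply: near_eq_cvg; apply: filterS nS => y nSy.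
by rewrite !fS// !mul0r.
Qed.

Lemma cts_at_comp (f : U -> W) (g : W -> R) x :
  continuous f -> {for f x, continuous g} -> {for x, continuous (fun x => g (f x))}.
Proof. by move=> cf cg; apply: (cvg_comp _ _ (cf x) cg). Qed.

End local_continuity.

(** * Localization *)

Section second_differences.
Context {R : realType} {N : nat} (op : 'rV[R]_N -> 'rV[R]_N -> 'rV[R]_N).
Hypothesis hop : is_exp_lie_group op.
Local Notation pt := 'rV[R]_N.
Local Notation e_ i := (delta_mx 0 i : pt).
Implicit Types (x y z v w a : pt) (f g h u k psi phi : pt -> R) (d e : R).
Context (s : nat) (V : nat -> {vspace pt}).
Hypothesis hV : is_stratification op s V.
Local Notation m := (\dim (V 1%N)).
Hypothesis V1e : forall j : 'I_N, (j < m)%N -> e_ j \in V 1%N.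
Local Notation hb := (hbasis V).
Local Notation L := (sublap op V).
Local Notation X := (lie_derive op).

Lemma flow_lip B f v : is_C1 f -> bsupp B f -> exists2 C : R, 0 < C &
  forall x (t : R), `|f (op x (t *: v)) - f x| <= C * `|t|.
Proof.
move=> f1 fB; have cX : continuous (X v f) by exact: lie_derive_continuous.
have [C C0 CP] := bounded_on_ball B cX.
have XC y : `|X v f y| <= C.
  have [yB|/CP//] := ltP B `|y|.
  by rewrite (bsupp_lie_derive hop v fB)// normr0 ltW.
exists C => // x t.
have lin (r : R) : is_derive r 1 (fun r : R => t * r) t.
  have := is_deriveM (is_derive_cst t r 1) (is_derive_id r 1); move=> h.
  by apply: is_derive_eq h _; rewrite /GRing.scale/= mulr0 addr0 mulr1.
have [c _] := MVT01 (fun r => @is_derive_comp1 _ _ _ (fun r => t * r) _ _ _ (is_derive_lie hop x v _ f1) (lin r)).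
by rewrite /= mulr1 mulr0 scale0r (opx0 hop) => ->; rewrite normrZ mulrC ler_wpM2r.
Qed.

Definition sdiff1 d v f x := f (op x (d *: v)) + f (op x (- d *: v)) - 2 * f x.
Definition sdiff d f x := d ^- 2 * \sum_(v <- hb) sdiff1 d v f x.

Lemma sdiff_cvg B psi e : is_Ck 2 psi -> bsupp B psi -> 0 < e ->
  exists2 d0 : R, 0 < d0 & forall d, 0 < d -> d <= d0 -> forall x, `|sdiff d psi x - L psi x| <= e.
Proof.
move=> p2 pB; rewrite /sdiff /sublap; elim: hb e => [|v vs IH] e e0.
  by exists 1 => // d _ _ x; rewrite !big_nil mulr0 subrr normr0 ltW.
have e2 : 0 < e / 2 by rewrite divr_gt0.
have [d0 d00 d0P] := IH _ e2; have [d1 d10 d1P] := taylor2 hop v p2 pB e2.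
exists (Num.min d0 d1) => [|d dd]; first by rewrite lt_min d00.
rewrite le_min => /andP[dd0 dd1] x; rewrite !big_cons mulrDr opprD addrACA.
rewrite (le_trans (ler_normD _ _))// [leRHS]splitr lerD ?d0P//.
have dsq : 0 < d ^+ 2 by rewrite exprn_gt0.
have := d1P x d; rewrite gtr0_norm// => /(_ dd1).
rewrite -/(sdiff1 d v psi x); move: (sdiff1 d v psi x) (X v _ x) => a b h.
have -> : d ^- 2 * a - b = d ^- 2 * (a - d ^+ 2 * b) by field; exact: lt0r_neq0.
by rewrite normrM gtr0_norm ?invr_gt0// mulrC ler_pdivrMr.
Qed.

Lemma bms_sum (I : Type) (r : seq I) (f : I -> pt -> R) : (forall i, bms (f i)) ->
  bms (fun x => \sum_(i <- r) f i x).
Proof.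
move=> hf; elim: r => [|i r IH].
  by rewrite (_ : (fun x => _) = fun=> 0); [exact: bms0|apply/funext => x; rewrite big_nil].
rewrite (_ : (fun x => _) = fun x => f i x + \sum_(i <- r) f i x); first exact: bmsD.
by apply/funext => x; rewrite big_cons.
Qed.

Lemma rint_sum (I : Type) (r : seq I) (f : I -> pt -> R) : (forall i, bms (f i)) ->
  rint (fun x => \sum_(i <- r) f i x) = \sum_(i <- r) rint (f i).
Proof.
move=> hf; elim: r => [|i r IH].
  rewrite big_nil -[RHS](@rint0 R N); congr rint; by apply/funext => x; rewrite big_nil.
rewrite big_cons -IH -rintD//; last exact: bms_sum.
by congr rint; apply/funext => x; rewrite big_cons.
Qed.

Lemma bms_sdiff1 d v f : bms f -> bms (sdiff1 d v f).
Proof.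
move=> hf; have h : bms (fun x => f (op x (d *: v)) + f (op x (- d *: v)) - 2 * f x).
  by apply: bmsB; [apply: bmsD; exact: (bms_op hop)|exact: bmsZ].
exact: h.
Qed.

Lemma bms_sdiff d f : bms f -> bms (sdiff d f).
Proof. by move=> hf; apply: bmsZ; apply: bms_sum => v; exact: bms_sdiff1. Qed.

Let rint_comb f g h : bms f -> bms g -> bms h ->
  rint (fun x => f x + g x - 2 * h x) = rint f + rint g - 2 * rint h.
Proof. by move=> hf hg hh; rewrite rintB ?rintD ?rintZ//; [exact: bmsD|exact: bmsZ]. Qed.

Lemma rint_sdiff1 d v u f : bms u -> bms f ->
  rint (fun x => u x * sdiff1 d v f x) = rint (fun x => sdiff1 d v u x * f x).
Proof.
move=> hu hf; have hu' := bms_lbm hu.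
have hf1 := bms_op hop (d *: v) hf; have hf2 := bms_op hop (- d *: v) hf.
have hu1 := bms_lbm (bms_op hop (- (d *: v)) hu); have hu2 := bms_lbm (bms_op hop (- (- d *: v)) hu).
transitivity (rint (fun x => u x * f (op x (d *: v)) + u x * f (op x (- d *: v)) - 2 * (u x * f x))).
  by congr rint; apply/funext => x; rewrite /sdiff1; move: (f _) (f (op x (d *: v))) (f x) => a b c; ring.
rewrite rint_comb; [|exact: bmsMl|exact: bmsMl|exact: bmsMl].
rewrite (rint_adj hop hV (d *: v) hu' hf) (rint_adj hop hV (- d *: v) hu' hf).
rewrite -rint_comb; [|exact: bmsMl|exact: bmsMl|exact: bmsMl].
congr rint; apply/funext => x; rewrite /sdiff1 -(scaleNr d v) -(scaleNr (- d) v) opprK.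
by move: (u _) (u (op x (d *: v))) (u x) => a b c; ring.
Qed.

Lemma rint_sdiff d u f : bms u -> bms f ->
  rint (fun x => u x * sdiff d f x) = rint (fun x => sdiff d u x * f x).
Proof.
move=> hu hf; have hu' := bms_lbm hu.
have b1 v : bms (fun x => u x * sdiff1 d v f x) by apply: bmsMl => //; exact: bms_sdiff1.
have b2 v : bms (fun x => sdiff1 d v u x * f x) by apply: bmsMl => //; exact/bms_lbm/bms_sdiff1.
transitivity (rint (fun x => d ^- 2 * \sum_(v <- hb) u x * sdiff1 d v f x)).
  by congr rint; apply/funext => x; rewrite /sdiff mulrCA mulr_sumr.
transitivity (rint (fun x => d ^- 2 * \sum_(v <- hb) sdiff1 d v u x * f x)); last first.
  by congr rint; apply/funext => x; rewrite /sdiff -mulrA mulr_suml.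
rewrite !rintZ; [|exact: bms_sum|exact: bms_sum].
by rewrite !rint_sum//; congr (_ * _); apply: eq_bigr => v _; exact: rint_sdiff1.
Qed.

Section cutoff_product.
Variables (S : set pt) (phi k : pt -> R) (delta A : R).
(** The closed [r]-neighbourhood of [S]. Since [k] is regular only in [Nb delta], its values near
    the support of [phi] are reached by small displacements only. *)
Let Nb r x := exists2 y, S y & `|x - y| <= r.
Hypotheses (cS : compact S) (phi2 : is_Ck 2 phi) (phiS : forall x, ~ S x -> phi x = 0).
Hypotheses (d0 : 0 < delta) (A0 : 0 < A) (bk : bms k).
Hypothesis kc : forall x, Nb delta x -> {for x, continuous k}.
Hypothesis kL : forall (j : 'I_N) x t, (j < m)%N -> Nb delta x -> Nb delta (op x (t *: e_ j)) ->
  `|k (op x (t *: e_ j)) - k x| <= A * `|t|.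

Let Sb : exists2 B : R, 0 < B & forall x, S x -> `|x| <= B.
Proof. exact: compact_bounded_norm cS. Qed.

Let phi_bsupp : exists2 B : R, 0 < B & bsupp B phi.
Proof.
have [B B0 BP] := Sb; exists B => // x xB; apply: phiS => /BP.
by rewrite leNgt xB.
Qed.

Let SNb x r : 0 <= r -> S x -> Nb r x.
Proof. by move=> r0 Sx; exists x => //; rewrite subrr normr0. Qed.

(** A small move either stays where [k] is regular, or has both ends where [phi] vanishes; the half
    of [delta] leaves room for the move. *)
Let displacement : exists2 d1 : R, 0 < d1 & forall x a, `|a| <= d1 ->
  (Nb (delta / 2) x -> Nb delta (op x a)) /\ (~ Nb (delta / 2) x -> phi x = 0 /\ phi (op x a) = 0).
Proof.
have [B B0 BP] := Sb; have d2 : 0 < delta / 2 by rewrite divr_gt0.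
have [d1 d10 dP] := op_near_id hop (B + delta) d2.
exists d1 => // x a ad; split=> [[y Sy xy]|nN].
  have xB : `|x| <= B + delta.
    have := BP y Sy; have := ler_normD (x - y) y; rewrite subrK; lra.
  have [h _] := dP x a xB ad; exists y => //.
  have := ler_normD (x - y) (op x a - x); rewrite distrC in h.
  by rewrite addrC addrA subrK; lra.
split; apply: phiS => Sx; apply: nN; first by apply: SNb => //; exact: ltW.
exists (op x a) => //; have xB : `|op x a| <= B + delta by rewrite (le_trans (BP _ Sx))// lerDl ltW.
have [||h _] := dP (op x a) (- a); rewrite ?normrN//.
by move: h; rewrite (opxK hop) distrC.
Qed.

Let hb_small v d : v \in hb -> `|d *: v| <= `|d|.
Proof. by move=> vh; rewrite normrZ ler_piMr//; exact: (hb_le1 vh). Qed.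

Let k_bound : exists2 M : R, 0 < M & forall x, `|k x| <= M.
Proof.
have [_ [B [M MP]]] := bk; exists (`|M| + 1) => [|x]; first by rewrite ltr_wpDl.
by rewrite (le_trans (MP x).1)// (le_trans (ler_norm M))// lerDl.
Qed.

Let cphi : continuous phi. Proof. exact: is_Ck_continuous phi2. Qed.
Let phi1 : is_C1 phi. Proof. exact: is_Ck_C1 phi2. Qed.

Let cphik : continuous (fun x => phi x * k x).
Proof.
apply: (@cts_mul_supp R pt S) => //; first exact: compact_closed (@norm_hausdorff _ _) cS.
by move=> x Sx; apply: kc; apply: SNb => //; exact: ltW.
Qed.

Let bphi : bms phi.
Proof. by have [B _ hB] := phi_bsupp; exact: cts_bms hB. Qed.

Let bphik : bms (fun x => phi x * k x).
Proof. by apply: bmsM => //; exact: bms_lbm. Qed.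

Let phi_lip : exists2 C : R, 0 < C & forall v x t, v \in hb -> `|phi (op x (t *: v)) - phi x| <= C * `|t|.
Proof.
have [B _ hB] := phi_bsupp.
elim: hb => [|v vs [C C0 CP]]; first by exists 1.
have [D D0 DP] := flow_lip v phi1 hB.
exists (C + D) => [|w x t]; first by rewrite addr_gt0.
rewrite inE => /predU1P[->|ws].
  by rewrite (le_trans (DP x t))// ler_wpM2r// lerDr ltW.
by rewrite (le_trans (CP w x t ws))// ler_wpM2r// lerDl ltW.
Qed.

Let phi_second : exists C d1 : R, [/\ 0 < C, 0 < d1 & forall v x d, v \in hb -> 0 < d -> d <= d1 ->
  `|sdiff1 d v phi x| <= C * d ^+ 2].
Proof.
have [B _ hB] := phi_bsupp.
elim: hb => [|v vs [C [d1 [C0 d10 CP]]]]; first by exists 1, 1.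
have [d2 d20 dP] := taylor2 hop v phi2 hB ltr01.
have cXX : continuous (X v (X v phi)) by apply: lie_derive_continuous => //; exact: lie_derive_C1.
have [M M0 MP] := bounded_on_ball B cXX.
have XM x : `|X v (X v phi) x| <= M.
  have [xB|/MP//] := ltP B `|x|.
  by rewrite (bsupp_lie_derive hop v (bsupp_lie_derive hop v hB))// normr0 ltW.
exists (C + (M + 1)), (Num.min d1 d2); split; [by rewrite !addr_gt0|by rewrite lt_min d10|].
move=> w x d; rewrite inE le_min => /predU1P[->|ws] dd /andP[dd1 dd2]; last first.
  by rewrite (le_trans (CP w x d ws dd dd1))// ler_wpM2r ?sqr_ge0// lerDl addr_ge0// ltW.
have := dP x d; rewrite gtr0_norm// => /(_ dd2).
rewrite -/(sdiff1 d v phi x); move: (sdiff1 d v phi x) (X v _ x) (XM x) => a b bM h.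
have dsq : 0 <= d ^+ 2 by rewrite sqr_ge0.
rewrite -[a](subrK (d ^+ 2 * b)) (le_trans (ler_normD _ _))// normrM (ger0_norm dsq).
have := ler_wpM2l dsq bM; have := mulr_ge0 (ltW C0) dsq; move: h; rewrite mul1r.
by move: (d ^+ 2 * `|b|) (`|a - _|) => c1 c2 h1 h2 h3; rewrite !mulrDl mul1r [M * _]mulrC; lra.
Qed.

Let Fd d x := sdiff d (fun x => phi x * k x) x - phi x * sdiff d k x.

Let FdE d x : Fd d x = d ^- 2 * \sum_(v <- hb) ((phi (op x (d *: v)) - phi x) * k (op x (d *: v)) +
  (phi (op x (- d *: v)) - phi x) * k (op x (- d *: v))).
Proof.
rewrite /Fd /sdiff mulrCA -mulrBr mulr_sumr -sumrB; congr (_ * _); apply: eq_bigr => v _.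
rewrite /sdiff1; move: (phi _) (phi (op x (d *: v))) (phi x) (k _) (k (op x (d *: v))) (k x).
by move=> a1 a2 a3 b1 b2 b3; ring.
Qed.

Let Fd_bound : exists C d1 : R, [/\ 0 < C, 0 < d1 & forall d, 0 < d -> d <= d1 -> forall x,
  `|Fd d x| <= C /\ (~ Nb (delta / 2) x -> Fd d x = 0)].
Proof.
have [C C0 CP] := phi_lip; have [D [d1 [D0 d10 DP]]] := phi_second.
have [d2 d20 dP] := displacement; have [M M0 MP] := k_bound.
pose K := D * M + 2 * (C * A).
have K0 : 0 < K by rewrite addr_gt0 ?mulr_gt0.
exists ((size hb)%:R * K + 1), (Num.min d1 d2); split.
- by rewrite ltr_wpDl// mulr_ge0// ltW.
- by rewrite lt_min d10.
move=> d dd; rewrite le_min => /andP[dd1 dd2] x.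
have small v : v \in hb -> `|d *: v| <= d2 /\ `|- d *: v| <= d2.
  by move=> vh; split; rewrite (le_trans (hb_small _ vh))// ?normrN gtr0_norm.
have F0 : ~ Nb (delta / 2) x -> Fd d x = 0.
  move=> nN; rewrite FdE big_seq big1 ?mulr0// => v vh; have [s1 s2] := small v vh.
  have [_ /(_ nN)[-> ->]] := dP x _ s1; have [_ /(_ nN)[_ ->]] := dP x _ s2.
  by rewrite subrr !mul0r addr0.
split=> //; have [hN|/F0 ->] := pselect (Nb (delta / 2) x); last first.
  by rewrite normr0 addr_ge0// mulr_ge0// ltW.
have hN' : Nb delta x.
  by have [y Sy xy] := hN; exists y => //; rewrite (le_trans xy)// ler_pdivrMr// ler_pMr// ler1n.
have dsq : 0 < d ^+ 2 by rewrite exprn_gt0.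
rewrite FdE normrM gtr0_norm ?invr_gt0// mulrC ler_pdivrMr//.
apply: (@le_trans _ _ ((size hb)%:R * K * d ^+ 2)); last by apply: ler_wpM2r; [exact: ltW|rewrite lerDl].
rewrite (le_trans (ler_norm_sum _ _ _))//.
rewrite -mulrA; apply: sum_seq_le => v vh.
have [s1 s2] := small v vh; have [/(_ hN) N1 _] := dP x _ s1; have [/(_ hN) N2 _] := dP x _ s2.
have [j jm vE] := hbasisP vh.
have k1 : `|k (op x (d *: v)) - k x| <= A * d.
  by have := @kL j x d jm hN'; rewrite -vE (gtr0_norm dd); exact.
have k2 : `|k (op x (- d *: v)) - k x| <= A * d.
  by have := @kL j x (- d) jm hN'; rewrite -vE normrN (gtr0_norm dd); exact.
have p1 := CP v x d vh; have p2 := CP v x (- d) vh; rewrite (gtr0_norm dd) in p1; rewrite normrN (gtr0_norm dd) in p2.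
have q := DP v x d vh dd dd1; rewrite /sdiff1 in q.
have := MP x; move: (phi _) (phi (op x (d *: v))) (phi x) (k _) (k (op x (d *: v))) (k x) k1 k2 p1 p2 q.
move=> a1 a2 a3 b1 b2 b3 k1 k2 p1 p2 q kM.
(* Displaced values of [k] are written as its value at [x] plus an increment. This leaves a second
   difference of [phi] and products of two first differences, all of order [d ^+ 2]. *)
have -> : (a2 - a3) * b2 + (a1 - a3) * b1 =
  (a2 + a1 - 2 * a3) * b3 + ((a2 - a3) * (b2 - b3) + (a1 - a3) * (b1 - b3)) by ring.
apply: le_trans (ler_normD _ _) _.
apply: le_trans (lerD (lexx _) (ler_normD _ _)) _.
rewrite !normrM; have r1 := ler_pM (normr_ge0 _) (normr_ge0 _) q kM.
have r2 := ler_pM (normr_ge0 _) (normr_ge0 _) p1 k1.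
have r3 := ler_pM (normr_ge0 _) (normr_ge0 _) p2 k2.
apply: le_trans (lerD r1 (lerD r2 r3)) _.
by rewrite le_eqVlt; apply/orP; left; apply/eqP; rewrite /K; ring.
Qed.

Let Fd_continuous : exists2 d1 : R, 0 < d1 & forall d, 0 < d -> d <= d1 -> continuous (Fd d).
Proof.
have [d2 d20 dP] := displacement; exists d2 => // d dd dd2.
have cop (f : pt -> R) a : continuous f -> continuous (fun x => f (op x a)).
  by move=> cf; exact: (cts_translate hop).
apply: ctsB.
  apply: ctsM; first exact: cts_cst.
  apply: cts_sum => v _; pose f x := phi x * k x.
  have h : continuous (fun x => f (op x (d *: v)) + f (op x (- d *: v)) - 2 * f x).
    by apply: ctsB; [apply: ctsD; exact: cop|apply: ctsM => //; exact: cts_cst].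
  exact: h.
have Sc : closed S by exact: compact_closed (@norm_hausdorff _ _) cS.
have kop x a : S x -> `|a| <= d2 -> {for x, continuous (fun x => k (op x a))}.
  move=> Sx ad; have [h _] := dP x a ad.
  apply: (@cts_at_comp R pt pt (fun x => op x a) k).
    by apply/rV_continuousP => i; exact: C1_continuous (op_C1l hop a i).
  by apply: kc; apply: h; apply: SNb => //; rewrite divr_ge0// ltW.
have E : (fun x => phi x * sdiff d k x) = fun x => d ^- 2 * \sum_(v <- hb)
    (phi x * k (op x (d *: v)) + phi x * k (op x (- d *: v)) - 2 * (phi x * k x)).
  apply/funext => x; rewrite /sdiff mulrCA mulr_sumr; congr (_ * _); apply: eq_bigr => v _.
  by rewrite /sdiff1; move: (k _) (k (op x (d *: v))) (k x) => b1 b2 b3; ring.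
rewrite E; apply: ctsM; first exact: cts_cst.
rewrite (_ : (fun x => \sum_(v <- hb) _) = fun x => \sum_(v <- hb | v \in hb) 
    (phi x * k (op x (d *: v)) + phi x * k (op x (- d *: v)) - 2 * (phi x * k x))); last first.
  by apply/funext => x; rewrite big_seq.
apply: cts_sum => v vh.
have s1 : `|d *: v| <= d2 by rewrite (le_trans (hb_small _ vh))// gtr0_norm.
have s2 : `|- d *: v| <= d2 by rewrite (le_trans (hb_small _ vh))// normrN gtr0_norm.
apply: ctsB; first apply: ctsD.
- by apply: (@cts_mul_supp R pt S) => // x Sx; exact: kop.
- by apply: (@cts_mul_supp R pt S) => // x Sx; exact: kop.
- by apply: ctsM => //; exact: cts_cst.
Qed.

Let phik_hlip : exists2 C : R, 0 < C & hlip op V C (fun x => phi x * k x).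
Proof.
have [C C0 CP] := phi_lip; have [d2 d20 dP] := displacement; have [M M0 MP] := k_bound.
have [Mp Mp0 MpP] : exists2 Mp : R, 0 < Mp & forall x, `|phi x| <= Mp.
  have [_ [B [Mp' hM]]] := bphi; exists (`|Mp'| + 1) => [|x]; first by rewrite ltr_wpDl.
  by rewrite (le_trans (hM x).1)// (le_trans (ler_norm Mp'))// lerDl.
exists (C * M + Mp * A) => [|]; first by rewrite addr_gt0// mulr_gt0.
apply: (hlip_small hop d20) => j x t jm td.
have jh := mem_hbasis jm.
have td' : `|t *: e_ j| <= d2 by rewrite (le_trans (hb_small _ jh)).
have [h1 h2] := dP x _ td'.
have [hN|/h2[-> ->]] := pselect (Nb (delta / 2) x); last first.
  by rewrite !mul0r subrr normr0 mulr_ge0// addr_ge0// mulr_ge0// ltW.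
have hN' : Nb delta x.
  by have [y Sy xy] := hN; exists y => //; rewrite (le_trans xy)// ler_pdivrMr// ler_pMr// ler1n.
have k1 := kL jm hN' (h1 hN); have p1 := CP _ x t jh; have := MP (op x (t *: e_ j)); have := MpP x.
move: (phi _) (phi x) (k _) (k x) k1 p1 => a1 a2 b1 b2 k1 p1 pM kM.
have -> : a1 * b1 - a2 * b2 = (a1 - a2) * b1 + a2 * (b1 - b2) by ring.
rewrite (le_trans (ler_normD _ _))// !normrM mulrDl lerD//.
  by rewrite mulrAC ler_pM.
by rewrite -mulrA ler_pM.
Qed.

(** Here [g = phi * k - Cb * h], with [h] obtained from the bounded sequence [Fd / Cb]. By symmetry
    of [sdiff], testing [Fd d] on [psi] compares [phi * k] against [sdiff d psi] with [k] against
    [sdiff d (phi * psi)]; the limit thus differentiates only [psi] and [phi * psi]. *)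
Lemma cutoff_product : exists2 g, (exists2 C : R, 0 < C & hlip op V C g) &
  forall psi B, is_Ck 2 psi -> bsupp B psi ->
    rint (fun x => g x * L psi x) = rint (fun x => k x * L (fun y => phi y * psi y) x).
Proof.
have [Cb [d1 [Cb0 d10 dP1]]] := Fd_bound; have [d2 d20 dP2] := Fd_continuous.
have [B B0 BP] := Sb; pose B1 := B + delta.
have [C C0 CP] := green_limit hop hV V1e B1.
pose dd i : R := Num.min d1 d2 / i.+1%:R.
have dmin : 0 < Num.min d1 d2 by rewrite lt_min d10.
have dd0 i : 0 < dd i by rewrite divr_gt0.
have ddle i : dd i <= Num.min d1 d2.
  by rewrite ler_pdivrMr// ler_peMr ?ler1n// ltW.
have ddd1 i : dd i <= d1 by rewrite (le_trans (ddle i))// ge_min lexx.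
have ddd2 i : dd i <= d2 by rewrite (le_trans (ddle i))// ge_min lexx orbT.
pose F i x := Cb^-1 * Fd (dd i) x.
have [||i x xB|h hh hP] := CP F.
- by move=> i; apply: ctsM; [exact: cts_cst|exact: dP2].
- move=> i x; rewrite normrM gtr0_norm ?invr_gt0// mulrC ler_pdivrMr// mul1r.
  by have [] := dP1 _ (dd0 i) (ddd1 i) x.
- rewrite /F; have [_ ->] := dP1 _ (dd0 i) (ddd1 i) x; first by rewrite mulr0.
  move=> [y Sy xy]; move: xB; rewrite /B1 ltNge => /negP; apply.
  by have := d0; have := BP y Sy; have := ler_normD (x - y) y; rewrite subrK; lra.
have [C' C'0 C'P] := phik_hlip.
exists (fun x => phi x * k x - Cb * h x).
  exists (C' + Cb * C) => [|j x t jm]; first by rewrite addr_gt0// mulr_gt0.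
  rewrite opprD addrACA -opprD -mulrBr (le_trans (ler_normB _ _))// mulrDl lerD ?C'P//.
  by rewrite normrM gtr0_norm// -mulrA ler_pM2l// hh.
move=> psi B' p2 pB; have pc : continuous psi by exact: is_Ck_continuous p2.
have bp := cts_bms pc pB.
have cphipsi : is_Ck 2 (fun y => phi y * psi y) by exact: is_CkM.
have phipsiB : bsupp B' (fun y => phi y * psi y) by move=> x xB; rewrite pB// mulr0.
have bphipsi : bms (fun y => phi y * psi y) by apply: bmsM => //; exact: bms_lbm.
have bL := cts_bms (sublap_continuous hop p2) (sublap_bsupp hop V pB).
have bL' := cts_bms (sublap_continuous hop cphipsi) (sublap_bsupp hop V phipsiB).
have hc := hlip_continuous hop hV V1e C0 hh.
pose a1 := rint (fun x => phi x * k x * L psi x).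
pose a2 := rint (fun x => k x * L (fun y => phi y * psi y) x).
have hE : rint (fun x => h x * L psi x) = Cb^-1 * (a1 - a2).
  apply: (hP _ _ _ p2 pB) => e e0.
  have [K K0 KP] := @rint_le R N B.
  have [M M0 MP] := bounded_on_ball B cphik; have [M' M'0 MP'] := k_bound.
  have [_ [Bk [Mk hk]]] := bk; have [K' K'0 KP'] := @rint_le R N Bk.
  pose r := Cb * e / (K * M + K' * M' + 1).
  have D0 : 0 < K * M + K' * M' + 1 by rewrite !addr_gt0// mulr_gt0.
  have r0 : 0 < r by rewrite divr_gt0// mulr_gt0.
  have [r1 r10 r1P] := sdiff_cvg p2 pB r0; have [r2 r20 r2P] := sdiff_cvg cphipsi phipsiB r0.
  have r3 : 0 < Num.min r1 r2 by rewrite lt_min r10.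
  exists (Num.truncn (Num.min d1 d2 / Num.min r1 r2)) => i ii.
  have : dd i <= Num.min r1 r2.
    rewrite /dd ler_pdivrMr// mulrC -ler_pdivrMr//.
    by rewrite (le_trans (ltW (truncnS_gt _)))// ler_nat.
  rewrite le_min => /andP[/r1P -/(_ (dd0 i)) i1 /r2P -/(_ (dd0 i)) i2].
  have bS := bms_sdiff (dd i) bp; have bS' := bms_sdiff (dd i) bphipsi; have bSk := bms_sdiff (dd i) bk.
  have kl := bms_lbm bk; have phikl := bms_lbm bphik.
  have FE : rint (fun x => F i x * psi x) = Cb^-1 * (rint (fun x => phi x * k x * sdiff (dd i) psi x) -
      rint (fun x => k x * sdiff (dd i) (fun y => phi y * psi y) x)).
    rewrite (rint_sdiff (dd i) bphik bp) (rint_sdiff (dd i) bk bphipsi).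
    rewrite -rintB -?rintZ; first last.
    - by apply: bmsMl => //; exact: bms_lbm.
    - by apply: bmsMl => //; exact/bms_lbm/bms_sdiff.
    - by apply: bmsB; apply: bmsMl => //; apply: bms_lbm => //; exact: bms_sdiff.
    congr rint; apply/funext => x; rewrite /F /Fd.
    by move: (sdiff _ _ x) (sdiff _ _ x) => a b; ring.
  have T1 : `|rint (fun x => phi x * k x * sdiff (dd i) psi x) - a1| <= K * (M * r).
    rewrite -rintB; [|exact: bmsMl|exact: bmsMl].
    apply: KP; [by apply: bmsB; exact: bmsMl|..].
    - by move=> x xB; rewrite phiS ?mul0r ?subrr// => /BP; rewrite leNgt xB.
    - by rewrite mulr_ge0// ltW.
    - by move=> x xB; rewrite -mulrBr normrM ler_pM ?MP.
  have T2 : `|rint (fun x => k x * sdiff (dd i) (fun y => phi y * psi y) x) - a2| <= K' * (M' * r).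
    rewrite -rintB; [|exact: bmsMl|exact: bmsMl].
    apply: KP'; [by apply: bmsB; exact: bmsMl|..].
    - by move=> x xB; rewrite (hk x).2// !mul0r subrr.
    - by rewrite mulr_ge0// ltW.
    - by move=> x xB; rewrite -mulrBr normrM ler_pM.
  rewrite FE -mulrBr normrM gtr0_norm ?invr_gt0// mulrC ler_pdivrMr// [e * _]mulrC.
  have -> : Cb * e = (K * M + K' * M' + 1) * r by rewrite [RHS]mulrC /r divfK// lt0r_neq0.
  move: T1 T2; move: (rint _) (rint (fun x => k x * _)) => b1 b2 T1 T2.
  have -> : b1 - b2 - (a1 - a2) = (b1 - a1) - (b2 - a2) by ring.
  rewrite (le_trans (ler_normB _ _))// (le_trans (lerD T1 T2))// !mulrDl !mulrA.
  by rewrite lerDl mul1r ltW.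
transitivity (a1 - Cb * rint (fun x => h x * L psi x)).
  rewrite -rintZ -?rintB; first 1 last.
  - exact/bmsMl/bL/bms_lbm.
  - by apply: bmsZ; apply: bmsMl => //; exact: cts_lbm.
  - by apply: bmsMl => //; exact: cts_lbm.
  by congr rint; apply/funext => x; rewrite mulrBl mulrA.
transitivity (a1 - Cb * (Cb^-1 * (a1 - a2))); first by congr (a1 - Cb * _); exact: hE.
by rewrite mulVKf ?lt0r_neq0// subKr.
Qed.

End cutoff_product.
End second_differences.

(** * Differentiation under the integral sign *)

Section parametric.
Context {R : realType}.

Lemma MVT0 (f df : R -> R) : (forall t : R, is_derive t 1 f (df t)) ->
  forall h, exists2 c, 0 <= c <= 1 & f h - f 0 = h * df (h * c).
Proof.
move=> fd h.
have lin (r : R) : is_derive r 1 (fun r : R => h * r) h.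
  have := is_deriveM (is_derive_cst h r 1) (is_derive_id r 1); move=> e.
  by apply: is_derive_eq e _; rewrite /GRing.scale/= mulr0 addr0 mulr1.
have [c c01] := MVT01 (fun r => @is_derive_comp1 _ _ f (fun r => h * r) _ _ _ (fd _) (lin r)).
by rewrite /= mulr1 mulr0 => ->; exists c.
Qed.

Lemma cts_pairl (U V W : normedModType R) (f : U * V -> W) y :
  continuous f -> continuous (fun x => f (x, y)).
Proof.
move=> cf x; apply: (@cvg_comp _ _ _ (fun x => (x, y)) f _ (nbhs (x, y))); last exact: cf.
by apply: (@cvg_pair_nbhs _ _ _ (nbhs x) _ id (cst y) x y) => //; exact: cvg_cst.
Qed.

Lemma cts_comp (U V W : normedModType R) (f : U -> V) (g : V -> W) :
  continuous f -> continuous g -> continuous (fun x => g (f x)).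
Proof. by move=> cf cg x; apply: (cvg_comp _ _ (cf x) (cg _)). Qed.

Lemma ctsZ (V : normedModType R) (c : R) : continuous (fun x : V => c *: x).
Proof. by move=> x; apply: cvgZl_tmp; exact: cvg_id. Qed.

Lemma bsupp_derive n B (f : 'rV[R]_n -> R) v : bsupp B f -> bsupp B ('D_v f).
Proof.
move=> fB x xB; have -> : 'D_v f x = 'D_v (fun=> 0 : R) x.
  apply: near_eq_derive; apply/nbhs_ballP.
  exists (`|x| - B) => [|y]; first by rewrite /= subr_gt0.
  rewrite -ball_normE /ball_ /= => xy; apply: fB.
  by have := ler_normB x y; have := ler_normD (x - y) y; rewrite subrK; lra.
by rewrite derive_cst.
Qed.

Context {N : nat}.
Local Notation pt := 'rV[R]_N.
Variables (g : pt -> R) (Psi : pt -> pt -> R) (dPsi : pt -> pt -> pt -> R).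
Hypothesis gc : continuous g.
Hypothesis Psic : forall x, continuous (Psi^~ x).
Hypothesis Psid : forall v z x (t : R), is_derive t 1 (fun s : R => Psi z (x + s *: v)) (dPsi v z (x + t *: v)).
Hypothesis dPsic : forall v, continuous (fun p : pt * pt => dPsi v p.1 p.2).
Hypothesis Psib : forall v B, exists Z, forall x, `|x| <= B -> bsupp Z (Psi^~ x) /\ bsupp Z (dPsi v ^~ x).

Let unif v B Z (e : R) : 0 < e -> exists2 d : R, 0 < d &
  forall z x y, `|z| <= Z -> `|x| <= B -> `|x - y| <= d -> `|y| <= B + 1 /\ `|dPsi v z x - dPsi v z y| <= e.
Proof.
move=> e0; pose Q : set (pt * pt) := [set x | `|x| <= Z] `*` [set x | `|x| <= B].
have cQ : compact Q by apply: compact_setX; exact: (@compact_ball R N).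
have [d d0 dP] := unif_cts_compact (@dPsic v) cQ e0.
exists (Num.min d 1); first by rewrite lt_min d0/=.
move=> z x y zZ xB; rewrite le_min => /andP[xyd xy1]; split.
  by rewrite -[y](subKr x) (le_trans (ler_normB _ _))// lerD.
have := dP (z, x) (z, y).
have -> : `|((z, x) : pt * pt) - (z, y)| = `|x - y|.
  by rewrite prod_normE/= subrr normr0; apply/max_idPr.
by move=> h; have : Q (z, x) by []; move=> /h/(_ xyd).
Qed.

Let G x := rint (fun z => g z * Psi z x).
Let D v x := rint (fun z => g z * dPsi v z x).

Let bPsi x : bms (Psi^~ x).
Proof. by have [Z /(_ x (lexx _))[h _]] := Psib 0 `|x|; exact: cts_bms h. Qed.

Let bdPsi v x : bms (dPsi v ^~ x).
Proof.
have [Z /(_ x (lexx _))[_ h]] := Psib v `|x|.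
by apply: (cts_bms _ h); exact: (@cts_pairl pt pt R (fun p => dPsi v p.1 p.2) x (@dPsic v)).
Qed.

Let gl : lbm g. Proof. exact: cts_lbm. Qed.

Lemma is_derive_param v x : is_derive x v G (D v x).
Proof.
apply/is_deriveP/cvgrPdist_le => e e0.
have [Z ZP] := Psib v (`|x| + 1).
have [M M0 MP] := bounded_on_ball Z gc; have [K K0 KP] := @rint_le R N Z.
have KM : 0 < K * M by rewrite mulr_gt0.
have r0 : 0 < e / (K * M) by rewrite divr_gt0.
have [d d0 dP] := unif v `|x| Z r0.
have v1 : 0 < `|v| + 1 by rewrite ltr_wpDl.
near=> h.
have h0 : h != 0 by near: h; exact: nbhs_dnbhs_neq.
have hd : `|h| * `|v| <= d.
  apply: le_trans (_ : `|h| * (`|v| + 1) <= _); first by rewrite ler_wpM2l// lerDl.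
  by rewrite -ler_pdivlMr//; near: h; apply: dnbhs0_le; rewrite divr_gt0.
have close c : 0 <= c <= 1 -> `|x - (x + (h * c) *: v)| <= d.
  move=> /andP[c0 c1]; rewrite opprD addrA subrr sub0r normrN normrZ normrM (ger0_norm c0).
  by apply: le_trans hd; rewrite -mulrA mulrCA ler_piMl// mulr_ge0.
have xh : `|x + h *: v| <= `|x| + 1.
  rewrite (le_trans (ler_normD _ _))// lerD2l normrZ.
  apply: le_trans (_ : `|h| * (`|v| + 1) <= _); first by rewrite ler_wpM2l// lerDl.
  by rewrite -ler_pdivlMr//; near: h; apply: dnbhs0_le; rewrite divr_gt0.
have [ZP1 _] := ZP _ xh; have [|ZP2 ZP3] := ZP x; first by rewrite lerDl.
have E : D v x - h^-1 *: (G (h *: v + x) - G x) =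
    h^-1 * rint (fun z => g z * (h * dPsi v z x - (Psi z (x + h *: v) - Psi z x))).
  have b1 := bmsMl gl (bdPsi v x); have b2 := bmsMl gl (bPsi (x + h *: v)); have b3 := bmsMl gl (bPsi x).
  have -> : (fun z => g z * (h * dPsi v z x - (Psi z (x + h *: v) - Psi z x))) =
      fun z => h * (g z * dPsi v z x) - (g z * Psi z (x + h *: v) - g z * Psi z x).
    by apply/funext => z; ring.
  rewrite rintB ?rintZ ?rintB//; [|exact: bmsZ|exact: bmsB].
  rewrite -/(D v x) -/(G x) [h *: v + x]addrC -/(G (x + h *: v)).
  by rewrite mulrBr mulKf.
rewrite E normrM normfV mulrC ler_pdivrMr ?normr_gt0//.
have -> : e * `|h| = K * (M * (`|h| * (e / (K * M)))) by field; rewrite !lt0r_neq0.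
apply: KP.
- apply: (bmsMl gl); apply: bmsB; first by apply: bmsZ; exact: bdPsi.
  by apply: bmsB; exact: bPsi.
- by move=> z zZ; rewrite ZP1// ZP2// ZP3// subrr mulr0 subrr mulr0.
- by apply: mulr_ge0; [exact: ltW|apply: mulr_ge0 => //; exact: ltW].
move=> z zZ; rewrite normrM ler_pM ?MP//.
have [c c01] := MVT0 (Psid v z x) h; rewrite scale0r addr0 => ->.
rewrite -mulrBr normrM ler_wpM2l//.
by have [] := dP z x _ zZ (lexx _) (close c c01).
Unshelve. all: by end_near. Qed.

Lemma param_C1 : is_C1 G.
Proof.
move=> v; split=> [x|]; first by have [] := is_derive_param v x.
have -> : 'D_v G = D v by apply/funext => x; have [_ ->] := is_derive_param v x.
apply/cts_distP => x e e0.
have [Z ZP] := Psib v (`|x| + 1).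
have [M M0 MP] := bounded_on_ball Z gc; have [K K0 KP] := @rint_le R N Z.
have KM : 0 < K * M by rewrite mulr_gt0.
have r0 : 0 < e / (K * M) by rewrite divr_gt0.
have [d d0 dP] := unif v `|x| Z r0.
exists (Num.min d 1) => [|y]; first by rewrite lt_min d0/=.
rewrite le_min => /andP[xy xy1].
have yx : `|y| <= `|x| + 1 by rewrite -[y](subKr x) (le_trans (ler_normB _ _))// lerD.
have [_ ZP1] := ZP _ yx; have [|_ ZP2] := ZP x; first by rewrite lerDl.
have b1 := bmsMl gl (bdPsi v x); have b2 := bmsMl gl (bdPsi v y).
rewrite -rintB//; have -> : e = K * (M * (e / (K * M))) by field; rewrite !lt0r_neq0.
apply: KP; [exact: bmsB| |by apply: mulr_ge0; exact: ltW|].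
- by move=> z zZ; rewrite ZP1// ZP2// !mulr0 subrr.
move=> z zZ; rewrite -mulrBr normrM ler_pM ?MP//.
by have [] := dP z x y zZ (lexx _) xy.
Qed.

End parametric.

Section nonneg_integral.
Context {R : realType} {N : nat}.
Local Notation pt := 'rV[R]_N.
Implicit Types (f g : pt -> R).

Lemma rint_mono f g : bms f -> bms g -> (forall x, f x <= g x) -> rint f <= rint g.
Proof. by move=> hf hg fg; apply: le_Rintegral => //; exact: bms_integrable. Qed.

Lemma rint_absle f g : bms f -> bms g -> (forall x, `|f x| <= g x) -> `|rint f| <= rint g.
Proof.
move=> hf hg fg; rewrite ler_norml -mulN1r -rintZ//; apply/andP; split.
  by apply: rint_mono => //; [exact: bmsZ|move=> x; have := fg x; rewrite ler_norml mulN1r => /andP[]].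
by apply: rint_mono => // x; rewrite (le_trans (ler_norm _)).
Qed.

Lemma rint_gt0 f (d : R) : bms f -> (forall x, 0 <= f x) -> 0 < d ->
  (forall x, `|x| <= d -> f x = 1) -> 0 < rint f.
Proof.
move=> hf f0 d0 f1; pose I : pt -> R := \1_(cball d).
have mI : measurable_fun setT I by apply: measurable_indic; exact: measurable_cball.
have IE x : I x = if `|x| <= d then 1 else 0.
  rewrite /I indicE; case: ifPn => xd; first by rewrite mem_set.
  by rewrite memNset// => /= h; move: xd; rewrite h.
have bI : bms I.
  split=> //; exists d, 1 => x; rewrite IE; split.
    by case: ifP; rewrite ?normr1 ?normr0.
  by rewrite ltNge => /negbTE ->.
apply: (@lt_le_trans _ _ (rint I)); last first.
  by apply: rint_mono => // x; rewrite IE; case: ifPn => // /f1 ->.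
have -> : rint I = fine (leb N (cball d)).
  rewrite /rint /Rintegral; congr fine.
  by rewrite integral_indic//; [rewrite setIT|exact: measurable_cball].
pose a : pt := const_mx (- d); pose b : pt := const_mx d.
have -> : cball d = [set v : pt | forall i, a 0 i <= v 0 i <= b 0 i].
  apply/seteqP; split=> x /= h; last first.
    by apply/rV_norm_leP => [|i]; [exact: ltW|have := h i; rewrite !mxE ler_norml].
  by move=> i; rewrite !mxE -ler_norml (le_trans (coord_le_norm _ _)).
rewrite leb_box/=; last by move=> i; rewrite !mxE; lra.
by apply: prodr_gt0 => i _; rewrite !mxE; lra.
Qed.

End nonneg_integral.

(** * Mollification and subunit curves *)

Section mollify.
Context {R : realType} {N : nat} (op : 'rV[R]_N -> 'rV[R]_N -> 'rV[R]_N).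
Hypothesis hop : is_exp_lie_group op.
Local Notation pt := 'rV[R]_N.
Local Notation e_ i := (delta_mx 0 i : pt).
Implicit Types (x y z v w a : pt) (f g h u : pt -> R).
Context (s : nat) (V : nat -> {vspace pt}).
Hypothesis hV : is_stratification op s V.
Local Notation m := (\dim (V 1%N)).

Let cts_negr : continuous (fun p : pt * pt => (p.1, - p.2)).
Proof.
move=> p; apply: (@cvg_pair_nbhs _ _ _ (nbhs p) _ (fun p : pt * pt => p.1) (fun p : pt * pt => - p.2) p.1 (- p.2)).
  exact: cvg_fst.
by apply: cvgN; exact: cvg_snd.
Qed.

(** Squaring makes the cutoff nonnegative whatever its sign; the dilation by [2 / r] brings the
    support from radius 2 to radius [r]. *)
Lemma mollifier (r : R) : 0 < r -> exists rho : pt -> R,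
  [/\ is_C1 rho, bsupp r rho, forall x, 0 <= rho x & 0 < rint rho].
Proof.
move=> r0; have [psi [ps p1 p0]] := @smooth_cutoff R N 1 ler01.
have q0 : 0 < 2 / r by rewrite divr_gt0.
pose phi x := psi ((2 / r) *: x).
have phis k : is_Ck k phi.
  apply: (@is_Ck_comp_affine _ pt pt R (fun x => (2 / r) *: x) (fun x => (2 / r) *: x) psi) => //.
    exact: (@ctsZ R pt).
  by move=> h w x; rewrite scalerDr !scalerA mulrC.
have rhos : is_Ck 1 (fun x => phi x * phi x) by exact: is_CkM.
have rb : bsupp r (fun x => phi x * phi x).
  move=> x xr; rewrite /phi p0 ?mul0r// normrZ gtr0_norm//.
  by rewrite mulrAC ltr_pdivlMr// -[1 + 1]/2%:R; lra.
exists (fun x => phi x * phi x); split=> //.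
- exact: is_Ck_C1 rhos.
- by move=> x; rewrite -expr2 sqr_ge0.
have rc := is_Ck_continuous rhos.
apply: (rint_gt0 (d := r / 2) (cts_bms rc rb)) => [x||x xr]; first by rewrite -expr2 sqr_ge0.
  by rewrite divr_gt0.
rewrite /phi p1 ?mulr1// normrZ gtr0_norm// mulrC -ler_pdivlMr//.
by rewrite div1r invf_div.
Qed.

(** [G x] is a mean of [g (op y x)] over small [y]. Left translations commute with horizontal
    increments, so the bound is kept. By right invariance [G x] is also an integral of [g z] against
    [rho (op z (- x))], and its derivatives fall on [rho]. *)
Lemma mollify C g B (e : R) : hlip op V C g -> continuous g -> 0 < e ->
  exists G, [/\ is_C1 G, hlip op V C G & forall x, `|x| <= B -> `|G x - g x| <= e].
Proof.
move=> hg cg e0.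
have [d d0 dP] := unif_cts_compact cg (@compact_ball R N B) e0.
have [r r0 rP] := op_near_id hop B d0.
have [rho [rho1 rhob rho0 rhoI]] := mollifier r0.
have rc := C1_continuous rho1; have brho := cts_bms rc rhob.
pose c := rint rho.
pose g' z := c^-1 * g z.
have cg' : continuous g' by apply: ctsM => //; exact: cts_cst.
pose Psi z x := rho (op z (- x)).
pose dPsi v z x := \sum_k dopr op (- v) (z, - x) 0 k * 'D_(e_ k) rho (op z (- x)).
pose G x := rint (fun z => g' z * Psi z x).
have bg a : bms (fun y => g (op y a) * rho y).
  by apply: bmsMl => //; apply: cts_lbm; exact: (cts_translate hop).
have GE x : G x = c^-1 * rint (fun y => g (op y x) * rho y).
  have bx : bms (fun z => g' z * Psi z x).
    by apply: bmsMl; [exact: cts_lbm|exact: (bms_op hop (- x) brho)].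
  rewrite /G -(rint_op hop hV x bx.1) -rintZ//.
  by congr rint; apply/funext => y; rewrite /Psi (opxK hop) mulrA.
have dom (E : pt -> R) (k : R) : bms E -> (forall y, `|E y| <= k * rho y) -> `|c^-1 * rint E| <= k.
  move=> bE Ek; rewrite normrM gtr0_norm ?invr_gt0// mulrC ler_pdivrMr// -rintZ//.
  by apply: rint_absle => //; exact: bmsZ.
exists G; split.
- apply: (@param_C1 _ _ _ _ dPsi) => //.
  + by move=> x; exact: (cts_translate hop).
  + move=> v z x t; apply: (C1_comp rho1 (is_derive_opr hop z _)).
    by have := is_derive_affine (- x) (- v) t; under eq_fun do rewrite scalerN -opprD.
  + move=> v; apply: cts_sum => k _; apply: ctsM.
      apply: (@cts_comp R (pt * pt)%type (pt * pt)%type R (fun p => (p.1, - p.2)) (fun p => dopr op (- v) p 0 k)) => //.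
      by move=> p; exact: ((cvg_rVP _ _).1 (dopr_continuous hop (w := - v) (x := p)) k).
    apply: (@cts_comp R (pt * pt)%type pt R (fun p : pt * pt => op p.1 (- p.2)) ('D_(e_ k) rho)); last by have [] := rho1 (e_ k).
    exact: (@cts_comp R (pt * pt)%type (pt * pt)%type pt _ (fun p => op p.1 p.2) cts_negr (op_continuous hop)).
  + move=> v A; have [Z Z0 ZP] := bsupp_op hop r A; exists Z => x xA.
    have xA' : `|- x| <= A by rewrite normrN.
    split; first by have [h _] := ZP _ rhob (- x) xA'.
    have db k : bsupp r ('D_(e_ k) rho) by exact: bsupp_derive.
    move=> z zZ; rewrite /dPsi big1// => k _.
    by have [h _] := ZP _ (db k) (- x) xA'; rewrite h// mulr0.
- move=> j x t jm; rewrite !GE -mulrBr -rintB//; apply: dom; first exact: bmsB.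
  move=> y; rewrite -mulrBl normrM (ger0_norm (rho0 y)) ler_wpM2r// (opA hop).
  exact: hg.
- move=> x xB; have -> : g x = c^-1 * rint (fun y => g x * rho y).
    by rewrite rintZ// mulrCA mulVf ?mulr1// lt0r_neq0.
  rewrite GE -mulrBr -rintB//; last exact: bmsZ.
  apply: dom; first by apply: bmsB => //; exact: bmsZ.
  move=> y; rewrite -mulrBl normrM (ger0_norm (rho0 y)).
  have [yr|yr] := leP `|y| r; last by rewrite rhob// !mulr0.
  by rewrite ler_wpM2r// distrC; apply: dP => //; have [] := rP x y xB yr.
Qed.

End mollify.

(** * Horizontal Lipschitz functions along subunit curves *)

Section horizontal_curves.
Context {R : realType} {N : nat} (op : 'rV[R]_N -> 'rV[R]_N -> 'rV[R]_N).
Hypothesis hop : is_exp_lie_group op.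
Local Notation pt := 'rV[R]_N.
Local Notation e_ i := (delta_mx 0 i : pt).
Implicit Types (x y z v w a : pt) (f g u : pt -> R).
Context (s : nat) (V : nat -> {vspace pt}).
Hypothesis hV : is_stratification op s V.
Local Notation m := (\dim (V 1%N)).
Hypothesis V1e : forall j : 'I_N, (j < m)%N -> e_ j \in V 1%N.
Local Notation X := (lie_derive op).

Lemma hlip_lie_le C g (j : 'I_N) x : (j < m)%N -> is_C1 g -> hlip op V C g -> `|X (e_ j) g x| <= C.
Proof.
move=> jm g1 hg; apply/ler_addgt0Pr => e e0.
have := is_derive_lie hop x (e_ j) 0 g1; rewrite scale0r (opx0 hop) => /is_deriveP.
move=> /cvgrPdist_le/(_ _ e0) h.
have [r [r0 /= hr]] := filter_ex (filterI (nbhs_dnbhs_neq (0 : R)) h).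
have hq : `|r^-1 *: (g (op x ((r *: 1 + 0) *: e_ j)) - g (op x (0 *: e_ j)))| <= C.
  rewrite normrZ normfV mulrC ler_pdivrMr ?normr_gt0// addr0 [r *: 1]mulr1.
  by rewrite scale0r (opx0 hop); exact: hg.
rewrite -(subrK (r^-1 *: (g (op x ((r *: 1 + 0) *: e_ j)) - g (op x (0 *: e_ j)))) (X _ _ _)).
by rewrite (le_trans (ler_normD _ _))// addrC lerD.
Qed.

(** Of the subunit condition only a bound on each coefficient is kept, at the price of a factor [N]
    in the length estimates. *)
Definition horizontal x w := exists c : pt, [/\ w = lfield op x c, forall i, `|c 0 i| <= 1 &
  forall i : 'I_N, (m <= i)%N -> c 0 i = 0].

Lemma C1_hlip_curve C g (h dh : R -> pt) (a b : R) : 0 <= C -> is_C1 g -> hlip op V C g ->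
  (forall t : R, is_derive t 1 h (dh t)) -> (forall t, a < t < b -> horizontal (h t) (dh t)) ->
  a < b -> `|g (h b) - g (h a)| <= C * N%:R * (b - a).
Proof.
move=> C0 g1 hg hd hh ab.
have gd (t : R) : is_derive t 1 (g \o h) (\sum_i dh t 0 i * 'D_(e_ i) g (h t)) by exact: C1_comp.
have cgh : {within `[a, b], continuous (g \o h)}.
  by apply/continuous_subspaceT => t; exact: is_derive_continuous (gd t).
have [t tab E] := MVT ab (fun t _ => gd t) cgh.
rewrite [g (h b) - g (h a)]E normrM (gtr0_norm (_ : 0 < b - a)) ?subr_gt0//.
apply: ler_wpM2r; first by rewrite subr_ge0 ltW.
rewrite in_itv/= in tab; have [c [-> c1 c0]] := hh t tab.
rewrite -lie_deriveE//.
have -> : X c g (h t) = \sum_j c 0 j * X (e_ j) g (h t).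
  rewrite lie_deriveE//; under [RHS]eq_bigr do rewrite lie_deriveE// mulr_sumr.
  rewrite exchange_big/=; apply: eq_bigr => i _.
  rewrite (linear_rV_sum c (lfield_linear hop (h t))) summxE mulr_suml.
  by apply: eq_bigr => k _; rewrite mxE mulrA.
rewrite (le_trans (ler_norm_sum _ _ _))//.
rewrite -[N in N%:R](card_ord N) mulr_natr -sumr_const; apply: ler_sum => i _.
have [im|mi] := ltnP i m; last by rewrite (c0 i mi) mul0r normr0.
by rewrite normrM -[C]mul1r ler_pM// hlip_lie_le.
Qed.

Lemma hlip_curve C g (h dh : R -> pt) (a b : R) : 0 < C -> hlip op V C g ->
  (forall t : R, is_derive t 1 h (dh t)) -> (forall t, a < t < b -> horizontal (h t) (dh t)) ->
  a < b -> `|g (h b) - g (h a)| <= C * N%:R * (b - a).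
Proof.
move=> C0 hg hd hh ab; apply/ler_addgt0Pr => e e0.
have e2 : 0 < e / 2 by rewrite divr_gt0.
have gc := hlip_continuous hop hV V1e C0 hg.
have [G [G1 hG Gg]] := mollify hop hV (Num.max `|h a| `|h b|) hg gc e2.
have h1 := C1_hlip_curve (ltW C0) G1 hG hd hh ab.
have h2 : `|G (h a) - g (h a)| <= e / 2 by apply: Gg; rewrite le_max lexx.
have h3 : `|G (h b) - g (h b)| <= e / 2 by apply: Gg; rewrite le_max lexx orbT.
move: h1 h2 h3; move: (G _) (g (h a)) (G (h b)) (g (h b)) (C * N%:R * (b - a)) => a1 a2 a3 a4 a5.
by rewrite !ler_norml => /andP[? ?] /andP[? ?] /andP[? ?]; apply/andP; split; lra.
Qed.

(** By [lfield_dlog] the two linear maps are inverse on one side, hence on both, being given by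
    square matrices. *)
Lemma dlog_lfield x v : dlog op s x (lfield op x v) = v.
Proof.
have lf := lfield_linear hop x; have ld := dlog_linear hop s x.
pose A : 'M[R]_N := \matrix_(k, i) dlog op s x (e_ k) 0 i.
pose B : 'M[R]_N := \matrix_(k, i) lfield op x (e_ k) 0 i.
have AE w : dlog op s x w = w *m A.
  by apply/rowP => i; rewrite (linear_rV_sum w ld) summxE mxE; apply: eq_bigr => k _; rewrite !mxE.
have BE w : lfield op x w = w *m B.
  by apply/rowP => i; rewrite (linear_rV_sum w lf) summxE mxE; apply: eq_bigr => k _; rewrite !mxE.
have AB : A *m B = 1%:M.
  apply/row_matrixP => i; rewrite row_mul row1.
  by have := lfield_dlog hop hV x (e_ i); rewrite AE BE -rowE.
by rewrite AE BE -mulmxA (mulmx1C AB) mulmx1.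
Qed.

Definition dot (u v : pt) : R := \sum_i u 0 i * v 0 i.

(** The covectors [xi i] are dual to the frame of left-invariant fields at [x]. Testing with [xi i]
    isolates the coefficient [i] and bounds its square by 1 if [i < m] and by 0 otherwise. *)
Lemma subunit_horizontal x w :
  (forall xi, dot w xi ^+ 2 <= \sum_(j < N | (j < m)%N) dot (lfield op x (e_ j)) xi ^+ 2) ->
  horizontal x w.
Proof.
move=> h; exists (dlog op s x w).
pose xi (i : 'I_N) : pt := \row_k dlog op s x (e_ k) 0 i.
have xiE i v : dot (lfield op x v) (xi i) = v 0 i.
  rewrite -[in RHS](dlog_lfield x v) (linear_rV_sum (lfield op x v) (dlog_linear hop s x)) summxE.
  by apply: eq_bigr => k _; rewrite !mxE.
have wE : w = lfield op x (dlog op s x w) by rewrite (lfield_dlog hop hV).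
have hi (i : 'I_N) : dlog op s x w 0 i ^+ 2 <= (i < m)%:R.
  have := h (xi i); rewrite {1}wE xiE => h'; apply: le_trans h' _.
  under eq_bigr do rewrite xiE mxE eqxx/=.
  have [im|mi] := ltnP i m.
    rewrite (bigD1 i)//= eqxx expr1n big1 ?addr0// => j /andP[_ ji].
    by rewrite eq_sym (negbTE ji) expr0n.
  rewrite big1// => j jm; case: eqVneq => [ij|]; last by rewrite expr0n.
  by move: jm; rewrite -ij ltnNge mi.
split=> // [i|i mi].
  rewrite -(@ler_pXn2r _ 2)// ?nnegrE// expr1n -normrX ger0_norm ?sqr_ge0//.
  by rewrite (le_trans (hi i))// lern1; case: ltnP.
by have := hi i; rewrite ltnNge mi/= => h0; apply/eqP; rewrite -sqrf_eq0 eq_le h0 sqr_ge0.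
Qed.

End horizontal_curves.

Section carnot_curves.
Context {R : realType} (G : carnotGroup R).
Local Notation N := (cdim G).
Local Notation pt := 'rV[R]_N.
Local Notation op := (@cop R G).
Local Notation hop := (cop_lie G).
Local Notation hV := (layer_strat G).
Local Notation V1e := (@layer1_coord R G).
Local Notation e_ i := (delta_mx 0 i : pt).

Lemma ae_exists_itv (P : R -> Prop) (a b : R) : {ae @lebesgue_measure R, forall t, P t} -> a < b ->
  exists2 t, a < t < b & P t.
Proof.
move=> [A [mA A0 PA]] ab; apply: contrapT => h.
have sub : `]a, b[ `<=` A.
  by move=> t; rewrite /= in_itv/= => tab; apply: PA => Pt; apply: h; exists t.
have : (@lebesgue_measure R `]a, b[%classic <= 0)%E.
  by rewrite -A0; apply: le_measure; rewrite ?inE.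
by rewrite lebesgue_measure_itv/= lte_fin ab -EFinB lee_fin leNgt subr_gt0 ab.
Qed.

(** The inequality is given almost everywhere, but its two sides are continuous along the smooth
    curve [h]; a violation at one time would persist on an interval. *)
Lemma subunit_piece (gam h : R -> pt) (T a b : R) : smooth h -> 0 <= a -> b <= T ->
  {in `[a, b], gam =1 h} ->
  {ae @lebesgue_measure R, forall t : R, t \in `[0, T] -> subunit_at gam t} ->
  forall t, a < t < b -> horizontal op (layer G) (h t) ('D_1 h t).
Proof.
move=> hs a0 bT gh ae t /andP[ta tb].
apply: (@subunit_horizontal _ _ _ hop _ _ hV).
move=> xi; rewrite leNgt; apply/negP => lt.
pose u r := dot ('D_1 h r) xi ^+ 2 - \sum_(j < N | (j < hdim G)%N) dot (lfield op (h r) (e_ j)) xi ^+ 2.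
have hc : continuous h by exact: is_Ck_continuous (hs 0%N).
have dhc : continuous ('D_1 h) by have [_ /(_ 1)[_ []]] := hs 1%N.
have dotc (f : R -> pt) : continuous f -> continuous (fun r => dot (f r) xi).
  move=> cf; apply: (@cts_sum R R^o R^o) => i _; apply: (@ctsM R R^o); last exact: (@cts_cst R R^o R^o).
  by have := (rV_continuousP f).1 cf i.
have sqc (f : R -> R) : continuous f -> continuous (fun r => f r ^+ 2).
  by move=> cf; under eq_fun do rewrite expr2; exact: (@ctsM R R^o).
have uc : continuous u.
  apply: (@ctsB R R^o R^o); first by apply: sqc; exact: dotc.
  apply: (@cts_sum R R^o R^o) => j _; apply: sqc; apply: dotc.
  exact: (@cts_comp R R^o pt pt h (fun x => lfield op x (e_ j)) hc (lfield_continuous hop (v := e_ j))).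
have ut : 0 < u t by rewrite subr_gt0.
have /cvgr_gt/(_ _ ut) /nbhs_ballP[d /= d0 dP] := uc t.
have ab : Num.max a (t - d) < Num.min b (t + d).
  by rewrite lt_min !gt_max; apply/andP; split; apply/andP; split; lra.
have [r] := ae_exists_itv ae ab.
rewrite gt_max lt_min => /andP[/andP[ar tr] /andP[rb rt]] sub.
have {}sub : subunit_at gam r by apply: sub; rewrite in_itv/=; apply/andP; split; lra.
have [_ /(_ xi)] := sub.
have rab : r \in `[a, b] by rewrite in_itv/=; apply/andP; split; exact: ltW.
have -> : derive1 gam r = 'D_1 h r.
  rewrite derive1E; apply: near_eq_derive.
  have : \forall y \near r, y \in `]a, b[ by apply: near_in_itvoo; rewrite in_itv/= ar.
  by apply: filterS => y yab; apply: gh; exact: subset_itv_oo_cc.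
rewrite gh// leNgt => /negP; apply.
have := dP r; rewrite /ball/= => /(_ _)/=; rewrite /u subr_gt0.
have -> : \sum_(j < N | (j < hdim G)%N) dotv (jac j id (h r)) xi ^+ 2 =
    \sum_(j < N | (j < hdim G)%N) dot (lfield op (h r) (e_ j)) xi ^+ 2.
  by apply: eq_bigr => j _; rewrite /jac (lfieldE hop).
by apply; rewrite ltr_norml; apply/andP; split; lra.
Qed.

Lemma hlip_subunit (C : R) (g : pt -> R) x y : 0 < C -> hlip op (layer G) C g ->
  (`|g x - g y|%:E <= (C * N%:R + 1)%:E * cc_dist x y)%E.
Proof.
move=> C0 hg; have D0 : 0 < C * N%:R + 1 by rewrite ltr_wpDl// mulr_ge0// ltW.
rewrite -lee_pdivrMl// /cc_dist; apply: le_ereal_inf_tmp => _ [T [gam [T0 [p [[pT plast] pP]] g0 gT ae]] <-].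
rewrite -EFinM lee_fin mulrC ler_pdivrMr//.
pose q i := nth 0 (0 :: p) i.
have qS i : (i < size p)%N -> q i < q i.+1 by move=> ip; move/(pathP 0): pT; exact.
have q0 i : (i <= size p)%N -> 0 <= q i.
  by elim: i => // i IH ip; rewrite (le_trans (IH (ltnW ip)))// ltW// qS.
have qTE : q (size p) = T by rewrite /q nth_last/=; exact/eqP.
have qT k : (k <= size p)%N -> q (size p - k)%N <= T.
  elim: k => [|k IH] kp; first by rewrite subn0 qTE.
  apply: le_trans (IH (ltnW kp)); rewrite ltW// (_ : (size p - k)%N = (size p - k.+1).+1); last by lia.
  by apply: qS; lia.
have hi i : (i <= size p)%N -> `|g (gam (q i)) - g x| <= C * N%:R * q i.
  elim: i => [|i IH] ip; first by rewrite /q/= g0 subrr normr0 mulr0.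
  have [h [hs gh]] := pP i ip.
  have ab := qS i ip; rewrite -/(q i) -/(q i.+1) in gh.
  have qiT : q i.+1 <= T by have := qT (size p - i.+1)%N (leq_subr _ _); rewrite subKn.
  have hd (t : R) : is_derive t 1 h ('D_1 h t).
    by apply: derivableP; have [_ /(_ 1)[]] := hs 1%N.
  have hh := subunit_piece hs (q0 i (ltnW ip)) qiT gh ae.
  have h1 := hlip_curve hop hV V1e C0 hg hd hh ab.
  rewrite gh ?in_itv/= ?lexx ?(ltW ab)//.
  rewrite -(subrKA (g (h (q i)))) (le_trans (ler_normD _ _))//.
  have -> : C * N%:R * q i.+1 = C * N%:R * (q i.+1 - q i) + C * N%:R * q i by ring.
  apply: lerD => //; rewrite -gh ?in_itv/= ?lexx ?(ltW ab)//; exact: IH (ltnW ip).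
have := hi _ (leqnn _); rewrite qTE gT distrC => h; apply: le_trans h _.
by rewrite [T * _]mulrC ler_wpM2r// lerDl.
Qed.

End carnot_curves.

Lemma stieltjes_itv {R : realType} (F : cumulative R R) (x y : R) : x <= y ->
  lebesgue_stieltjes_measure F `]x, y]%classic = (F y - F x)%:E.
Proof.
move=> xy; rewrite /lebesgue_stieltjes_measure/= /measure_extension/=.
rewrite measurable_mu_extE/=; last exact: is_ocitv.
rewrite wlength_itv/= lte_fin; case: ltP => [_|yx]; first by rewrite EFinB.
by have -> : x = y; [apply: le_anti; rewrite xy|rewrite subrr].
Qed.

(** * Almost everywhere differentiability along horizontal lines *)

Section lipschitz_ae.
Context {R : realType}.
Local Notation leb := (@lebesgue_measure R).
Variables (u : R -> R) (C : R).
Hypotheses (C0 : 0 < C) (uL : forall s t, `|u s - u t| <= C * `|s - t|).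

Let uc : continuous u.
Proof.
apply/(@cts_distP R R^o R^o) => x e e0; exists (e / C) => [|y xy]; first by rewrite divr_gt0.
by rewrite (le_trans (uL _ _))// mulrC -ler_pdivlMr.
Qed.

(** Both functions [(t + u t / C) / 2] and [(t - u t / C) / 2] are nondecreasing, and their sum is
    [t]. So their Stieltjes measures add up to Lebesgue measure, the first one has a density, and
    Lebesgue's differentiation theorem applies to its primitive. *)
Let w (b : bool) (t : R) := (t + (-1) ^+ b * (u t / C)) / 2.

Let w_nd b : {homo w b : s t / s <= t}.
Proof.
move=> s t st; rewrite /w ler_pM2r// -subr_ge0.
have : `|(u s - u t) / C| <= t - s.
  by rewrite normrM normfV (gtr0_norm C0) ler_pdivrMr// mulrC (le_trans (uL _ _))// distrC ger0_norm// subr_ge0.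
rewrite mulrBl ler_norml => /andP[h1 h2].
by case: b; rewrite ?expr1 ?expr0 ?mul1r ?mulN1r; lra.
Qed.

Let w_rc b : right_continuous (w b).
Proof.
apply: right_continuousW; apply: (@ctsM R R^o); last exact: (@cts_cst R R^o R^o).
apply: (@ctsD R R^o R^o); first by move=> x; exact: cvg_id.
apply: (@ctsM R R^o); first exact: (@cts_cst R R^o R^o).
by apply: (@ctsM R R^o) => //; exact: (@cts_cst R R^o R^o).
Qed.

Let W b : cumulative R R := HB.pack (w b) (isCumulative.Build R _ R (w b) (@w_nd b) (@w_rc b)).

Let nu b := lebesgue_stieltjes_measure (W b).

Let nu_itv b (x y : R) : x <= y -> nu b `]x, y]%classic = (w b y - w b x)%:E.
Proof. exact: (stieltjes_itv (W b)). Qed.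

Let leb_sum A : measurable A -> leb A = (nu false A + nu true A)%E.
Proof.
move=> mA; rewrite -measure_addE; apply: lebesgue_measure_unique mA => _ [[x y] _ <-].
rewrite [(x, y).1]/= [(x, y).2]/=.
transitivity (nu false `]x, y]%classic + nu true `]x, y]%classic)%E; last exact: (esym (measure_addE (nu false) (nu true) _)).
have [xy|yx] := leP x y; last first.
  have -> : `]x, y]%classic = set0 by apply: set_itv_ge; rewrite bnd_simp -leNgt ltW.
  transitivity (0 + 0 : \bar R)%E; first by rewrite adde0; exact: measure0.
  by congr (_ + _)%E; apply/esym; exact: measure0.
rewrite lebesgue_measure_itv/= !nu_itv// lte_fin.
transitivity (w false y - w false x + (w true y - w true x))%:E; last by [].
have -> : w false y - w false x + (w true y - w true x) = y - x.
  by rewrite /w expr0 expr1; field; exact: lt0r_neq0.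
by case: ltP => [//|yx]; have -> : x = y; [apply: le_anti; rewrite xy|rewrite subrr].
Qed.

(** Restricting to a bounded interval makes the measure finite; the times [|t| < 1] are interior to
    it. *)
Let D : set (measurableTypeR R) := `]-2, 2]%classic.
Let mD : measurable D. Proof. exact: measurable_itv. Qed.
Let nuD : (nu false D < +oo)%E.
Proof. by rewrite /D nu_itv ?ltry//; lra. Qed.

Let nuf := charge_of_finite_measure (mfrestr mD nuD).

Let nu_dom : nuf `<< leb.
Proof.
apply/null_content_dominatesP => A mA A0.
have E := leb_sum mA; have {A0} A0 : leb A = 0%E := A0; rewrite A0 in E.
have h : (nu false (A `&` D) <= nu false A)%E.
  by apply: le_measure; rewrite ?inE//; exact: measurableI.
have h' : (nu false A <= 0)%E by rewrite E leeDl.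
have : nu false (A `&` D) = 0%E by apply/eqP; rewrite eq_le (le_trans h h')/= measure_ge0.
exact.
Qed.

Lemma lipschitz_ae_derivable : {ae leb, forall t : R, `|t| < 1 -> derivable u t 1}.
Proof.
have fi := Radon_Nikodym_integrable nu_dom.
have ff x := Radon_Nikodym_fin_num x nu_dom.
have fE := fun A => @Radon_Nikodym_integral _ _ _ nuf leb A nu_dom.
pose f (x : R) : R := fine (Radon_Nikodym nuf leb x).
have EF : EFin \o f = Radon_Nikodym nuf leb by apply/funext => x; rewrite /= fineK.
rewrite -EF in fi.
have loc : locally_integrable setT f by apply: open_integrable_locally => //; exact: openT.
have fiy (y : R) : leb.-integrable `]-oo, y] (EFin \o f).
  by apply: integrableS fi => //; exact: measurable_itv.
have := FTC1Ny fiy loc; apply: filterS; first exact: (ae_filter_ringOfSetsType leb).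
move=> t [Fd _] t1.
move: t1; rewrite ltr_norml => /andP[t1 t2].
have FE : \forall x \near t, \int[leb]_(y in `]-oo, x]) f y = w false x - w false (-2).
  have : \forall x \near t, x \in `]-1, 1[ by apply: near_in_itvoo; rewrite in_itv/= t1.
  apply: filterS => x; rewrite in_itv/= => /andP[x1 x2].
  rewrite /Rintegral -/(EFin \o f) EF -fE; last exact: measurable_itv.
  transitivity (fine (nu false (`]-oo, x]%classic `&` D))); first by [].
  have -> : `]-oo, x]%classic `&` D = `]-2, x]%classic.
    apply/seteqP; split=> z; rewrite /D/= !in_itv/=; first by move=> [-> /andP[->]].
    by move=> /andP[z1 z2]; split=> //; apply/andP; split=> //; lra.
  by rewrite nu_itv//; lra.
have wd : derivable (w false) t 1.
  have [h _] := is_deriveD (derivableP Fd) (is_derive_cst (w false (-2)) t 1).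
  by apply: near_eq_derivable h; apply: filterS FE => x /= E; rewrite -[RHS](subrK (w false (-2))) -E.
have := is_deriveM (is_derive_cst C t 1) (is_deriveB (is_deriveM (is_derive_cst (2 : R) t 1) (derivableP wd)) (is_derive_id t 1)).
move=> [ud _]; rewrite (_ : u = fun x => C * (2 * w false x - x))//.
by apply/funext => x; rewrite /w expr0; field; exact: lt0r_neq0.
Qed.

End lipschitz_ae.

Section horizontal_ae.
Context {R : realType} {N : nat} (op : 'rV[R]_N -> 'rV[R]_N -> 'rV[R]_N).
Hypothesis hop : is_exp_lie_group op.
Local Notation pt := 'rV[R]_N.
Local Notation e_ i := (delta_mx 0 i : pt).
Implicit Types (x y z w a : pt).
Context (s : nat) (V : nat -> {vspace pt}).
Hypothesis hV : is_stratification op s V.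
Variables (g : pt -> R) (v : pt) (C : R).
Hypotheses (C0 : 0 < C) (gc : continuous g).
Hypothesis gL : forall x (t : R), `|g (op x (t *: v)) - g x| <= C * `|t|.
Local Notation lebR := (@lebesgue_measure R).

Let q x (r : R) := r^-1 * (g (op x (r *: v)) - g x).

Let flow_cts x : continuous (fun r : R => g (op x (r *: v))).
Proof.
apply/(@cts_distP R R^o R^o) => r e e0; exists (e / C) => [|r' rr]; first by rewrite divr_gt0.
have -> : op x (r *: v) = op (op x (r' *: v)) ((r - r') *: v).
  by rewrite -(opA hop) (exp_op hop) subrKC.
by rewrite (le_trans (gL _ _))// mulrC -ler_pdivlMr.
Qed.

(** Cauchy's criterion for the difference quotients, tested on rational increments only, so that the
    set [P] of points of differentiability is measurable. *)
Let Q (n k : nat) (rs : rat * rat) : set pt :=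
  if (0 < `|ratr rs.1 : R| < k.+1%:R^-1) && (0 < `|ratr rs.2 : R| < k.+1%:R^-1)
  then [set x | `|q x (ratr rs.1) - q x (ratr rs.2)| <= n.+1%:R^-1] else setT.

Let P : set pt := [set x | forall n, exists k, forall rs, Q n k rs x].

Let q_near x (r e d : R) : 0 < `|r| < d -> 0 < e -> exists r' : rat, 0 < `|ratr r' : R| < d /\ `|q x r - q x (ratr r')| <= e.
Proof.
move=> /andP[r0 rd] e0; rewrite normr_gt0 in r0.
have qc : {for r, continuous (q x)}.
  apply: (@cvgM R R^o); first by apply: (@cvgV R R) => //; exact: cvg_id.
  by apply: (@cvgB R R^o); [exact: flow_cts|exact: cvg_cst].
have /nbhs_ballP[b /= b0 bP] : \forall y \near r, `|q x r - q x y| <= e by move/cvgrPdist_le: qc; exact.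
pose b' := Num.min b (Num.min (d - `|r|) `|r|).
have b'0 : 0 < b' by rewrite !lt_min b0 subr_gt0 rd normr_gt0.
have [|r'] := @rat_in_itvoo R (r - b') (r + b'); first by lra.
rewrite in_itv/= -ltr_distl distrC !lt_min => /andP[h1 /andP[h2 h3]].
exists r'; split; last exact: bP.
have := ler_normB r (r - ratr r'); have := ler_normD (r - ratr r') (ratr r').
by rewrite subrK subKr => h4 h5; apply/andP; split; lra.
Qed.

Let derivableP' x : derivable (fun t : R => g (op x (t *: v))) 0 1 <-> P x.
Proof.
have E : (fun h : R => h^-1 *: (g (op x ((h *: 1 + 0) *: v)) - g (op x (0 *: v)))) = q x.
  by apply/funext => h; rewrite /q addr0 [h *: 1]mulr1 scale0r (opx0 hop).
rewrite /derivable E; split=> [cv n|h].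
  have n0 : 0 < n.+1%:R^-1 / 2 :> R by rewrite divr_gt0 ?invr_gt0.
  have /cvg_cauchy/cauchyP/(_ _ n0)[y [d /= d0 dP]] := cv.
  exists (Num.truncn d^-1) => -[r1 r2]; rewrite /Q/=; case: ifP => // /andP[/andP[r10 r1k] /andP[r20 r2k]] /=.
  have kd : (Num.truncn d^-1).+1%:R^-1 < d.
    by rewrite invf_plt ?posrE//; exact: truncnS_gt.
  pose y' : R := y.
  have h (r : R) : 0 < `|r| -> `|r| < (Num.truncn d^-1).+1%:R^-1 -> `|y' - q x r| < n.+1%:R^-1 / 2.
    move=> r0 rk; apply: dP; first by rewrite /ball_/= sub0r normrN (lt_trans rk).
    by rewrite -normr_gt0.
  have := h _ r10 r1k; have := h _ r20 r2k; clear -y'; clearbody y'.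
  move: (q x (ratr r1)) (q x (ratr r2)) (n.+1%:R^-1 : R) => a b c; rewrite !ltr_norml ler_norml => /andP[? ?] /andP[? ?].
  by apply/andP; split; lra.
apply: cauchy_cvg; apply: cauchy_exP => e e0.
have [n ne] : exists n : nat, n.+1%:R^-1 + n.+1%:R^-1 < e.
  exists (Num.truncn (2 / e)); rewrite -mulr2n -[_ *+ 2]mulr_natl ltr_pdivrMr// mulrC -ltr_pdivrMr//.
  exact: truncnS_gt.
have n0 : 0 < n.+1%:R^-1 :> R by rewrite invr_gt0.
have [k kP] := h n; have k0 : 0 < k.+1%:R^-1 :> R by rewrite invr_gt0.
have k2 : 0 < `|k.+1%:R^-1 / 2 : R| < k.+1%:R^-1.
  by rewrite gtr0_norm ?divr_gt0//= ltr_pdivrMr// ltr_pMr// ltr1n.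
have [r0 [r0k _]] := q_near x k2 n0.
exists (q x (ratr r0)).
suff : \forall r \near 0^', ball (q x (ratr r0)) e (q x r) by [].
near=> r.
have rk : 0 < `|r| < k.+1%:R^-1.
  apply/andP; split; first by rewrite normr_gt0; near: r; exact: nbhs_dnbhs_neq.
  by near: r; exact: dnbhs0_lt.
have [r1 [r1k r1n]] := q_near x rk n0.
have := kP (r0, r1); rewrite /Q/= r0k r1k/= => h1.
rewrite /ball/= (le_lt_trans _ ne)// -(subrKA (q x (ratr r1))) (le_trans (ler_normD _ _))// lerD//.
by rewrite distrC.
Unshelve. all: by end_near. Qed.

Let mP : measurable P.
Proof.
have mq (r : R) : measurable_fun setT (fun x => q x r).
  apply: continuous_rV_measurable; apply: ctsM; first exact: cts_cst.
  by apply: ctsB => //; exact: (cts_translate hop).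
have mQ n k rs : measurable (Q n k rs).
  rewrite /Q; case: ifP => _ //.
  have mD : measurable_fun setT (fun x => `|q x (ratr rs.1) - q x (ratr rs.2)|).
    by apply: measurableT_comp => //; exact: measurable_funB.
  have := mD measurableT `]-oo, n.+1%:R^-1]%classic (measurable_itv _); rewrite setTI.
  by congr measurable; apply/seteqP; split=> x; rewrite /= in_itv.
have -> : P = \bigcap_n \bigcup_k ~` (\bigcup_rs ~` (Q n k rs)).
  apply/seteqP; split=> x h.
    by move=> n _; have [k kP] := h n; exists k => // -[rs _]; apply.
  by move=> n; have [k _ kP] := h n I; exists k => rs; apply: contrapT => nQ; apply: kP; exists rs.
apply: bigcapT_measurable => n; apply: bigcup_measurable => k _; apply: measurableC.
apply: countable_bigcupT_measurable => [|rs]; first exact: countableP.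
by apply: measurableC.
Qed.

Let mflow : measurable_fun setT (fun p : measurableTypeR R * pt => op p.2 ((p.1 : R) *: v)).
Proof.
pose f (y : 'rV[R]_N.+1) : pt := op (rV_uncons y).2 ((rV_uncons y).1 *: v).
rewrite (_ : (fun p => _) = f \o @rV_cons R N); last first.
  by apply/funext => p; have E := @rV_consK R N p; rewrite /f /comp E.
apply: measurableT_comp; last exact: measurable_rV_cons.
apply: continuous_rV_measurable_rV => y; apply: (@cvg_op _ _ _ hop _ (nbhs y)).
  have h : continuous (fun y : 'rV[R]_N.+1 => (rV_uncons y).2).
    by apply/rV_continuousP => i; under eq_fun do rewrite mxE; exact: cts_coord.
  exact: h.
have h : continuous (fun y : 'rV[R]_N.+1 => (rV_uncons y).1 *: v).
  apply/rV_continuousP => i; under eq_fun do rewrite mxE.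
  by apply: ctsM; [exact: cts_coord|exact: cts_cst].
exact: h.
Qed.

(** The function [H] is integrated in both orders. Along each flow line the integral vanishes by the
    theorem in one variable; at each fixed time in []0, 1[] the integral over the group is the
    measure of the complement of [P], by right invariance. *)
Lemma flow_ae_derivable : {ae leb N, forall x, derivable (fun t : R => g (op x (t *: v))) 0 1}.
Proof.
exists (~` P); split; [exact: measurableC| |by move=> x /= nd; rewrite -derivableP'].
pose H (p : measurableTypeR R * pt) : \bar R := (\1_(`]0, 1[%classic : set (measurableTypeR R)) p.1 * \1_(~` P) (op p.2 ((p.1 : R) *: v)))%:E.
have mA : measurable (~` P) by exact: measurableC.
have mI : measurable_fun setT (\1_(~` P) : pt -> R) by exact: measurable_indic.
have mJ : measurable_fun setT (\1_(`]0, 1[%classic : set (measurableTypeR R)) : measurableTypeR R -> R).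
  by apply: measurable_indic; exact: measurable_itv.
have mH : measurable_fun setT H.
  apply/measurable_EFinP; apply: measurable_funM; first exact: measurableT_comp.
  exact: measurableT_comp.
have H0 p : (0 <= H p)%E by rewrite lee_fin mulr_ge0.
have := @fubini_tonelli _ _ _ _ _ lebR (leb N) H mH H0.
have -> : (\int[leb N]_y \int[lebR]_x H (x, y) = 0)%E.
  apply: integral0_eq => x _.
  pose T : set (measurableTypeR R) := `]0, 1[%classic `&` [set t | ~ P (op x ((t : R) *: v))].
  have mT : measurable T.
    apply: measurableI; first exact: measurable_itv.
    have mm : measurable_fun setT (fun t : measurableTypeR R => op x ((t : R) *: v)).
      exact: measurableT_comp mflow (measurable_pair2 x).
    have := mm measurableT _ mA.
    by rewrite setTI.
  have HT t : H (t, x) = (\1_T t)%:E.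
    by rewrite /H/= /T indicI.
  under eq_integral do rewrite HT.
  rewrite integral_indic// setIT; apply: measure_negligible => //.
  pose u t := g (op x (t *: v)).
  have uL (r t : R) : `|u r - u t| <= C * `|r - t|.
    rewrite /u; have -> : op x (r *: v) = op (op x (t *: v)) ((r - t) *: v).
      by rewrite -(opA hop) (exp_op hop) subrKC.
    exact: gL.
  apply: negligibleS (lipschitz_ae_derivable C0 uL) => t [/=]; rewrite in_itv/= => /andP[t0 t1] nP ud.
  apply: nP; apply/derivableP'; have t1' : `|t| < 1 by rewrite gtr0_norm.
  have ud' : is_derive (t + 0 *: 1) 1 u ('D_1 u t) by rewrite scale0r addr0; exact: derivableP (ud t1').
  have -> : (fun r : R => g (op (op x (t *: v)) (r *: v))) = fun r : R => u (t + r *: 1).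
    by apply/funext => r; rewrite /u -(opA hop) (exp_op hop) [r *: 1]mulr1.
  by have [] := is_derive_line ud'.
move=> E; apply/eqP; rewrite eq_le measure_ge0 andbT -E.
have mt (t : R) : measurable_fun setT (fun y => \1_(~` P) (op y (t *: v)) : R).
  by apply: measurableT_comp => //; exact: (op_measurable hop).
have Et (t : measurableTypeR R) : (\int[leb N]_y H (t, y) = (\1_(`]0, 1[%classic : set (measurableTypeR R)) t)%:E * leb N (~` P))%E.
  rewrite /H/=; under eq_integral do rewrite EFinM.
  rewrite ge0_integralZl_EFin//; last by apply/measurable_EFinP; exact: mt.
  congr (_ * _)%E; rewrite (ge0_haar hop hV (t *: v) (f := fun y => (\1_(~` P) y)%:E))//.
    by rewrite integral_indic// setIT.
  exact/measurable_EFinP.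
under eq_integral do rewrite Et.
have mJ' : measurable_fun setT (fun t : measurableTypeR R => ((\1_(`]0, 1[%classic : set (measurableTypeR R)) t : R)%:E)).
  exact/measurable_EFinP.
rewrite ge0_integralZr//.
have -> : (\int[lebR]_t (\1_(`]0, 1[%classic : set (measurableTypeR R)) t : R)%:E = 1)%E.
  transitivity (lebR `]0, 1[%classic); first by rewrite integral_indic// setIT.
  by rewrite lebesgue_measure_itv/= lte_fin ltr01 oppr0 adde0.
by rewrite mul1e.
Qed.

End horizontal_ae.

Lemma cts_at_dist {R : realType} (V W : normedModType R) (f : V -> W) x :
  (forall e, 0 < e -> exists2 d : R, 0 < d & forall y, `|x - y| < d -> `|f x - f y| <= e) ->
  {for x, continuous f}.
Proof.
move=> h; apply/cvgrPdist_le => e /h[d d0 dP]; apply/nbhs_ballP; exists d => //= y.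
by rewrite -ball_normE; exact: dP.
Qed.

(** * Horizontal Lipschitz functions on a Carnot group *)

Section carnot.
Context {R : realType} (G : carnotGroup R).
Local Notation N := (cdim G).
Local Notation pt := 'rV[R]_N.
Local Notation op := (@cop R G).
Local Notation hop := (cop_lie G).
Local Notation hV := (layer_strat G).
Local Notation V1e := (@layer1_coord R G).
Local Notation V := (layer G).
Local Notation e_ i := (delta_mx 0 i : pt).
Local Notation mu := (leb N).
Implicit Types (f g phi psi : pt -> R) (x y : pt) (Om U : set pt).

Lemma sub_laplacianE psi : sub_laplacian psi = sublap op V psi.
Proof.
apply/funext => x; rewrite /sublap /sub_laplacian /hbasis big_map /hidx big_filter.
by rewrite big_enum_cond; apply: eq_bigl => j.
Qed.

Lemma cc_dist_line (j : 'I_N) x (t : R) : (j < hdim G)%N -> (cc_dist x (op x (t *: e_ j)) <= `|t|%:E)%E.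
Proof.
move=> jm; apply: ereal_inf_lbound; exists `|t| => //.
pose w := Num.sg t *: e_ j; pose h (s : R) := op x (s *: w).
have hd (s : R) : is_derive s 1 h (lfield op (h s) w) by exact: (is_derive_flow hop x w s).
have hs : smooth h.
  move=> k; apply: (@is_Ck_comp_affine _ _ _ _ (fun s : R => (x, s *: w)) (fun s : R => (0, s *: w)) (fun p => op p.1 p.2)).
  - move=> s; apply: (@cvg_pair_nbhs _ _ _ (nbhs s) _ (cst x) (fun s : R => s *: w) x (s *: w)); first exact: cvg_cst.
    by apply: cvgZr_tmp; exact: cvg_id.
  - move=> c a b; transitivity ((c *: 0 + x, c *: (a *: w) + b *: w)); last by [].
    by rewrite scaler0 add0r scalerDl; congr (_, _ + _); exact: (esym (scalerA _ _ _)).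
  - exact: exp_op_smooth hop k.
exists h; split=> //.
(* The points of a partition increase strictly, so an interval of length 0 has the empty
   partition. *)
- have [->|t0] := eqVneq t 0; first by exists [::]; split=> //; split=> //=; rewrite normr0.
  exists [:: `|t|]; split; first by split=> //=; rewrite normr_gt0 t0.
  by move=> [|//] _; exists h.
- by rewrite /h scale0r (opx0 hop).
- by rewrite /h /w scalerA mulrC mulr_sg_norm.
apply: aeW => s _; split=> [|xi]; first by have [] := hd s.
rewrite derive1E (_ : 'D_1 h s = Num.sg t *: lfield op (h s) (e_ j)); last first.
  by have [_ ->] := hd s; rewrite /w (linZ (lfield_linear hop _)).
have -> : dotv (Num.sg t *: lfield op (h s) (e_ j)) xi = Num.sg t * dotv (lfield op (h s) (e_ j)) xi.
  by rewrite /dotv mulr_sumr; apply: eq_bigr => i _; rewrite mxE mulrA.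
rewrite (bigD1 j)//= /jac (lfieldE hop) ler_wpDr//; first by apply: sumr_ge0 => i _; exact: sqr_ge0.
rewrite exprMn ler_piMl ?sqr_ge0// sqr_sg.
by case: (t != 0).
Qed.

Lemma lip_on_horizontal Om f : lip_on Om f -> exists2 A : R, 0 < A & forall (j : 'I_N) x (t : R),
  (j < hdim G)%N -> Om x -> Om (op x (t *: e_ j)) -> `|f (op x (t *: e_ j)) - f x| <= A * `|t|.
Proof.
move=> [A A0 AP]; exists A => // j x t jm Ox Oy.
rewrite distrC -lee_fin EFinM (le_trans (AP _ _ Ox Oy))//.
by rewrite lee_pmul2l//; exact: cc_dist_line.
Qed.

(** The equicontinuity argument in local form: chains with small steps starting at [x] stay inside
    [Om], the only place where the bound is available. *)
Lemma horizontal_lip_continuous Om f (A : R) : open Om -> 0 < A ->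
  (forall (j : 'I_N) x (t : R), (j < hdim G)%N -> Om x -> Om (op x (t *: e_ j)) ->
     `|f (op x (t *: e_ j)) - f x| <= A * `|t|) ->
  forall x, Om x -> {for x, continuous f}.
Proof.
move=> oO A0 AP x Ox; apply: cts_at_dist => e e0.
have /nbhs_ballP[r /= r0 rP] : nbhs x Om by exact: open_nbhs_nbhs.
have r2 : 0 < r / 2 by rewrite divr_gt0.
have [d d0 dP] := op_near_id hop `|x| r2.
have [p hp] := chow hop hV V1e.
have [r1 r10 r1P] := reach_small hop V p d0.
have p0 : 0 < p%:R + 1 :> R by rewrite ltr_wpDl.
pose q := Num.min r1 (e / (A * (p%:R + 1))).
have q0 : 0 < q by rewrite lt_min r10 divr_gt0// mulr_gt0.
have [dz dz0 dzP] := hp q q0; have [b b0 bP] := opN_near_id hop `|x| dz0.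
exists b => // y xy.
have [l [lp lr lE]] := dzP _ (bP x y (lexx _) (ltW xy)).
have yE : y = chain op x l by rewrite (chain_op hop) -lE (opNK hop).
rewrite distrC {1}yE.
apply: le_trans (@chain_diff _ _ op V f Om (A * q) q x l lr _ _) _.
- by move=> j z t jm Oz Oz' tq; rewrite (le_trans (AP j z t jm Oz Oz'))// ler_pM2l.
- move=> k; apply: rP; rewrite -ball_normE /ball_/= (chain_op hop).
  have kd : `|chain op 0 (take k l)| <= d.
    apply: r1P; exists (take k l); split=> //.
      by rewrite size_take_min (leq_trans (geq_minr _ _)).
    apply/allP => c /mem_take cl; have /allP/(_ c cl)/andP[-> h] := lr.
    by rewrite (le_trans h)// ge_min lexx.
  have [h _] := dP x _ (lexx _) kd.
  by rewrite (le_lt_trans h)// ltr_pdivrMr// ltr_pMr// ltr1n.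
apply: (@le_trans _ _ ((p%:R + 1) * (A * q))).
  by apply: ler_wpM2r; [rewrite mulr_ge0// ltW|rewrite ler_wpDr// ler_nat].
rewrite mulrCA mulrA -ler_pdivlMl ?mulr_gt0// mulrC.
by rewrite /q ge_min lexx orbT.
Qed.

Lemma hlip_lip_loc C g : 0 < C -> hlip op V C g -> lip_loc g.
Proof.
move=> C0 hg E _; exists (C * N%:R + 1); first by rewrite ltr_wpDl// mulr_ge0// ltW.
by move=> x y _ _; exact: hlip_subunit.
Qed.

Lemma derive_le_lip (u : R -> R) (C : R) : derivable u 0 1 -> (forall t, `|u t - u 0| <= C * `|t|) ->
  `|derive1 u 0| <= C.
Proof.
move=> ud uL; apply/ler_addgt0Pr => e e0; rewrite derive1E.
have /is_deriveP/cvgrPdist_le/(_ _ e0) h := derivableP ud.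
have [r [r0 /= hr]] := filter_ex (filterI (nbhs_dnbhs_neq (0 : R)) h).
have hq : `|r^-1 *: (u (r *: 1 + 0) - u 0)| <= C.
  by rewrite normrZ normfV mulrC ler_pdivrMr ?normr_gt0// addr0 [r *: 1]mulr1.
rewrite -(subrK (r^-1 *: (u (r *: 1 + 0) - u 0)) ('D_1 u 0)).
by rewrite (le_trans (ler_normD _ _))// addrC lerD.
Qed.

(** There are at most [N] horizontal derivatives, each bounded by [C] where it exists, and
    [N <= (N + 1) ^ 2]. *)
Lemma hlip_hgrad_le1 C g : 0 < C -> hlip op V C g -> C * (N%:R + 1) <= 1 -> hgrad_le1 g.
Proof.
move=> C0 hg C1; have gc := hlip_continuous hop hV V1e C0 hg.
have ae : {ae mu, forall x, forall j : 'I_N, (j < hdim G)%N -> jac_derivable j g x}.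
  apply: (@filter_forall _ _ _ _ (ae_filter_ringOfSetsType mu)).
  move=> j; have [jm|mj] := ltnP j (hdim G); last by apply: aeW => x.
  have := flow_ae_derivable hop hV C0 gc (v := e_ j) (fun x t => hg j x t jm).
  by apply: filterS => //; exact: ae_filter_ringOfSetsType.
split=> //; rewrite unlock; case: ifP => // _; apply/ess_supP.
apply: (@filterS _ _ (ae_filter_ringOfSetsType mu) _ _ _ ae).
move=> x hx /=; rewrite lee_fin ger0_norm ?sqrtr_ge0// /hgrad_norm.
rewrite -[leRHS]sqrtr1; apply: ler_wsqrtr.
have D0 : 0 <= C * (N%:R + 1) by rewrite mulr_ge0 ?addr_ge0// ltW.
apply: (@le_trans _ _ ((C * (N%:R + 1)) ^+ 2)); last by rewrite exprn_ile1.
apply: (@le_trans _ _ (\sum_(j < N) C ^+ 2)).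
  rewrite big_mkcond/=; apply: ler_sum => j _; case: ifPn => jm; last exact: sqr_ge0.
  rewrite -[jac j g x ^+ 2]ger0_norm ?sqr_ge0// normrX; apply: lerXn2r; rewrite ?nnegrE ?(ltW C0)//.
  apply: derive_le_lip => [|t]; first exact: hx.
  by rewrite scale0r (opx0 hop); exact: hg.
rewrite sumr_const card_ord exprMn -[leLHS]mulr_natr; apply: ler_wpM2l; first exact: sqr_ge0.
rewrite sqrrD1; have := ler0n R N; move: (N%:R : R) => n n0.
by rewrite -addrA ler_wpDl ?sqr_ge0// mulr2n; lra.
Qed.

End carnot.

Lemma closure_sub_closed (T : topologicalType) (A B : set T) : A `<=` B -> closed B -> closure A `<=` B.
Proof. by move=> AB cB; rewrite [B](closure_id B).1//; exact: closureS. Qed.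

(** * Removability and capacity *)

Section distributions.
Context {R : realType} (G : carnotGroup R).
Local Notation N := (cdim G).
Local Notation pt := 'rV[R]_N.
Local Notation op := (@cop R G).
Local Notation hop := (cop_lie G).
Local Notation hV := (layer_strat G).
Local Notation V1e := (@layer1_coord R G).
Local Notation V := (layer G).
Local Notation e_ i := (delta_mx 0 i : pt).
Local Notation mu := (leb N).
Implicit Types (f g phi psi : pt -> R) (x y : pt) (Om U K : set pt).

Lemma supp_eq0 phi x : ~ supp phi x -> phi x = 0.
Proof. by move=> h; apply: contrapT => /eqP nz; apply: h; exact: subset_closure. Qed.

Lemma supp_near0 phi x : ~ supp phi x -> \forall y \near x, phi y = 0.
Proof.
move=> h; have := closed_openC (@closed_closure _ [set x | phi x != 0]).
rewrite openE => /(_ x h); apply: filterS => y; exact: supp_eq0.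
Qed.

Lemma lie_derive_supp v phi : supp (lie_derive op v phi) `<=` supp phi.
Proof.
apply: closure_sub_closed; last exact: closed_closure.
move=> x /= /eqP nz; apply: contrapT => /supp_near0 h; apply: nz.
exact: (lie_derive_near0 hop).
Qed.

Lemma sub_laplacian_supp phi x : ~ supp phi x -> sub_laplacian phi x = 0.
Proof.
move=> h; rewrite /sub_laplacian big1// => j _; apply: supp_eq0 => h'; apply: h.
by apply: lie_derive_supp; apply: lie_derive_supp h'.
Qed.

Lemma distr_L_restrict Om f phi : supp phi `<=` Om -> distr_L Om f phi = distr_L setT f phi.
Proof.
move=> sO; rewrite /distr_L Rintegral_mkcond; apply: eq_Rintegral => x _.
rewrite patchE; case: ifPn => // /negP xO.
by rewrite sub_laplacian_supp ?mulr0// => /sO h; apply: xO; rewrite inE.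
Qed.

Lemma compact_supp_bsupp phi : compact (supp phi) -> exists2 B, 0 < B & bsupp B phi /\ forall x, supp phi x -> `|x| <= B.
Proof.
move=> /compact_bounded_norm[B B0 BP]; exists B => //; split=> // x xB.
by apply: supp_eq0 => /BP; rewrite leNgt xB.
Qed.

Lemma bsupp_compact_supp B phi : bsupp B phi -> compact (supp phi) /\ forall x, supp phi x -> `|x| <= B.
Proof.
move=> pB; have cB := @compact_ball R N B.
have clB := compact_closed (@norm_hausdorff _ _) cB.
have sB : supp phi `<=` [set x | `|x| <= B].
  apply: closure_sub_closed => // x /= nz; rewrite leNgt; apply/negP => /pB h.
  by move: nz; rewrite h eqxx.
by split=> //; apply: subclosed_compact cB sB; exact: closed_closure.
Qed.

Lemma ball_domain (B : R) : 0 < B -> domain [set x : pt | `|x| < B].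
Proof.
move=> B0; split.
- have -> : [set x : pt | `|x| < B] = ball 0 B.
    by apply/seteqP; split=> x; rewrite -ball_normE /ball_/= sub0r normrN.
  exact: ball_open.
- have -> : [set x : pt | `|x| < B] = \bigcup_(x in [set x : pt | `|x| < B]) ((fun t : R => t *: x) @` `[0, 1]%classic).
    apply/seteqP; split=> x /=.
      by move=> xB; exists x => //; exists 1; rewrite ?scale1r//= in_itv/= ler01 lexx.
    move=> [y yB [t t01 <-]]; move: t01; rewrite /= in_itv/= => /andP[t0 t1].
    by rewrite normrZ ger0_norm// (le_lt_trans _ yB)// ler_piMl.
  apply: bigcup_connected.
    by exists 0 => x _; exists 0; rewrite ?scale0r//= in_itv/= ler01 lexx.
  move=> x _; apply: connected_continuous_connected; first exact: segment_connected.
  by apply: continuous_subspaceT => t; apply: cvgZr_tmp; exact: cvg_id.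
- by exists 0; rewrite /= normr0.
Qed.

Lemma lip_on_subset (A D : set pt) f : A `<=` D -> lip_on D f -> lip_on A f.
Proof. by move=> AD [C C0 CP]; exists C => // x y Ax Ay; apply: CP; exact: AD. Qed.

(** The cutoff [psi] of the pairing is a test function in a ball that contains its support. There
    [f] is Lipschitz, closed balls being compact, and removability applies. *)
Lemma removable_pairing0 K f c : removable K -> lip_loc f ->
  distr_supp setT (distr_L setT f) `<=` K -> pairing1 (distr_L setT f) c -> c = 0.
Proof.
move=> rK lf sK [psi [[ps cps _] _ <-]].
have [B B0 [_ BP]] := compact_supp_bsupp cps.
pose Om : set pt := [set x | `|x| < B + 1].
have sO : supp psi `<=` Om by move=> x /BP h; rewrite /Om/= (le_lt_trans h)// ltrDl.
have B1 : 0 < B + 1 by rewrite addr_gt0.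
have dO := ball_domain B1.
have lO : lip_on Om f.
  apply: (@lip_on_subset _ [set x | `|x| <= B + 1]); first by move=> x /ltW.
  by apply: lf; exact: (@compact_ball R N).
rewrite -(distr_L_restrict f sO); apply: (rK Om) => // x [Ox xP]; apply: sK; split=> // U oU Ux _.
have [oO _ _] := dO.
have [phi [p1 p2 p3] nz] := xP (U `&` Om) (openI oU oO) (conj Ux Ox) (@subIsetr _ _ _).
exists phi; first by split=> // y /p3[].
by rewrite -(@distr_L_restrict Om)// => y /p3[].
Qed.

Lemma removable_capacity0 K : removable K -> lip_capacity K = 0%E.
Proof.
move=> rK; apply/eqP; rewrite eq_le; apply/andP; split.
  apply: ge_ereal_sup => _ [c [f [lf _ sK pc]] <-].
  by rewrite (removable_pairing0 rK lf sK pc) normr0.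
(* The value 0 has to be attained, here by [f = 0], because the supremum of the empty set is
   [-oo]. *)
apply: ereal_sup_ubound; exists 0; last by rewrite normr0.
exists (fun=> 0).
have L0 phi : distr_L setT (fun=> 0) phi = 0.
  by rewrite /distr_L -[RHS](@rint0 R N); apply: eq_Rintegral => x _; rewrite mul0r.
have s0 : distr_supp setT (distr_L (G := G) setT (fun=> 0)) = set0.
  by apply/seteqP; split=> // x [_ /(_ setT openT I (@subset_refl _ _))[phi _]]; rewrite L0 eqxx.
pose c : R := (N%:R + 1)^-1.
have c0 : 0 < c by rewrite invr_gt0 ltr_wpDl.
have h0 : hlip op V c (fun=> 0).
  by move=> j x t _; rewrite subrr normr0 mulr_ge0// ltW.
split.
- exact: hlip_lip_loc h0.
- by apply: hlip_hgrad_le1 h0 _ => //; rewrite mulVf// gt_eqF// ltr_wpDl.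
- by rewrite s0.
- exists (fun=> 0); split=> //; last by rewrite s0.
  split=> //; first by move=> k; exact: is_Ck_cst.
  by apply: (bsupp_compact_supp (B := 0) _).1.
Qed.

Lemma compact_thicken (S U : set pt) : compact S -> open U -> S `<=` U ->
  exists2 d : R, 0 < d & forall x y, S y -> `|x - y| <= d -> U x.
Proof.
move=> /compact_near_coveringP cS oU SU.
have : \forall d \near (0 : R)^'+, S `<=` [set y | forall x, `|x - y| <= d -> U x].
  apply: (cS _ _ (fun d y => forall x, `|x - y| <= d -> U x)) => y Sy.
  have /nbhs_ballP[r /= r0 rP] : nbhs y U by apply: open_nbhs_nbhs; split=> //; exact: SU.
  exists (ball y (r / 2), `]0, (r / 2)[%classic).
    split; first by apply: nbhsx_ballx; rewrite divr_gt0.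
    near=> t; rewrite /= in_itv/=; apply/andP; split; near: t; [exact: nbhs_right_gt|].
    by apply: nbhs_right_lt; rewrite divr_gt0.
  move=> [y' d] /= [+ +] x; rewrite -ball_normE /ball_/= in_itv/= => yy /andP[d0 dr] xy.
  apply: rP; rewrite -ball_normE /ball_/= -(subrKA y') (le_lt_trans (ler_normD _ _))//.
  by rewrite [ltRHS]splitr ltrD// distrC (le_lt_trans xy).
move=> h; near (0 : R)^'+ => d; exists d => [|x y Sy xy].
  by near: d; exact: nbhs_right_gt.
by have : S `<=` [set y | forall x, `|x - y| <= d -> U x]; [near: d|move=> /(_ y Sy); exact].
Unshelve. all: by end_near. Qed.

(* [k] is [f] cut off to a compact neighbourhood of [S]. *)
Lemma compact_extension (S Om : set pt) f : compact S -> open Om -> S `<=` Om ->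
  (forall x, Om x -> {for x, continuous f}) -> exists k (d : R), [/\ 0 < d, bms k,
   forall x y, S y -> `|x - y| <= d -> Om x /\ k x = f x &
   forall x y, S y -> `|x - y| <= d -> {for x, continuous k}].
Proof.
move=> cS oO SO fc; have [d0 d00 d0P] := compact_thicken cS oO SO.
pose D : set pt := (fun p : pt * pt => p.1 + p.2) @` (S `*` [set x | `|x| <= d0]).
have cD : compact D.
  apply: continuous_compact; last by apply: compact_setX => //; exact: (@compact_ball R N).
  by apply: continuous_subspaceT => p; apply: cvgD; [exact: cvg_fst|exact: cvg_snd].
have DP x : D x <-> exists2 y, S y & `|x - y| <= d0.
  split=> [[[y a] /= [Sy ad] <-]|[y Sy xy]]; first by exists y => //; rewrite addrAC subrr add0r.
  by exists (y, x - y) => //=; rewrite addrC subrK.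
have DO : D `<=` Om by move=> x /DP[y Sy xy]; exact: d0P xy.
have clD : closed D by exact: compact_closed (@norm_hausdorff _ _) cD.
have mD : measurable D.
  by rewrite -[D]setCK; apply: measurableC; apply: open_rV_measurable; exact: closed_openC.
have mf : measurable_fun D f.
  apply: (@measurable_funS _ _ _ _ Om) => //; first exact: open_rV_measurable.
  apply: (measurability _ (RGenOpens.measurableE R)).
  move=> _ [_ [a [b ->] <-]]; apply: open_rV_measurable.
  rewrite openE => x [Ox /= fx]; apply: filterI; first exact: open_nbhs_nbhs.
  by apply: (fc x Ox); apply: open_nbhs_nbhs; split=> //; exact: interval_open.
have [M M0 MP] : exists2 M : R, 0 < M & forall x, D x -> `|f x| <= M.
  have [|M M0 MP] := @compact_bounded_norm R R (f @` D).
    apply: continuous_compact => //; apply: continuous_in_subspaceT => x; rewrite inE => /DO.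
    exact: fc.
  by exists M => // x Dx; apply: MP; exists x.
have [B B0 BP] := compact_bounded_norm cD.
exists (f \_ D), (d0 / 2); split; first by rewrite divr_gt0.
- split; first exact: (measurable_restrictT f mD).1.
  exists B, M => x; rewrite patchE; case: ifPn => [|xD].
    by rewrite inE => Dx; split; [exact: MP|rewrite ltNge BP].
  by rewrite normr0; split=> //; exact: ltW.
- move=> x y Sy xy; have Dx : D x by apply/DP; exists y => //; rewrite (le_trans xy)// ler_pdivrMr// ler_pMr// ler1n.
  by split; [exact: DO|rewrite patchE mem_set].
move=> x y Sy xy; have Dx z : `|x - z| < d0 / 2 -> D z.
  move=> xz; apply/DP; exists y => //; rewrite -(subrKA x) (le_trans (ler_normD _ _))//.
  by rewrite [leRHS]splitr lerD// distrC ltW.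
apply: cts_at_dist => e e0.
have Ox : Om x by apply: DO; apply: Dx; rewrite subrr normr0 divr_gt0.
have := fc x Ox; move=> /cvgrPdist_le/(_ _ e0)/nbhs_ballP[r /= r0 rP].
exists (Num.min r (d0 / 2)) => [|z]; first by rewrite lt_min r0 divr_gt0.
rewrite lt_min => /andP[zr zd]; rewrite !patchE !mem_set; [|exact: Dx|by apply: Dx; rewrite subrr normr0 divr_gt0].
by apply: rP; rewrite -ball_normE.
Qed.

Lemma rint_distr_L g psi : rint (fun x => g x * sublap op V psi x) = distr_L setT g psi.
Proof. by rewrite /distr_L sub_laplacianE. Qed.

Lemma capacity0_removable K : lip_capacity K = 0%E -> removable K.
Proof.
move=> cap0 Om f [oO _ _] lf sK phi [ps cps sO]; apply/eqP; rewrite -[_ == 0]negbK; apply/negP => nz.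
have [A A0 AP] := lip_on_horizontal lf.
have fc := horizontal_lip_continuous oO A0 AP.
have [k [d [d0 bk kf kc]]] := compact_extension cps oO sO fc.
have kc' x : (exists2 y, supp phi y & `|x - y| <= d) -> {for x, continuous k} by move=> [y]; exact: kc.
have kL (j : 'I_N) x (t : R) : (j < \dim (V 1%N))%N -> (exists2 y, supp phi y & `|x - y| <= d) ->
    (exists2 y, supp phi y & `|op x (t *: e_ j) - y| <= d) -> `|k (op x (t *: e_ j)) - k x| <= A * `|t|.
  move=> jm [y Sy xy] [y' Sy' xy'].
  have [Ox ->] := kf _ _ Sy xy; have [Ox' ->] := kf _ _ Sy' xy'; exact: AP.
have [g [C C0 gC] gL] := cutoff_product hop hV V1e cps (ps 2%N) (@supp_eq0 phi) d0 A0 bk kc' kL.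
(* Normalized so that [a * C * (N + 1) = 1], as [hlip_hgrad_le1] requires. *)
pose a := (C * (N%:R + 1))^-1.
have a0 : 0 < a by rewrite invr_gt0 mulr_gt0// ltr_wpDl.
pose g' x := a * g x.
have gc := hlip_continuous hop hV V1e C0 gC.
have smulp psi : smooth psi -> smooth (fun y => phi y * psi y) by move=> h q; exact: is_CkM.
(* In terms of distributions, [L g'] is [a] times the product of [phi] and [L f]. *)
have gE psi : smooth psi -> compact (supp psi) ->
    distr_L setT g' psi = a * distr_L Om f (fun y => phi y * psi y).
  move=> hp cp; have [B _ [pB _]] := compact_supp_bsupp cp.
  have bL := cts_bms (sublap_continuous hop (hp 2%N)) (sublap_bsupp hop V pB).
  rewrite -rint_distr_L.
  transitivity (a * rint (fun x => g x * sublap op V psi x)).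
    rewrite -rintZ; last by apply: bmsMl => //; exact: cts_lbm.
    by congr rint; apply/funext => x; rewrite /g' mulrA.
  congr (_ * _); rewrite (gL psi B (hp 2%N) pB) rint_distr_L.
  have sO' : supp (fun y => phi y * psi y) `<=` supp phi.
    apply: closureS => x /= /eqP h; apply/eqP => h'; apply: h; by rewrite h' mul0r.
  rewrite -(@distr_L_restrict Om); last by move=> x /sO' /sO.
  rewrite /distr_L; apply: eq_Rintegral => x _.
  have [Sx|nSx] := pselect (supp phi x); last first.
    by rewrite sub_laplacian_supp ?mulr0// => /sO'.
  by have [|_ ->] := kf x x Sx; rewrite // subrr normr0 ltW.
have out x : ~ supp phi x -> ~ distr_supp setT (distr_L (G := G) setT g') x.
  move=> nS [_ /(_ (~` supp phi))]; case=> //.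
    exact: closed_openC (@closed_closure _ _).
  move=> psi [qs cq sq]; rewrite gE//.
  have -> : (fun y => phi y * psi y) = fun=> 0.
    apply/funext => y; have [Sy|nSy] := pselect (supp phi y); last by rewrite (supp_eq0 nSy) mul0r.
    by rewrite (supp_eq0 (phi := psi)) ?mulr0// => /sq.
  rewrite /distr_L -[X in a * X](_ : 0 = _) ?mulr0 ?eqxx//.
  rewrite Rintegral_mkcond -[LHS](@rint0 R N); apply: eq_Rintegral => y _.
  rewrite patchE; case: ifP => // _; rewrite sub_laplacian_supp ?mulr0//.
  have -> : supp (fun=> 0 : R) = set0 :> set pt.
    rewrite /supp (_ : [set _ | _] = set0) ?closure0//.
    by apply/seteqP; split=> // z /=; rewrite eqxx.
  exact.
(* If [psi] detects [g'] in [U], then [phi * psi], whose support is no larger, detects [f] there. *)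
have sK' : distr_supp setT (distr_L setT g') `<=` K.
  move=> x xP; apply: sK; split; first by apply: contrapT => nO; apply: (out x) => // /sO.
  move=> U oU Ux UO; have [_ /(_ U oU Ux (@subsetT _ _))[psi [qs cq sq]]] := xP.
  rewrite gE// mulf_eq0 negb_or => /andP[_ nz'].
  exists (fun y => phi y * psi y) => //.
  have s' : supp (fun y => phi y * psi y) `<=` supp psi.
    apply: closureS => y /= /eqP h; apply/eqP => h'; apply: h; by rewrite h' mulr0.
  split; [exact: smulp| |by move=> y /s' /sq].
  by apply: subclosed_compact cq s'; exact: closed_closure.
have [B B0 [pB BP]] := compact_supp_bsupp cps.
have B1 : 0 <= B + 1 by rewrite addr_ge0// ltW.
(* The margin 1 makes [psi] equal to 1 near every point of the support of [phi], hence near the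
   support of [L g']. *)
have [psi [qs q1 q0]] := @smooth_cutoff R N (B + 1) B1.
have [cq _] := bsupp_compact_supp q0.
have pE : distr_L setT g' psi = a * distr_L Om f phi.
  have <- : (fun y => phi y * psi y) = phi; last exact: gE.
  apply/funext => x; have [xB|xB] := leP `|x| (B + 1); first by rewrite q1// mulr1.
  by rewrite pB ?mul0r// (lt_trans _ xB)// ltrDl.
have h' : hlip op V (a * C) g'.
  move=> j x t jm; rewrite -mulrBr normrM (gtr0_norm a0) -mulrA ler_pM2l//; exact: gC.
have aC0 : 0 < a * C by rewrite mulr_gt0.
have : (`|a * distr_L Om f phi|%:E <= lip_capacity K)%E.
  apply: ereal_sup_ubound; exists (a * distr_L Om f phi) => //; exists g'; split=> //.
  - exact: hlip_lip_loc h'.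
  - by apply: hlip_hgrad_le1 h' _ => //; rewrite -mulrA mulVf// gt_eqF// mulr_gt0// ltr_wpDl.
  - exists psi; split=> //.
    move=> x xP; have Sx : supp phi x by apply: contrapT => /out.
    apply/nbhs_ballP; exists 1 => //= y; rewrite -ball_normE /ball_/= => xy.
    apply: q1; rewrite -[y](subrK x) (le_trans (ler_normD _ _))// addrC.
    by apply: lerD; [exact: BP|rewrite distrC; exact: ltW].
by rewrite cap0 lee_fin normr_le0 mulf_eq0 gt_eqF//= (negbTE nz).
Qed.

End distributions.

Theorem theorem1p1 (R : realType) (G : carnotGroup R)
  (K : set 'rV[R]_(cdim G)) (hK : cc_bounded K) :
  removable K <-> lip_capacity K = 0%E.
Proof. by split; [exact: removable_capacity0|exact: capacity0_removable]. Qed.
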